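(* Let $G$ be a semisimple Lie group, $\tau_{\mathrm{mod}}\subset\sigma_{\mathrm{mod}}$ an $\iota$-invariant face, and $\Gamma<G$ a subgroup which is a non-elementary word-hyperbolic group. The following are equivalent. (1) $\Gamma$ is non-uniformly $\tau_{\mathrm{mod}}$-Anosov with asymptotic embedding $\psi:\partial_\infty\Gamma\to\Lambda_\Gamma(\tau_{\mathrm{mod}})$. (2) $\Gamma$ is $\tau_{\mathrm{mod}}$-boundary embedded with a boundary embedding $\varphi:\partial_\infty\Gamma\to\mathrm{Flag}(\tau_{\mathrm{mod}})$ and the $\Gamma$-action on $\mathrm{Flag}(\tau_{\mathrm{mod}})$ is expanding at $\varphi(\partial_\infty\Gamma)$. (3) There exists a closed $\Gamma$-invariant antipodal subset $\Lambda\subset\mathrm{Flag}(\tau_{\mathrm{mod}})$ such that the action $\Gamma\to\mathrm{LHomeo}(\mathrm{Flag}(\tau_{\mathrm{mod}}))$ is S-hyperbolic at $\Lambda$ with injective postal map $\pi:\Lambda\to\partial_\infty\Gamma$. Moreover, the maps $\psi$ and $\varphi$ in (1) and (2) coincide, and the map $\pi$ in (3) equals $\psi^{-1}$.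
   Context: Lie-theoretic setting. $X$ is the symmetric space of $G$; its visual boundary $\partial_\infty X$ carries the Tits spherical building structure with model apartment $a_{\mathrm{mod}}$, Weyl group $W$ and model chamber $\sigma_{\mathrm{mod}}\subset a_{\mathrm{mod}}$; the opposition involution of $\sigma_{\mathrm{mod}}$ is $\iota=-w_0$, where $w_0\in W$ sends $\sigma_{\mathrm{mod}}$ to $-\sigma_{\mathrm{mod}}$. Every $G$-orbit in $\partial_\infty X$ meets every chamber exactly once, giving the type map $\partial_\infty X\to\partial_\infty X/G\cong\sigma_{\mathrm{mod}}$. $\mathrm{Flag}(\tau_{\mathrm{mod}})$ is the compact manifold of simplices of type $\tau_{\mathrm{mod}}$ in $\partial_\infty X$, identified with $G/P_\tau$ ($P_\tau$ the stabilizer of such a simplex), with an auxiliary Riemannian metric. Two simplices are antipodal if they are opposite in an apartment containing both. A subset of $\mathrm{Flag}(\tau_{\mathrm{mod}})$ is antipodal if any two of its distinct elements are antipodal; a map into $\mathrm{Flag}(\tau_{\mathrm{mod}})$ is antipodal if it is injective with antipodal image. Anosov subgroups. For a diffeomorphism $\Phi$ of a Riemannian manifold, the expansion factor at $x$ is $\mathcal E(\Phi,x)=\inf_{0\ne v\in T_x}\|D_x\Phi(v)\|/\|v\|$. A subgroup $\Gamma<G$ is $\tau_{\mathrm{mod}}$-boundary embedded if it is a hyperbolic group and there is an antipodal $\Gamma$-equivariant continuous map (a boundary embedding) $\partial_\infty\Gamma\to\mathrm{Flag}(\tau_{\mathrm{mod}})$. A $\tau_{\mathrm{mod}}$-boundary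 embedded subgroup with boundary embedding $\psi$ is non-uniformly $\tau_{\mathrm{mod}}$-Anosov if for every $\xi\in\partial_\infty\Gamma$ and every geodesic ray $r:\mathbb N_0\to\Gamma$ starting at the identity and asymptotic to $\xi$, $\sup_{k\in\mathbb N_0}\mathcal E(r(k)^{-1},\psi(\xi))=+\infty$. Such $\psi$ is unique; it is called the asymptotic embedding for $\Gamma$, and its image is the $\tau_{\mathrm{mod}}$-limit set $\Lambda_\Gamma(\tau_{\mathrm{mod}})$. Expansion. Let $(M,d)$ be a proper geodesic metric space (below $M=\mathrm{Flag}(\tau_{\mathrm{mod}})$), $\mathrm{LHomeo}(M)$ the group of homeomorphisms of $M$ whose restrictions to compact subsets are bi-Lipschitz, $B_r(x)$ open balls, $N_r(\Lambda)$ open $r$-neighborhoods. For a homeomorphism $f$ of $M$, $\lambda>1$, $U\subset M$, $\delta>0$: $f$ is $(\lambda,U)$-expanding if $d(f(x),f(y))\ge\lambda d(x,y)$ for all $x,y\in U$; it is $(\lambda,U;\delta)$-expanding if moreover $B_{\lambda\eta}(f(x))\subset f(B_\eta(x))$ whenever $B_\eta(x)\subset U$ and $\eta\le\delta$. For an open cover $\mathcal U$ of $\Lambda$, $\delta_{\mathcal U}$ is the supremum of its Lebesgue numbers (numbers $\delta>0$ such that for every $x\in\Lambda$, $B_\delta(x)$ lies in a member of $\mathcal U$). An action $\rho:\Gamma\to\mathrm{LHomeo}(M)$ with non-empty compact invariant subset $\Lambda$, no point of which is isolated in $M$, is expanding at $\Lambda$ if there are a finite index set $\mathcal I$, a cover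 $\mathcal U=\{U_i\mid i\in\mathcal I\}$ of $\Lambda$ by open (possibly empty) subsets of $M$, a map $\mathcal I\to\Gamma$, $i\mapsto s_i$, and $L\ge\lambda>1$, $0<\delta\le\delta_{\mathcal U}$ such that each $\rho(s_i^{-1})$ is $L$-Lipschitz on $N_\delta(\Lambda)$ and $(\lambda,U_i;\delta)$-expanding, and $\Sigma=\{s_i\mid i\in\mathcal I\}$ is a symmetric generating set of $\Gamma$; $\mathcal D=(\mathcal I,\mathcal U,\Sigma,\delta,L,\lambda)$ is an expansion datum. Codes, rays, S-hyperbolicity, postal map. For $x\in\Lambda$, $0<\eta\le\delta$, $\alpha:\mathbb N_0\to\mathcal I$, put $p_0=x$, $p_{k+1}=\rho(s_{\alpha(k)}^{-1})(p_k)$; $\alpha$ is a $(\mathcal D,\eta)$-code for $x$ if $B_\eta(p_k)\subset U_{\alpha(k)}$ for every $k\ge1$. Its ray is $c^\alpha_k=s_{\alpha(0)}\cdots s_{\alpha(k)}$, $k\in\mathbb N_0$; $\mathrm{Ray}_x(\mathcal D,\eta)$ is the set of such rays. $\rho$ is S-hyperbolic at $\Lambda$ if it has an expansion datum $\mathcal D$ and there is an integer $N\ge1$ such that for every $x\in\Lambda$ the images of any two rays in $\mathrm{Ray}_x(\mathcal D,\delta)$ are within Hausdorff distance $N$ in $\Gamma$ with the word metric of $\Sigma$. Rays are quasigeodesic rays in $\Gamma$; for $\Gamma$ hyperbolic and $\rho$ S-hyperbolic the postal map $\pi:\Lambda\to\partial_\infty\Gamma$ sends $x$ to the boundary point represented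 by any ray in $\mathrm{Ray}_x(\mathcal D,\delta)$. *)

(* Defs.v *)
From HB Require Import structures.
From mathcomp Require Import all_boot all_order all_algebra.
From mathcomp Require Import all_classical all_reals all_analysis.

Set Implicit Arguments.
Unset Strict Implicit.
Unset Printing Implicit Defensive.

Import Order.TTheory GRing.Theory Num.Theory.
Import numFieldNormedType.Exports.

Local Open Scope classical_set_scope.
Local Open Scope ring_scope.

(** * Smooth manifolds *)

Section Smoothness.
Context {R : realType} {V W : normedModType R}.

(* [k] times continuously differentiable on the open set [U]. *)
Fixpoint Ck (k : nat) (f : V -> W) (U : set V) : Prop :=
  if k is k'.+1 then
    (forall x, U x -> differentiable f x) /\
    (forall v, Ck k' (fun x => 'D_v f x) U)
  else forall x, U x -> {for x, continuous f}.

Definition smooth_on (U : set V) (f : V -> W) : Prop := forall k, Ck k f U.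
End Smoothness.

(* [cinv] is only meaningful on [cfun @` cdom]. *)
Record chart (R : realType) (n : nat) (M : Type) := Chart {
  cdom : set M;
  cfun : M -> 'rV[R]_n;
  cinv : 'rV[R]_n -> M;
  cfunK : forall x, cdom x -> cinv (cfun x) = x }.

(* [chart_at x] is a preferred chart around [x]; it identifies the tangent
   space at [x] with ['rV_n]. *)
Record atlas (R : realType) (n : nat) (M : Type) := Atlas {
  charts : set (chart R n M);
  chart_at : M -> chart R n M;
  chart_atP : forall x, charts (chart_at x);
  mem_chart_at : forall x, cdom (chart_at x) x;
  open_overlap : forall c c', charts c -> charts c' ->
    open (cfun c @` (cdom c `&` cdom c'));
  smooth_transition : forall c c', charts c -> charts c' ->
    smooth_on (cfun c @` (cdom c `&` cdom c')) (cfun c' \o cinv c) }.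

(* The carrier of an atlas with the topology induced by its charts. *)
Definition mspace (R : realType) (n : nat) (M : Type) (A : atlas R n M) : Type
  := M.

Section AtlasTopology.
Context {R : realType} {n : nat} {M : Type} (A : atlas R n M).

HB.instance Definition _ := gen_eqMixin (mspace A).
HB.instance Definition _ := gen_choiceMixin (mspace A).

Definition atlas_open (U : set (mspace A)) : Prop :=
  forall c, charts A c -> open (cfun c @` (U `&` cdom c)).

Lemma atlas_openT : atlas_open setT.
Proof.
by move=> c Ac; rewrite setTI; have := open_overlap Ac Ac; rewrite setIid.
Qed.

Lemma atlas_openI (U V : set (mspace A)) :
  atlas_open U -> atlas_open V -> atlas_open (U `&` V).
Proof.
move=> oU oV c Ac.
rewrite (_ : _ @` _ = (cfun c @` (U `&` cdom c)) `&` (cfun c @` (V `&` cdom c))).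
  by apply: openI; [exact: oU | exact: oV].
apply/seteqP; split=> [_ [x [[Ux Vx] cx] <-]|u].
  by split; exists x.
move=> [[x [Ux cx] <-] [y [Vy cy] yx]]; exists x => //; split=> //; split=> //.
by rewrite -(cfunK cx) -yx cfunK.
Qed.

Lemma atlas_open_bigU (I : Type) (F : I -> set (mspace A)) :
  (forall i, atlas_open (F i)) -> atlas_open (\bigcup_i F i).
Proof.
move=> oF c Ac.
rewrite (_ : _ @` _ = \bigcup_i (cfun c @` (F i `&` cdom c))).
  by apply: bigcup_open => i _; exact: oF.
apply/seteqP; split=> [_ [x [[i _ Fx] cx] <-]|_ [i _ [x [Fx cx] <-]]].
  by exists i => //; exists x.
by exists x => //; split=> //; exists i.
Qed.

HB.instance Definition _ := isOpenTopological.Build (mspace A)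
  atlas_openT atlas_openI atlas_open_bigU.
End AtlasTopology.

Record manifold (R : realType) (n : nat) (M : Type) := Manifold {
  manifold_atlas :> atlas R n M;
  manifold_hausdorff : hausdorff_space (mspace manifold_atlas);
  manifold_countable : @second_countable (mspace manifold_atlas) }.

Section SmoothMaps.
Context {R : realType}.

Definition smooth_into {n : nat} {M : Type} (A : atlas R n M)
    {V : normedModType R} (f : V -> M) (u : V) : Prop :=
  forall c, charts A c -> cdom c (f u) ->
  exists U : set V, [/\ open U, U u, forall v, U v -> cdom c (f v)
                      & smooth_on U (cfun c \o f)].

Definition smooth_map {m n : nat} {M N : Type} (A : atlas R m M)
    (B : atlas R n N) (f : M -> N) : Prop :=
  forall c x, charts A c -> cdom c x -> smooth_into B (f \o cinv c) (cfun c x).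

Definition tangent_map {m n : nat} {M N : Type} (A : atlas R m M)
    (B : atlas R n N) (f : M -> N) (x : M) : 'rV[R]_m -> 'rV[R]_n :=
  'd (cfun (chart_at B (f x)) \o f \o cinv (chart_at A x))
     (cfun (chart_at A x) x).

Definition submersion {m n : nat} {M N : Type} (A : atlas R m M)
    (B : atlas R n N) (f : M -> N) : Prop :=
  smooth_map A B f /\
  forall x w, exists v, tangent_map A B f x v = w.
End SmoothMaps.

(** * Riemannian metrics *)

Section Riemannian.
Context {R : realType} {n : nat} {M : Type} (A : atlas R n M).

(* Gram matrices [q x] in the tangent coordinates of [chart_at A x]. *)
Definition tangent_form (q : M -> 'M[R]_n) (x : M) (v w : 'rV[R]_n) : R :=
  (v *m q x *m w^T) 0 0.

(* From the tangent coordinates of [c] at [cinv c u] to the preferred ones. *)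
Definition to_preferred (c : chart R n M) (u : 'rV[R]_n) :
    'rV[R]_n -> 'rV[R]_n :=
  'd (cfun (chart_at A (cinv c u)) \o cinv c) u.

Record riemannian_metric := RiemannianMetric {
  gram :> M -> 'M[R]_n;
  gram_sym : forall x, (gram x)^T = gram x;
  gram_pos : forall x v, v != 0 -> 0 < tangent_form gram x v v;
  gram_smooth : forall c v w, charts A c ->
    smooth_on (cfun c @` cdom c)
      (fun u => tangent_form gram (cinv c u)
                  (to_preferred c u v) (to_preferred c u w) : R) }.

Context (q : riemannian_metric).

Definition tangent_norm (x : M) (v : 'rV[R]_n) : R :=
  Num.sqrt (tangent_form q x v v).

Definition velocity (c : R -> M) (t : R) : 'rV[R]_n :=
  'D_1 (cfun (chart_at A (c t)) \o c) t.

Definition curve_length (c : R -> M) : \bar R :=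
  (\int[lebesgue_measure]_(t in `[0%R, 1%R])
     (tangent_norm (c t) (velocity c t))%:E)%E.

(* Finite when [M] is connected, as flag manifolds are. *)
Definition riemannian_dist (x y : M) : R :=
  fine (ereal_inf [set curve_length c | c in
    [set c : R -> M | (forall t : R, smooth_into A c t) /\ c 0 = x /\ c 1 = y]]).

Definition expansion_factor (f : M -> M) (x : M) : R :=
  inf [set tangent_norm (f x) (tangent_map A A f x v) / tangent_norm x v
      | v in [set v | v != 0]].
End Riemannian.

(** * Lie groups and their Lie algebras *)

Record lie_group (R : realType) (n : nat) (G : groupType) := LieGroup {
  lie_manifold :> manifold R n G;
  lie_mul_smooth : forall c1 c2 g1 g2,
    charts lie_manifold c1 -> charts lie_manifold c2 ->
    cdom c1 g1 -> cdom c2 g2 ->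
    smooth_into lie_manifold
      (fun u : ('rV[R]_n * 'rV[R]_n)%type =>
         (cinv c1 u.1 * cinv c2 u.2)%g)
      (cfun c1 g1, cfun c2 g2);
  lie_inv_smooth : smooth_map lie_manifold lie_manifold (fun g : G => g^-1%g) }.

Section LieAlgebra.
Context {R : realType} {n : nat} {G : groupType} (LG : lie_group R n G).

(* The Lie algebra is the tangent space at 1, in its preferred coordinates. *)
Definition Ad (g : G) : 'rV[R]_n -> 'rV[R]_n :=
  tangent_map LG LG (fun x => g * x * g^-1)%g 1%g.

(* The bracket is given by ad, the derivative of Ad at 1. *)
Definition lie_bracket (x y : 'rV[R]_n) : 'rV[R]_n :=
  let c := chart_at LG 1%g in 'D_x (fun u => Ad (cinv c u) y) (cfun c 1%g).

(* Matrices act on row vectors from the right. *)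
Definition Ad_mx (g : G) : 'M[R]_n := lin1_mx (Ad g).
Definition ad_mx (x : 'rV[R]_n) : 'M[R]_n := lin1_mx (lie_bracket x).

Definition killing (x y : 'rV[R]_n) : R := \tr (ad_mx x *m ad_mx y).

(* Semisimplicity as defined by Helgason. *)
Definition semisimple : Prop :=
  forall x, (forall y, killing x y = 0) -> x = 0.
End LieAlgebra.

(** * The symmetric space and its visual boundary

   The symmetric space X = G/K is realized as the space of Cartan involutions
   of the Lie algebra: Ad(G) acts on it transitively by conjugation, and the
   stabilizers are the subgroups K. *)

Definition expmx (R : realType) (n : nat) (A : 'M[R]_n) : 'M[R]_n :=
  limn (series (fun k => (k`!%:R)^-1 *: A ^+ k)).

Section SymmetricSpace.
Context {R : realType} {n : nat} {G : groupType} (LG : lie_group R n G).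
Local Notation g := 'rV[R]_n.
Local Notation B := (killing LG).
Local Notation "[ x , y ]" := (lie_bracket LG x y) : ring_scope.

Definition cartan_involution (th : 'M[R]_n) : Prop :=
  [/\ forall x y : g, [x, y] *m th = [x *m th, y *m th],
      th *m th = 1%:M
    & forall x : g, x != 0 -> 0 < - B x (x *m th)].

Definition act_X (h : G) (th : 'M[R]_n) : 'M[R]_n :=
  Ad_mx LG h^-1%g *m th *m Ad_mx LG h.

(* The (-1)-eigenspace of [th], which is the tangent space of X at [th]. *)
Definition p_part (th : 'M[R]_n) : set g := [set v | v *m th = - v].

(* The action of exp(v) on X. *)
Definition act_exp (v : g) (th : 'M[R]_n) : 'M[R]_n :=
  expmx (ad_mx LG (- v)) *m th *m expmx (ad_mx LG v).

(* X has the invariant metric that is the Killing form on each tangent space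
   [p_part th]. Its geodesics through [th] are t |-> exp(tv) th, and any two
   points of X are joined by exactly one geodesic segment. *)
Definition dist_X (th th' : 'M[R]_n) : R :=
  inf [set Num.sqrt (B v v) | v in [set v | p_part th v /\ act_exp v th = th']].

(* Only the restriction to nonnegative reals matters. *)
Definition ray_X (c : R -> 'M[R]_n) : Prop :=
  (forall t, 0 <= t -> cartan_involution (c t)) /\
  (forall s t, 0 <= s -> 0 <= t -> dist_X (c s) (c t) = `|s - t|).

Definition asymptotic_X (c c' : R -> 'M[R]_n) : Prop :=
  exists C : R, forall t, 0 <= t -> dist_X (c t) (c' t) <= C.

Definition ideal_point : Type := set (R -> 'M[R]_n).

Definition ray_end (c : R -> 'M[R]_n) : ideal_point :=
  [set c' | ray_X c' /\ asymptotic_X c c'].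

Definition visual_boundary : set ideal_point := [set ray_end c | c in ray_X].

Definition act_ideal (h : G) (xi : ideal_point) : ideal_point :=
  [set act_X h \o c | c in xi].

Definition orbit_ideal (xi : ideal_point) : set ideal_point :=
  [set act_ideal h xi | h in [set: G]].

(** * The spherical building structure *)

(* The maximal flats through [th] are the exp(a) th for these [a]. *)
Definition maximal_abelian (th : 'M[R]_n) (a : {vspace g}) : Prop :=
  let abelian_in_p (b : {vspace g}) :=
    (forall x, x \in b -> p_part th x) /\
    (forall x y, x \in b -> y \in b -> [x, y] = 0) in
  abelian_in_p a /\ forall b, abelian_in_p b -> (a <= b)%VS -> b = a.

(* [h] represents the restricted root H |-> B h H. *)
Definition root_of (a : {vspace g}) (h : g) : Prop :=
  [/\ h \in a, h != 0 &
      exists2 x : g, x != 0 & forall H, H \in a -> [H, x] = B h H *: x].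

Definition unit_sphere (a : {vspace g}) : set g :=
  [set H | H \in a /\ B H H = 1].

(* The smallest closed simplex of the Coxeter complex in the unit sphere of
   [a] that contains [H0]. *)
Definition cone_simplex (a : {vspace g}) (H0 : g) : set g :=
  [set H | unit_sphere a H /\ forall h, root_of a h ->
     (0 < B h H0 -> 0 <= B h H) /\ (B h H0 = 0 -> B h H = 0)].

Definition regular (a : {vspace g}) (H0 : g) : Prop :=
  unit_sphere a H0 /\ forall h, root_of a h -> B h H0 != 0.

(* The directions [S] at [th], viewed in the apartment at infinity. *)
Definition ends_at (th : 'M[R]_n) (S : set g) : set ideal_point :=
  [set ray_end (fun t => act_exp (t *: H) th) | H in S].

Definition simplex (s : set ideal_point) : Prop :=
  exists th a H0, [/\ cartan_involution th, maximal_abelian th a,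
    unit_sphere a H0 & s = ends_at th (cone_simplex a H0)].

Definition chamber (s : set ideal_point) : Prop :=
  exists th a H0, [/\ cartan_involution th, maximal_abelian th a,
    regular a H0 & s = ends_at th (cone_simplex a H0)].

Definition antipodal (s s' : set ideal_point) : Prop :=
  exists th a H0, [/\ cartan_involution th, maximal_abelian th a,
    unit_sphere a H0, s = ends_at th (cone_simplex a H0)
    & s' = ends_at th (-%R @` cone_simplex a H0)].

Definition act_simplex (h : G) (s : set ideal_point) : set ideal_point :=
  [set act_ideal h xi | xi in s].

(* This is what makes the type map to the model chamber well defined. *)
Definition orbits_meet_chambers_once : Prop :=
  forall xi, visual_boundary xi -> forall s, chamber s ->
  exists! eta, s eta /\ orbit_ideal xi eta.

Definition same_type (s s' : set ideal_point) : Prop :=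
  [set orbit_ideal xi | xi in s] = [set orbit_ideal xi | xi in s'].

Definition reflection (h H : g) : g := H - (2 * B h H / B h h) *: h.

Inductive weyl (a : {vspace g}) : (g -> g) -> Prop :=
| weyl1 : weyl a id
| weyl_refl h w : root_of a h -> weyl a w -> weyl a (reflection h \o w).

(* The model apartment is the unit sphere of [mod_a], the model chamber is
   [cone_simplex mod_a mod_reg], and its face tau_mod is
   [cone_simplex mod_a mod_face]. *)
Record model := Model {
  mod_th : 'M[R]_n;
  mod_a : {vspace g};
  mod_reg : g;
  mod_face : g;
  mod_thP : cartan_involution mod_th;
  mod_aP : maximal_abelian mod_th mod_a;
  mod_regP : regular mod_a mod_reg;
  mod_faceP : cone_simplex mod_a mod_reg mod_face }.

Definition sigma_mod (D : model) : set g := cone_simplex (mod_a D) (mod_reg D).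
Definition tau_mod (D : model) : set g := cone_simplex (mod_a D) (mod_face D).

Definition iota_invariant (D : model) : Prop :=
  exists w0, [/\ weyl (mod_a D) w0,
    w0 @` sigma_mod D = -%R @` sigma_mod D
    & (fun H => - w0 H) @` tau_mod D = tau_mod D].

Definition Flag (D : model) : set (set ideal_point) :=
  [set s | simplex s /\ same_type s (ends_at (mod_th D) (tau_mod D))].

(* G maps simplices to simplices of the same type, so that the default value
   [x] of [insubd] is never used. *)
Definition act_Flag (D : model) (h : G) (x : Flag D) : Flag D :=
  insubd x (act_simplex h (val x)).

(* The manifold structure of G/P_tau: the one for which the orbit maps are
   smooth submersions. *)
Definition homogeneous_structure (D : model) (m : nat)
    (F : manifold R m (Flag D)) : Prop :=
  forall x : Flag D, submersion LG F (fun h => act_Flag h x).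
End SymmetricSpace.

(** * Word metrics, hyperbolic groups and their Gromov boundary *)

Section WordMetric.
Context {Gam : groupType}.
Local Open Scope group_scope.

Definition is_word (S : seq Gam) (w : seq Gam) : bool :=
  all (fun x => (x \in S) || (x^-1 \in S)) w.

Definition word_ball (S : seq Gam) (k : nat) (x : Gam) : Prop :=
  exists w : seq Gam, [/\ is_word S w, (size w <= k)%N & x = foldr *%g 1 w].

Definition generates (S : seq Gam) : Prop :=
  forall x, exists k, word_ball S k x.

Definition word_length (S : seq Gam) (x : Gam) : nat :=
  if pselect (exists k, `[< word_ball S k x >]) is left e then ex_minn e else 0.

Definition word_dist (S : seq Gam) (x y : Gam) : nat :=
  word_length S (x^-1 * y).

(* Gromov's four-point condition. *)
Definition gromov_hyperbolic (S : seq Gam) : Prop :=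
  exists delta : nat, forall x y z w,
    (word_dist S x y + word_dist S z w <=
     maxn (word_dist S x z + word_dist S y w)
          (word_dist S x w + word_dist S y z) + delta.*2)%N.

Definition geodesic_ray (S : seq Gam) (r : nat -> Gam) : Prop :=
  forall k l, word_dist S (r k) (r l) = (maxn k l - minn k l)%N.

Definition asymptotic (S : seq Gam) (r r' : nat -> Gam) : Prop :=
  exists C, forall k, (word_dist S (r k) (r' k) <= C)%N.

Definition hausdorff_close (S : seq Gam) (N : nat) (c c' : nat -> Gam) : Prop :=
  (forall k, exists l, (word_dist S (c k) (c' l) <= N)%N) /\
  (forall l, exists k, (word_dist S (c k) (c' l) <= N)%N).

Definition ray_class (S : seq Gam) (r : nat -> Gam) : set (nat -> Gam) :=
  [set r' | geodesic_ray S r' /\ asymptotic S r r'].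

Definition boundary_set (S : seq Gam) : set (set (nat -> Gam)) :=
  [set ray_class S r | r in geodesic_ray S].

Definition gromov_boundary (S : seq Gam) : Type := boundary_set S.

Definition in_class {S : seq Gam} (xi : gromov_boundary S) (r : nat -> Gam) :
  Prop := (sval xi) r.

HB.instance Definition _ S := gen_eqMixin (gromov_boundary S).
HB.instance Definition _ S := gen_choiceMixin (gromov_boundary S).

(* The quotient of the topology of pointwise convergence on the geodesic rays
   from the identity. *)
Definition boundary_open {S : seq Gam} (U : set (gromov_boundary S)) : Prop :=
  forall xi r, U xi -> in_class xi r -> r 0%N = 1 ->
  exists k, forall xi' r', in_class xi' r' -> r' 0%N = 1 ->
    (forall i, (i <= k)%N -> r' i = r i) -> U xi'.

Lemma boundary_openT S : boundary_open [set: gromov_boundary S].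
Proof. by move=> xi r _ _ _; exists 0%N. Qed.

Lemma boundary_openI S (U V : set (gromov_boundary S)) :
  boundary_open U -> boundary_open V -> boundary_open (U `&` V).
Proof.
move=> oU oV xi r [Ux Vx] xr r0.
have [k Uk] := oU _ _ Ux xr r0; have [l Vl] := oV _ _ Vx xr r0.
exists (maxn k l) => xi' r' xr' r0' rr'; split.
  by apply: (Uk _ r') => // i ik; apply: rr'; rewrite leq_max ik.
by apply: (Vl _ r') => // i il; apply: rr'; rewrite leq_max il orbT.
Qed.

Lemma boundary_open_bigU S (I : Type) (F : I -> set (gromov_boundary S)) :
  (forall i, boundary_open (F i)) -> boundary_open (\bigcup_i F i).
Proof.
move=> oF xi r [i _ Fx] xr r0; have [k Fk] := oF i _ _ Fx xr r0.
by exists k => xi' r' xr' r0' rr'; exists i => //; exact: (Fk _ r').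
Qed.

HB.instance Definition _ S := isOpenTopological.Build (gromov_boundary S)
  (@boundary_openT S) (@boundary_openI S) (@boundary_open_bigU S).

Lemma word_distM S (x y z : Gam) : word_dist S (x * y) (x * z) = word_dist S y z.
Proof. by rewrite /word_dist invgM -mulgA mulKg. Qed.

Definition translate (x : Gam) (r : nat -> Gam) : nat -> Gam := fun k => x * r k.

Lemma translate_boundary S x (xi : gromov_boundary S) :
  [set translate x r | r in sval xi] \in boundary_set S.
Proof.
case: xi => xi /=; rewrite !inE => -[r gr <-].
exists (translate x r).
  by move=> k l; rewrite /translate word_distM gr.
apply/seteqP; split=> [r' [gr' [C rr']]|_ [r' [gr' [C rr']] <-]].
  exists (translate x^-1 r'); last first.
    by apply/funext => k; rewrite /translate mulVKg.
  split; first by move=> k l; rewrite /translate word_distM gr'.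
  exists C => k; rewrite /translate -(word_distM S x) mulVKg.
  exact: rr'.
split; first by move=> k l; rewrite /translate word_distM gr'.
by exists C => k; rewrite /translate word_distM.
Qed.

Definition act_boundary {S} (x : Gam) (xi : gromov_boundary S) :
  gromov_boundary S := exist (fun z => z \in boundary_set S) _ (translate_boundary x xi).

Definition represents {S} (xi : gromov_boundary S) (c : nat -> Gam) : Prop :=
  exists r N, in_class xi r /\ hausdorff_close S N c r.
End WordMetric.

Definition word_hyperbolic (Gam : groupType) : Prop :=
  exists S : seq Gam, generates S /\ gromov_hyperbolic S.

(* Finitely many cosets of a cyclic subgroup cover the group. *)
Definition virtually_cyclic (Gam : groupType) : Prop :=
  exists (c : Gam) (F : seq Gam), forall x, exists2 f, f \in F &
  exists k : nat, (x = f * c ^+ k)%g \/ (x = f * (c ^+ k)^-1)%g.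

Definition non_elementary (Gam : groupType) : Prop := ~ virtually_cyclic Gam.

(** * Expanding and S-hyperbolic actions *)

(* [d] stands for a distance function that induces the topology of [M]. *)
Section Expansion.
Context {R : realType} {M : topologicalType} (d : M -> M -> R).

Definition mball (r : R) (x : M) : set M := [set y | d x y < r].

Definition nbhd_of (r : R) (Lam : set M) : set M :=
  \bigcup_(x in Lam) mball r x.

Definition biLipschitz_on (K : set M) (f : M -> M) : Prop :=
  exists2 L : R, 0 < L & forall x y, K x -> K y ->
    L^-1 * d x y <= d (f x) (f y) <= L * d x y.

Definition LHomeo (f : M -> M) : Prop :=
  [/\ continuous f, exists2 f', cancel f f' /\ cancel f' f & continuous f'
    & forall K, compact K -> biLipschitz_on K f].

Definition lipschitz_at_most (L : R) (U : set M) (f : M -> M) : Prop :=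
  forall x y, U x -> U y -> d (f x) (f y) <= L * d x y.

Definition expanding_map (lam : R) (U : set M) (f : M -> M) : Prop :=
  forall x y, U x -> U y -> lam * d x y <= d (f x) (f y).

Definition expanding_map_delta (lam : R) (U : set M) (delta : R)
    (f : M -> M) : Prop :=
  expanding_map lam U f /\
  forall x eta, 0 < eta -> eta <= delta -> mball eta x `<=` U ->
    mball (lam * eta) (f x) `<=` f @` mball eta x.

Definition lebesgue_number (I : Type) (U : I -> set M) (Lam : set M)
    (delta : R) : Prop :=
  0 < delta /\ forall x, Lam x -> exists i, mball delta x `<=` U i.

(* It may be infinite. *)
Definition sup_lebesgue_number (I : Type) (U : I -> set M) (Lam : set M) :
  \bar R := ereal_sup [set delta%:E | delta in lebesgue_number U Lam].

Context {Gam : groupType} (rho : Gam -> M -> M).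

Record datum := Datum {
  dI : finType;
  dU : dI -> set M;
  ds : dI -> Gam;
  ddelta : R;
  dL : R;
  dlam : R }.

Definition dSigma (D : datum) : seq Gam := codom (@ds D).

Definition LHomeo_action : Prop :=
  [/\ forall x, rho 1%g x = x,
      forall a b x, rho (a * b)%g x = rho a (rho b x)
    & forall a, LHomeo (rho a)].

Definition invariant (Lam : set M) : Prop :=
  forall a x, Lam x -> Lam (rho a x).

Definition expansion_datum (Lam : set M) (D : datum) : Prop :=
  [/\ (forall i : dI D, open (dU i)) /\ Lam `<=` \bigcup_i (@dU D i),
      1 < dlam D <= dL D,
      0 < ddelta D /\ ((ddelta D)%:E <= sup_lebesgue_number (@dU D) Lam)%E,
      forall i : dI D,
        lipschitz_at_most (dL D) (nbhd_of (ddelta D) Lam) (rho (ds i)^-1%g) /\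
        expanding_map_delta (dlam D) (dU i) (ddelta D) (rho (ds i)^-1%g)
    & (forall i : dI D, exists j : dI D, ds j = (ds i)^-1%g) /\
      generates (dSigma D)].

(* The standing assumptions on (rho, Lam). *)
Definition admissible (Lam : set M) : Prop :=
  [/\ LHomeo_action, Lam !=set0, compact Lam, invariant Lam
    & forall x, Lam x -> forall r : R, 0 < r -> exists2 y, y <> x & mball r x y].

Definition expanding_at (Lam : set M) : Prop :=
  admissible Lam /\ exists D, expansion_datum Lam D.

Fixpoint code_point (D : datum) (x : M) (alpha : nat -> dI D) (k : nat) : M :=
  if k is k'.+1 then rho (ds (alpha k'))^-1%g (code_point x alpha k') else x.

Definition code (D : datum) (eta : R) (x : M) (alpha : nat -> dI D) : Prop :=
  forall k, (1 <= k)%N -> mball eta (code_point x alpha k) `<=` dU (alpha k).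

Fixpoint code_ray (D : datum) (alpha : nat -> dI D) (k : nat) : Gam :=
  if k is k'.+1 then (code_ray alpha k' * ds (alpha k))%g else ds (alpha 0%N).

Definition Ray (D : datum) (eta : R) (x : M) : set (nat -> Gam) :=
  [set code_ray alpha | alpha in @code D eta x].

Definition S_hyperbolic_with (Lam : set M) (D : datum) (N : nat) : Prop :=
  [/\ admissible Lam, expansion_datum Lam D, (1 <= N)%N &
      forall x, Lam x -> forall c c',
        Ray D (ddelta D) x c -> Ray D (ddelta D) x c' ->
        hausdorff_close (dSigma D) N c c'].

(* Only the values of [pi] on [Lam] matter. *)
Definition postal_map (S : seq Gam) (Lam : set M) (D : datum)
    (pi : M -> gromov_boundary S) : Prop :=
  forall x, Lam x -> forall c, Ray D (ddelta D) x c -> represents (pi x) c.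
End Expansion.

(** * Anosov subgroups *)

Section Anosov.
Context {R : realType} {n m : nat} {G : groupType} {LG : lie_group R n G}.
Context {D : model LG} (F : manifold R m (Flag D)) (q : riemannian_metric F).
Context {P : {pred G}} {Gam : subGroupType P} (S : seq Gam).

Definition gam_act (x : Gam) : mspace F -> mspace F := act_Flag (val x).

Definition flag_dist : mspace F -> mspace F -> R := riemannian_dist q.

Definition flag_antipodal (x y : mspace F) : Prop :=
  antipodal LG (val (x : Flag D)) (val (y : Flag D)).

Definition antipodal_set (Lam : set (mspace F)) : Prop :=
  forall x y, Lam x -> Lam y -> x <> y -> flag_antipodal x y.

Definition boundary_embedding (psi : gromov_boundary S -> mspace F) : Prop :=
  [/\ continuous psi,
      forall a xi, psi (act_boundary a xi) = gam_act a (psi xi),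
      injective psi & antipodal_set (range psi)].

(* Gam is boundary embedded, with boundary embedding [psi]. *)
Definition boundary_embedded_with (psi : gromov_boundary S -> mspace F) : Prop :=
  word_hyperbolic Gam /\ boundary_embedding psi.

(* Gam is non-uniformly Anosov, with asymptotic embedding [psi]. *)
Definition nonuniformly_anosov_with (psi : gromov_boundary S -> mspace F) :
    Prop :=
  boundary_embedded_with psi /\
  forall xi r, in_class xi r -> r 0%N = 1%g ->
    ereal_sup [set (expansion_factor q (gam_act (r k)^-1%g) (psi xi))%:E
              | k in [set: nat]] = +oo%E.

Definition boundary_expanding_with (phi : gromov_boundary S -> mspace F) :
    Prop :=
  boundary_embedded_with phi /\ expanding_at flag_dist gam_act (range phi).

(* The action is S-hyperbolic at [Lam] (with expansion datum [E] and constant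
   [N]), and its postal map [pi] is injective. *)
Definition S_hyperbolic_postal (Lam : set (mspace F))
    (E : @datum R (mspace F) Gam) (N : nat)
    (pi : mspace F -> gromov_boundary S) : Prop :=
  [/\ [/\ closed Lam, invariant gam_act Lam & antipodal_set Lam],
      S_hyperbolic_with flag_dist gam_act Lam E N,
      postal_map flag_dist gam_act Lam E pi
    & {in Lam &, injective pi}].
End Anosov.

(* Main.v *)
(* Expansion of [g^-1] at [x] bounds the adjoint action of [g^-1] on the nilradical of the stabilizer of [x]; this forces
   limit maps to agree. Codes of an expanding action trace quasigeodesics, and their branches contract, so the postal map
   inverts the boundary embedding. Conversely the inverse of an injective postal map is continuous, by ultralimits of
   codes. Infinitesimal and metric expansion agree up to constants; [Flag] is a metric space under path length because the
   simplices of one type form a single orbit of the identity component. *)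
Require Import Defs.
From HB Require Import structures.
From mathcomp Require Import all_boot all_order all_algebra.
From mathcomp Require Import all_classical all_reals all_analysis.
From mathcomp Require Import zify ring lra.

Set Implicit Arguments.
Unset Strict Implicit.
Unset Printing Implicit Defensive.

Import Order.TTheory GRing.Theory Num.Theory.
Import numFieldNormedType.Exports.

Local Open Scope classical_set_scope.
Local Open Scope ring_scope.

(** Two points of [Flag] are compared through the Killing form. If expansion factors are unbounded
    at one point and bounded below at the other along the same group elements, the pairing of the
    two nilradicals, which is invariant under [Ad], tends to 0. Orthogonal nilradicals put both
    simplices into one closed chamber, and there equality of type is equality. The Anosov condition
    is only a supremum, approached along a sequence that depends on the map, so two Anosov maps
    cannot be compared directly: one of them has to come from an S-hyperbolic action, where codes
    give a lower bound at every point of the ray. This is why uniqueness passes through (3). [G] is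
    known through its charts and its Killing form only, so variational arguments stand in for
    structure theory: a minimum of an energy shows that parabolic subgroups act transitively on X,
    and an extremum over the compact isotropy group moves two simplices into one chamber. A point of
    X is handled through the positive form of its Cartan involution; distances and asymptotic rays
    become ratios of such forms. *)

Section ZmodReflection.
Variable V: zmodType.

(** Syntax of abelian group expressions. The tactic [zmod] reads both sides of an equation into it
    and compares integer coefficients. *)
Inductive zexpr:= ZVar of nat | ZZero | ZAdd of zexpr & zexpr | ZOpp of zexpr.

Fixpoint zeval (env: seq V) (e: zexpr): V:= match e with | ZVar i=> nth 0 env i | ZZero=> 0 | ZAdd a b=> zeval env a + zeval env b | ZOpp a=> - zeval env a end.

Fixpoint zcoef (e: zexpr) (i: nat): int:= match e with | ZVar j=> if i == j then 1 else 0 | ZZero=> 0 | ZAdd a b=> zcoef a i + zcoef b i | ZOpp a=> - zcoef a i end.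

Lemma zeval_sum env e: zeval env e = \sum_(i <- iota 0 (size env)) nth 0 env i *~ zcoef e i.
Proof.
elim: e=>[j||a IHa b IHb|a IHa]/=.
- have [ji|ij]:= ltnP j (size env);last first. rewrite nth_default// big_seq big1// => i;rewrite mem_iota add0n=> /andP[_ il]. by rewrite ltn_eqF ?mulr0z// (leq_trans il).
 rewrite (bigD1_seq j) ?iota_uniq ?mem_iota//= eqxx mulr1z big1 ?addr0// => i. by move=> /negPf->;rewrite mulr0z.
- by rewrite big1// => i _;rewrite mulr0z.
- by rewrite IHa IHb -big_split;apply: eq_bigr=> i _;rewrite mulrzDr.
- by rewrite IHa -sumrN;apply: eq_bigr=> i _;rewrite mulrNz.
Qed.
Lemma zeval_eq env e1 e2: all (fun i=> zcoef e1 i == zcoef e2 i) (iota 0 (size env)) -> zeval env e1 = zeval env e2.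
Proof.
move=> /allP H;rewrite !zeval_sum;apply: eq_big_seq=> i /H/eqP -> //.
Qed.
End ZmodReflection.

(** The matches on [Set] run a tactic inside an Ltac that returns a term. Atoms are compared
    syntactically first and then up to unification. *)
Ltac zmod_same x y:= match constr:(Set) with | _=> let _:= match constr:(Set) with _=> constr_eq_nounivs x y end in constr:(true)
 | _=> let _:= match constr:(Set) with _=> unify x y end in constr:(true) | _=> constr:(false) end.
Ltac zmod_mem x l:= lazymatch l with | nil=> constr:(false) | ?y :: ?l'=> lazymatch zmod_same x y with | true=> constr:(true) | false=> zmod_mem x l' end end.
Ltac zmod_env env t:= lazymatch t with | (?a + ?b)%R=> let env:= zmod_env env a in zmod_env env b | (- ?a)%R=> zmod_env env a | (0)%R=> env
 | _=> lazymatch zmod_mem t env with true=> env | false=> constr:(t :: env) end end.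
Ltac zmod_idx x l:= lazymatch l with | ?y :: ?l'=> lazymatch zmod_same x y with | true=> constr:(0%N) | false=> let n:= zmod_idx x l' in constr:(S n) end end.
Ltac zmod_reify env t:= lazymatch t with | (?a + ?b)%R=> let a:= zmod_reify env a in let b:= zmod_reify env b in constr:(ZAdd a b) | (- ?a)%R=> let a:= zmod_reify env a in constr:(ZOpp a)
 | (0)%R=> constr:(ZZero) | _=> let n:= zmod_idx t env in constr:(ZVar n) end.
Ltac zmod:= lazymatch goal with | |- @eq ?T ?s ?t=> let env:= zmod_env (@nil T) s in let env:= zmod_env env t in let s':= zmod_reify env s in let t':= zmod_reify env t in
  refine (@zeval_eq _ env s' t' _);vm_compute;reflexivity end.

(** * Finite-dimensional normed spaces *)

Section FiniteDimension.
Context {R: realType}.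

(** A spanning family with bounded coordinate forms. This covers row vectors, matrices and products
    alike, and the bound [K] is what makes linear maps continuous. *)
Definition fdim (V: normedModType R): Prop:= exists (I: finType) (e: I -> V) (l: I -> {linear V -> R^o}) (K: R),
 [/\ 0 < K, forall i v, `|l i v| <= K * `|v| & forall v, v = \sum_i l i v *: e i].

Definition mklin (V W: lmodType R) (f: V -> W) (lf: linear f): {linear V -> W}:= HB.pack f (GRing.isLinear.Build _ _ _ _ f lf).

Lemma lip_lin_cont (V W: normedModType R) (f: {linear V -> W}) (K: R): (forall v, `|f v| <= K * `|v|) -> continuous f.
Proof.
move=> fK x;apply/cvgrPdist_lt=> e e0.
have K1: 0 < `|K| + 1 by rewrite ltr_wpDl.
near=> y;rewrite -linearB (le_lt_trans (fK _))//.
apply: (@le_lt_trans _ _ ((`|K| + 1) * `|x - y|)). by rewrite ler_wpM2r// (le_trans (ler_norm _))// lerDl.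
rewrite -ltr_pdivlMl//;near: y.
by apply: cvgr_dist_lt=>//;rewrite mulr_gt0// invr_gt0.
Unshelve. all: by end_near. Qed.
Lemma fdim_bnd (V W: normedModType R) (f: V -> W): fdim V -> linear f -> exists2 K, 0 < K & forall v, `|f v| <= K * `|v|.
Proof.
move=>[I [e [l [K [K0 lK vE]]]]] lf.
exists (K * (\sum_i `|mklin lf (e i)|) + 1). by rewrite ltr_wpDl// mulr_ge0 ?(ltW K0) ?sumr_ge0.
move=> v;rewrite [in leLHS](vE v) -[f _]/(mklin lf _) linear_sum mulrDl mul1r.
apply: (le_trans (ler_norm_sum _ _ _)).
rewrite -[leLHS]addr0 lerD// mulrAC mulr_sumr ler_sum// => i _.
by rewrite linearZ normrZ ler_wpM2r.
Qed.
Lemma fdim_cont (V W: normedModType R) (f: {linear V -> W}): fdim V -> continuous f.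
Proof.
move=> fV;have [K _ fK]:= fdim_bnd fV (linearP f).
exact: lip_lin_cont fK.
Qed.
Lemma fdim_R: fdim R^o.
Proof.
exists unit, (fun=> 1), (fun=> idfun), 1;split=>// [i v|v]. by rewrite mul1r.
by rewrite (bigD1 tt)//= big1 ?addr0//;rewrite [_ *: _]mulr1.
Qed.
Lemma co_is_lin m n i j: linear (fun A: 'M[R]_(m, n)=> A i j: R^o).
Proof. by move=> a u v;rewrite !mxE. Qed.
Lemma mx_co_le m n (A: 'M[R]_(m, n)) i j: `|A i j| <= `|A|.
Proof.
rewrite [leRHS]mx_normrE.
exact: (@le_bigmax _ _ _ 0 (fun p=> `|A p.1 p.2|) (i, j)).
Qed.
Lemma mx_norm_leP m n (A: 'M[R]_(m, n)) (c: R): 0 <= c -> (forall i j, `|A i j| <= c) -> `|A| <= c.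
Proof.
move=> c0 Ac;rewrite [leLHS]mx_normrE;by apply: bigmax_le.
Qed.
Lemma fmx m n: fdim 'M[R]_(m, n).
Proof.
exists ('I_m * 'I_n)%type, (fun p=> delta_mx p.1 p.2), (fun p=> mklin (@co_is_lin m n p.1 p.2)), 1.
split=>// [p A|A];first by rewrite mul1r;exact: mx_co_le.
by rewrite {1}[A]matrix_sum_delta pair_bigA.
Qed.
Lemma fst_is_lin (V W: normedModType R) (l: {linear V -> R^o}): linear (fun p: V * W=> l p.1).
Proof. by move=> a u v;rewrite/= linearP. Qed.
Lemma snd_is_lin (V W: normedModType R) (l: {linear W -> R^o}): linear (fun p: V * W=> l p.2).
Proof. by move=> a u v;rewrite/= linearP. Qed.
Lemma fdim_prod (V W: normedModType R): fdim V -> fdim W -> fdim (V * W)%type.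
Proof.
move=>[I [e [l [K [K0 lK vE]]]]] [J [e' [l' [K' [K'0 lK' vE']]]]].
exists (I + J)%type, (fun i=> match i with inl i=> (e i, 0) | inr j=> (0, e' j) end), (fun i=> match i with | inl i=> mklin (@fst_is_lin V W (l i))
  | inr j=> mklin (@snd_is_lin V W (l' j)) end), (K + K').
split;first exact: addr_gt0. move=>[i|j] v/=. rewrite (le_trans (lK _ _))// mulrDl -[leLHS]addr0 lerD ?mulr_ge0 ?(ltW K'0)//. by rewrite ler_wpM2l ?(ltW K0)// prod_normE le_max lexx.
 rewrite (le_trans (lK' _ _))// mulrDl -[leLHS]add0r lerD ?mulr_ge0 ?(ltW K0)//. by rewrite ler_wpM2l ?(ltW K'0)// prod_normE le_max lexx orbT.
have sum1 (A: finType) (F: A -> V * W): \sum_i F i = (\sum_i (F i).1, \sum_i (F i).2). by elim/big_rec3: _=>// i x y z _ ->;case: (F i).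
move=>[v w];rewrite big_sumType/= !sum1/=.
congr (_, _). rewrite [LHS]vE [X in _ + X]big1 ?addr0// => j _. by rewrite scaler0.
rewrite [LHS]vE' [X in X + _]big1 ?add0r// => i _.
by rewrite scaler0.
Qed.
End FiniteDimension.

(** * Differentiability and bilinear maps *)

Section Differentiability.
Context {R: realType}.
Implicit Types V W Z: normedModType R.

Lemma nbhs_ltP V (x: V) (P: V -> Prop): (\forall y \near x, P y) <-> exists2 r: R, 0 < r & forall y, `|y - x| < r -> P y.
Proof.
split=>[/nbhs_normP[r/= r0 rP]|[r r0 rP]]. by exists r=>// y yx;apply: rP;rewrite/= distrC.
by apply/nbhs_normP;exists r=>//= y/=;rewrite distrC=> /rP.
Qed.
Lemma cont_ltP V W (f: V -> W) (x: V): {for x, continuous f} <-> forall e: R, 0 < e -> exists2 r: R, 0 < r & forall y, `|y - x| < r -> `|f y - f x| < e.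
Proof.
split=>[cf e e0|H]. by apply/nbhs_ltP;move/cvgrPdist_lt: cf=> /(_ e e0);apply: filterS=> y;rewrite distrC.
apply/cvgrPdist_lt=> e e0;have /nbhs_ltP:= H e e0.
by apply: filterS=> y;rewrite distrC.
Qed.
Lemma dif_ltP V W (f: V -> W) (x: V): differentiable f x -> forall e: R, 0 < e -> exists2 r: R, 0 < r & forall y, `|y - x| < r -> `|f y - f x - 'd f x (y - x)| <= e * `|y - x|.
Proof.
move=> /diff_locallyP[_ fE] e e0.
have:= fE=> /eqaddoP /(_ e e0) /nbhs_ltP[r r0 rP].
exists r=>// y yx;have:= rP (y - x);rewrite subr0=> /(_ yx).
rewrite (_: _ (y - x) = f y - f x - 'd f x (y - x))//.
by rewrite !fctE/= /shift/= subrK opprD addrA.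
Qed.
Lemma lt_dif V W (f: V -> W) (x: V) (L: {linear V -> W}): continuous L -> (forall e: R, 0 < e -> exists2 r: R, 0 < r & forall y, `|y - x| < r -> `|f y - f x - L (y - x)| <= e * `|y - x|) ->
 differentiable f x /\ 'd f x = L :> (V -> W).
Proof.
move=> cL H.
have fE: f \o shift x = cst (f x) + L +o_ (0: V) id. apply/eqaddoP=> e e0;apply/nbhs_ltP;have [r r0 rP]:= H e e0. exists r=>// y;rewrite subr0=> yr;have:= rP (y + x).
 by rewrite addrK !fctE /shift/= opprD addrA;exact.
have dL:= diff_unique cL fE.
by split=>//;apply/diff_locallyP;rewrite dL.
Qed.

Definition bilin_map V1 V2 W (b: V1 -> V2 -> W): Prop:= [/\ forall v, linear (b^~ v), forall u, linear (b u) & exists2 K: R, 0 < K & forall u v, `|b u v| <= K * `|u| * `|v|].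

Lemma fdim_bilin V1 V2 W (b: V1 -> V2 -> W): fdim V1 -> fdim V2 -> (forall v, linear (b^~ v)) -> (forall u, linear (b u)) -> bilin_map b.
Proof.
move=>[I [e [l [K [K0 lK vE]]]]] f2 bl br;split=>//.
have /choice[C CP] : forall i, exists C, 0 <= C /\ forall v, `|b (e i) v| <= C * `|v|. by move=> i;have [C C0 CP]:= fdim_bnd f2 (br (e i));exists C;split=>//;exact: ltW.
exists (K * (\sum_i C i) + 1). by rewrite ltr_wpDl// mulr_ge0 ?(ltW K0) ?sumr_ge0// => i _;have []:= CP i.
move=> u v;rewrite [in leLHS](vE u) -[b _ v]/(mklin (bl v) _) linear_sum.
apply: (le_trans (ler_norm_sum _ _ _)).
apply: (@le_trans _ _ (K * (\sum_i C i) * `|u| * `|v|));last first. by rewrite ler_wpM2r// ler_wpM2r// lerDl.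
rewrite mulr_sumr !mulr_suml ler_sum// => i _.
rewrite linearZ normrZ/= (mulrAC K) -mulrA.
have [_ /(_ v) Cv]:= CP i.
by rewrite mulrA -(mulrA (K * _)) ler_pM.
Qed.
Lemma diff_bilin V V1 V2 W (b: V1 -> V2 -> W) (f: V -> V1) (g: V -> V2) x: bilin_map b -> differentiable f x -> differentiable g x -> differentiable (fun y=> b (f y) (g y)) x /\
 'd (fun y=> b (f y) (g y)) x = (fun v=> b ('d f x v) (g x) + b (f x) ('d g x v)) :> (V -> W).
Proof.
move=>[bl br [K K0 bK]] df dg.
have bBl u u' v: b (u - u') v = b u v - b u' v by exact: (linearB (mklin (bl v))).
have bBr u v v': b u (v - v') = b u v - b u v' by exact: (linearB (mklin (br u))).
have bDl u u' v: b (u + u') v = b u v + b u' v by exact: (linearD (mklin (bl v))).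
have bDr u v v': b u (v + v') = b u v + b u v' by exact: (linearD (mklin (br u))).
have lL: linear (fun v=> b ('d f x v) (g x) + b (f x) ('d g x v)). move=> a u v;rewrite !linearP [b (_ *: _ + _) _]bl [b _ (_ *: _ + _)]br. by rewrite scalerDr addrACA.
have [A A0 dfA]:= linear_lipschitz (diff_continuous df).
have [B B0 dgB]:= linear_lipschitz (diff_continuous dg).
apply: (lt_dif (L:= mklin lL)). apply: (@lip_lin_cont _ _ _ _ (K * A * `|g x| + K * `|f x| * B))=> v. rewrite/= (le_trans (ler_normD _ _))// mulrDl lerD// (le_trans (bK _ _))//.
  by rewrite (mulrAC (K * A)) ler_wpM2r// -mulrA ler_pM2l. by rewrite -(mulrA _ B) ler_wpM2l// mulr_ge0// ltW.
move=> e e0;pose M:= K * (`|g x| + `|f x| + A + 1).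
have M0: 0 < M by rewrite mulr_gt0// ltr_wpDl// !addr_ge0// ltW.
have eM0: 0 < Num.min 1 (e / (M * 1)) by rewrite lt_min ltr01 divr_gt0// mulr1.
have e1: 0 < Num.min 1 (e / M) by rewrite lt_min ltr01 divr_gt0.
have [r1 r10 H1]:= dif_ltP df e1.
have [r2 r20 H2]:= dif_ltP dg e1.
have cg:= differentiable_continuous dg.
have /cont_ltP/(_ _ e1)[r3 r30 H3]:= cg.
exists (Num.min r1 (Num.min r2 r3));first by rewrite !lt_min r10 r20.
move=> y;rewrite !lt_min=> /and3P[y1 y2 y3].
have {}H1:= H1 _ y1;have {}H2:= H2 _ y2;have {}H3:= H3 _ y3.
set h:= y - x in y1 y2 y3 H1 H2 *.
(* The remainder consists of the two remainders of [f] and [g] and of the product of the increments,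
   which is of second order. *)
have -> : b (f y) (g y) - b (f x) (g x) - (mklin lL) h = b (f y - f x - 'd f x h) (g x) + b (f x) (g y - g x - 'd g x h)
  + b (f y - f x) (g y - g x). rewrite/= !bBl !bBr. zmod.
have fyx: `|f y - f x| <= (A + 1) * `|h|. rewrite -[f y - f x](subrK ('d f x h)) (le_trans (ler_normD _ _))// mulrDl addrC lerD//. by rewrite (le_trans H1)// ler_wpM2r// ge_min lexx.
have emE: K * (Num.min 1 (e / M)) * (`|g x| + `|f x| + A + 1) <= e. rewrite mulrAC -/M -ler_pdivlMl// mulrC ge_min mulrC;apply/orP;right;by rewrite mulrC.
set em:= Num.min 1 (e / M) in e1 H1 H2 H3 emE.
apply: (le_trans (ler_normD _ _));apply: (le_trans (lerD (ler_normD _ _) (lexx _))).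
apply: (@le_trans _ _ (K * em * (`|g x| + `|f x| + A + 1) * `|h|));last by rewrite ler_wpM2r.
have T1:= le_trans (bK (f y - f x - 'd f x h) (g x)) (ler_wpM2r (normr_ge0 _) (ler_wpM2l (ltW K0) H1)).
have T2:= le_trans (bK (f x) (g y - g x - 'd g x h)) (ler_wpM2l (mulr_ge0 (ltW K0) (normr_ge0 _)) H2).
have T3:= le_trans (bK (f y - f x) (g y - g x)) (ler_pM (mulr_ge0 (ltW K0) (normr_ge0 _)) (normr_ge0 _) (ler_wpM2l (ltW K0) fyx) (ltW H3)).
move: T1 T2 T3;move: `|b _ _| `|b _ _| `|b _ _| `|f x| `|g x| `|h| => *.
lra.
Qed.
Lemma dif_near V W (f g: V -> W) (x: V): {near x, f =1 g} -> differentiable f x -> differentiable g x /\ 'd g x = 'd f x :> (V -> W).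
Proof.
move=> fg df;apply: lt_dif;first exact: diff_continuous.
have fgx:= nbhs_singleton fg;move/nbhs_ltP: fg=>[r r0 fg] e e0.
have [s s0 H]:= dif_ltP df e0.
exists (Num.min r s);first by rewrite lt_min r0.
by move=> y;rewrite lt_min=> /andP[yr ys];rewrite -fg// -fgx;exact: H.
Qed.
End Differentiability.

(** * Calculus of [Ck] maps *)

Section CkTheory.
Context {R: realType}.
Implicit Types V W Z: normedModType R.

Lemma Ck_ext V W k (f g: V -> W) (U: set V): open U -> (forall x, U x -> f x = g x) -> Ck k f U -> Ck k g U.
Proof.
move=> oU;elim: k f g=>[|k IH] f g fg/=. move=> cf x Ux;have fgx: {near x, f =1 g}. by apply: filterS (open_nbhs_nbhs (conj oU Ux))=> y /fg. rewrite /prop_for/continuous_at -(fg _ Ux).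
 exact: cvg_trans (near_eq_cvg fgx) (cf x Ux).
have near_fg x: U x -> {near x, f =1 g}. by move=> Ux;apply: filterS (open_nbhs_nbhs (conj oU Ux))=> y /fg.
move=>[df Cf];split=>[x Ux|v]. exact: (dif_near (near_fg _ Ux) (df _ Ux)).1.
apply: IH (Cf v)=> x Ux;exact: near_eq_derive (near_fg _ Ux).
Qed.
Lemma Ck_sub V W k (f: V -> W) (U U': set V): U' `<=` U -> Ck k f U -> Ck k f U'.
Proof.
move=> U'U;elim: k f=>[|k IH] f/=;first by move=> cf x /U'U;exact: cf.
by move=>[df Cf];split=>[x /U'U/df//|v];exact: IH.
Qed.
Lemma Ck_cont V W k (f: V -> W) (U: set V): Ck k f U -> forall x, U x -> {for x, continuous f}.
Proof.
case: k=>[//|k [df _] x Ux];exact: differentiable_continuous (df x Ux).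
Qed.
Lemma CkS V W k (f: V -> W) (U: set V): Ck k.+1 f U -> Ck k f U.
Proof.
elim: k f=>[|k IH] f;first by case=> df _ x Ux;exact/differentiable_continuous/df.
by case=> df Cf;split=>// v;exact: IH.
Qed.
Lemma Ck_cst V W k (c: W) (U: set V): Ck k (cst c) U.
Proof.
elim: k c=>[|k IH] c;first by move=> x _;exact: cst_continuous.
split=>[x _|v];first exact: differentiable_cst.
rewrite (_: (fun x=> _) = cst 0)//.
by apply/funext=> x;rewrite derive_cst.
Qed.
Lemma CkD V W k (f g: V -> W) (U: set V): open U -> Ck k f U -> Ck k g U -> Ck k (fun x=> f x + g x) U.
Proof.
move=> oU;elim: k f g=>[|k IH] f g. by move=> cf cg x Ux;apply: continuousD; [exact: cf|exact: cg].
move=>[df Cf] [dg Cg];split=>[x Ux|v];first by apply: differentiableD;auto.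
apply: (Ck_ext oU _ (IH _ _ (Cf v) (Cg v)))=> x Ux.
by rewrite -deriveD//;apply: diff_derivable;auto.
Qed.
Lemma Ck_sum V W k (I: finType) (f: I -> V -> W) (U: set V): open U -> (forall i, Ck k (f i) U) -> Ck k (fun x=> \sum_i f i x) U.
Proof.
move=> oU Cf;elim: (index_enum I)=>[|i s IH]. apply: (Ck_ext oU _ (Ck_cst k 0 U))=> x _;by rewrite big_nil.
by apply: (Ck_ext oU _ (CkD oU (Cf i) IH))=> x _;rewrite big_cons.
Qed.
Lemma Ck_lin V W Z k (f: V -> W) (l: {linear W -> Z}) (U: set V): open U -> continuous l -> Ck k f U -> Ck k (fun x=> l (f x)) U.
Proof.
move=> oU cl;elim: k f=>[|k IH] f. by move=> cf x Ux;apply: (@continuous_comp _ _ _ f l); [exact: cf|exact: cl].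
move=>[df Cf];have dl y: differentiable l y by exact: linear_differentiable.
split=>[x Ux|v];first by apply: (@differentiable_comp _ _ _ _ f l);auto.
apply: (Ck_ext oU _ (IH _ (Cf v)))=> x Ux.
have dlf: differentiable (l \o f) x by apply: differentiable_comp;auto.
rewrite [RHS](deriveE _ dlf) deriveE;last exact: df.
by rewrite (@diff_comp _ _ _ _ f l) ?diff_lin//;exact: df.
Qed.
Lemma CkZ V W k (a: V -> R) (f: V -> W) (U: set V): open U -> Ck k a U -> Ck k f U -> Ck k (fun x=> a x *: f x) U.
Proof.
move=> oU;elim: k a f=>[|k IH] a f. by move=> ca cf x Ux;apply: continuousZ; [exact: ca|exact: cf].
move=> Ca Cf;have [da Da]:= Ca;have [df Df]:= Cf.
have bil: bilin_map (fun (c: R^o) (w: W)=> c *: w). split=>[v c u w|c d v w|];first by rewrite scalerDl scalerA. by rewrite scalerDr !scalerA mulrC. by exists 1=>// c w;rewrite mul1r normrZ.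
split=>[x Ux|v];first exact: (diff_bilin bil (da x Ux) (df x Ux)).1.
apply: (Ck_ext oU _ (CkD oU (IH _ _ (Da v) (CkS Cf)) (IH _ _ (CkS Ca) (Df v))))=> x Ux.
have [D1 D2]:= diff_bilin bil (da x Ux) (df x Ux).
rewrite (deriveE _ (df x Ux)) (deriveE _ (da x Ux)) [RHS](deriveE _ D1).
by rewrite -[RHS]/(('d _ x: V -> W) v) D2.
Qed.
(** In the finite coordinates of [W], the chain rule writes a directional derivative of [f \o g] as
    a sum of coordinates of that of [g] times partial derivatives of [f] composed with [g]. The
    induction hypothesis applies to each of these compositions. *)
Lemma Ck_comp V W Z k (g: V -> W) (f: W -> Z) (U: set V) (U': set W): fdim W -> open U -> open U' -> (forall x, U x -> U' (g x)) -> Ck k g U -> Ck k f U' -> Ck k (f \o g) U.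
Proof.
move=> fW oU oU' gU;have [I [e [l [K [K0 lK wE]]]]]:= fW.
elim: k f=>[|k IH] f. by move=> cg cf x Ux;apply: continuous_comp; [exact: cg|exact/cf/gU].
move=> Cg Cf;have [dg Dg]:= Cg;have [df Df]:= Cf.
have dfg x: U x -> differentiable (f \o g) x. by move=> Ux;apply: differentiable_comp; [exact: dg|exact/df/gU].
split=>// v.
have C1: Ck k (fun x=> \sum_i l i ('D_v g x) *: ('D_(e i) f \o g) x) U. apply: Ck_sum=>// i;apply: CkZ=>//;last exact: IH (CkS Cg) (Df _).
 by apply: (@Ck_lin _ _ _ _ _ (l i))=>//; [exact: fdim_cont|exact: Dg].
apply: (Ck_ext oU _ C1)=> x Ux.
rewrite (deriveE _ (dfg _ Ux)) -[RHS]/(('d (f \o g) x: V -> Z) v).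
rewrite (diff_comp (dg _ Ux) (df _ (gU _ Ux)))/=.
rewrite [in RHS](wE ('d g x v)) linear_sum.
by apply: eq_bigr=> i _;rewrite linearZ (deriveE _ (df _ (gU _ Ux))) (deriveE _ (dg _ Ux)).
Qed.
End CkTheory.

(** * Strict derivatives and the mean value inequality *)

Section StrictDifferentiability.
Context {R: realType}.
Implicit Types V W Z: normedModType R.

(** In a strict derivative both points vary. It gives a Lipschitz bound near [x] and, through
    [local_surj], local surjectivity; the derivative at a single point gives neither. *)
Definition sdiff V W (f: V -> W) (x: V) (L: {linear V -> W}): Prop:= forall e: R, 0 < e -> exists2 r: R, 0 < r & forall y z, `|y - x| < r -> `|z - x| < r ->
  `|f y - f z - L (y - z)| <= e * `|y - z|.

Lemma sd_dif V W (f: V -> W) x L: fdim V -> sdiff f x L -> differentiable f x /\ 'd f x = L :> (V -> W).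
Proof.
move=> fV fL;apply: lt_dif;first exact: fdim_cont.
move=> e e0;have [r r0 rP]:= fL e e0;exists r=>// y yx;apply: rP=>//.
by rewrite subrr normr0.
Qed.
Lemma sd_lip V W (f: V -> W) x L: fdim V -> sdiff f x L -> exists K: R, 0 < K /\ exists2 r: R, 0 < r & forall y z, `|y - x| < r -> `|z - x| < r -> `|f y - f z| <= K * `|y - z|.
Proof.
move=> fV fL;have [K K0 LK]:= fdim_bnd fV (linearP L).
exists (1 + K);split;first by rewrite addr_gt0.
have [r r0 rP]:= fL 1 ltr01;exists r=>// y z yx zx.
rewrite -[f y - f z](subrK (L (y - z))) (le_trans (ler_normD _ _))// mulrDl.
by rewrite lerD ?rP.
Qed.
Lemma sd_cont V W (f: V -> W) x L: fdim V -> sdiff f x L -> {for x, continuous f}.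
Proof. by move=> fV /(sd_dif fV)[/differentiable_continuous]. Qed.
Lemma sd_near V W (f g: V -> W) x L: {near x, f =1 g} -> sdiff f x L -> sdiff g x L.
Proof.
move=> /nbhs_ltP[s s0 fg] fL e e0;have [r r0 rP]:= fL e e0.
exists (Num.min r s);first by rewrite lt_min r0.
move=> y z;rewrite !lt_min=> /andP[yr ys] /andP[zr zs].
by rewrite -!fg//;exact: rP.
Qed.
Lemma sd_eq V W (f: V -> W) x (L L': {linear V -> W}): L =1 L' -> sdiff f x L -> sdiff f x L'.
Proof.
move=> LL' fL e e0;have [r r0 rP]:= fL e e0.
by exists r=>// y z *;rewrite -LL';exact: rP.
Qed.
Lemma sd_comp V W Z (f: V -> W) (g: W -> Z) x (L: {linear V -> W}) (L': {linear W -> Z}): fdim V -> fdim W -> sdiff f x L -> sdiff g (f x) L' -> sdiff (g \o f) x (L' \o L).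
Proof.
move=> fV fW fL gL e e0.
have [K [K0 [r r0 rP]]]:= sd_lip fV fL.
have [K' K'0 LK]:= fdim_bnd fW (linearP L').
have e1: 0 < e / 2 / K by rewrite !divr_gt0.
have [s s0 sP]:= gL _ e1.
have e2: 0 < e / 2 / K' by rewrite !divr_gt0.
have [t t0 tP]:= fL _ e2.
have cf: {for x, continuous f}:= sd_cont fV fL.
have /cont_ltP/(_ _ s0)[q q0 qP]:= cf.
exists (Num.min r (Num.min t q));first by rewrite !lt_min r0 t0.
move=> y z;rewrite !lt_min=> /and3P[yr yt yq] /and3P[zr zt zq].
have H1:= sP _ _ (qP _ yq) (qP _ zq).
have H2:= tP _ _ yt zt.
have H3:= rP _ _ yr zr.
have -> : (g \o f) y - (g \o f) z - (L' \o L) (y - z) = (g (f y) - g (f z) - L' (f y - f z)) + L' (f y - f z - L (y - z)). by rewrite/= (linearB L' _ (L _)) addrA subrK.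
apply: (le_trans (ler_normD _ _));rewrite [e]splitr mulrDl lerD//. apply: (le_trans H1);apply: (@le_trans _ _ (e / 2 / K * (K * `|y - z|))). by rewrite ler_wpM2l// ltW.
 by rewrite mulrA divfK// gt_eqF.
apply: (le_trans (LK _));rewrite mulrC -ler_pdivlMr//.
by apply: (le_trans H2);rewrite mulrAC.
Qed.
Lemma is_dere_line V W (g: V -> W) (z h: V) (t: R): differentiable g (z + t *: h) -> is_derive t 1 (fun s: R=> g (z + s *: h)) ('d g (z + t *: h) h).
Proof.
move=> dg.
have lh: linear (fun s: R^o=> s *: h). by move=> a u v;rewrite scalerDl scalerA.
have [dl dlE] : differentiable (fun s: R^o=> z + s *: h) t /\ 'd (fun s: R^o=> z + s *: h) t = mklin lh :> (R^o -> V). apply: lt_dif;first exact/fdim_cont/fdim_R. move=> e e0;exists 1=>// y _.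
 have -> : z + y *: h - (z + t *: h) - mklin lh (y - t) = 0. by rewrite/= scalerBl;zmod. by rewrite normr0 mulr_ge0 ?(ltW e0).
have dc: differentiable (g \o (fun s: R^o=> z + s *: h)) t. exact: differentiable_comp.
apply: DeriveDef;first by apply: diff_derivable dc.
rewrite (deriveE _ dc) -[LHS]/(('d _ t: R -> W) 1) (diff_comp dl dg)/=.
by rewrite dlE/= scale1r.
Qed.
(** The scalar mean value theorem holds in each coordinate, at intermediate points that differ;
    hence the constant [K], which depends on [W] alone. *)
Lemma fdim_mean_value W: fdim W -> exists2 K: R, 0 < K & forall V (g: V -> W) (M: R) (z h: V), 0 <= M -> (forall t: R, 0 <= t <= 1 -> differentiable g (z + t *: h)) ->
 (forall t: R, 0 <= t <= 1 -> `|'d g (z + t *: h) h| <= M) -> `|g (z + h) - g z| <= K * M.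
Proof.
move=> fW;have [I [e [l [K [K0 lK wE]]]]]:= fW.
exists (K * (\sum_i `|e i|) + 1). by rewrite ltr_wpDl// mulr_ge0 ?(ltW K0) ?sumr_ge0.
move=> V g M z h M0 dg gM.
have H i: `|l i (g (z + h) - g z)| <= K * M. have cl: continuous (l i) by exact: fdim_cont. pose phi (t: R): R:= l i (g (z + t *: h)).
 have dphi (t: R): 0 <= t <= 1 -> is_derive t 1 phi (l i ('d g (z + t *: h) h)). move=> t01;have dli y: differentiable (l i) y by exact: linear_differentiable.
  have dlg: differentiable (l i \o g) (z + t *: h). by apply: differentiable_comp; [exact: dg|exact: dli]. have:= is_dere_line dlg.
  by rewrite -[X in is_derive _ _ _ X]/(('d (l i \o g) _: V -> _) h) diff_comp ?diff_lin//;exact: dg.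
 have [c c01 cE] : exists2 c: R, c \in `[0, 1] & phi 1 - phi 0 = l i ('d g (z + c *: h) h) * (1 - 0). apply: (@MVT_segment R phi (fun c=> l i ('d g (z + c *: h) h)))=>//.
   by move=> t /itvP t01;apply: dphi;rewrite !t01. apply: continuous_in_subspaceT=> t;rewrite inE/= in_itv/= => t01. have:= dphi t t01=> D;apply: differentiable_continuous.
  exact/derivable1_diffP. move: cE;rewrite /phi scale1r scale0r addr0 subr0 mulr1 linearB=> ->. by rewrite (le_trans (lK _ _))// ler_pM2l// gM// -in_itv.
rewrite [X in `|X|](wE (g (z + h) - g z)) (le_trans (ler_norm_sum _ _ _))//.
apply: (@le_trans _ _ (K * (\sum_i `|e i|) * M));last first. by rewrite ler_wpM2r// lerDl.
rewrite mulr_sumr mulr_suml ler_sum// => i _.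
by rewrite normrZ mulrAC ler_wpM2r.
Qed.
(** The mean value inequality is applied to [f] minus its derivative at [x]. The derivative of the
    difference is small along the segment, because the finitely many partial derivatives are
    continuous. *)
Lemma C1_sd V W (f: V -> W) (U: set V) x: fdim V -> fdim W -> open U -> U x -> Ck 1 f U -> sdiff f x ('d f x).
Proof.
move=> fV fW oU Ux [df Cf] e e0.
have [K K0 KP]:= fdim_mean_value fW.
have [I [b [l [B [B0 lB vE]]]]]:= fV.
have [r0 r00 rU] : exists2 r: R, 0 < r & forall y, `|y - x| < r -> U y. by apply/nbhs_ltP;exact: open_nbhs_nbhs.
pose e':= e / (K * B * (#|I|%:R + 1)).
have I0: 0 < #|I|%:R + 1 :> R by rewrite ltr_wpDl.
have e'0: 0 < e' by rewrite divr_gt0// !mulr_gt0.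
have [r r1 rP] : exists2 r: R, 0 < r & forall y, `|y - x| < r -> U y /\ forall i, `|'D_(b i) f y - 'D_(b i) f x| <= e'.
 have: \forall y \near x, U y /\ forall i, `|'D_(b i) f y - 'D_(b i) f x| <= e'. near=> y;split;first by near: y;exact: open_nbhs_nbhs. near: y;apply: filter_forall=> i.
  have /cont_ltP/(_ _ e'0)[s s0 sP]:= Cf (b i) x Ux. by apply/nbhs_ltP;exists s=>// y /sP/ltW. by move=> /nbhs_ltP.
exists r=>// y z yr zr;set h:= y - z.
have seg (t: R): 0 <= t <= 1 -> `|z + t *: h - x| < r. move=> /andP[t0 t1]. have -> : z + t *: h - x = (1 - t) *: (z - x) + t *: (y - x). rewrite /h !scalerBr !scalerBl !scale1r;zmod.
 rewrite (le_lt_trans (ler_normD _ _))// !normrZ (ger0_norm t0) ger0_norm ?subr_ge0//. have [t00|tn0]:= eqVneq t 0;first by rewrite t00 subr0 mul1r mul0r addr0.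
 have tp: 0 < t by rewrite lt_neqAle eq_sym tn0. have: (1 - t) * `|z - x| <= (1 - t) * r by rewrite ler_wpM2l ?subr_ge0// ltW. have: t * `|y - x| < t * r by rewrite ltr_pM2l. lra.
pose L: {linear V -> W}:= 'd f x.
have cL: continuous L by exact: diff_continuous (df _ Ux).
have dLx v: differentiable L v by exact: linear_differentiable.
pose g v:= f v - L v.
have dg (t: R): 0 <= t <= 1 -> differentiable g (z + t *: h). move=> t01;apply: differentiableB;last exact: dLx. by apply: df;have []:= rP _ (seg _ t01).
have:= KP V g (e / K * `|h|) z h.
have -> : z + h = y by rewrite /h addrC subrK.
have -> : g y - g z = f y - f z - L h. by rewrite /g /h (linearB L);zmod.
rewrite [K * (_ * _)]mulrA [K * (e / K)]mulrC divfK ?gt_eqF//;apply=>//. by rewrite mulr_ge0// divr_ge0// ltW.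
move=> t t01;have [Uy Dy]:= rP _ (seg _ t01).
rewrite -[X in `|X|]/(('d (f - (L: V -> W)) (z + t *: h): V -> W) h).
have -> : ('d (f - (L: V -> W)) (z + t *: h): V -> W) h = 'd f (z + t *: h) h - L h. by rewrite (diffB (df _ Uy) (dLx _))/= diff_lin.
have lin_h (A: {linear V -> W}): A h = \sum_i l i h *: A (b i). by rewrite {1}(vE h) linear_sum;apply: eq_bigr=> i _;rewrite linearZ.
rewrite !lin_h -sumrB (le_trans (ler_norm_sum _ _ _))//.
apply: (@le_trans _ _ (\sum_(i: I) B * `|h| * e')). apply: ler_sum=> i _;rewrite -scalerBr normrZ ler_pM//. by have:= Dy i;rewrite !deriveE//;exact: df.
rewrite sumr_const -mulr_natr.
have -> : e / K = e' * B * (#|I|%:R + 1). by rewrite /e';field;rewrite !gt_eqF.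
have -> : #|(xpredT: pred I)| = #|I| by exact: eq_card.
have: 0 <= B * `|h| * e':= mulr_ge0 (mulr_ge0 (ltW B0) (normr_ge0 h)) (ltW e'0).
lra.
Unshelve. all: by end_near. Qed.
End StrictDifferentiability.

(** * Flat functions and the smooth step *)

Section FlatFunctions.
Context {R: realType}.

(** The derivatives of [expR (- t^-1)] are combinations of these functions, so that smoothness is
    proved for the whole family at once. *)
Definition flat (k: nat) (t: R): R:= if t <= 0 then 0 else t^-1 ^+ k * expR (- t^-1).

Lemma flat_le0 k t: t <= 0 -> flat k t = 0.
Proof. by rewrite /flat=> ->. Qed.
Lemma flat_gt0E k t: 0 < t -> flat k t = t^-1 ^+ k * expR (- t^-1).
Proof. by move=> t0;rewrite /flat leNgt t0. Qed.
Lemma flat_ge0 k t: 0 <= flat k t.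
Proof.
rewrite /flat;case: ifPn=>// ;rewrite -ltNge=> t0.
by rewrite mulr_ge0 ?expR_ge0// exprn_ge0// invr_ge0 ltW.
Qed.
(** This is [(y / N) ^ N <= expR y] with [y = t^-1] and [N = k.+2]. The quadratic bound makes the
    derivative at 0 vanish. *)
Lemma flat_bound k t: 0 <= t -> flat k t <= (k.+2)%:R ^+ k.+2 * t ^+ 2.
Proof.
rewrite le_eqVlt=> /orP[/eqP<-|t0]. by rewrite flat_le0// mulr_ge0 ?exprn_ge0.
rewrite flat_gt0E// expRN.
set N:= k.+2;have N0: 0 < N%:R :> R by rewrite ltr0n.
have xN: 0 < t^-1 / N%:R by rewrite divr_gt0 ?invr_gt0.
have H: (t^-1 / N%:R) ^+ N <= expR (t^-1). rewrite -[X in expR X](@divfK _ N%:R) ?gt_eqF// expRM_natr. rewrite lerXn2r ?nnegrE ?expR_ge0 ?ltW//. by apply: lt_le_trans (expR_ge1Dx _);rewrite ltrDr.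
have xN': 0 < (t^-1 / N%:R) ^+ N by rewrite exprn_gt0.
apply: (@le_trans _ _ (t^-1 ^+ k * ((t^-1 / N%:R) ^+ N)^-1)). rewrite ler_pM2l ?exprn_gt0 ?invr_gt0//. by rewrite lef_pV2 ?posrE ?expR_gt0.
rewrite exprMn invfM -exprVn invrK -!exprVn !invrK [X in _ * (X * _)]exprS exprS.
rewrite le_eqVlt;apply/orP;left;apply/eqP.
rewrite exprVn;field.
by rewrite expf_neq0 ?gt_eqF.
Qed.
Lemma is_dere_flat k (t: R): is_derive t 1 (flat k) (flat k.+2 t - k%:R * flat k.+1 t).
Proof.
have [t0|t0|->]:= ltgtP t 0.
- rewrite !flat_le0 ?ltW// mulr0 subrr. have D0: is_derive t 1 (cst 0: R -> R) 0 by exact: is_derive_cst. apply: near_eq_is_derive D0.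
 near=> u;rewrite flat_le0//;apply/ltW;near: u;exact: lt_nbhsl.
- have tn0: t != 0 by rewrite gt_eqF. have D1: is_derive t 1 (fun u: R=> u^-1) (- t ^- 2). apply: DeriveDef;first by apply: (@derivableV _ _ id)=>//;exact: derivable_id.
  rewrite (@deriveV _ _ id t 1 tn0 (@derivable_id _ _ t 1)). by rewrite derive_id [_ *: 1]mulr1. have D2: is_derive t 1 (fun u: R=> expR (- u^-1)) (t ^- 2 * expR (- t^-1)).
  have DN: is_derive t 1 (fun u: R=> - u^-1) (t ^- 2). by have:= is_deriveN D1;rewrite opprK. have:= @is_derive1_comp _ expR (fun u: R=> - u^-1) t _ _ (is_derive_expR (- t^-1)) DN.
  by rewrite mulrC. have D3:= is_deriveM (is_deriveX k D1) D2. have D4: is_derive t 1 (fun u: R=> u^-1 ^+ k * expR (- u^-1)) (flat k.+2 t - k%:R * flat k.+1 t).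
  have -> : (fun u: R=> u^-1 ^+ k * expR (- u^-1)) = [eta GRing.inv] ^+ k * (fun u: R=> expR (- u^-1)). by apply/funext=> u;rewrite mulrfctE exprfctE. apply: (is_derive_eq D3);rewrite exprfctE.
  rewrite !flat_gt0E// /GRing.scale/=. case: (k)=>[|j];first by rewrite !mul0r !mulr0 subr0 addr0 expr0 mul1r exprVn. set z:= expR _;rewrite -(exprVn t 2).
  by move: (t^-1)=> y;rewrite/= !exprS;ring. apply: near_eq_is_derive D4. by near=> u;rewrite flat_gt0E//;near: u;exact: lt_nbhsr.
rewrite !flat_le0// mulr0 subrr.
have z1: linear (fun _: R^o=> 0: R^o) by move=> a u v;rewrite scaler0 addr0.
have [d0 d0E] : differentiable (flat k: R^o -> R^o) 0 /\ 'd (flat k: R^o -> R^o) 0 = mklin z1 :> (R^o -> R^o). apply: lt_dif;first exact: cst_continuous. move=> e e0;set C:= k.+2%:R ^+ k.+2: R.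
 have C0: 0 < C by rewrite exprn_gt0// ltr0n. exists (e / C)=>[|y];first by rewrite divr_gt0. rewrite subr0 (flat_le0 _ (lexx 0)) !subr0 ltr_pdivlMr// => yC.
 have [y0|y0]:= leP y 0;first by rewrite flat_le0// normr0 mulr_ge0 ?(ltW e0). rewrite ger0_norm ?flat_ge0// (le_trans (flat_bound _ (ltW y0)))//.
 rewrite -/C expr2 mulrA;rewrite gtr0_norm// in yC *. by rewrite ler_pM2r// mulrC ltW.
apply: DeriveDef;first by apply: diff_derivable d0.
by rewrite (deriveE _ d0) -[LHS]/(('d (flat k: R^o -> R^o) 0: R^o -> R^o) 1) d0E.
Unshelve. all: by end_near. Qed.
Lemma sm_flat k: smooth_on setT (flat k: R^o -> R^o).
Proof.
move=> j;elim: j k=>[|j IH] k. move=> t _;have D:= is_dere_flat k t. by apply: differentiable_continuous;exact/derivable1_diffP.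
have df t: differentiable (flat k: R^o -> R^o) t. by have D:= is_dere_flat k t;exact/derivable1_diffP.
split=>// v.
have C1: Ck j (fun t=> v *: (flat k.+2 t + (- k%:R) *: flat k.+1 t): R^o) setT. apply: (CkZ openT)=>//;first exact: Ck_cst. apply: (CkD openT)=>//;apply: (CkZ openT)=>//;exact: Ck_cst.
apply: (Ck_ext openT _ C1)=> t _.
have D:= is_dere_flat k t.
have linv (L: {linear R^o -> R^o}): L v = v *: L 1. by rewrite -linearZ [_ *: 1]mulr1.
rewrite (deriveE _ (df t)) linv -(deriveE _ (df t)) derive_val.
by rewrite [_ *: flat _ _]mulNr.
Qed.

(* [step 0 = 0] and [step 1 = 1]; all the derivatives of [step] vanish at 0. *)
Definition step (t: R): R:= expR 1 * flat 0 t.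

Lemma sm_step: smooth_on setT (step: R^o -> R^o).
Proof.
move=> k;apply: (CkZ openT); [exact: Ck_cst|exact: sm_flat].
Qed.
Lemma step_le0 t: t <= 0 -> step t = 0.
Proof. by move=> t0;rewrite /step flat_le0// mulr0. Qed.
Lemma step1: step 1 = 1.
Proof. by rewrite /step flat_gt0E// invr1 expr0 mul1r -expRD subrr expR0. Qed.
Lemma is_dere_step (t: R): is_derive t 1 step (expR 1 * flat 2 t).
Proof.
have:= @is_deriveZ _ _ _ (flat 0) (expR 1) t 1 _ (is_dere_flat 0 t).
by rewrite mul0r subr0.
Qed.
Lemma step_bound t: 0 <= step t < expR 1.
Proof.
rewrite /step mulr_ge0 ?expR_ge0 ?flat_ge0//= gtr_pMr ?expR_gt0//.
have [t0|t0]:= leP t 0;first by rewrite flat_le0.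
by rewrite flat_gt0E// expr0 mul1r expR_lt1 oppr_lt0 invr_gt0.
Qed.
End FlatFunctions.

Lemma nbhsI2 (T: topologicalType) (x: T) (P Q: set T): nbhs x P -> nbhs x Q -> nbhs x (P `&` Q).
Proof. exact: filterI. Qed.
Lemma nbhs_imp (T: topologicalType) (x: T) (P Q: set T): (forall y, P y -> Q y) -> nbhs x P -> nbhs x Q.
Proof. exact: filterS. Qed.
Lemma open_setI_pre (T U: topologicalType) (f: T -> U) (O: set T) (V: set U): open O -> (forall x, O x -> {for x, continuous f}) -> open V -> open (O `&` f @^-1` V).
Proof.
move=> oO cf oV;rewrite openE=> x [Ox Vx].
exact: nbhsI2 (open_nbhs_nbhs (conj oO Ox)) (cf x Ox _ (open_nbhs_nbhs (conj oV Vx))).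
Qed.
Lemma Ck_id (R: realType) (V: normedModType R) k (U: set V): open U -> Ck k id U.
Proof.
move=> oU;case: k=>[|k];first by move=> x _;exact: cvg_id.
split=>[x _|v]. by apply: (@linear_differentiable _ _ _ idfun)=> y;exact: cvg_id.
apply: (Ck_ext oU (f:= cst v));last exact: Ck_cst.
by move=> x _;rewrite derive_id.
Qed.

(** * The topology of a manifold in charts *)

Section ChartTopology.
Context {R: realType} {n: nat} {M: Type} (A: atlas R n M).
Implicit Types c: chart R n M.

Lemma ch_image_open c (U: set (mspace A)): charts A c -> open U -> open (cfun c @` (U `&` cdom c)).
Proof. by move=> Ac oU;exact: oU. Qed.
Lemma open_atlas (U: set (mspace A)): (forall c, charts A c -> open (cfun c @` (U `&` cdom c))) -> open U.
Proof. by []. Qed.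
Lemma open_ch_pre c (V: set 'rV[R]_n): charts A c -> open V -> open (cdom c `&` cfun c @^-1` V: set (mspace A)).
Proof.
move=> Ac oV;apply: open_atlas=> c' Ac'.
have oI:= open_overlap Ac' Ac;have [cT _]:= smooth_transition Ac' Ac 1%N.
rewrite openE=> _ [y [[cy Vy] c'y] <-].
have oy: (cfun c' @` (cdom c' `&` cdom c)) (cfun c' y) by exists y.
have ct: {for cfun c' y, continuous (cfun c \o cinv c')}. exact/differentiable_continuous/cT.
have nV: nbhs ((cfun c \o cinv c') (cfun c' y)) V. by rewrite/= (cfunK c'y);exact: open_nbhs_nbhs.
have nI:= open_nbhs_nbhs (conj oI oy).
apply: nbhs_imp (nbhsI2 nI (ct _ nV))=> _ [[x [c'x cx] <-]]/=.
by rewrite cfunK// => Vx;exists x.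
Qed.
Lemma open_ch_domain c: charts A c -> open (cdom c: set (mspace A)).
Proof.
by move=> Ac;have:= open_ch_pre Ac openT;rewrite preimage_setT setIT.
Qed.
Lemma open_ch_image c: charts A c -> open (cfun c @` cdom c).
Proof. by move=> Ac;have:= open_overlap Ac Ac;rewrite setIid. Qed.
Lemma ch_cont c (x: mspace A): charts A c -> cdom c x -> forall r: R, 0 < r -> \forall y \near x, cdom c y /\ `|cfun c y - cfun c x| < r.
Proof.
move=> Ac cx r r0;have:= open_nbhs_nbhs (conj (open_ch_pre Ac (@ball_open _ _ (cfun c x) r)) _).
move=> /(_ x)[];first by split=>//;exact: ballxx.
move=> U [oU Ux UP];exists U;split=>// y /UP[cy].
by rewrite /preimage/= -ball_normE/= distrC.
Qed.
Lemma ch_inv_cont c (x: mspace A) (U: set (mspace A)): charts A c -> cdom c x -> nbhs x U -> \forall u \near cfun c x, [/\ cdom c (cinv c u), cfun c (cinv c u) = u & U (cinv c u)].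
Proof.
move=> Ac cx;rewrite nbhsE=> -[V [oV Vx] VU].
have:= open_nbhs_nbhs (conj (ch_image_open Ac oV) _).
move=> /(_ (cfun c x))[];first by exists x.
move=> r/= r0 rP;exists r=>// u /rP[y [Vy cy] <-].
by rewrite cfunK//;split=>//;exact: VU.
Qed.
Lemma ch_inv_near c (x: mspace A): charts A c -> cdom c x -> \forall u \near cfun c x, cdom c (cinv c u) /\ cfun c (cinv c u) = u.
Proof.
move=> Ac cx;have nT: nbhs x setT by exact: filterT.
by apply: nbhs_imp (ch_inv_cont Ac cx nT)=> u [].
Qed.
Lemma ch_nbhs c (x: mspace A) (r: R): charts A c -> cdom c x -> 0 < r -> nbhs x ([set y | cdom c y /\ `|cfun c y - cfun c x| < r] : set (mspace A)).
Proof. by move=> Ac cx r0;exact: ch_cont. Qed.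
Lemma sub_ch_nbhs c (x: mspace A) (U: set (mspace A)): charts A c -> cdom c x -> nbhs x U -> exists2 r: R, 0 < r & forall y, cdom c y -> `|cfun c y - cfun c x| < r -> U y.
Proof.
move=> Ac cx /(ch_inv_cont Ac cx)/nbhs_ltP[r r0 rP].
by exists r=>// y cy /rP[_ _];rewrite cfunK.
Qed.
Lemma transition_sd c c' (x: M): charts A c -> charts A c' -> cdom c x -> cdom c' x -> sdiff (cfun c' \o cinv c) (cfun c x) ('d (cfun c' \o cinv c) (cfun c x)).
Proof.
move=> Ac Ac' cx c'x.
apply: (C1_sd (fmx _ _) (fmx _ _) (open_overlap Ac Ac')). by exists x.
exact: (smooth_transition Ac Ac' 1).
Qed.
End ChartTopology.

(** * Smooth curves and their concatenation *)

Section SmoothInto.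
Context {R: realType} {n: nat} {M: Type} (A: atlas R n M).

(** [smooth_into] quantifies over all charts; smooth transition maps reduce it to one. *)
Lemma sm_into_ch (V: normedModType R) (f: V -> M) (u: V) c (U: set V): charts A c -> open U -> U u -> (forall v, U v -> cdom c (f v)) -> smooth_on U (cfun c \o f) -> smooth_into A f u.
Proof.
move=> Ac oU Uu Uc Cf c' Ac' c'u.
have oT:= open_overlap Ac Ac'.
pose U':= U `&` [set v | (cfun c @` (cdom c `&` cdom c')) (cfun c (f v))].
have U'c v: U' v -> cdom c' (f v). move=>[Uv [y [cy c'y]] ye]. by rewrite -(cfunK (Uc _ Uv)) -ye cfunK.
have oU': open U'. exact: (open_setI_pre oU (Ck_cont (Cf 0%N)) oT).
exists U';split=>//.
- by split=>//;exists (f u)=>//;split=>//;exact: Uc.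
- move=> k;have C1: Ck k ((cfun c' \o cinv c) \o (cfun c \o f)) U'. apply: (Ck_comp (fmx _ _) oU' oT)=>[v []//||]. by apply: (@Ck_sub _ _ _ _ _ U)=>// v [].
  exact: (smooth_transition Ac Ac' k). apply: (Ck_ext oU' _ C1)=> v [Uv _]/=. by rewrite cfunK//;exact: Uc.
Qed.
Lemma sm_into_comp (V W: normedModType R) (f: V -> M) (h: W -> V) (w: W) (O: set W): fdim V -> open O -> O w -> smooth_on O h -> smooth_into A f (h w) -> smooth_into A (f \o h) w.
Proof.
move=> fV oO Ow Ch Sf;pose c:= chart_at A (f (h w)).
have Ac: charts A c by exact: chart_atP.
have cw: cdom c (f (h w)) by exact: mem_chart_at.
have [U [oU Uw Uc CU]]:= Sf c Ac cw.
have oU':= open_setI_pre oO (Ck_cont (Ch 0%N)) oU.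
apply: (sm_into_ch Ac oU')=>// [v [_ /Uc]//|k].
apply: (@Ck_comp _ _ _ _ _ h (cfun c \o f) _ _ fV oU' oU)=>// [v []//|].
by apply: (@Ck_sub _ _ _ _ _ O)=>// v [].
Qed.
Lemma sm_into_near (V: normedModType R) (f g: V -> M) (u: V) (O: set V): open O -> O u -> (forall v, O v -> f v = g v) -> smooth_into A f u -> smooth_into A g u.
Proof.
move=> oO Ou fg Sf;pose c:= chart_at A (f u).
have Ac: charts A c by exact: chart_atP.
have [U [oU Uu Uc CU]]:= Sf c Ac (mem_chart_at A (f u)).
have oI:= openI oU oO.
apply: (sm_into_ch Ac oI)=>// [v [Uv Ov]|k]. by rewrite -fg//;exact: Uc.
apply: (Ck_ext oI (f:= cfun c \o f));first by move=> v [_ Ov]/=;rewrite fg.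
by apply: (@Ck_sub _ _ _ _ _ U)=>// v [].
Qed.
Lemma sm_into_inv c (u: 'rV[R]_n): charts A c -> (cfun c @` cdom c) u -> smooth_into A (cinv c) u.
Proof.
move=> Ac cu;have oI:= open_ch_image Ac.
apply: (sm_into_ch Ac oI)=>// [v [x cx <-]|k];first by rewrite cfunK.
apply: (Ck_ext oI (f:= id))=>[v [x cx <-] /=|];first by rewrite cfunK.
exact: Ck_id.
Qed.

Definition sm_crv (g: R -> M): Prop:= forall t: R^o, smooth_into A (g: R^o -> M) t.

Lemma sm_crv_comp (V: normedModType R) (f: V -> M) (h: R^o -> V): fdim V -> smooth_on setT h -> (forall t, smooth_into A f (h t)) -> sm_crv (f \o h).
Proof. by move=> fV Ch Sf t;apply: (sm_into_comp fV openT). Qed.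
Lemma sm_aff (V: normedModType R) (a b: V): smooth_on setT (fun t: R^o=> a + t *: b).
Proof.
move=> k;apply: (CkD openT);first exact: Ck_cst.
apply: (CkZ openT);last exact: Ck_cst.
exact: (Ck_id _ openT).
Qed.
Lemma sm_crv_cst (x: M): sm_crv (fun=> x).
Proof.
move=> t;have Ac:= chart_atP A x.
apply: (sm_into_ch Ac openT)=>// [v _|k];first exact: mem_chart_at.
exact: Ck_cst.
Qed.
Lemma sm_crv_aff (g: R -> M) (a b: R): sm_crv g -> sm_crv (fun t=> g (a + t * b)).
Proof.
move=> Sg;apply: (sm_crv_comp (f:= (g: R^o -> M)) fdim_R)=>[|t]. exact: sm_aff.
exact: Sg.
Qed.

(** [step] runs past 1 but stays below [expR 1]. The chart therefore has to contain the segment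
    prolonged by that factor. *)
Definition line_crv (c: chart R n M) (a b: 'rV[R]_n) (t: R): M:= cinv c (a + step t *: (b - a)).

Lemma line_crv_sm c a b: charts A c -> (forall s: R, 0 <= s < expR 1 -> (cfun c @` cdom c) (a + s *: (b - a))) -> sm_crv (line_crv c a b).
Proof.
move=> Ac cab;apply: (@sm_crv_comp _ (cinv c) (fun t=> a + step t *: (b - a)) (fmx _ _)).
 move=> k;apply: (Ck_comp fdim_R openT openT (g:= step: R^o -> R^o) (f:= fun s: R^o=> a + s *: (b - a)))=>//. exact: sm_step. exact: sm_aff.
by move=> t;apply: sm_into_inv=>//;apply: cab;exact: step_bound.
Qed.

(** Both pieces come to rest at time 0 with all derivatives zero. The concatenation has to be smooth
    and not only piecewise smooth, because the distance is an infimum over smooth curves. *)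
Definition cat_crv (g1 g2: R -> M) (t: R): M:= if t <= 0 then g1 (1 - step (- t)) else g2 (step t).

Lemma cat_crv_sm (g1 g2: R -> M): sm_crv g1 -> sm_crv g2 -> g1 1 = g2 0 -> sm_crv (cat_crv g1 g2).
Proof.
move=> S1 S2 g12.
have Cstep (f: R^o -> R^o): smooth_on setT f -> smooth_on setT (fun t=> step (f t): R^o). move=> Cf k;apply: (Ck_comp fdim_R openT openT (f:= step: R^o -> R^o))=>//. exact: sm_step.
have CN: smooth_on setT (fun t: R^o=> - t: R^o). move=> k;apply: (Ck_ext openT (f:= fun t: R^o=> 0 + t *: (-1: R^o): R^o))=>[t _|]. by rewrite add0r [_ *: _]mulrN1. exact: sm_aff.
have C1: smooth_on setT (fun t: R^o=> 1 - step (- t): R^o). move=> k;apply: (Ck_ext openT (f:= fun t: R^o=> 1 + (-1) *: (step (- t): R^o): R^o))=>[t _|]. by rewrite [_ *: _]mulN1r.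
 apply: (CkD openT);first exact: Ck_cst. apply: (CkZ openT); [exact: Ck_cst|exact: Cstep].
have C2: smooth_on setT (fun t: R^o=> step t: R^o) by exact: sm_step.
have K1: sm_crv (g1 \o (fun t=> 1 - step (- t))). by apply: (@sm_crv_comp _ (g1: R^o -> M) _ fdim_R C1)=> t;exact: S1.
have K2: sm_crv (g2 \o step). by apply: (@sm_crv_comp _ (g2: R^o -> M) _ fdim_R C2)=> t;exact: S2.
move=> t;have [t0|t0|->]:= ltgtP t 0.
- apply: (sm_into_near (O:= [set s: R^o | s < 0]) _ _ _ (K1 t))=>//. by move=> v/= v0;rewrite /cat_crv ltW.
- apply: (sm_into_near (O:= [set s: R^o | 0 < s]) _ _ _ (K2 t))=>//. by move=> v/= v0;rewrite /cat_crv leNgt v0.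
- pose c:= chart_at A (g1 1);have Ac: charts A c:= chart_atP A _. have cy: cdom c (g1 1):= mem_chart_at A _. have K10: (g1 \o (fun t=> 1 - step (- t))) 0 = g1 1.
  by rewrite/= oppr0 step_le0// subr0. have K20: (g2 \o step) 0 = g1 1 by rewrite/= step_le0. have [U1 [oU1 U10 U1c U1C]]:= K1 0 c Ac (eq_ind_r (cdom c) cy K10).
 have [U2 [oU2 U20 U2c U2C]]:= K2 0 c Ac (eq_ind_r (cdom c) cy K20). have oI:= openI oU1 oU2. apply: (sm_into_ch Ac oI)=>// [v [v1 v2]|k].
  (* In the chart, the concatenation is the sum of the two pieces minus their common value, since
     one of them is always at rest. *)
  by rewrite /cat_crv;case: ifP=> _; [exact: U1c|exact: U2c]. have CC: Ck k (fun t: R^o=> cfun c ((g1 \o (fun t=> 1 - step (- t))) t) +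
        (cfun c ((g2 \o step) t) + cst (- cfun c (g1 1)) t)) (U1 `&` U2). apply: (CkD oI);first by apply: (@Ck_sub _ _ _ _ _ U1)=>// v [].
  apply: (CkD oI);first by apply: (@Ck_sub _ _ _ _ _ U2)=>// v []. exact: Ck_cst. apply: (Ck_ext oI _ CC)=> v _;rewrite /cat_crv/=;case: ifP=> v0. by rewrite (step_le0 v0) -g12 subrr addr0.
 by rewrite step_le0 ?subr0 ?oppr_le0 1?ltW// 1?ltNge ?v0// addrCA subrr addr0.
Qed.

Definition joined (x y: M): Prop:= exists g: R -> M, [/\ sm_crv g, g 0 = x & g 1 = y].

Lemma joined_refl x: joined x x.
Proof. by exists (fun=> x);split=>//;exact: sm_crv_cst. Qed.
Lemma joined_trans y x z: joined x y -> joined y z -> joined x z.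
Proof.
move=>[g [Sg g0 g1]] [h [Sh h0 h1]].
exists (fun t=> cat_crv g h (-1 + t * 2));split.
- by apply: sm_crv_aff;apply: cat_crv_sm=>//;rewrite g1.
- by rewrite mul0r addr0 /cat_crv lerN10 opprK step1 subrr.
- rewrite mul1r (_: -1 + 2 = 1);last by ring. by rewrite /cat_crv lt_geF// step1.
Qed.
End SmoothInto.

(** * Inner products and positive forms *)

Section InnerProduct.
Context {R: realType} {V: lmodType R} (b: V -> V -> R).
Hypothesis bl: forall w, linear (b^~ w: V -> R^o).
Hypothesis bs: forall v w, b v w = b w v.
Hypothesis bp: forall v, v != 0 -> 0 < b v v.

Definition ip_norm (v: V): R:= Num.sqrt (b v v).

Lemma ipDl u v w: b (u + v) w = b u w + b v w.
Proof. exact: (linearD (mklin (bl w))). Qed.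
Lemma ipZl a v w: b (a *: v) w = a * b v w.
Proof. by rewrite -[b (a *: v) w]/(mklin (bl w) (a *: v)) linearZ. Qed.
Lemma ipDr u v w: b w (u + v) = b w u + b w v.
Proof. by rewrite bs ipDl !(bs w). Qed.
Lemma ipZr a v w: b w (a *: v) = a * b w v.
Proof. by rewrite bs ipZl bs. Qed.
Lemma ip0l w: b 0 w = 0.
Proof. by rewrite -(scale0r 0) ipZl mul0r. Qed.
Lemma ip0r w: b w 0 = 0.
Proof. by rewrite bs ip0l. Qed.
Lemma ipNl v w: b (- v) w = - b v w.
Proof. by rewrite -scaleN1r ipZl mulN1r. Qed.
Lemma ipNr v w: b w (- v) = - b w v.
Proof. by rewrite bs ipNl bs. Qed.
Lemma ip_ge0 v: 0 <= b v v.
Proof. by have [->|/bp/ltW//]:= eqVneq v 0;rewrite ip0l. Qed.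
Lemma ip_norm_ge0 v: 0 <= ip_norm v.
Proof. exact: sqrtr_ge0. Qed.
Lemma ip_norm_sqr v: ip_norm v ^+ 2 = b v v.
Proof. by rewrite sqr_sqrtr ?ip_ge0. Qed.
Lemma ip_norm_gt0 v: v != 0 -> 0 < ip_norm v.
Proof. by move=> /bp v0;rewrite sqrtr_gt0. Qed.
Lemma ip_norm0: ip_norm 0 = 0.
Proof. by rewrite /ip_norm ip0l sqrtr0. Qed.
Lemma ip_normZ a v: ip_norm (a *: v) = `|a| * ip_norm v.
Proof.
by rewrite /ip_norm ipZl ipZr mulrA -expr2 sqrtrM ?sqr_ge0// sqrtr_sqr.
Qed.
Lemma cauchy_schwarz v w: b v w <= ip_norm v * ip_norm w.
Proof.
have [->|w0]:= eqVneq w 0;first by rewrite ip0r ip_norm0 mulr0.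
have w1:= bp w0.
have:= ip_ge0 (b w w *: v - b v w *: w).
rewrite !(ipDl, ipDr, ipNl, ipNr, ipZl, ipZr) (bs w v)=> H.
have {}H: 0 <= b w w * (b v v * b w w - b v w ^+ 2). by apply: le_trans H _;rewrite le_eqVlt;apply/orP;left;apply/eqP;ring.
rewrite pmulr_rge0// subr_ge0 in H.
rewrite (le_trans (ler_norm _))// -sqrtr_sqr /ip_norm -sqrtrM ?ip_ge0//.
by rewrite ler_wsqrtr.
Qed.
Lemma ip_norm_tri v w: ip_norm (v + w) <= ip_norm v + ip_norm w.
Proof.
rewrite -(@ler_pXn2r _ 2)// ?nnegrE ?addr_ge0 ?ip_norm_ge0//.
rewrite ip_norm_sqr sqrrD !ip_norm_sqr ipDl !ipDr (bs w v).
have:= cauchy_schwarz v w;lra.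
Qed.
End InnerProduct.

Section PositiveForms.
Context {R: realType} {n: nat}.

Lemma pos_form_bounds (b: 'rV[R]_n -> 'rV[R]_n -> R): (forall w, linear (b^~ w: _ -> R^o)) -> (forall v w, b v w = b w v) -> (forall v, v != 0 -> 0 < b v v) ->
 exists2 k: R, 0 < k & forall v, k * `|v| <= ip_norm b v.
Proof.
move=> bl bs bp.
have bilin: bilin_map (b: 'rV[R]_n -> 'rV[R]_n -> R^o). apply: (fdim_bilin (fmx _ _) (fmx _ _) bl)=> u a v w. by rewrite !(bs u) bl.
have cf: continuous (fun v=> b v v). move=> v;have []:= diff_bilin bilin (f:= id) (g:= id) (x:= v).
 - exact: ex_diff.
 - exact: ex_diff. by move=> /differentiable_continuous.
(* The unit sphere is empty in dimension 0, where every constant will do. *)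
have [S0|S0]:= pselect ([set v: 'rV[R]_n | `|v| = 1] !=set0);last first. exists 1=>// v;have [->|v0]:= eqVneq v 0;first by rewrite normr0 mulr0 ip_norm_ge0.
 exfalso;apply: S0;exists (`|v|^-1 *: v). by rewrite/= normrZ normfV normr_id mulVf// normr_eq0.
have cS: compact [set v: 'rV[R]_n | `|v| = 1]. apply: bounded_closed_compact. by exists 1;split=>// x x1 v/= ->;exact: ltW.
 have -> : [set v: 'rV[R]_n | `|v| = 1] = Num.norm @^-1` [set 1] by []. apply: closed_comp=>[v _|];first exact: norm_continuous. exact: closed_eq.
have [v v1 vmin]:= EVT_min_rV S0 cS (continuous_subspaceT cf).
rewrite inE/= in v1.
have v0: v != 0 by rewrite -normr_eq0 v1 oner_eq0.
exists (ip_norm b v)=>[|w];first exact: (ip_norm_gt0 bp).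
have [->|w0]:= eqVneq w 0;first by rewrite normr0 mulr0 ip_norm_ge0.
have w1: `|w| != 0 by rewrite normr_eq0.
have:= vmin (`|w|^-1 *: w);rewrite inE/= normrZ normfV normr_id mulVf// => /(_ erefl) H.
rewrite -ler_pdivlMr ?normr_gt0// mulrC.
rewrite -[X in X * _](@ger0_norm _ (`|w|^-1)) ?invr_ge0// -(ip_normZ bl bs).
by rewrite ler_wsqrtr.
Qed.
Lemma pos_form_upper (b: 'rV[R]_n -> 'rV[R]_n -> R): (forall w, linear (b^~ w: _ -> R^o)) -> (forall v w, b v w = b w v) -> exists2 k: R, 0 < k & forall v, ip_norm b v <= k * `|v|.
Proof.
move=> bl bs.
have [_ _ [K K0 bK]] : bilin_map (b: 'rV[R]_n -> 'rV[R]_n -> R^o). apply: (fdim_bilin (fmx _ _) (fmx _ _) bl)=> u a v w. by rewrite !(bs u) bl.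
exists (Num.sqrt K)=>[|v];first by rewrite sqrtr_gt0.
have -> : Num.sqrt K * `|v| = Num.sqrt (K * `|v| ^+ 2). by rewrite sqrtrM ?ltW// sqrtr_sqr normr_id.
rewrite ler_wsqrtr//.
by rewrite (le_trans (ler_norm _))// expr2 mulrA bK.
Qed.
End PositiveForms.

(** Consider the supremum of the initial segments on which [P] holds: the first premise includes it,
    and the second pushes beyond it unless it is 1. *)
Lemma real_induction (R: realType) (P: R -> Prop): (forall t, 0 <= t <= 1 -> (forall s, 0 <= s < t -> P s) -> P t) -> (forall t, 0 <= t < 1 -> (forall s, 0 <= s <= t -> P s) ->
   exists2 e: R, 0 < e & forall s, t <= s < t + e -> P s) -> forall t, 0 <= t <= 1 -> P t.
Proof.
move=> H1 H2.
pose S:= [set t: R | 0 <= t <= 1 /\ forall s, 0 <= s <= t -> P s].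
have P0: P 0 by apply: H1=>[|s /andP[s0 s1]];rewrite ?lexx ?ler01//;move: (le_lt_trans s0 s1);rewrite ltxx.
have S0: S 0. by split=>[|s s0];rewrite ?lexx ?ler01//;rewrite -(le_anti s0).
have hS: has_sup S. split;first by exists 0. by exists 1=> t [/andP[]].
set T:= sup S.
have T0: 0 <= T by exact: (ub_le_sup hS.2).
have T1: T <= 1 by apply: (ge_sup hS.1)=> t [/andP[]].
have PT s: 0 <= s < T -> P s. move=> /andP[s0 sT]. have [t St st]:= @sup_adherent _ S (T - s) (eq_ind_r _ sT (subr_gt0 s T)) hS.
 by apply: St.2;rewrite s0 ltW//;move: st;rewrite /T opprB addrC subrK.
have PT' s: 0 <= s <= T -> P s. move=> /andP[s0];rewrite le_eqVlt=> /orP[/eqP->|sT];last by apply: PT;rewrite s0. by apply: H1;rewrite ?T0.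
move: T1;rewrite le_eqVlt=> /orP[/eqP T1|T1]. by move=> t;rewrite -T1;exact: PT'.
have [|e e0 eP]:= H2 T _ PT';first by rewrite T0.
exfalso;pose t:= T + Num.min (e / 2) (1 - T).
have m0: 0 < Num.min (e / 2) (1 - T) by rewrite lt_min divr_gt0// subr_gt0.
have St: S t. split=>[|s /andP[s0 st]]. rewrite addr_ge0 ?(ltW m0)//= /t -lerBrDl. by rewrite ge_min lexx orbT. have [sT|sT]:= leP s T;first by apply: PT';rewrite s0.
 apply: eP;rewrite (ltW sT)/= (le_lt_trans st)// /t ltrD2l gt_min. by rewrite ltr_pdivrMr// ltr_pMr// ltr1n.
have:= ub_le_sup hS.2 St;rewrite -/T /t gerDl leNgt m0;exact: negP.
Qed.

Section DeriveComp.
Context {R: realType}.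

Lemma dere_comp (U V W: normedModType R) (f: U -> V) (g: V -> W) (x v: U): differentiable f x -> differentiable g (f x) -> 'D_v (g \o f) x = 'd g (f x) ('D_v f x).
Proof.
move=> df dg;rewrite (deriveE _ (differentiable_comp df dg)) (deriveE _ df).
exact: (congr1 (fun F: U -> W=> F v) (diff_comp df dg)).
Qed.
Lemma cont_sumR (T: topologicalType) (I: finType) (f: I -> T -> R) (x: T): (forall i, {for x, continuous (f i)}) -> {for x, continuous (fun y=> \sum_i f i y)}.
Proof.
move=> cf;elim: (index_enum I)=>[|i s IH]. rewrite (_: (fun y=> _) = cst 0);first exact: cst_continuous. by apply/funext=> y;rewrite big_nil.
rewrite (_: (fun y=> _) = (fun y=> f i y + \sum_(j <- s) f j y));last first. by apply/funext=> y;rewrite big_cons.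
by apply: cvgD; [exact: cf|exact: IH].
Qed.
End DeriveComp.

(** * Riemannian forms in charts and the length of curves *)

Section RiemannianForms.
Context {R: realType} {n: nat} {M: Type} (A: atlas R n M).
Context (q: riemannian_metric A).
Implicit Types c: chart R n M.

Lemma tform_linl x w: linear (fun v=> tangent_form q x v w: R^o).
Proof.
by move=> a u v;rewrite /tangent_form mulmxDl mulmxDl -!scalemxAl !mxE.
Qed.
Lemma tform_sym x v w: tangent_form q x v w = tangent_form q x w v.
Proof.
rewrite /tangent_form -[LHS]/((v *m q x *m w^T) 0 0) -[in LHS](trmxK (v *m q x *m w^T)) mxE.
by rewrite !trmx_mul trmxK gram_sym mulmxA.
Qed.
Lemma tform_pos x v: v != 0 -> 0 < tangent_form q x v v.
Proof. exact: gram_pos. Qed.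

Definition ch_form c (u v w: 'rV[R]_n): R:= tangent_form q (cinv c u) (to_preferred A c u v) (to_preferred A c u w).

Lemma ch_form_linl c u w: linear (fun v=> ch_form c u v w: R^o).
Proof.
move=> a v v';rewrite /ch_form /to_preferred linearP.
exact: tform_linl.
Qed.
Lemma ch_form_sym c u v w: ch_form c u v w = ch_form c u w v.
Proof. exact: tform_sym. Qed.
Lemma ch_form_sum c u v w: ch_form c u v w = \sum_i \sum_j v 0 i * w 0 j * ch_form c u (delta_mx 0 i) (delta_mx 0 j).
Proof.
have E v' w': ch_form c u v' w' = \sum_i v' 0 i * ch_form c u (delta_mx 0 i) w'. rewrite -[LHS]/(mklin (ch_form_linl c u w') v') [in LHS](row_sum_delta v') linear_sum.
 by apply: eq_bigr=> i _;rewrite linearZ.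
rewrite E;apply: eq_bigr=> i _;rewrite ch_form_sym E mulr_sumr.
by apply: eq_bigr=> j _;rewrite ch_form_sym mulrA.
Qed.
Lemma to_preferred_center x v: to_preferred A (chart_at A x) (cfun (chart_at A x) x) v = v.
Proof.
set c:= chart_at A x;have cx: cdom c x:= mem_chart_at A x.
rewrite /to_preferred (cfunK cx) -/c.
have D: {near cfun c x, id =1 cfun c \o cinv c}. by apply: nbhs_imp (ch_inv_near (chart_atP A x) cx)=> u [_ uE];rewrite/= uE.
have did: differentiable (@id 'rV[R]_n) (cfun c x) by exact: ex_diff.
have [_ ->]:= dif_near D did.
by rewrite diff_val.
Qed.
Lemma ch_form_center x v w: ch_form (chart_at A x) (cfun (chart_at A x) x) v w = tangent_form q x v w.
Proof. by rewrite /ch_form !to_preferred_center cfunK//;exact: mem_chart_at. Qed.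
Lemma ch_form_cont c u v w: charts A c -> (cfun c @` cdom c) u -> {for u, continuous (fun u=> ch_form c u v w)}.
Proof. by move=> Ac cu;exact: (gram_smooth q v w Ac 0%N). Qed.
Lemma tnormE x v: tangent_norm q x v = ip_norm (tangent_form q x) v.
Proof. by []. Qed.
Lemma tnorm_ge0 x v: 0 <= tangent_norm q x v.
Proof. exact: sqrtr_ge0. Qed.
Lemma tnormZ x a v: tangent_norm q x (a *: v) = `|a| * tangent_norm q x v.
Proof. exact: ip_normZ (tform_linl x) (tform_sym x) _ _. Qed.
Lemma tnorm_gt0 x v: v != 0 -> 0 < tangent_norm q x v.
Proof. exact: ip_norm_gt0 (@tform_pos x) _. Qed.
Lemma tnorm0 x: tangent_norm q x 0 = 0.
Proof. exact: ip_norm0 (tform_linl x) . Qed.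
Lemma tnorm_tri x v w: tangent_norm q x (v + w) <= tangent_norm q x v + tangent_norm q x w.
Proof.
exact: (ip_norm_tri (tform_linl x) (tform_sym x) (@tform_pos x)).
Qed.
Lemma tnorm_equiv x: exists k: R, 0 < k /\ exists2 K: R, 0 < K & forall v, k * `|v| <= tangent_norm q x v <= K * `|v|.
Proof.
have [k k0 kP]:= pos_form_bounds (tform_linl x) (tform_sym x) (@tform_pos x).
have [K K0 KP]:= pos_form_upper (tform_linl x) (tform_sym x).
by exists k;split=>//;exists K=>// v;rewrite kP KP.
Qed.
Lemma ch_form_compare x: let c:= chart_at A x in exists2 r: R, 0 < r & forall u, `|u - cfun c x| < r -> (cfun c @` cdom c) u /\ forall v, Num.sqrt (ch_form c u v v) <= 2 * tangent_norm q x v /\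
  tangent_norm q x v <= 2 * Num.sqrt (ch_form c u v v).
Proof.
move=> c;have Ac: charts A c:= chart_atP A x.
have cx: cdom c x:= mem_chart_at A x.
have [k [k0 [K K0 kK]]]:= tnorm_equiv x.
(* An error of [e] in each of the [n ^ 2] entries changes the form at [v] by at most half of
   [(k * |v|) ^ 2], which is at most half of its value at [x]. *)
pose e:= k ^+ 2 / 2 / (n%:R ^+ 2 + 1).
have n0: 0 < n%:R ^+ 2 + 1 :> R by rewrite ltr_wpDl// exprn_ge0.
have e0: 0 < e by rewrite !divr_gt0// exprn_gt0.
have H: \forall u \near cfun c x, (cfun c @` cdom c) u /\ forall ij: 'I_n * 'I_n, `|ch_form c u (delta_mx 0 ij.1) (delta_mx 0 ij.2) - ch_form c (cfun c x) (delta_mx 0 ij.1) (delta_mx 0 ij.2)| < e.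
 near=> u;split;near: u. by apply: open_nbhs_nbhs;split; [exact: (open_ch_image Ac)|exists x]. apply: filter_forall=> ij. have cu: (cfun c @` cdom c) (cfun c x) by exists x.
 have /cont_ltP/(_ _ e0)[r r0 rP]:= @ch_form_cont c (cfun c x) (delta_mx 0 ij.1) (delta_mx 0 ij.2) Ac cu. by apply: (proj2 (@nbhs_ltP R 'rV[R]_n (cfun c x) _));exists r.
move: H=> /nbhs_ltP[r r0 rP];exists r=>// u /rP[cu uP];split=>// v.
have D: `|ch_form c u v v - tangent_form q x v v| <= tangent_form q x v v / 2. apply: (@le_trans _ _ (k ^+ 2 / 2 * `|v| ^+ 2));last first.
  rewrite mulrAC ler_pM2r// -exprMn -[leRHS](ip_norm_sqr (tform_linl x) (tform_sym x) (@tform_pos x)). rewrite lerXn2r ?nnegrE ?mulr_ge0 ?(ltW k0) ?ip_norm_ge0//. by have /andP[]:= kK v.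
 rewrite -ch_form_center -/c !(ch_form_sum c _ v v) -sumrB. apply: (@le_trans _ _ (\sum_(i < n) \sum_(j < n) e * `|v| ^+ 2));last first. have -> (a: R): \sum_(i < n) \sum_(j < n) a = a * n%:R ^+ 2.
   by rewrite !sumr_const !card_ord -[_ *+ n]mulr_natr -[a *+ n]mulr_natr -mulrA expr2. rewrite mulrAC ler_wpM2r ?exprn_ge0//.
  apply: (@le_trans _ _ (e * (n%:R ^+ 2 + 1)));first by apply: (ler_wpM2l (ltW e0));rewrite lerDl. by rewrite /e divfK ?gt_eqF. rewrite (le_trans (ler_norm_sum _ _ _))// ler_sum// => i _.
 rewrite -sumrB (le_trans (ler_norm_sum _ _ _))// ler_sum// => j _. rewrite -mulrBr normrM mulrC ler_pM ?(ltW (uP (i, j)))//. by rewrite normrM expr2 ler_pM// mx_co_le.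
have tfE:= ip_norm_sqr (tform_linl x) (tform_sym x) (@tform_pos x) v.
have N0:= tnorm_ge0 x v.
have t0:= ip_ge0 (tform_linl x) (@tform_pos x) v.
rewrite -tnormE in tfE.
have [D1 D2] : tangent_form q x v v <= 2 * ch_form c u v v /\ ch_form c u v v <= 2 * tangent_form q x v v. by move: D;rewrite ler_norml=> /andP[];lra.
have c0: 0 <= ch_form c u v v by move: (le_trans t0 D1);lra.
have sE:= sqr_sqrtr c0;have s0:= sqrtr_ge0 (ch_form c u v v).
by split;rewrite -(@ler_pXn2r _ 2)// ?nnegrE ?mulr_ge0// exprMn ?tfE ?sE;lra.
Unshelve. all: by end_near. Qed.

Definition speed (g: R -> M) (t: R): R:= tangent_norm q (g t) (velocity A g t).

Lemma crv_ch_dif c (g: R -> M) (t: R): charts A c -> cdom c (g t) -> smooth_into A (g: R^o -> M) t -> differentiable (cfun c \o g: R^o -> 'rV[R]_n) t.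
Proof.
by move=> Ac ct Sg;have [U [oU Ut Uc CU]]:= Sg c Ac ct;have [+ _]:= CU 1%N;exact.
Qed.
Lemma velocityE (g: R -> M) (t: R): velocity A g t = 'D_(1: R^o) (cfun (chart_at A (g t)) \o g: R^o -> _) (t: R^o).
Proof. by []. Qed.
Lemma speed_ch c (g: R -> M) (t: R): charts A c -> cdom c (g t) -> smooth_into A (g: R^o -> M) t -> speed g t = Num.sqrt (ch_form c (cfun c (g t))
  ('D_1 (cfun c \o g: R^o -> _) t) ('D_1 (cfun c \o g: R^o -> _) t)).
Proof.
move=> Ac ct Sg;rewrite /speed /tangent_norm /ch_form (cfunK ct).
suff -> : velocity A g t = to_preferred A c (cfun c (g t)) ('D_1 (cfun c \o g: R^o -> _) t) by [].
set c':= chart_at A (g t);have Ac': charts A c':= chart_atP A _.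
have c't: cdom c' (g t):= mem_chart_at A _.
have dg:= crv_ch_dif Ac ct Sg.
have dT: differentiable (cfun c' \o cinv c) (cfun c (g t)). exact: (sd_dif (fmx _ _) (transition_sd Ac Ac' ct c't)).1.
rewrite velocityE /to_preferred (cfunK ct) -/c'.
have [U [oU Ut Uc _]]:= Sg c Ac ct.
have E: {near (t: R^o), (cfun c' \o cinv c) \o (cfun c \o g) =1 cfun c' \o g}. by apply: nbhs_imp (open_nbhs_nbhs (conj oU Ut))=> s Us/=;rewrite cfunK//;exact: Uc.
rewrite -(near_eq_derive _ E);exact: dere_comp.
Qed.
Lemma speed_near (g h: R -> M) (t: R): {near t, g =1 h} -> speed g t = speed h t.
Proof.
move=> gh;rewrite /speed /velocity -(nbhs_singleton gh).
congr (tangent_norm _ _ _);apply: near_eq_derive.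
by apply: nbhs_imp gh=> s/= ->.
Qed.
Lemma speed_ge0 g t: 0 <= speed g t.
Proof. exact: tnorm_ge0. Qed.
Lemma speed_comp (g: R -> M) (h: R -> R) (t h': R): sm_crv A g -> is_derive t 1 h h' -> speed (g \o h) t = `|h'| * speed g (h t).
Proof.
move=> Sg Dh;set c:= chart_at A (g (h t));have Ac: charts A c:= chart_atP A _.
have ct: cdom c (g (h t)):= mem_chart_at A _.
have dg:= crv_ch_dif Ac ct (Sg (h t)).
have dh: differentiable (h: R^o -> R^o) t by apply/derivable1_diffP;exact: ex_derive.
rewrite /speed !velocityE/= -/c -tnormZ;congr (tangent_norm _ _ _).
rewrite (@dere_comp _ _ _ _ (h: R^o -> R^o) (cfun c \o g: R^o -> _))//.
have -> : 'D_(1: R^o) (h: R^o -> R^o) t = h' by exact: derive_val.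
by rewrite -[h' in LHS]mulr1 -[h' * 1]/(h' *: (1: R^o)) linearZ (deriveE _ dg).
Qed.
Lemma sm_into_cont (V: normedModType R) (f: V -> M) (u: V): smooth_into A f u -> {for u, continuous (f: V -> mspace A)}.
Proof.
move=> Sf;set c:= chart_at A (f u);have Ac: charts A c:= chart_atP A _.
have cu: cdom c (f u):= mem_chart_at A _.
have [U [oU Uu Uc CU]]:= Sf c Ac cu.
move=> O /(sub_ch_nbhs Ac cu)[r r0 rO].
have /cont_ltP/(_ _ r0)/nbhs_ltP H:= Ck_cont (CU 0%N) Uu.
by apply: nbhs_imp (nbhsI2 (open_nbhs_nbhs (conj oU Uu)) H)=> v [/Uc cv /rO];exact.
Qed.
Lemma speed_cont (g: R -> M): sm_crv A g -> continuous (speed g).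
Proof.
move=> Sg t;set c:= chart_at A (g t);have Ac: charts A c:= chart_atP A _.
have ct: cdom c (g t):= mem_chart_at A _.
have [U [oU Ut Uc CU]]:= Sg t c Ac ct.
pose D (s: R^o):= 'D_1 (cfun c \o g: R^o -> _) s.
have cD: {for (t: R^o), continuous D} by have [_ /(_ 1)]:= CU 1%N;exact.
have cg: {for (t: R^o), continuous (cfun c \o g: R^o -> _)}:= Ck_cont (CU 0%N) Ut.
have E: {near t, speed g =1 (fun s=> Num.sqrt (\sum_i \sum_j D s 0 i * D s 0 j * ch_form c (cfun c (g s)) (delta_mx 0 i) (delta_mx 0 j)))}. apply: nbhs_imp (open_nbhs_nbhs (conj oU Ut))=> s Us.
 by rewrite (speed_ch Ac (Uc _ Us) (Sg s)) ch_form_sum.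
have cD' i: {for t, continuous (fun s=> D s 0 i: R)}. apply: (@continuous_comp _ _ _ D (fun v: 'rV[R]_n=> v 0 i));first exact: cD. exact: coord_continuous.
suff C: {for t, continuous (fun s=> Num.sqrt (\sum_i \sum_j D s 0 i * D s 0 j * ch_form c (cfun c (g s)) (delta_mx 0 i) (delta_mx 0 j)))}.
 rewrite /continuous_at (nbhs_singleton E);apply: cvg_trans C. by apply: near_eq_cvg;apply: nbhs_imp E=> s.
apply: continuous_comp;last exact: sqrt_continuous.
apply: cont_sumR=> i;apply: cont_sumR=> j.
apply: cvgM;first by apply: cvgM;exact: cD'.
apply: (@continuous_comp _ _ _ (cfun c \o g: R^o -> _) (fun u=> ch_form c u (delta_mx 0 i) (delta_mx 0 j)))=>//.
by apply: ch_form_cont=>//;exists (g t).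
Qed.
(** Lengths are used only as increments of a primitive of the speed. Reparametrization and
    concatenation thereby reduce to the chain rule. *)
Lemma crv_len_eq (g: R -> M) (L: R -> R): sm_crv A g -> (forall t: R, 0 <= t <= 1 -> is_derive t 1 L (speed g t)) -> curve_length q g = (L 1 - L 0)%:E.
Proof.
move=> Sg LP;rewrite /curve_length EFinB.
have cL (t: R): 0 <= t <= 1 -> {for t, continuous L}. by move=> /LP D;apply: differentiable_continuous;exact/derivable1_diffP.
apply: (continuous_FTC2 (f:= speed g))=>//.
- exact/continuous_subspaceT/speed_cont.
- split.
 + by move=> t /itvP t01;have [] : is_derive t 1 L (speed g t) by apply: LP;rewrite !t01.
 + by apply: cvg_at_right_filter;apply: cL;rewrite lexx ler01.
 + by apply: cvg_at_left_filter;apply: cL;rewrite lexx ler01.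
- move=> t /itvP t01;have D: is_derive t 1 L (speed g t) by apply: LP;rewrite !t01. by rewrite derive1E derive_val.
Qed.
Lemma len_function (g: R -> M): sm_crv A g -> exists L: R -> R, forall t: R, 0 <= t <= 1 -> is_derive t 1 L (speed g t).
Proof.
(* The integral starts at -1 so that all of [[0, 1]] is interior for the fundamental theorem. *)
move=> Sg;exists (fun x=> (\int[lebesgue_measure]_(t in `[(-1)%R, x]) (speed g t))%R).
move=> t /andP[t0 t1].
have i2: lebesgue_measure.-integrable `[(-1)%R, 2%R] (EFin \o speed g). apply: continuous_compact_integrable;first exact: segment_compact. exact/continuous_subspaceT/speed_cont.
have t2: t < 2 by rewrite (le_lt_trans t1)// ltr1n.
have tm1: -1 < t by rewrite (lt_le_trans _ t0)// ltrN10.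
have [D1 D2]:= continuous_FTC1_closed t2 i2 tm1 (@speed_cont g Sg t).
by apply: DeriveDef; [exact: D1|exact: etrans (esym (derive1E _ _)) D2].
Qed.
End RiemannianForms.

Lemma dere_ge0_le {R: realType} (f f': R -> R) (s t: R): s <= t -> (forall u: R, s <= u <= t -> is_derive u 1 f (f' u) /\ 0 <= f' u) -> f s <= f t.
Proof.
move=> st fP;have df (u: R): u \in `]s, t[ -> derivable f u 1. by move=> /itvP u1;have [D _] : is_derive u 1 f (f' u) /\ 0 <= f' u by apply: fP;rewrite !u1.
apply: (ger0_derive1_le_cc df)=>//;last 2 first.
- by rewrite in_itv/= lexx st.
- by rewrite in_itv/= lexx st.
- move=> u /itvP u1;have [D f0] : is_derive u 1 f (f' u) /\ 0 <= f' u by apply: fP;rewrite !u1. by rewrite derive1E derive_val.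
- apply: continuous_in_subspaceT=> u;rewrite inE/= => /itvP u1. have [D _] : is_derive u 1 f (f' u) /\ 0 <= f' u by apply: fP;rewrite !u1.
 by apply: differentiable_continuous;exact/derivable1_diffP.
Qed.

(** * The path metric of a Riemannian manifold *)

Section RiemannianDistance.
Context {R: realType} {n: nat} {M: Type} (A: atlas R n M).
Context (q: riemannian_metric A) (HM: hausdorff_space (mspace A)).
Hypothesis joinedM: forall x y: M, joined A x y.
Local Notation d:= (riemannian_dist q).

Definition len_of (g: R -> M) (L: R -> R): Prop:= sm_crv A g /\ forall t: R, 0 <= t <= 1 -> is_derive t 1 L (speed q g t).

Lemma len_of_mono g L: len_of g L -> forall s t, 0 <= s -> s <= t -> t <= 1 -> L s <= L t.
Proof.
move=>[Sg LP] s t s0 st t1.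
apply: (dere_ge0_le (f':= speed q g))=>// u /andP[su ut].
split;last exact: speed_ge0.
by apply: LP;rewrite (le_trans s0 su) (le_trans ut t1).
Qed.
Lemma len_of_ex g: sm_crv A g -> exists L, len_of g L.
Proof. by move=> Sg;have [L LP]:= len_function q Sg;exists L. Qed.
Lemma len_of_aff g L (a b: R): len_of g L -> 0 <= b -> 0 <= a -> a + b <= 1 -> len_of (fun t=> g (a + t * b)) (fun t=> L (a + t * b)).
Proof.
move=>[Sg LP] b0 a0 ab1;split;first exact: sm_crv_aff.
move=> t /andP[t0 t1].
have Dh: is_derive t 1 (fun t: R=> a + t * b) b. have:= is_deriveD (is_derive_cst a t 1) (is_deriveM (is_derive_id t 1) (is_derive_cst b t 1)). by rewrite scaler0 !add0r [b *: 1]mulr1;exact.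
have DL: is_derive (a + t * b) 1 L (speed q g (a + t * b)). by apply: LP;rewrite addr_ge0 ?mulr_ge0//= (le_trans _ ab1)// lerD2l ler_piMl.
have -> : speed q (fun t=> g (a + t * b)) t = b * speed q g (a + t * b). by apply: etrans (speed_comp q Sg Dh) _;rewrite ger0_norm.
by have:= @is_derive1_comp _ L (fun t: R=> a + t * b) t _ _ DL Dh;rewrite mulrC.
Qed.
Lemma len_of_rev g L: len_of g L -> len_of (fun t=> g (1 + t * -1)) (fun t=> - L (1 + t * -1)).
Proof.
move=>[Sg LP];split;first exact: sm_crv_aff.
move=> t /andP[t0 t1].
have Dh: is_derive t 1 (fun t: R=> 1 + t * -1) (-1). have:= is_deriveD (is_derive_cst (1: R) t 1) (is_deriveM (is_derive_id t 1) (is_derive_cst (-1: R) t 1)).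
 by rewrite scaler0 !add0r [_ *: 1]mulr1;exact.
have DL: is_derive (1 + t * -1) 1 L (speed q g (1 + t * -1)). by apply: LP;rewrite mulrN1 subr_ge0 t1 gerDl oppr_le0.
have -> : speed q (fun t=> g (1 + t * -1)) t = - (-1 * speed q g (1 + t * -1)). by apply: etrans (speed_comp q Sg Dh) _;rewrite normrN1 mul1r mulN1r opprK.
have:= is_deriveN (@is_derive1_comp _ L (fun t: R=> 1 + t * -1) t _ _ DL Dh).
by rewrite mulrC.
Qed.
Lemma crv_len_ge0 (g: R -> M): (0 <= curve_length q g)%E.
Proof. by apply: integral_ge0=> t _;rewrite lee_fin tnorm_ge0. Qed.
(** Some smooth curve joins the two points, so the infimum is finite and [fine] loses nothing. *)
Lemma distE x y: (d x y)%:E = ereal_inf [set curve_length q c | c in [set c: R -> M | (forall t: R, smooth_into A c t) /\ c 0 = x /\ c 1 = y]].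
Proof.
rewrite /riemannian_dist fineK// fin_numElt;apply/andP;split. apply: (@lt_le_trans _ _ 0%E)=>//;apply: le_ereal_inf_tmp=> _ [c _ <-]. exact: crv_len_ge0.
have [g [Sg g0 g1]]:= joinedM x y.
have [L [_ LP]]:= len_of_ex Sg.
apply: (@le_lt_trans _ _ (curve_length q g));last by rewrite (crv_len_eq Sg LP) ltry.
by apply: ereal_inf_lbound;exists g.
Qed.
Lemma dist_le g L x y: len_of g L -> g 0 = x -> g 1 = y -> d x y <= L 1 - L 0.
Proof.
move=>[Sg LP] g0 g1;rewrite -lee_fin distE -(crv_len_eq Sg LP).
by apply: ereal_inf_lbound;exists g.
Qed.
Lemma dist_lt x y r: d x y < r -> exists g L, [/\ len_of g L, g 0 = x, g 1 = y & L 1 - L 0 < r].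
Proof.
rewrite -lte_fin distE=> /ereal_inf_lt[_ [g [Sg [g0 g1]] <-]].
have [L LP]:= len_of_ex Sg;rewrite (crv_len_eq Sg LP.2) lte_fin=> Lr.
by exists g, L.
Qed.
Lemma dist_ge0 x y: 0 <= d x y.
Proof.
rewrite -lee_fin distE;apply: le_ereal_inf_tmp=> _ [c _ <-].
exact: crv_len_ge0.
Qed.
Lemma dist_refl x: d x x = 0.
Proof.
apply/eqP;rewrite eq_le dist_ge0 andbT.
have S0: sm_crv A (fun=> x) by exact: sm_crv_cst.
have H: len_of (fun=> x) (fun=> 0). split=>// t _;have -> : speed q (fun=> x) t = 0. rewrite /Defs.velocity /speed /velocity.
  rewrite (_: _ \o _ = cst (cfun (chart_at A x) x)) ?derive_cst ?tnorm0//. exact: is_derive_cst.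
by have:= dist_le H erefl erefl;rewrite subrr.
Qed.
Lemma dist_sym x y: d x y = d y x.
Proof.
suff H u v: d u v <= d v u by apply/le_anti;rewrite !H.
apply/ler_addgt0Pr=> e e0.
have [|g [L [gL g0 g1 Le]]]:= @dist_lt v u (d v u + e);first by rewrite ltrDl.
apply: le_trans (ltW Le).
apply: le_trans (dist_le (len_of_rev gL) _ _) _;rewrite ?mul0r ?addr0 ?mul1r ?subrr//.
by rewrite opprK addrC.
Qed.
Lemma speed_eq0 (g: R -> M) (t: R): sm_crv A g -> is_derive t 1 (cfun (chart_at A (g t)) \o g: R -> 'rV[R]_n) 0 -> speed q g t = 0.
Proof. by move=> Sg D;rewrite /speed /velocity derive_val tnorm0. Qed.
Lemma is_dere_step_rev (s: R): is_derive s 1 (fun s: R=> 1 - step (- s)) (expR 1 * flat 2 (- s)).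
Proof.
have D:= is_deriveN (is_derive_id s (1: R)).
have:= is_deriveB (is_derive_cst (1: R) s 1) (@is_derive1_comp _ step (fun s: R=> - s) s _ _ (is_dere_step (- s)) D).
by rewrite sub0r mulrN1 opprK.
Qed.
(** Away from the joint one of the two summands is constant, and at the joint both speeds vanish. *)
Lemma len_of_cat g1 g2 L1 L2: len_of g1 L1 -> len_of g2 L2 -> g1 1 = g2 0 -> len_of (fun t=> cat_crv g1 g2 (-1 + t * 2)) (fun t=> L1 (1 - step (- (-1 + t * 2))) + L2 (step (-1 + t * 2))).
Proof.
move=>[S1 P1] [S2 P2] g12;have S:= cat_crv_sm S1 S2 g12.
have step01 (s: R): s <= 1 -> 0 <= step s <= 1. move=> s1;have /andP[-> _]/= := step_bound s. have [s0|s0]:= leP s 0;first by rewrite step_le0.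
 rewrite /step flat_gt0E// expr0 mul1r -expRD -[leRHS]expR0 ler_expR subr_le0. by rewrite invf_ge1.
split;first exact: sm_crv_aff.
move=> t /andP[t0 t1].
have Dh: is_derive t 1 (fun t: R=> -1 + t * 2) 2. have:= is_deriveD (is_derive_cst (-1: R) t 1) (is_deriveM (is_derive_id t 1) (is_derive_cst (2: R) t 1)).
 by rewrite scaler0 !add0r [_ *: 1]mulr1;exact.
suff H (s: R): -1 <= s <= 1 -> is_derive s 1 (fun s=> L1 (1 - step (- s)) + L2 (step s)) (speed q (cat_crv g1 g2) s). have Hs: -1 <= -1 + t * 2 <= 1 by apply/andP;split;lra.
 have:= @is_derive1_comp _ (fun s=> L1 (1 - step (- s)) + L2 (step s)) (fun t: R=> -1 + t * 2) t _ _ (H _ Hs) Dh.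
 have -> : speed q (fun t=> cat_crv g1 g2 (-1 + t * 2)) t = 2 * speed q (cat_crv g1 g2) (-1 + t * 2). by apply: etrans (speed_comp q S Dh) _;rewrite ger0_norm. by rewrite mulrC.
move=> /andP[sm1 s1].
have D1: is_derive s 1 (fun s=> L1 (1 - step (- s))) (speed q g1 (1 - step (- s)) * (expR 1 * flat 2 (- s))).
 apply: (@is_derive1_comp _ L1 (fun s: R=> 1 - step (- s)));last exact: is_dere_step_rev. apply: P1;have /step01/andP[a b] : - s <= 1 by lra. by rewrite subr_ge0 b gerBl.
have D2: is_derive s 1 (fun s=> L2 (step s)) (speed q g2 (step s) * (expR 1 * flat 2 s)). apply: (@is_derive1_comp _ L2 step);last exact: is_dere_step. by apply: P2;exact: step01.
apply: (is_derive_eq (is_deriveD D1 D2)).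
have e0: 0 <= expR 1 :> R by exact: expR_ge0.
have Z1 (a b c d: R): d = 0 -> a + b * (c * d) = a by move=> ->;rewrite !mulr0 addr0.
have Z2 (a b c d: R): d = 0 -> b * (c * d) + a = a by move=> ->;rewrite !mulr0 add0r.
have Z3 (a b: R): a * (b * 0) = 0 by rewrite !mulr0.
have [s0|s0|s0]:= ltgtP s 0.
- have E2:= flat_le0 2 (ltW s0). transitivity (speed q g1 (1 - step (- s)) * (expR 1 * flat 2 (- s))). exact: Z1 E2. have E: {near s, g1 \o (fun s=> 1 - step (- s)) =1 cat_crv g1 g2}.
  near=> u;rewrite /cat_crv ltW//;near: u;exact: lt_nbhsl. apply: etrans _ (speed_near q E). apply: etrans _ (esym (speed_comp q S1 (is_dere_step_rev s))).
 rewrite ger0_norm; [exact: mulrC|exact: mulr_ge0 e0 (flat_ge0 _ _)].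
- have ms0: - s <= 0 by rewrite oppr_le0 ltW. have E2:= flat_le0 2 ms0. transitivity (speed q g2 (step s) * (expR 1 * flat 2 s)). exact: Z2 E2. have E: {near s, g2 \o step =1 cat_crv g1 g2}.
  near=> u;rewrite /cat_crv leNgt;have -> // : 0 < u. near: u;exact: lt_nbhsr. apply: etrans _ (speed_near q E). apply: etrans _ (esym (speed_comp q S2 (is_dere_step s))).
 rewrite ger0_norm; [exact: mulrC|exact: mulr_ge0 e0 (flat_ge0 _ _)].
- have E2:= flat_le0 2 (lexx (0: R)). rewrite s0 oppr0 (Z1 _ _ _ _ E2) E2 (Z3 _ _);apply/esym/speed_eq0=>//. have E: cat_crv g1 g2 0 = g1 1 by rewrite /cat_crv lexx oppr0 step_le0// subr0.
 rewrite E;set c:= chart_at A (g1 1);have Ac: charts A c:= chart_atP A _. have c1: cdom c (g1 1):= mem_chart_at A _. have c2: cdom c (g2 0) by rewrite -g12.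
 have Z (g: R -> M) (h: R -> R): sm_crv A g -> is_derive (0: R) 1 h 0 -> cdom c (g (h 0)) -> is_derive (0: R) 1 (fun s=> cfun c (g (h s))) 0.
  move=> Sg Dh0 ch;have dg:= crv_ch_dif Ac ch (Sg _). have dh: differentiable (h: R^o -> R^o) 0 by apply/derivable1_diffP;exact: ex_derive.
  have dd: differentiable ((cfun c \o g: R^o -> _) \o (h: R^o -> R^o)) 0 by exact: differentiable_comp. apply: DeriveDef;first by apply: diff_derivable dd.
  rewrite -[LHS]/('D_(1: R^o) ((cfun c \o g: R^o -> _) \o (h: R^o -> R^o)) 0). rewrite (dere_comp _ dh dg) (_: 'D_(1: R^o) (h: R^o -> R^o) 0 = 0) ?linear0//. exact: derive_val.
 have Dr: is_derive (0: R) 1 (fun s: R=> 1 - step (- s)) 0. by have:= is_dere_step_rev (0: R);rewrite oppr0 flat_le0// mulr0. have Ds: is_derive (0: R) 1 (@step R) 0.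
  by have:= is_dere_step (0: R);rewrite flat_le0// mulr0. have W1:= Z g1 _ S1 Dr;rewrite oppr0 step_le0// subr0 in W1. have W2:= Z g2 _ S2 Ds;rewrite step_le0// in W2.
 have:= is_deriveD (is_deriveD (W1 c1) (W2 c2)) (is_derive_cst (- cfun c (g1 1)) (0: R) 1). rewrite !addr0;apply: near_eq_is_derive. near=> v;rewrite/= /cat_crv;case: ifP=> v0.
  rewrite -[LHS]/(cfun c (g1 (1 - step (- v))) + cfun c (g2 (step v)) - cfun c (g1 1)). by rewrite (step_le0 v0) -g12 addrK. have mv0: - v <= 0 by rewrite oppr_le0 ltW// ltNge v0.
 rewrite -[LHS]/(cfun c (g1 (1 - step (- v))) + cfun c (g2 (step v)) - cfun c (g1 1)). by rewrite (step_le0 mv0) subr0 addrAC subrr add0r.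
Unshelve. all: by end_near. Qed.
Lemma dist_tri y x z: d x z <= d x y + d y z.
Proof.
apply/ler_addgt0Pr=> e e0;have e2: 0 < e / 2 by rewrite divr_gt0.
have [|g1 [L1 [gL1 g10 g11 Le1]]]:= @dist_lt x y (d x y + e / 2);first by rewrite ltrDl.
have [|g2 [L2 [gL2 g20 g21 Le2]]]:= @dist_lt y z (d y z + e / 2);first by rewrite ltrDl.
have g12: g1 1 = g2 0 by rewrite g11.
apply: le_trans (dist_le (len_of_cat gL1 gL2 g12) _ _) _.
- by rewrite mul0r addr0 /cat_crv lerN10 opprK step1 subrr.
- by rewrite mul1r (_: -1 + 2 = 1) /cat_crv ?lt_geF ?step1//;ring.
- rewrite mul0r mul1r addr0 opprK step1 (_: -1 + 2 = 1);last by ring. by rewrite step1 [step (-1)]step_le0 ?lerN10// !subr0 subrr;lra.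
Qed.
Lemma dist_path x y r: d x y < r -> exists g: R -> M, [/\ sm_crv A g, g 0 = x, g 1 = y & forall t, 0 <= t <= 1 -> d x (g t) < r].
Proof.
move=> /dist_lt[g [L [gL g0 g1 Lr]]];exists g;split=>//;first exact: gL.1.
move=> t /andP[t0 t1];apply: le_lt_trans Lr.
have t1': 0 + t <= 1 by rewrite add0r.
have H:= dist_le (len_of_aff gL t0 (lexx 0) t1').
apply: le_trans (H x (g t) _ _) _;rewrite ?mul0r ?mul1r ?add0r//.
by rewrite lerB// (len_of_mono gL).
Qed.
Lemma line_crv_velocity c (a b: 'rV[R]_n) (t: R): charts A c -> (forall s: R, 0 <= s < expR 1 -> (cfun c @` cdom c) (a + s *: (b - a))) ->
 'D_(1: R^o) (cfun c \o line_crv c a b: R^o -> _) t = (expR 1 * flat 2 t) *: (b - a).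
Proof.
move=> Ac cab;set h:= b - a.
have -> : cfun c \o line_crv c a b = (fun s: R^o=> a + s *: h) \o (step: R^o -> R^o). apply/funext=> s;rewrite/= /line_crv -/h. by have [x cx <-]:= cab _ (step_bound s);rewrite cfunK.
have did v: differentiable (@id 'rV[R]_n) v by exact: ex_diff.
have Dl s: is_derive (s: R^o) (1: R^o) (fun s: R^o=> a + s *: h) h. by have:= is_dere_line (did (a + s *: h));rewrite diff_val.
have dl s: differentiable (fun s: R^o=> a + s *: h) s. by have D:= Dl s;exact/derivable1_diffP.
have Ds:= is_dere_step t.
have ds: differentiable (step: R^o -> R^o) t by exact/derivable1_diffP.
have -> : 'D_(1: R^o) ((fun s: R^o=> a + s *: h) \o (step: R^o -> R^o)) t = 'd (fun s: R^o=> a + s *: h) (step t) ('D_(1: R^o) (step: R^o -> R^o) t). exact: (dere_comp _ ds (dl _)).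
have -> : 'D_(1: R^o) (step: R^o -> R^o) t = expR 1 * flat 2 t by exact: derive_val.
have lin1 (L: {linear R^o -> 'rV[R]_n}) (k: R): L k = k *: L 1. by rewrite -linearZ [_ *: 1]mulr1.
by rewrite lin1 -(deriveE _ (dl _));congr (_ *: _);have D:= Dl (step t);exact: derive_val.
Qed.
Lemma dist_upper (z: M): let c:= chart_at A z in exists2 r: R, 0 < r & forall y y', cdom c y -> cdom c y' -> `|cfun c y - cfun c z| < r -> `|cfun c y' - cfun c z| < r ->
  d y y' <= 2 * tangent_norm q z (cfun c y' - cfun c y).
Proof.
move=> c;have Ac: charts A c:= chart_atP A z.
have [r r0 rP]:= ch_form_compare q z.
pose E: R:= expR 1;have E0: 0 <= E by exact: expR_ge0.
(* [line_crv] stretches the segment by a factor below [E]; this radius keeps all of it within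
   distance [r] of the centre. *)
exists (r / (1 + 2 * E));first by rewrite divr_gt0// ltr_wpDr// mulr_ge0.
move=> y y' cy cy';rewrite !ltr_pdivlMr ?ltr_wpDr ?mulr_ge0// => yr y'r.
set a:= cfun c y in yr *;set b:= cfun c y' in y'r *.
have abr (s: R): 0 <= s < E -> `|a + s *: (b - a) - cfun c z| < r. move=> /andP[s0 sE];have -> : a + s *: (b - a) - cfun c z = (a - cfun c z) + s *: ((b - cfun c z) - (a - cfun c z)).
  by rewrite (_: (b - cfun c z) - (a - cfun c z) = b - a);zmod. apply: le_lt_trans (ler_normD _ _) _;rewrite normrZ (ger0_norm s0). have H:= ler_normB (b - cfun c z) (a - cfun c z).
 have H2: s * `|(b - cfun c z) - (a - cfun c z)| <= E * (`|b - cfun c z| + `|a - cfun c z|). by apply: ler_pM=>//;exact: ltW. have [ab|ab]:= leP `|a - cfun c z| `|b - cfun c z|.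
  have: E * `|a - cfun c z| <= E * `|b - cfun c z| by rewrite ler_wpM2l. lra. have: E * `|b - cfun c z| <= E * `|a - cfun c z| by rewrite ler_wpM2l// ltW. lra.
have cab (s: R): 0 <= s < expR 1 -> (cfun c @` cdom c) (a + s *: (b - a)). by move=> /abr/rP[].
have Sg:= line_crv_sm Ac cab.
have [L LP]:= len_of_ex Sg.
have g0: line_crv c a b 0 = y by rewrite /line_crv step_le0// scale0r addr0 cfunK.
have g1: line_crv c a b 1 = y'. by rewrite /line_crv step1 scale1r addrC subrK cfunK.
apply: le_trans (dist_le LP g0 g1) _.
pose N:= tangent_norm q z (b - a).
pose H t:= 2 * N * step t - L t.
have: H 0 <= H 1. apply: (@dere_ge0_le R H (fun t=> 2 * N * (expR 1 * flat 2 t) - speed q (line_crv c a b) t) 0 1 ler01)=> t t01.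
 split;first exact: is_deriveB (is_deriveZ (2 * N) (is_dere_step t)) (LP.2 t t01). have [x cx xE]:= cab _ (step_bound t). have ct: cdom c (line_crv c a b t) by rewrite /line_crv -xE cfunK.
 rewrite (speed_ch q Ac ct (Sg t)) line_crv_velocity//. have cE: cfun c (line_crv c a b t) = a + step t *: (b - a). by rewrite /line_crv -xE cfunK.
 rewrite cE;have [_ /(_ ((expR 1 * flat 2 t) *: (b - a)))[+ _]]:= rP _ (abr _ (step_bound t)). rewrite tnormZ ger0_norm;last exact: mulr_ge0 (expR_ge0 _) (flat_ge0 _ _).
 have Z (e f: R): 2 * (e * f) = 2 * f * e by ring. by rewrite subr_ge0=> H';apply: le_trans H' _;rewrite [leLHS]Z.
by rewrite /H step1 step_le0// mulr0 mulr1 -/N;lra.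
Qed.
(** By Cauchy-Schwarz the speed controls the derivative of the component along the total
    displacement [w]. The norms at [z] and at the points of the curve differ by a factor of at most
    2. *)
Lemma local_len (z: M) (r: R) (g: R -> M) L (s t: R): let c:= chart_at A z in (forall u, `|u - cfun c z| < r -> (cfun c @` cdom c) u /\ forall v,
  Num.sqrt (ch_form q c u v v) <= 2 * tangent_norm q z v /\ tangent_norm q z v <= 2 * Num.sqrt (ch_form q c u v v)) -> len_of g L -> 0 <= s -> s <= t -> t <= 1 ->
 (forall u, s <= u <= t -> cdom c (g u) /\ `|cfun c (g u) - cfun c z| < r) -> tangent_norm q z (cfun c (g t) - cfun c (g s)) <= 2 * (L t - L s).
Proof.
move=> c rP [Sg LP] s0 st t1 gr;have Ac: charts A c:= chart_atP A z.
set w:= cfun c (g t) - cfun c (g s).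
have [->|w0]:= eqVneq w 0. rewrite tnorm0 mulr_ge0// subr_ge0. exact: (len_of_mono (conj Sg LP)).
pose l:= mklin (tform_linl q z w).
have cl: continuous l by exact: fdim_cont (fmx _ _).
have N0:= tnorm_gt0 q z w0;set N:= tangent_norm q z w in N0 *.
pose D u:= 'D_(1: R^o) (cfun c \o g: R^o -> _) u.
have H: 2 * L s - N^-1 * l (cfun c (g s)) <= 2 * L t - N^-1 * l (cfun c (g t)). apply: (dere_ge0_le (f:= fun u=> 2 * L u - N^-1 * l (cfun c (g u)))
  (f':= fun u=> 2 * speed q g u - N^-1 * l (D u)))=>// u sut. have u01: 0 <= u <= 1. by move: sut=> /andP[su ut];rewrite (le_trans s0 su) (le_trans ut t1). have [cu ur]:= gr u sut.
 have dg:= crv_ch_dif Ac cu (Sg u). have dl v: differentiable l v by exact: linear_differentiable. have Dl: is_derive (u: R^o) (1: R^o) (l \o (cfun c \o g)) (l (D u)).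
  apply: DeriveDef;first by apply: diff_derivable;exact: differentiable_comp. by rewrite (dere_comp _ dg (dl _)) diff_lin.
 split;first exact: is_deriveB (is_deriveZ (2: R) (LP u u01)) (is_deriveZ (N^-1) Dl). have [_ /(_ (D u))[_ nD]]:= rP _ ur. rewrite (speed_ch q Ac cu (Sg u)) subr_ge0.
 apply: le_trans _ nD;rewrite mulrC ler_pdivrMr//. exact: (cauchy_schwarz (tform_linl q z) (tform_sym q z) (@tform_pos _ _ _ _ q z)).
have: N^-1 * l w = N. rewrite -[l w]/(tangent_form q z w w) -(ip_norm_sqr (tform_linl q z) (tform_sym q z) (@tform_pos _ _ _ _ q z)) -tnormE. by rewrite -/N expr2 mulKf ?gt_eqF.
rewrite /w (linearB l) mulrBr;move: H;lra.
Qed.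
(** A closed ball of the chart is a continuous image of a compact set; Hausdorff separation enters
    the metric here. *)
Lemma ch_ball_cl (z: M) (c: chart R n M) (r: R): charts A c -> (forall u, `|u - cfun c z| <= r -> (cfun c @` cdom c) u) ->
 closed ([set y | cdom c y /\ `|cfun c y - cfun c z| <= r] : set (mspace A)).
Proof.
move=> Ac rP.
have -> : [set y | cdom c y /\ `|cfun c y - cfun c z| <= r] = (cinv c: _ -> mspace A) @` [set u | `|u - cfun c z| <= r].
 apply/seteqP;split=>[y [cy yr]|_ [u ur <-]];first by exists (cfun c y)=>//;rewrite cfunK. by have [x cx xu]:= rP _ ur;move: ur;rewrite/= -xu (cfunK cx).
apply: (compact_closed HM);apply: continuous_compact. apply: continuous_in_subspaceT=> u;rewrite inE=> ur. have [x cx <-]:= rP _ ur;move=> U;rewrite (cfunK cx)=> xU.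
 by apply: nbhs_imp (ch_inv_cont Ac cx xU)=> v [].
apply: bounded_closed_compact. exists (`|cfun c z| + r);split;first exact: num_real. move=> K zK u/= ur;rewrite ltW// (le_lt_trans _ zK)//.
 by rewrite -[u](subrK (cfun c z)) addrC (le_trans (ler_normD _ _))// lerD2l.
have -> : [set u: 'rV[R]_n | `|u - cfun c z| <= r] = (fun u=> `|u - cfun c z|) @^-1` [set s: R | s <= r] by [].
apply: closed_comp;last exact: closed_le.
move=> u _;apply: continuous_comp;last exact: norm_continuous.
by apply: (@continuousB _ _ _ id (cst (cfun c z)) u); [exact: cvg_id|exact: cst_continuous].
Qed.
(** A short curve cannot leave the chart ball: as long as it is inside, [local_len] confines it to
    half the radius, so real induction keeps it there for all times. *)
Lemma dist_lower (z: M): let c:= chart_at A z in exists r: R, 0 < r /\ exists2 rho: R, 0 < rho & forall r', 0 < r' -> r' <= r ->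
  forall y y', cdom c y -> `|cfun c y - cfun c z| < r' / 4 -> d y y' < rho * r' -> [/\ cdom c y', `|cfun c y' - cfun c z| < r' & tangent_norm q z (cfun c y' - cfun c y) <= 2 * d y y'].
Proof.
move=> c;have Ac: charts A c:= chart_atP A z.
have [r1 r10 rP]:= ch_form_compare q z.
have [k [k0 [K _ kN]]]:= tnorm_equiv q z.
(* A length below [k * r / 8] moves the coordinates by less than [r / 4]. With the initial [r / 4]
   this stays below [r / 2]. *)
exists r1;split=>//;exists (k / 8);first by rewrite divr_gt0.
move=> r r0 rr1 y y' cy yr dyr.
have rin (u: 'rV[R]_n): `|u - cfun c z| < r -> `|u - cfun c z| < r1 by move/lt_le_trans;apply.
suff H e: 0 < e -> d y y' + e < k / 8 * r -> [/\ cdom c y', `|cfun c y' - cfun c z| < r & tangent_norm q z (cfun c y' - cfun c y) <= 2 * (d y y' + e)].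
 have e0: 0 < (k / 8 * r - d y y') / 2 by rewrite divr_gt0// subr_gt0. have [|cy' y'r _]:= H _ e0;first by move: e0;lra. split=>//;apply/ler_addgt0Pr=> e' e'0.
 pose e:= Num.min (e' / 2) ((k / 8 * r - d y y') / 2). have e1: 0 < e by rewrite lt_min divr_gt0. have ee': e <= e' / 2 by rewrite ge_min lexx.
 have ee2: e <= (k / 8 * r - d y y') / 2 by rewrite ge_min lexx orbT. have [|_ _ ]:= H e e1;first by move: e0 ee2;lra. by move=> /le_trans;apply;move: ee';lra.
move=> e0 der.
have [|g [L [gL g0 g1 Lr]]]:= @dist_lt y y' (d y y' + e);first by rewrite ltrDl.
have [Sg LP]:= gL.
have LrP t: 0 <= t <= 1 -> L t - L 0 < k / 8 * r. move=> /andP[t0 t1];apply: le_lt_trans _ (lt_trans Lr der). by rewrite lerB// (len_of_mono gL).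
have cK: closed ([set y | cdom c y /\ `|cfun c y - cfun c z| <= r / 2] : set (mspace A)). apply: ch_ball_cl=>// u ur;have []// := rP u. by apply: rin;apply: le_lt_trans ur _;move: r0;lra.
have gc (t: R) (B: set (mspace A)): nbhs (g t: mspace A) B -> exists2 s: R, 0 < s & forall u, `|u - t| < s -> B (g u). by move=> /(sm_into_cont (Sg t))/(@nbhs_ltP R R^o t).
have half t: 0 <= t <= 1 -> (forall s, 0 <= s <= t -> cdom c (g s) /\ `|cfun c (g s) - cfun c z| < r) -> cdom c (g t) /\ `|cfun c (g t) - cfun c z| < r / 2.
 move=> /andP[t0 t1] gs;have [ct _]:= gs t (introT andP (conj t0 (lexx t)));split=>//. have H:= local_len rP gL (lexx 0) t0 t1 (fun s st=> conj (gs s st).1 (rin _ (gs s st).2)).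
 have:= LrP t (introT andP (conj t0 t1)). have /andP[+ _]:= kN (cfun c (g t) - cfun c (g 0)). rewrite -/c g0 in H * => H2 H3.
 have H4: k * `|cfun c (g t) - cfun c y| < k * (r / 4) by move: H H2 H3;lra. rewrite ltr_pM2l// in H4. rewrite -[cfun c (g t) - cfun c z](subrK (cfun c (g t) - cfun c y)).
 rewrite (_: _ - _ - _ = cfun c y - cfun c z);last by zmod. by apply: le_lt_trans (ler_normD _ _) _;move: yr H4;lra.
have gP: forall t, 0 <= t <= 1 -> cdom c (g t) /\ `|cfun c (g t) - cfun c z| < r. apply: real_induction=>[t t01 gs|t /andP[t0 t1] gs].
  have [->|tn0]:= eqVneq t 0;first by rewrite g0;split=>//;move: yr r0;lra. have tp: 0 < t by move: t01;rewrite lt_neqAle eq_sym tn0=> /andP[].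
  suff [ct tr] : [set y | cdom c y /\ `|cfun c y - cfun c z| <= r / 2] (g t). by split=>//;apply: le_lt_trans tr _;move: r0;lra. apply: cK=> B /(gc t) [s s0 sP]. pose u:= Num.max 0 (t - s / 2).
  have ut: u < t by rewrite gt_max tp/= gtrBl divr_gt0. have u0: 0 <= u by rewrite le_max lexx. exists (g u);split. have u01: 0 <= u <= 1 by rewrite u0 (le_trans (ltW ut))//;case/andP: t01.
   have [|cu ur]:= half u u01;last by split=>//;exact: ltW. by move=> v /andP[v0 vu];apply: gs;rewrite v0 (le_lt_trans vu ut). apply: sP;rewrite distrC gtr0_norm ?subr_gt0//.
  have: t - s / 2 <= u by rewrite le_max lexx orbT. by move: s0;lra. have [ct tr]:= half t (introT andP (conj t0 (ltW t1))) gs. have tr': `|cfun c (g t) - cfun c z| < r by move: tr r0;lra.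
 have oB:= open_ch_pre Ac (@ball_open _ _ (cfun c z) r). have nB:= open_nbhs_nbhs (conj oB (conj ct _: (cdom c `&` cfun c @^-1` ball (cfun c z) r) (g t))).
 have {}nB:= nB ltac:(by rewrite /preimage/= -ball_normE/= distrC). have [e1 e10 eP]:= gc t _ nB. exists e1=>// s /andP[ts se]. have [|cs]:= eP s;first by rewrite ger0_norm ?subr_ge0// ltrBlDl.
 by rewrite /preimage/= -ball_normE/= distrC.
have [cy' y'r]:= gP 1 (introT andP (conj ler01 (lexx 1))).
rewrite g1 in cy' y'r;split=>//.
have:= local_len rP gL (lexx 0) ler01 (lexx 1) (fun s st=> conj (gP s st).1 (rin _ (gP s st).2)).
by rewrite g0 g1=> /le_trans;apply;rewrite ler_pM2l// ltW.
Qed.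
End RiemannianDistance.

(** * The path metric induces the manifold topology *)

Section CompatibleMetric.
Context {R: realType} {M: topologicalType}.

Definition metr_for (d: M -> M -> R): Prop:= [/\ forall x, d x x = 0, forall x y, x <> y -> 0 < d x y, forall x y, d x y = d y x, forall y x z, d x z <= d x y + d y z
  & forall x (U: set M), nbhs x U <-> exists2 r, 0 < r & mball d r x `<=` U].
End CompatibleMetric.

Section RiemannianMetricSpace.
Context {R: realType} {n: nat} {M: Type} (A: atlas R n M).
Context (q: riemannian_metric A) (HM: hausdorff_space (mspace A)).
Hypothesis joinedM: forall x y: M, joined A x y.
Local Notation d:= (riemannian_dist q: mspace A -> mspace A -> R).

Lemma riem_metr_for: metr_for d.
Proof.
have d0:= dist_refl q joinedM.
have lower z:= dist_lower q HM joinedM z.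
have ball_nbhs x (U: set (mspace A)): nbhs x U -> exists2 r, 0 < r & mball d r x `<=` U. move=> /(sub_ch_nbhs (chart_atP A x) (mem_chart_at A x))[s s0 sU]. have [r [r0 [rho rho0 H]]]:= lower x.
 have m0: 0 < Num.min r s by rewrite lt_min r0. exists (rho * Num.min r s)=>[|y xy];first by rewrite mulr_gt0. have [||cy yr _]:= H _ m0 _ x y (mem_chart_at A x) _ xy.
 - by rewrite ge_min lexx.
 - by rewrite subrr normr0 divr_gt0.
 - by apply: sU=>//;apply: lt_le_trans yr _;rewrite ge_min lexx orbT.
split=>//.
- move=> x y xy;rewrite lt_neqAle dist_ge0// andbT;apply/eqP=> dxy;apply: xy. have [r [r0 [rho rho0 H]]]:= lower x.
 have small s: 0 < s -> s <= r -> cdom (chart_at A x) y /\ `|cfun (chart_at A x) y - cfun (chart_at A x) x| < s. move=> s0 sr;have [||cy yr _]:= H s s0 sr x y (mem_chart_at A x).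
  - by rewrite subrr normr0 divr_gt0.
  - by rewrite -dxy mulr_gt0.
  - by []. have [cy _]:= small r r0 (lexx _). rewrite -(cfunK (mem_chart_at A x)) -(cfunK cy);congr (cinv _ _).
 apply/eqP;rewrite -subr_eq0 -normr_eq0 distrC;apply/eqP/le_anti;rewrite normr_ge0 andbT. apply/ler_addgt0Pr=> e e0;rewrite add0r.
 have [||_ /ltW/le_trans]:= small (Num.min r e);rewrite ?lt_min ?r0 ?ge_min ?lexx//. by apply;rewrite ge_min lexx orbT.
- exact: dist_sym.
- exact: dist_tri.
- move=> x U;split;first exact: ball_nbhs. move=>[r r0 rU]. have [s s0 sP]:= dist_upper q joinedM x. have [k [k0 [K K0 kK]]]:= tnorm_equiv q x.
 have m0: 0 < Num.min s (r / (2 * K)) by rewrite lt_min s0 divr_gt0// mulr_gt0. apply: nbhs_imp (ch_cont (chart_atP A x) (mem_chart_at A x) m0)=> y [cy]. rewrite lt_min=> /andP[ys yr];apply: rU.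
 have:= sP _ _ (mem_chart_at A x) cy;rewrite subrr normr0=> /(_ s0 ys) H. apply: le_lt_trans H _;have /andP[_ H]:= kK (cfun (chart_at A x) y - cfun (chart_at A x) x).
 apply: le_lt_trans (ler_wpM2l _ H) _=>//. by rewrite mulrA mulrC -ltr_pdivlMr ?mulr_gt0.
Qed.
Lemma dist_compare (z: M): let c:= chart_at A z in exists2 r: R, 0 < r & forall y y', cdom c y -> cdom c y' -> `|cfun c y - cfun c z| < r -> `|cfun c y' - cfun c z| < r ->
  d y y' <= 2 * tangent_norm q z (cfun c y' - cfun c y) /\ tangent_norm q z (cfun c y' - cfun c y) <= 2 * d y y'.
Proof.
move=> c;have [r [r0 [rho rho0 L]]]:= dist_lower q HM joinedM z.
have [s s0 U]:= dist_upper q joinedM z.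
have [k [k0 [K K0 kK]]]:= tnorm_equiv q z.
pose t:= Num.min (r / 4) (Num.min s (rho * r / (4 * K))).
have t0: 0 < t by rewrite !lt_min s0 divr_gt0//= divr_gt0 ?mulr_gt0.
have [ta [tb tc]] : t <= r / 4 /\ t <= s /\ t <= rho * r / (4 * K). by rewrite /t !ge_min !lexx !orbT.
exists t=>// y y' cy cy' yt y't.
have H:= U y y' cy cy' (lt_le_trans yt tb) (lt_le_trans y't tb).
split=>//;have [//||_ _ //]:= L r r0 (lexx _) y y' cy _ _. exact: lt_le_trans yt ta.
apply: le_lt_trans H _;have /andP[_ H]:= kK (cfun c y' - cfun c y).
apply: le_lt_trans (ler_wpM2l _ H) _=>//.
have H2: `|cfun c y' - cfun c y| < 2 * t. have:= ler_normB (cfun c y' - cfun c z) (cfun c y - cfun c z). rewrite (_: _ - _ - _ = cfun c y' - cfun c y);last by zmod. by move: yt y't;lra.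
rewrite mulrA mulrC -ltr_pdivlMr ?mulr_gt0//;apply: lt_le_trans H2 _.
apply: le_trans (ler_wpM2l _ tc) _=>//.
by rewrite le_eqVlt;apply/orP;left;apply/eqP;field;rewrite gt_eqF.
Qed.
End RiemannianMetricSpace.

(** * Local surjectivity from a strict derivative *)

Section LocalInverse.
Context {R: realType}.

Lemma cl_ball_cpt n (x: 'rV[R]_n) (r: R): compact [set u | `|u - x| <= r].
Proof.
apply: bounded_closed_compact. exists (`|x| + r);split;first exact: num_real. move=> K zK u/= ur;rewrite ltW// (le_lt_trans _ zK)//.
 by rewrite -[u](subrK x) addrC (le_trans (ler_normD _ _))// lerD2l.
have -> : [set u: 'rV[R]_n | `|u - x| <= r] = (fun u=> `|u - x|) @^-1` [set s: R | s <= r] by [].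
apply: closed_comp;last exact: closed_le.
move=> u _;apply: continuous_comp;last exact: norm_continuous.
by apply: (@continuousB _ _ _ id (cst x) u); [exact: cvg_id|exact: cst_continuous].
Qed.

(* Minimize [|f w - y|] over a ball: at a minimizer [w] with [f w <> y] the
   Newton step [w + (y - f w)] would do better. *)
Lemma local_surj n (f: 'rV[R]_n -> 'rV[R]_n) (x: 'rV[R]_n): sdiff f x idfun -> exists2 r: R, 0 < r & forall y, `|y - f x| < r -> exists2 w, f w = y & `|w - x| <= 2 * `|y - f x|.
Proof.
move=> fx;have e0: 0 < 4^-1 :> R by rewrite invr_gt0.
have [s s0 sP]:= fx _ e0.
exists (s / 8)=>[|y yr];first by rewrite divr_gt0.
pose B:= [set u: 'rV[R]_n | `|u - x| <= s / 2].
have Bs u: B u -> `|u - x| < s by move=> /le_lt_trans;apply;rewrite ltr_pdivrMr// ltr_pMr// ltr1n.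
have xx: `|x - x| < s by rewrite subrr normr0.
have cf: {within B, continuous (fun w=> `|f w - y|)}. apply: continuous_in_subspaceT=> u;rewrite inE=> /Bs us. apply: continuous_comp;last exact: norm_continuous.
 apply: (@continuousB _ _ _ f (cst y) u);last exact: cst_continuous. apply/cont_ltP=> e ep;exists (Num.min (e / 2) (s - `|u - x|)). by rewrite lt_min divr_gt0//= subr_gt0.
 move=> v;rewrite lt_min=> /andP[ve vs]. have vs': `|v - x| < s. rewrite -[v - x](subrK (u - x)) (_: v - x - (u - x) = v - u);last by zmod.
  by apply: le_lt_trans (ler_normD _ _) _;rewrite -ltrBrDr. have H:= sP v u vs' us;have:= ler_normD (f v - f u - (v - u)) (v - u). by rewrite subrK/=;move: H=> /=;lra.
have B0: B !=set0 by exists x;rewrite /B/= subrr normr0 divr_ge0// ltW.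
have [w + wmin]:= EVT_min_rV B0 (@cl_ball_cpt n x (s / 2)) cf.
rewrite inE=> Bw.
have Bx: B x by rewrite /B/= subrr normr0 divr_ge0// ltW.
have H1: `|f w - y| <= `|y - f x|. by rewrite (distrC y);apply: wmin;rewrite inE.
have wx: `|w - x| <= 4 / 3 * `|f w - f x|. have:= sP w x (Bs _ Bw) xx=> /=. have:= ler_normD (f w - f x) (w - x - (f w - f x)). rewrite [X in `|X| <= _ -> _](_: _ = w - x);last by zmod.
 rewrite [`|w - x - _|]distrC;lra.
have fwx: `|f w - f x| <= `|f w - y| + `|y - f x|. by rewrite -[f w - f x](subrK (y - f x)) (_: f w - f x - (y - f x) = f w - y) ?ler_normD//;zmod.
pose w':= w + (y - f w).
have Bw': B w'. rewrite /B/= /w';have:= ler_normD (w - x) (y - f w). rewrite [X in `|X| <= _ -> _](_: _ = w + (y - f w) - x);last by zmod. by rewrite [`|y - f w|]distrC;move: yr H1 wx fwx;lra.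
have fw: f w = y. have:= sP w' w (Bs _ Bw') (Bs _ Bw). rewrite/= (_: w' - w = y - f w);last by rewrite /w';zmod. rewrite (_: f w' - f w - (y - f w) = f w' - y);last by zmod.
 move=> H2;have:= wmin w';rewrite inE=> /(_ Bw'). rewrite [`|f w - y|]distrC=> H3;apply/esym/eqP;rewrite -subr_eq0 -normr_eq0.
 have:= normr_ge0 (y - f w);move: H2 H3;move: `|y - f w| `|f w' - y| => a b. by move=> *;apply/eqP;lra.
exists w=>//;rewrite fw in wx;have:= normr_ge0 (y - f x);lra.
Qed.
End LocalInverse.

(** * Multiplication and conjugation in a chart around the identity *)

Section LieGroupCalculus.
Context {R: realType} {n: nat} {G: groupType} (LG: lie_group R n G).
Local Notation c0:= (chart_at LG 1%g).
Local Notation e0:= (cfun (chart_at LG 1%g) 1%g).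

Lemma c0P: charts LG c0. Proof. exact: chart_atP. Qed.
Lemma c01: cdom c0 (1%g: G). Proof. exact: mem_chart_at. Qed.
Lemma c0e0: cinv c0 e0 = 1%g. Proof. exact: cfunK c01. Qed.
Lemma sd_pairr (V W U: normedModType R) (f: V * W -> U) (a: V) (x: W) (L: {linear (V * W)%type -> U}): sdiff f (a, x) L -> exists L': {linear W -> U}, (forall v, L' v = L (0, v)) /\
 sdiff (fun y=> f (a, y)) x L'.
Proof.
move=> fL;have lL: linear (fun v: W=> L (0, v)). by move=> k u v;rewrite -linearP;congr (L _);rewrite -[RHS]/(k *: 0 + 0, k *: u + v) scaler0 addr0.
exists (mklin lL);split=>// e ep;have [r r0 rP]:= fL e ep.
have nE (v: W): `|(0: V, v)| = `|v| by rewrite prod_normE/= normr0;apply/max_idPr.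
exists r=>// y z yr zr;have sE u v: (a, u) - (a, v) = (0, u - v) :> V * W. by rewrite -[LHS]/(a - a, u - v) subrr.
have:= rP (a, y) (a, z);rewrite !sE !nE;exact.
Qed.
Lemma sd_pairl (V W U: normedModType R) (f: V * W -> U) (a: W) (x: V) (L: {linear (V * W)%type -> U}): sdiff f (x, a) L -> exists L': {linear V -> U}, (forall v, L' v = L (v, 0)) /\
 sdiff (fun y=> f (y, a)) x L'.
Proof.
move=> fL;have lL: linear (fun v: V=> L (v, 0)). by move=> k u v;rewrite -linearP;congr (L _);rewrite -[RHS]/(k *: u + v, k *: 0 + 0) scaler0 addr0.
exists (mklin lL);split=>// e ep;have [r r0 rP]:= fL e ep.
have nE (v: V): `|(v, 0: W)| = `|v| by rewrite prod_normE/= normr0;apply/max_idPl.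
exists r=>// y z yr zr;have sE u v: (u, a) - (v, a) = (u - v, 0) :> V * W. by rewrite -[LHS]/(u - v, a - a) subrr.
have:= rP (y, a) (z, a);rewrite !sE !nE;exact.
Qed.
Lemma sm_into_sd (V: normedModType R) N (X: Type) (A: atlas R N X) (f: V -> X) (u: V) c: fdim V -> smooth_into A f u -> charts A c -> cdom c (f u) -> sdiff (cfun c \o f) u ('d (cfun c \o f) u).
Proof.
move=> fV Sf Ac cu;have [U [oU Uu _ CU]]:= Sf c Ac cu.
exact: (C1_sd fV (fmx _ _) oU Uu (CU 1%N)).
Qed.
Lemma mul_sd (c1 c2 c: chart R n G) g1 g2: charts LG c1 -> charts LG c2 -> charts LG c -> cdom c1 g1 -> cdom c2 g2 -> cdom c (g1 * g2)%g ->
 exists L, sdiff (fun u: 'rV[R]_n * 'rV[R]_n=> cfun c (cinv c1 u.1 * cinv c2 u.2)%g) (cfun c1 g1, cfun c2 g2) L.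
Proof.
move=> Ac1 Ac2 Ac cg1 cg2 cg.
have S:= lie_mul_smooth Ac1 Ac2 cg1 cg2;eexists.
apply: (sm_into_sd (fdim_prod (fmx _ _) (fmx _ _)) S Ac).
by rewrite/= !cfunK.
Qed.
Lemma left_mul_sd (c1 c: chart R n G) (h g: G): charts LG c1 -> charts LG c -> cdom c1 g -> cdom c (h * g)%g -> exists L, sdiff (fun u=> cfun c (h * cinv c1 u)%g) (cfun c1 g) L.
Proof.
move=> Ac1 Ac cg chg;have ch:= mem_chart_at LG h.
have [L LP]:= mul_sd (chart_atP LG h) Ac1 Ac ch cg chg.
have [L' [_ H]]:= sd_pairr LP;exists L'.
by move: H;rewrite/= (cfunK ch).
Qed.
Lemma right_mul_sd (c1 c: chart R n G) (h g: G): charts LG c1 -> charts LG c -> cdom c1 g -> cdom c (g * h)%g -> exists L, sdiff (fun u=> cfun c (cinv c1 u * h)%g) (cfun c1 g) L.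
Proof.
move=> Ac1 Ac cg cgh;have ch:= mem_chart_at LG h.
have [L LP]:= mul_sd Ac1 (chart_atP LG h) Ac cg ch cgh.
have [L' [_ H]]:= sd_pairl LP;exists L'.
by move: H;rewrite/= (cfunK ch).
Qed.
Lemma sd_ch_comp (c: chart R n G) (f: 'rV[R]_n -> G) (h: G -> 'rV[R]_n) u (L L': {linear 'rV[R]_n -> 'rV[R]_n}): charts LG c -> cdom c (f u) -> {for u, continuous (f: 'rV[R]_n -> mspace LG)} ->
 sdiff (cfun c \o f) u L -> sdiff (h \o cinv c) (cfun c (f u)) L' -> sdiff (h \o f) u (L' \o L).
Proof.
move=> Ac cu cf fL hL.
have H:= sd_comp (fmx _ _) (fmx _ _) fL hL.
apply: sd_near H;have nc:= open_nbhs_nbhs (conj (open_ch_domain Ac) cu).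
by apply: nbhs_imp (cf _ nc)=> v cv/=;rewrite cfunK.
Qed.
Lemma left_mul_cont (h g: G) (c: chart R n G): charts LG c -> cdom c g -> {for (cfun c g), continuous ((fun u=> (h * cinv c u)%g): 'rV[R]_n -> mspace LG)}.
Proof.
move=> Ac cg U;rewrite (cfunK cg)=> hU.
have chg:= mem_chart_at LG (h * g)%g;have Achg:= chart_atP LG (h * g)%g.
have [r r0 rU]:= sub_ch_nbhs Achg chg hU.
have S:= lie_mul_smooth (chart_atP LG h) Ac (mem_chart_at LG h) cg.
have cp: cdom (chart_at LG (h * g)%g) (cinv (chart_at LG h) (cfun (chart_at LG h) h) * cinv c (cfun c g))%g. by rewrite !cfunK//;exact: mem_chart_at.
have [Uo [oO Ou Oc CO]]:= S _ Achg cp.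
have nO:= open_nbhs_nbhs (conj oO Ou).
have /cont_ltP/(_ _ r0)/nbhs_ltP nr:= Ck_cont (CO 0%N) Ou.
have /nbhs_ltP[s s0 sP]:= nbhsI2 nO nr.
apply/(@nbhs_ltP R 'rV[R]_n);exists s=>// y ys.
have [|Oy yr]:= sP (cfun (chart_at LG h) h, y). rewrite -[_ - _]/(cfun (chart_at LG h) h - cfun (chart_at LG h) h, y - cfun c g) subrr. by rewrite prod_normE/= normr0 (max_idPr _).
have:= Oc _ Oy;rewrite/= (cfunK (mem_chart_at LG h))=> cy.
apply: rU=>//;move: yr;rewrite/= !cfunK//;exact: mem_chart_at.
Qed.

Definition conj_ch (h: G) (u: 'rV[R]_n): 'rV[R]_n:= cfun c0 (h * cinv c0 u * h^-1)%g.

Lemma conj_ch_sd h: sdiff (conj_ch h) e0 ('d (conj_ch h) e0).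
Proof.
have ch:= mem_chart_at LG h;have Ah:= chart_atP LG h.
have ch1: cdom (chart_at LG h) (h * 1)%g by rewrite mulg1.
have [L LP]:= left_mul_sd c0P Ah c01 ch1.
have chh: cdom c0 (h * h^-1)%g by rewrite mulgV;exact: c01.
have [L' LP']:= right_mul_sd Ah c0P ch chh.
have Lc: cdom (chart_at LG h) ((fun u=> (h * cinv c0 u)%g) e0) by rewrite c0e0.
have H: sdiff (conj_ch h) e0 (L' \o L). apply: (@sd_ch_comp (chart_at LG h) (fun u=> (h * cinv c0 u)%g) (fun g=> cfun c0 (g * h^-1)%g) e0 L L')=>//. exact: left_mul_cont c0P c01.
 by rewrite/= c0e0 mulg1.
have [_ E]:= sd_dif (fmx _ _) H.
by apply: sd_eq H=> v;rewrite E.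
Qed.
Lemma AdE h v: Ad LG h v = 'd (conj_ch h) e0 v.
Proof.
rewrite /Ad /tangent_map;have -> : (h * 1 * h^-1 = 1)%g by rewrite mulg1 mulgV.
by [].
Qed.
Lemma conj_ch_e0 h: conj_ch h e0 = e0.
Proof. by rewrite /conj_ch c0e0 mulg1 mulgV. Qed.
Lemma conj_near_dom h: \forall u \near e0, cdom c0 (cinv c0 u) /\ cdom c0 (h * cinv c0 u * h^-1)%g.
Proof.
apply: nbhsI2;first by apply: nbhs_imp (ch_inv_near c0P c01)=> u [].
have cf:= left_mul_cont (h:= h) c0P c01.
have ch:= mem_chart_at LG h;have Ah:= chart_atP LG h.
have oc:= open_nbhs_nbhs (conj (open_ch_domain c0P) c01).
have S:= lie_mul_smooth Ah (chart_atP LG h^-1%g) ch (mem_chart_at LG h^-1%g).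
have cp: cdom c0 (cinv (chart_at LG h) (cfun (chart_at LG h) h, cfun (chart_at LG h^-1%g) h^-1%g).1 * cinv (chart_at LG h^-1%g) (cfun (chart_at LG h) h, cfun (chart_at LG h^-1%g) h^-1%g).2)%g.
 by rewrite/= !cfunK ?mulgV//; [exact: c01|exact: mem_chart_at].
have [Uo [oO Ou Oc _]]:= S _ c0P cp.
have /nbhs_ltP[s s0 sP]:= open_nbhs_nbhs (conj oO Ou).
have nh:= ch_nbhs Ah ch s0.
have e0h: (h * cinv c0 e0 = h)%g by rewrite c0e0 mulg1.
have:= cf;rewrite /prop_for /continuous_at e0h=> /(_ _ nh).
apply: nbhs_imp=> u [cu us].
have:= Oc (cfun (chart_at LG h) (h * cinv c0 u)%g, cfun (chart_at LG h^-1%g) h^-1%g).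
rewrite/= !cfunK//;last exact: mem_chart_at.
apply;apply: sP.
rewrite -[_ - _]/(cfun (chart_at LG h) (h * cinv c0 u)%g - cfun (chart_at LG h) h, _ - _) subrr.
by rewrite prod_normE/= normr0 (max_idPl _).
Qed.

Definition mul_ch (u v: 'rV[R]_n): 'rV[R]_n:= cfun c0 (cinv c0 u * cinv c0 v)%g.

Lemma mul_ch_dom: exists2 r: R, 0 < r & forall u v, `|u - e0| < r -> `|v - e0| < r -> [/\ cdom c0 (cinv c0 u), cfun c0 (cinv c0 u) = u & cdom c0 (cinv c0 u * cinv c0 v)%g].
Proof.
have S:= lie_mul_smooth c0P c0P c01 c01.
have cp: cdom c0 (cinv c0 (e0, e0).1 * cinv c0 (e0, e0).2)%g by rewrite/= !c0e0 mulg1;exact: c01.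
have [Uo [oO Ou Oc _]]:= S _ c0P cp.
have /nbhs_ltP[s s0 sP]:= open_nbhs_nbhs (conj oO Ou).
have /nbhs_ltP[t t0 tP]:= ch_inv_near c0P c01.
exists (Num.min s t)=>[|u v];first by rewrite lt_min s0.
rewrite !lt_min=> /andP[us ut] /andP[vs vt];have [cu uE]:= tP _ ut.
split=>//;apply: (Oc (u, v));apply: sP.
by rewrite -[_ - _]/(u - e0, v - e0) prod_normE gt_max us.
Qed.
Lemma mul_ch_lip: exists C: R, 0 < C /\ exists2 r: R, 0 < r & forall u v, `|u - e0| < r -> `|v - e0| < r -> `|mul_ch u v - v| <= C * `|u - e0|.
Proof.
have cc: cdom c0 (1 * 1)%g by rewrite mulg1;exact: c01.
have [L LP]:= mul_sd c0P c0P c0P c01 c01 cc.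
have [C [C0 [r r0 rP]]]:= sd_lip (fdim_prod (fmx _ _) (fmx _ _)) LP.
have [s s0 sP]:= mul_ch_dom.
exists C;split=>//;exists (Num.min r s)=>[|u v];first by rewrite lt_min r0.
rewrite !lt_min=> /andP[ur us] /andP[vr vs].
have [_ vE _]:= sP v v vs vs.
have:= rP (u, v) (e0, v);rewrite/= c0e0 mul1g vE.
rewrite -![(_, _) - (_, _)]/(_ - _, _ - _) !prod_normE/= !subrr normr0 !gt_max ur vr r0.
by rewrite (max_idPl _)//;apply.
Qed.
End LieGroupCalculus.

(** This stands in for an inverse of [f0]: points are lifted through [f0] by [local_surj], and a
    strict derivative of [g] does not care which lifts are chosen. *)
Lemma sd_factor {R: realType} m (W: normedModType R) (f0: 'rV[R]_m -> 'rV[R]_m) (g f: 'rV[R]_m -> W) (x: 'rV[R]_m) (T: {linear 'rV[R]_m -> W}): sdiff f0 x idfun -> f0 x = x -> sdiff g x T ->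
 (\forall w \near x, f (f0 w) = g w) -> sdiff f x T.
Proof.
move=> f0x fx gT /nbhs_ltP[r1 r10 fg] e e0.
have [K K0 KT]:= fdim_bnd (fmx 1 m) (linearP T).
have [s s0 sP]:= local_surj f0x;rewrite fx in sP.
pose e1:= Num.min 2^-1 (e / (2 * (K + 1))).
have e10: 0 < e1 by rewrite lt_min invr_gt0 ltr0n/= divr_gt0// mulr_gt0// addr_gt0.
have e1h: e1 <= 2^-1 by rewrite ge_min lexx.
have e1e: 2 * (K + 1) * e1 <= e. have K1: 0 < 2 * (K + 1) by rewrite mulr_gt0// addr_gt0. by rewrite mulrC -ler_pdivlMr// ge_min lexx orbT.
have [r2 r20 P2]:= f0x _ e10;have [r3 r30 P3]:= gT _ e10.
pose r:= Num.min r1 (Num.min r2 r3).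
have r0: 0 < r by rewrite !lt_min r10 r20.
exists (Num.min s (r / 2));first by rewrite lt_min s0 divr_gt0.
move=> y z;rewrite !lt_min=> /andP[ys yr] /andP[zs zr].
have [v yv vy]:= sP _ ys;have [w zw wz]:= sP _ zs.
have small a b: `|a - x| < r / 2 -> `|b - x| <= 2 * `|a - x| -> `|b - x| < r by move=> /[swap];lra.
have:= small _ _ yr vy;rewrite !lt_min=> /and3P[v1 v2 v3].
have:= small _ _ zr wz;rewrite !lt_min=> /and3P[w1 w2 w3].
have Ey: f y = g v by rewrite -yv fg.
have Ez: f z = g w by rewrite -zw fg.
rewrite Ey Ez;have H2:= P2 _ _ v2 w2;have H3:= P3 _ _ v3 w3.
rewrite yv zw/= in H2.
have Hvw: `|v - w| <= 2 * `|y - z|. have H: `|v - w| <= `|y - z| + `|y - z - (v - w)|. by rewrite {1}(_: v - w = y - z - (y - z - (v - w))) ?ler_normB//;zmod.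
 have: e1 * `|v - w| <= 2^-1 * `|v - w| by rewrite ler_wpM2r. move: H H2;lra.
have HT: `|T (v - w) - T (y - z)| <= K * (e1 * `|v - w|). rewrite -linearB;apply: le_trans (KT _) _;rewrite ler_pM2l// distrC;exact: H2.
have -> : g v - g w - T (y - z) = g v - g w - T (v - w) + (T (v - w) - T (y - z)) by zmod.
apply: le_trans (ler_normD _ _) _;apply: le_trans (lerD H3 HT) _.
have: (K + 1) * e1 * `|v - w| <= (K + 1) * e1 * (2 * `|y - z|). by rewrite ler_wpM2l// mulr_ge0// ltW// addr_gt0.
have: 2 * (K + 1) * e1 * `|y - z| <= e * `|y - z| by rewrite ler_wpM2r.
have Z (a b c t: R): a * t * b <= a * t * (2 * c) -> 2 * a * t * c <= e * c -> t * b + (a - 1) * (t * b) <= e * c by move=> *;lra.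
by move=> P4 P5;have:= Z _ _ _ _ P5 P4;rewrite addrK.
Qed.
Lemma sd_unique {R: realType} (V W: normedModType R) (f: V -> W) x (L L': {linear V -> W}): fdim V -> sdiff f x L -> sdiff f x L' -> L =1 L'.
Proof.
move=> fV /(sd_dif fV)[_ <-] /(sd_dif fV)[_ E] v.
by rewrite E.
Qed.
Lemma sd_aff {R: realType} (V W: normedModType R) (a: W) (x: V) (L: {linear V -> W}): sdiff (fun y=> a + L (y - x)) x L.
Proof.
move=> e e0;exists 1=>// y z _ _.
have -> : a + L (y - x) - (a + L (z - x)) - L (y - z) = 0 by rewrite !(linearB L);zmod.
by rewrite normr0 mulr_ge0// ltW.
Qed.

(** * Homogeneous spaces with submersive orbit maps *)

Section HomogeneousSpace.
Context {R: realType} {n m: nat} {G: groupType} (LG: lie_group R n G).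
Context {X: Type} (F: atlas R m X) (act: G -> X -> X).
Hypothesis act1: forall x, act 1%g x = x.
Hypothesis actM: forall g h x, act (g * h)%g x = act g (act h x).
Hypothesis actS: forall x, submersion LG F (fun g=> act g x).
Local Notation c0:= (chart_at LG 1%g).
Local Notation e0:= (cfun (chart_at LG 1%g) 1%g).
Local Notation Xs:= (mspace F).

Definition orb_ch (x: X) (u: 'rV[R]_n): 'rV[R]_m:= cfun (chart_at F x) (act (cinv c0 u) x).

Lemma orb_ch_e0 x: orb_ch x e0 = cfun (chart_at F x) x.
Proof. by rewrite /orb_ch c0e0 act1. Qed.
Lemma orb_sm x u: (cfun c0 @` cdom c0) u -> smooth_into F (fun u=> act (cinv c0 u) x) u.
Proof. by move=>[g cg <-];exact: (actS x).1 (c0P LG) cg. Qed.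
Lemma orb_sm_e0 x: smooth_into F (fun u=> act (cinv c0 u) x) e0.
Proof. by apply: orb_sm;exists 1%g=>//;exact: c01. Qed.
Lemma orb_near x (U: set Xs): nbhs (x: Xs) U -> \forall u \near e0, U (act (cinv c0 u) x).
Proof.
move=> xU;have:= sm_into_cont (@orb_sm_e0 x).
by rewrite /prop_for /continuous_at c0e0 act1=> /(_ U xU).
Qed.
Lemma orb_ch_sd x: sdiff (orb_ch x) e0 ('d (orb_ch x) e0).
Proof.
apply: (sm_into_sd (fmx _ _) (@orb_sm_e0 x) (chart_atP F x)).
by rewrite/= c0e0 act1;exact: mem_chart_at.
Qed.
Lemma orb_ch_onto x: exists P: {linear 'rV[R]_m -> 'rV[R]_n}, forall w, 'd (orb_ch x) e0 (P w) = w.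
Proof.
have H w: exists v, 'd (orb_ch x) e0 v = w. by have:= (actS x).2 1%g w;rewrite /tangent_map act1.
have [p pP]:= choice (fun i: 'I_m=> H (delta_mx 0 i)).
have lp : linear (fun w: 'rV[R]_m=> \sum_i w 0 i *: p i). move=> k u v;rewrite scaler_sumr -big_split;apply: eq_bigr=> i _/=. by rewrite !mxE scalerDl scalerA.
exists (mklin lp)=> w/=;rewrite linear_sum [RHS]row_sum_delta.
by apply: eq_bigr=> i _;rewrite linearZ pP.
Qed.
(** [P] is a linear right inverse of the derivative of the orbit map. Composing the orbit map with
    the affine map along [P] gives a map tangent to the identity, to which [local_surj] and
    [sd_factor] apply. *)
Lemma orb_section x: exists (P: {linear 'rV[R]_m -> 'rV[R]_n}), let f0:= fun w=> orb_ch x (e0 + P (w - cfun (chart_at F x) x)) in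
 [/\ forall w, 'd (orb_ch x) e0 (P w) = w, f0 (cfun (chart_at F x) x) = cfun (chart_at F x) x & sdiff f0 (cfun (chart_at F x) x) idfun].
Proof.
have [P PP]:= orb_ch_onto x;exists P;split=>//. by rewrite subrr linear0 addr0 orb_ch_e0.
have e0E: e0 + P (cfun (chart_at F x) x - cfun (chart_at F x) x) = e0 by rewrite subrr linear0 addr0.
have H1:= @sd_aff R _ _ e0 (cfun (chart_at F x) x) P.
have H2:= @orb_ch_sd x;rewrite -[X in sdiff _ X _]e0E in H2.
have H3:= sd_comp (fmx _ _) (fmx _ _) H1 H2.
by apply: sd_eq H3=> w/=;rewrite PP.
Qed.
Lemma local_section x: exists C: R, 0 < C /\ exists2 r: R, 0 < r & forall y, cdom (chart_at F x) y -> `|cfun (chart_at F x) y - cfun (chart_at F x) x| < r ->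
 exists2 u, `|u - e0| <= C * `|cfun (chart_at F x) y - cfun (chart_at F x) x| & act (cinv c0 u) x = y.
Proof.
have [P [PP f0x f0S]]:= orb_section x.
have [K K0 KP]:= fdim_bnd (fmx 1 m) (linearP P).
have [s s0 sP]:= local_surj f0S;rewrite f0x in sP.
have xx: cdom (chart_at F x) x:= mem_chart_at F x.
have /orb_near/nbhs_ltP[t t0 tP]:= open_nbhs_nbhs (conj (open_ch_domain (chart_atP F x)) xx).
exists (2 * K);split;first by rewrite mulr_gt0.
exists (Num.min s (t / (2 * K)))=>[|y cy]. by rewrite lt_min s0 divr_gt0// mulr_gt0.
rewrite lt_min=> /andP[ys yt];have [w wy wx]:= sP _ ys.
exists (e0 + P (w - cfun (chart_at F x) x)). rewrite addrC addKr;apply: le_trans (KP _) _;rewrite (mulrC 2) -mulrA ler_pM2l//.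
have H: `|e0 + P (w - cfun (chart_at F x) x) - e0| < t. rewrite addrC addKr;apply: le_lt_trans (KP _) _. move: yt;rewrite ltr_pdivlMr ?mulr_gt0// => yt.
 have: K * `|w - cfun (chart_at F x) x| <= K * (2 * `|cfun (chart_at F x) y - cfun (chart_at F x) x|) by rewrite ler_pM2l. move: yt;lra.
have cu:= tP _ H.
by rewrite -(cfunK cu) -[RHS](cfunK cy);congr (cinv _ _);exact: wy.
Qed.
Lemma near_orb (x: Xs) (r: R): 0 < r -> nbhs x ([set y | exists2 u, `|u - e0| < r & act (cinv c0 u) x = y] : set Xs).
Proof.
move=> r0;have [C [C0 [s s0 sP]]]:= local_section x.
have t0: 0 < Num.min s (r / C) by rewrite lt_min s0 divr_gt0.
apply: nbhs_imp (ch_nbhs (chart_atP F x) (mem_chart_at F x) t0)=> y [cy].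
rewrite lt_min=> /andP[ys yr];have [u ux uy]:= sP y cy ys;exists u=>//.
by apply: le_lt_trans ux _;rewrite mulrC -ltr_pdivlMr.
Qed.
Lemma act_conj h x: \forall u \near e0, act h (act (cinv c0 u) x) = act (cinv c0 (conj_ch LG h u)) (act h x).
Proof.
apply: nbhs_imp (conj_near_dom LG h)=> v [_ cv].
by rewrite /conj_ch (cfunK cv) -!actM mulgVK.
Qed.
Lemma act_continuous h: continuous (act h: Xs -> Xs).
Proof.
move=> x U hU;have /nbhs_ltP[r r0 rP]:= orb_near hU.
have c1:= sd_cont (fmx _ _) (conj_ch_sd LG h).
have /cont_ltP/(_ _ r0)[s s0 sP]:= c1.
have /nbhs_ltP[t t0 tP]:= act_conj h x.
have st: 0 < Num.min s t by rewrite lt_min s0.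
apply: nbhs_imp (near_orb x st)=> _ [u + <-]/=.
rewrite lt_min=> /andP[us ut];rewrite /preimage/= tP//;apply: rP.
by have:= sP u us;rewrite conj_ch_e0.
Qed.

Definition act_ch h x: 'rV[R]_m -> 'rV[R]_m:= cfun (chart_at F (act h x)) \o act h \o cinv (chart_at F x).

(** Only the orbit maps are known to be smooth. Read through the orbit map at [x], the action of [h]
    is conjugation by [h] followed by the orbit map at [act h x]; [sd_factor] transfers its
    derivative to the chart. *)
Lemma act_ch_sd h x: sdiff (act_ch h x) (cfun (chart_at F x) x) ('d (act_ch h x) (cfun (chart_at F x) x)) /\ forall v, tangent_map F F (act h) x ('d (orb_ch x) e0 v) =
      'd (orb_ch (act h x)) e0 (Ad LG h v).
Proof.
have [P [PP f0x f0S]]:= orb_section x.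
pose k:= cfun (chart_at F x) x;pose aff w:= e0 + P (w - k).
have affk: aff k = e0 by rewrite /aff subrr linear0 addr0.
have S1:= @sd_aff R _ _ e0 k P.
have S2:= conj_ch_sd LG h;rewrite -[X in sdiff _ X _]affk in S2.
have S12:= sd_comp (fmx _ _) (fmx _ _) S1 S2.
have S3:= @orb_ch_sd (act h x);rewrite -[X in sdiff _ X _](conj_ch_e0 LG h) -[X in conj_ch _ _ X]affk in S3.
have S:= sd_comp (fmx _ _) (fmx _ _) S12 S3.
have cx:= mem_chart_at F x.
have dom: \forall u \near e0, act_ch h x (orb_ch x u) = orb_ch (act h x) (conj_ch LG h u). have H1:= orb_near (open_nbhs_nbhs (conj (open_ch_domain (chart_atP F x)) cx)).
 apply: nbhs_imp (nbhsI2 H1 (act_conj h x))=> u [cu E]. by rewrite /act_ch /orb_ch/= (cfunK cu) E.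
have H: sdiff (act_ch h x) k ('d (act_ch h x) k). have near : \forall w \near k, act_ch h x (orb_ch x (aff w)) = orb_ch (act h x) (conj_ch LG h (aff w)).
  have:= sd_cont (fmx _ _) S1;rewrite /prop_for /continuous_at -/(aff k) affk=> /(_ _ dom). by apply: nbhs_imp=> w. have L:= sd_factor f0S f0x S near. have [_ E]:= sd_dif (fmx _ _) L.
 by apply: sd_eq L=> v;rewrite E.
split; [exact: H|move=> v].
have H':= H;rewrite /k -orb_ch_e0 in H'.
have C1:= sd_comp (fmx _ _) (fmx _ _) (@orb_ch_sd x) H'.
have S4:= @orb_ch_sd (act h x);rewrite -[X in sdiff _ X _](conj_ch_e0 LG h) in S4.
have C2:= sd_comp (fmx _ _) (fmx _ _) (conj_ch_sd LG h) S4.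
have C1':= sd_near dom C1.
have:= sd_unique (fmx _ _) C1' C2 v.
by rewrite/= orb_ch_e0 AdE.
Qed.
Lemma orb_joined: exists2 r: R, 0 < r & forall u, `|u - e0| < r -> forall x, joined F x (act (cinv c0 u) x).
Proof.
have /nbhs_ltP[r r0 rP]:= ch_inv_near (c0P LG) (c01 LG).
have e1: 0 < expR 1 :> R:= expR_gt0 1.
exists (r / expR 1)=>[|u];first by rewrite divr_gt0.
rewrite ltr_pdivlMr// => ur.
have im (s: R): 0 <= s < expR 1 -> (cfun c0 @` cdom c0) (e0 + s *: (u - e0)). move=> /andP[s0 s1];exists (cinv c0 (e0 + s *: (u - e0)));last first.
  by apply: (rP _ _).2;rewrite addrC addKr normrZ ger0_norm// (le_lt_trans _ ur)// mulrC ler_wpM2l// ltW.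
 by apply: (rP _ _).1;rewrite addrC addKr normrZ ger0_norm// (le_lt_trans _ ur)// mulrC ler_wpM2l// ltW.
move=> x;exists (fun t=> act (line_crv c0 e0 u t) x);split.
- apply: (@sm_crv_comp R m X F _ (fun u=> act (cinv c0 u) x) (fun t=> e0 + step t *: (u - e0)) (fmx _ _)).
  move=> k;apply: (Ck_comp fdim_R openT openT (g:= step: R^o -> R^o) (f:= fun s: R^o=> e0 + s *: (u - e0)))=>//. exact: sm_step. exact: sm_aff.
 by move=> t;apply: orb_sm;apply: im;exact: step_bound.
- by rewrite /line_crv step_le0// scale0r addr0 c0e0 act1.
- by rewrite /line_crv step1 scale1r addrC subrK.
Qed.

(** * Expansion factors against expansion of distances *)

Section HomogeneousMetric.
Context (q: riemannian_metric F) (HM: hausdorff_space (mspace F)).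
Hypothesis joinedM: forall x y: X, joined F x y.
Local Notation d:= (riemannian_dist q: mspace F -> mspace F -> R).
Local Notation N:= (tangent_norm q).
Local Notation k x:= (cfun (chart_at F x)).
Local Notation orb:= (orb_ch).

Lemma act_local h x (e: R): 0 < e -> exists2 r: R, 0 < r & forall y y', cdom (chart_at F x) y -> cdom (chart_at F x) y' -> `|k x y - k x x| < r -> `|k x y' - k x x| < r ->
 [/\ d y y' <= 2 * N x (k x y' - k x y), N x (k x y' - k x y) <= 2 * d y y', d (act h y) (act h y') <= 2 * N (act h x) (k (act h x) (act h y') - k (act h x) (act h y)),
   N (act h x) (k (act h x) (act h y') - k (act h x) (act h y)) <= 2 * d (act h y) (act h y') & N (act h x) (k (act h x) (act h y') - k (act h x) (act h y) -
    tangent_map F F (act h) x (k x y' - k x y)) <= e * N x (k x y' - k x y)].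
Proof.
move=> ep;have [r1 r10 P1]:= dist_compare q HM joinedM x.
have [r2 r20 P2]:= dist_compare q HM joinedM (act h x).
have nh:= ch_nbhs (chart_atP F (act h x)) (mem_chart_at F (act h x)) r20.
have [r3 r30 P3]:= sub_ch_nbhs (chart_atP F x) (mem_chart_at F x) (act_continuous nh).
have [a [a0 [b b0 Pa]]]:= tnorm_equiv q x.
have [a' [a'0 [b' b'0 Pa']]]:= tnorm_equiv q (act h x).
have e10: 0 < e * a / b' by rewrite divr_gt0// mulr_gt0.
have [r4 r40 P4]:= (act_ch_sd h x).1 _ e10.
exists (Num.min (Num.min r1 r3) r4)=>[|y y' cy cy'];first by rewrite !lt_min r10 r30.
rewrite !lt_min=> /andP[/andP[y1 y3] y4] /andP[/andP[y1' y3'] y4'].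
have [cz z2]:= P3 _ cy y3;have [cz' z2']:= P3 _ cy' y3'.
have [A1 A2]:= P1 _ _ cy cy' y1 y1';have [B1 B2]:= P2 _ _ cz cz' z2 z2'.
split=>//;have:= P4 _ _ y4' y4;rewrite /act_ch/= !cfunK// => H.
have /andP[_ H1]:= Pa' (k (act h x) (act h y') - k (act h x) (act h y) - tangent_map F F (act h) x (k x y' - k x y)).
apply: le_trans H1 _;have /andP[H2 _]:= Pa (k x y' - k x y).
have H3: b' * `|k (act h x) (act h y') - k (act h x) (act h y) - tangent_map F F (act h) x (k x y' - k x y)| <= b' * (e * a / b' * `|k x y' - k x y|) by rewrite ler_pM2l.
apply: le_trans H3 _.
have -> : b' * (e * a / b' * `|k x y' - k x y|) = e * (a * `|k x y' - k x y|). by field;rewrite gt_eqF.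
by rewrite ler_pM2l.
Qed.
Lemma mball_ch x (r: R): 0 < r -> exists2 s: R, 0 < s & forall y, d x y < s -> cdom (chart_at F x) y /\ `|k x y - k x x| < r.
Proof.
move=> r0;have [_ _ _ _ nb]:= riem_metr_for q HM joinedM.
by have /nb[s s0 sP]:= ch_nbhs (chart_atP F x) (mem_chart_at F x) r0;exists s.
Qed.
Lemma act_local_lip h x: exists L: R, 0 < L /\ exists2 r: R, 0 < r & forall y y', d x y < r -> d x y' < r -> d (act h y) (act h y') <= L * d y y'.
Proof.
have [r r0 rP]:= act_local h x ltr01;have [s s0 sP]:= mball_ch x r0.
have [a [a0 [b b0 Pa]]]:= tnorm_equiv q x.
have [a' [a'0 [b' b'0 Pa']]]:= tnorm_equiv q (act h x).
pose T:= 'd (act_ch h x) (k x x).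
have [K K0 KT]:= fdim_bnd (fmx 1 m) (linearP T).
exists (2 * (b' * K / a + 1) * 2);split;first by rewrite !mulr_gt0// addr_gt0// divr_gt0// mulr_gt0.
exists s=>// y y' /sP[cy ys] /sP[cy' ys'].
have [_ H2 H3 _ H5]:= rP _ _ cy cy' ys ys'.
set w:= k x y' - k x y in H2 H5;set w':= k (act h x) _ - _ in H3 H5.
have Tw: N (act h x) (T w) <= b' * K / a * N x w. have /andP[_ H]:= Pa' (T w);apply: le_trans H _. have /andP[H _]:= Pa w;rewrite -!mulrA ler_pM2l//;apply: le_trans (KT w) _.
 by rewrite ler_pM2l// ler_pdivlMl.
have Nw': N (act h x) w' <= (b' * K / a + 1) * N x w. rewrite -[w'](subrK (T w));apply: le_trans (tnorm_tri _ _ _ _) _. by rewrite addrC mulrDl mul1r lerD//;rewrite mul1r in H5.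
apply: le_trans H3 _;rewrite -!(mulrA 2) ler_pM2l//;apply: le_trans Nw' _.
by rewrite -(mulrA (_ + 1)) ler_pM2l// addr_gt0// divr_gt0// mulr_gt0.
Qed.
Lemma expn_factor_le h x v: v != 0 -> expansion_factor q (act h) x * N x v <= N (act h x) (tangent_map F F (act h) x v).
Proof.
move=> v0;rewrite -ler_pdivlMr ?tnorm_gt0//.
apply: ge_inf;last by exists v.
by exists 0=> _ [w _ <-];rewrite divr_ge0// tnorm_ge0.
Qed.
(** Passing between norm and distance costs a factor 2 at the source and one at the target, and the
    error of the linearization is at most the norm itself; together they make [4 * lam + 1]. *)
Lemma expn_factor_expd h x (lam: R): 0 < lam -> 4 * lam + 1 <= expansion_factor q (act h) x -> exists2 r: R, 0 < r & forall y y', d x y < r -> d x y' < r -> lam * d y y' <= d (act h y) (act h y').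
Proof.
move=> l0 lE;have [r r0 rP]:= act_local h x ltr01;have [s s0 sP]:= mball_ch x r0.
exists s=>// y y' /sP[cy ys] /sP[cy' ys'].
have [H1 _ _ H4 H5]:= rP _ _ cy cy' ys ys'.
set w:= k x y' - k x y in H1 H5;set w':= k (act h x) _ - _ in H4 H5.
have [w0|w0]:= eqVneq w 0. rewrite w0 tnorm0 mulr0 in H1;have:= dist_ge0 q joinedM (act h y) (act h y'). have:= dist_ge0 q joinedM y y';nra.
set T:= tangent_map F F (act h) x in H5.
have H: N (act h x) (T w) <= N (act h x) (w' - T w) + N (act h x) w'. rewrite {1}(_: T w = - (w' - T w) + w');last by zmod. apply: le_trans (tnorm_tri _ _ _ _) _.
 by rewrite -scaleN1r tnormZ normrN1 mul1r.
have HE:= expn_factor_le h x w0.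
have: (4 * lam + 1) * N x w <= expansion_factor q (act h) x * N x w. by rewrite ler_wpM2r// tnorm_ge0.
move: H H1 H4 H5 HE;rewrite -/T mul1r;set E:= _ * N x w.
have Z (dd dh nw nw' nd nt EE: R): nt <= nd + nw' -> dd <= 2 * nw -> nw' <= 2 * dh -> nd <= nw -> EE <= nt -> (4 * lam + 1) * nw <= EE -> lam * dd <= dh.
 move=> *;have: lam * dd <= lam * (2 * nw) by rewrite ler_pM2l. lra.
exact: Z.
Qed.
(** A vector that violates the bound is scaled down until the linearization is accurate enough for
    its endpoint to violate [lP]. *)
Lemma expd_tangent h x (lam r: R): 0 < lam -> 0 < r -> (forall y y', d x y < r -> d x y' < r -> lam * d y y' <= d (act h y) (act h y')) ->
 forall v, lam / 4 * N x v <= N (act h x) (tangent_map F F (act h) x v).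
Proof.
move=> l0 r0 lP v;set T:= tangent_map F F (act h) x.
have [->|v0]:= eqVneq v 0. by rewrite tnorm0 mulr0 tnorm_ge0.
rewrite leNgt;apply/negP=> H.
have Nv:= tnorm_gt0 q x v0.
pose e:= (lam / 4 * N x v - N (act h x) (T v)) / (2 * N x v).
have ep: 0 < e by rewrite divr_gt0 ?subr_gt0// mulr_gt0.
have [s s0 sP]:= act_local h x ep.
have [_ _ _ _ nb]:= riem_metr_for q HM joinedM.
have nx: nbhs (x: mspace F) (mball d r x) by apply/nb;exists r.
have /nbhs_ltP[t t0 tP]:= ch_inv_cont (chart_atP F x) (mem_chart_at F x) nx.
have nv: 0 < `|v| by rewrite normr_gt0.
pose a:= Num.min s t / (2 * `|v|).
have st: 0 < Num.min s t by rewrite lt_min s0.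
have a0: 0 < a by rewrite divr_gt0// mulr_gt0.
have av: `|k x x + a *: v - k x x| < Num.min s t. rewrite addrC addKr normrZ gtr0_norm// /a (_: _ / _ * _ = Num.min s t / 2);last by field;rewrite gt_eqF. by rewrite ltr_pdivrMr// ltr_pMr// ltr1n.
move: (av);rewrite lt_min=> /andP[avs avt].
have [cy yE yr]:= tP _ avt.
have cx:= mem_chart_at F x.
have:= sP _ _ cx cy _ _;rewrite subrr normr0 yE=> /(_ s0 avs) [_ H2 H3 H4 H5].
have rx: d x x < r by rewrite dist_refl.
have:= lP _ _ rx yr.
have TZ: T (a *: v) = a *: T v by rewrite /T /tangent_map linearZ.
have wE: k x x + a *: v - k x x = a *: v by rewrite addrC addKr.
move: H2 H3 H4 H5;rewrite wE -/T TZ tnormZ (gtr0_norm a0).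
set w':= k (act h x) _ - _=> H2 H3 _ H5 H6.
have H7: N (act h x) w' <= e * (a * N x v) + a * N (act h x) (T v). rewrite -[w'](subrK (a *: T v));apply: le_trans (tnorm_tri _ _ _ _) _. by rewrite tnormZ (gtr0_norm a0) lerD2r.
have H8: e * N x v = (lam / 4 * N x v - N (act h x) (T v)) / 2. by rewrite /e;field;rewrite gt_eqF.
have: lam * (a * N x v) <= 4 * (e * (a * N x v) + a * N (act h x) (T v)). move: H2 H3 H6 H7;set D:= riemannian_dist _ x _;set D':= riemannian_dist _ _ _=> H2 H3 H6 H7.
 have: lam * (a * N x v) <= lam * (2 * D) by rewrite ler_pM2l. lra.
rewrite [e * (a * _)]mulrCA H8 -mulrDr [lam * _]mulrCA [4 * _]mulrCA ler_pM2l//.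
move: H;lra.
Qed.
Lemma expn_factor_ge h x (lam r: R) (v0: 'rV[R]_m): v0 != 0 -> 0 < lam -> 0 < r -> (forall y y', d x y < r -> d x y' < r -> lam * d y y' <= d (act h y) (act h y')) ->
 lam / 4 <= expansion_factor q (act h) x.
Proof.
move=> v00 l0 r0 lP;apply: lb_le_inf;first by exists (N (act h x) (tangent_map F F (act h) x v0) / N x v0);exists v0.
move=> _ [w w0 <-];rewrite ler_pdivlMr ?tnorm_gt0//.
exact: expd_tangent l0 r0 lP w.
Qed.
(** A point near [z0] is [act s z0] with [s] near 1. Its displacement by [u] is then seen in the
    single orbit map at [z0], where multiplication by [u] moves [s] by a multiple of the distance
    from [u] to [e0]. *)
Lemma orb_displ z0: exists C: R, 0 < C /\ exists2 r: R, 0 < r & forall z, d z0 z < r -> forall u, `|u - e0| < r -> d z (act (cinv c0 u) z) <= C * `|u - e0|.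
Proof.
have [r1 r10 P1]:= dist_compare q HM joinedM z0.
have [K [K0 [r2 r20 P2]]]:= sd_lip (fmx _ _) (orb_ch_sd z0).
have nz:= ch_nbhs (chart_atP F z0) (mem_chart_at F z0) r10.
have /nbhs_ltP[r3 r30 P3]:= orb_near nz.
have [C [C0 [r4 r40 P4]]]:= mul_ch_lip LG.
have [r5 r50 P5]:= mul_ch_dom LG.
have [a [a0 [b b0 Pb]]]:= tnorm_equiv q z0.
pose r:= Num.min (Num.min r2 r3) (Num.min r4 r5).
have r0: 0 < r by rewrite !lt_min r20 r30 r40.
have [_ _ _ _ nb]:= riem_metr_for q HM joinedM.
have r2': 0 < r / 2 by rewrite divr_gt0.
have /nb[t t0 tP]:= near_orb z0 r2'.
exists (2 * (b * (K * C)));split;first by rewrite !mulr_gt0.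
exists (Num.min t (Num.min (r / 2) (r / (2 * C))))=>[|z]. by rewrite !lt_min t0 r2'/= divr_gt0// mulr_gt0.
rewrite lt_min=> /andP[zt _] u;rewrite !lt_min=> /and3P[_ ur uC].
have [s ss <-]:= tP z zt.
have [sr ur'] : `|s - e0| < r /\ `|u - e0| < r by move: r0 ss ur;lra.
move: (sr) (ur');rewrite !lt_min=> /andP[/andP[s2 s3] /andP[s4 s5]] /andP[_ /andP[u4 u5]].
have H4:= P4 _ _ u4 s4;have [_ _ us]:= P5 _ _ u5 s5.
pose p:= mul_ch LG u s.
have pr: `|p - e0| < r. rewrite -[p - e0](subrKA s);apply: le_lt_trans (ler_normD _ _) _. move: H4 uC ss;rewrite -/p ltr_pdivlMr ?mulr_gt0// => H4 uC ss. by move: H4 uC ss;rewrite -/p;lra.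
move: (pr);rewrite !lt_min=> /andP[/andP[p2 p3] _].
have pE: act (cinv c0 u) (act (cinv c0 s) z0) = act (cinv c0 p) z0. by rewrite -actM /p /mul_ch (cfunK us).
rewrite pE;have [cs ds]:= P3 _ s3;have [cp dp]:= P3 _ p3.
have [H1 _]:= P1 _ _ cs cp ds dp;apply: le_trans H1 _.
rewrite -mulrA ler_pM2l//;have /andP[_ H5]:= Pb (k z0 (act (cinv c0 p) z0) - k z0 (act (cinv c0 s) z0)).
apply: le_trans H5 _;rewrite -mulrA ler_pM2l//.
apply: le_trans (P2 _ _ p2 s2) _;rewrite -mulrA ler_pM2l//.
Qed.
(** The derivative at [z] is written in the preferred chart at [z], and these charts vary without
    any continuity. The displacement bound [orb_displ] is free of charts, which makes the estimate
    uniform in [z]. *)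
Lemma orb_der_bound z0: exists C: R, 0 < C /\ exists2 r: R, 0 < r & forall z, d z0 z < r -> forall v, N z ('d (orb z) e0 v) <= C * `|v|.
Proof.
have [C [C0 [r r0 rP]]]:= orb_displ z0;exists (2 * C);split;first by rewrite mulr_gt0.
exists r=>// z zr v;rewrite leNgt;apply/negP=> H.
have v0: v != 0. by apply: contraTneq H=> ->;rewrite linear0 tnorm0 normr0 mulr0 ltxx.
have nv: 0 < `|v| by rewrite normr_gt0.
have [a [a0 [b b0 Pb]]]:= tnorm_equiv q z.
pose e:= (N z ('d (orb z) e0 v) - 2 * C * `|v|) / (2 * (b * `|v|)).
have ep: 0 < e by rewrite divr_gt0 ?subr_gt0// !mulr_gt0.
have [s s0 sP]:= orb_ch_sd z ep.
have [r1 r10 P1]:= dist_compare q HM joinedM z.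
have nz:= ch_nbhs (chart_atP F z) (mem_chart_at F z) r10.
have /nbhs_ltP[r3 r30 P3]:= orb_near nz.
pose M:= Num.min (Num.min r s) r3.
have M0: 0 < M by rewrite !lt_min r0 s0.
pose t:= M / (2 * `|v|);have t0: 0 < t by rewrite divr_gt0// mulr_gt0.
have tv: `|e0 + t *: v - e0| < M. rewrite addrC addKr normrZ gtr0_norm// /t (_: _ / _ * _ = M / 2);last by field;rewrite gt_eqF. by rewrite ltr_pdivrMr// ltr_pMr// ltr1n.
have tvE: e0 + t *: v - e0 = t *: v by rewrite addrC addKr.
move: (tv);rewrite !lt_min=> /andP[/andP[tr ts] t3].
have e0s: `|e0 - e0| < s by rewrite subrr normr0.
have [cu du]:= P3 _ t3;have cz:= mem_chart_at F z.
have []:= P1 _ _ cz cu _ du;first by rewrite subrr normr0.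
move=> _ H2;have H3:= rP z zr _ tr;have:= sP _ _ ts e0s.
rewrite /orb_ch c0e0 act1 tvE linearZ normrZ (gtr0_norm t0)=> H4.
set w:= k z _ - k z z in H2 H4;rewrite tvE normrZ (gtr0_norm t0) in H3.
have /andP[_ H5]:= Pb (w - t *: 'd (orb z) e0 v).
have H6: t * N z ('d (orb z) e0 v) <= N z w + b * (e * (t * `|v|)). rewrite -[X in X * _](gtr0_norm t0) -tnormZ.
 rewrite (_: t *: _ = w + (-1) *: (w - t *: 'd (orb z) e0 v));last by rewrite scaleN1r;zmod. apply: le_trans (tnorm_tri _ _ _ _) _;rewrite lerD2l tnormZ normrN1 mul1r.
 by apply: le_trans H5 _;rewrite ler_pM2l.
have H7: b * (e * `|v|) = (N z ('d (orb z) e0 v) - 2 * C * `|v|) / 2. by rewrite /e;field;rewrite !gt_eqF.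
have: t * N z ('d (orb z) e0 v) <= 2 * (C * (t * `|v|)) + t * (b * (e * `|v|)). have -> : t * (b * (e * `|v|)) = b * (e * (t * `|v|)) by ring.
 by apply: le_trans H6 _;rewrite lerD2r;apply: le_trans H2 _;rewrite ler_pM2l.
rewrite H7 [C * (t * _)]mulrCA [2 * (t * _)]mulrCA -mulrDr ler_pM2l//.
move: H;lra.
Qed.
End HomogeneousMetric.
End HomogeneousSpace.

(** * Minimization over closed sets of matrices *)

Section MatrixMinimization.
Context {R: realType}.

Lemma rV_min n (Q: set 'rV[R]_n) (f: 'rV[R]_n -> R) (x0: 'rV[R]_n): closed Q -> continuous f -> Q x0 -> (exists M: R, forall x, Q x -> f x <= f x0 -> `|x| <= M) ->
 exists2 x, Q x & forall y, Q y -> f x <= f y.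
Proof.
move=> cQ cf Q0 [M MP];pose A:= Q `&` [set x | f x <= f x0].
have cA: closed A. apply: closedI=>//;have -> : [set x | f x <= f x0] = f @^-1` [set s: R | s <= f x0] by []. by apply: closed_comp; [move=> u _;exact: cf|exact: closed_le].
have bA: bounded_set A. exists M;split;first exact: num_real. by move=> K MK u/= [Qu fu];apply: le_trans (MP _ Qu fu) (ltW MK).
have [x + xmin]:= @EVT_min_rV R n f A (ex_intro _ x0 (conj Q0 (lexx _))) (bounded_closed_compact bA cA) (continuous_subspaceT cf).
rewrite inE=> -[Qx fx];exists x=>// y Qy.
have [fy|fy]:= leP (f y) (f x0);first by apply: xmin;rewrite inE.
exact: le_trans fx (ltW fy).
Qed.
Lemma mx_lin_cont m n p q (f: 'M[R]_(m, n) -> 'M[R]_(p, q)): linear f -> continuous f.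
Proof. by move=> lf;exact: (@fdim_cont R _ _ (mklin lf) (fmx m n)). Qed.
Lemma vec_mx_cont m n: continuous (vec_mx: 'rV[R]_(m * n) -> 'M[R]_(m, n)).
Proof. exact: mx_lin_cont (linearP vec_mx). Qed.
Lemma mxvec_bound m n (A: 'M[R]_(m, n)): `|mxvec A| <= `|A|.
Proof.
apply: mx_norm_leP=>// i j;rewrite ord1;case/mxvec_indexP: j=> a b.
by rewrite mxvecE mx_co_le.
Qed.
Lemma mx_min m n (Q: set 'M[R]_(m, n)) (f: 'M[R]_(m, n) -> R) x0: closed Q -> continuous f -> Q x0 -> (exists M: R, forall x, Q x -> f x <= f x0 -> `|x| <= M) ->
 exists2 x, Q x & forall y, Q y -> f x <= f y.
Proof.
move=> cQ cf Q0 [M MP].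
have [||||x Qx xmin]:= @rV_min _ (vec_mx @^-1` Q) (f \o vec_mx) (mxvec x0).
- by apply: closed_comp=>// u _;exact: vec_mx_cont.
- by move=> u;apply: continuous_comp; [exact: vec_mx_cont|exact: cf].
- by rewrite /preimage/= mxvecK.
- exists M=> x Qx;rewrite/= mxvecK=> fx;rewrite -[x]vec_mxK. by apply: le_trans (mxvec_bound _) (MP _ Qx fx).
by exists (vec_mx x)=>// y Qy;have:= xmin (mxvec y);rewrite /preimage/= mxvecK;exact.
Qed.
Lemma mx_cpt m n (Q: set 'M[R]_(m, n)) (M: R): closed Q -> (forall x, Q x -> `|x| <= M) -> compact Q.
Proof.
move=> cQ QM;have -> : Q = vec_mx @` (vec_mx @^-1` Q). apply/seteqP;split=>[x Qx|_ [x Qx <-]//]. by exists (mxvec x);rewrite ?mxvecK// /preimage/= mxvecK.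
apply: continuous_compact;first by apply: continuous_subspaceT;exact: vec_mx_cont.
apply: bounded_closed_compact;last by apply: closed_comp=>// u _;exact: vec_mx_cont.
exists M;split;first exact: num_real.
move=> K MK x Qx;rewrite -[x]vec_mxK;apply: le_trans (mxvec_bound _) _.
exact: le_trans (QM _ Qx) (ltW MK).
Qed.
Lemma cl_cont_eq (T: topologicalType) (W: normedModType R) (f g: T -> W): continuous f -> continuous g -> closed [set x | f x = g x].
Proof.
move=> cf cg;have -> : [set x | f x = g x] = (fun x=> f x - g x) @^-1` [set 0]. apply/seteqP;split=> x/=;first by move=> ->;rewrite subrr. by move=> /eqP;rewrite subr_eq0=> /eqP.
apply: closed_comp;last by apply: accessible_closed_set1;apply: hausdorff_accessible;exact: norm_hausdorff.
by move=> x _;apply: continuousB; [exact: cf|exact: cg].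
Qed.
Lemma mulmxr_cont m n p (A: 'M[R]_(n, p)): continuous (fun X: 'M[R]_(m, n)=> X *m A).
Proof. exact: mx_lin_cont (linearP (mulmxr A)). Qed.
Lemma mulmxl_cont m n p (A: 'M[R]_(m, n)): continuous (fun X: 'M[R]_(n, p)=> A *m X).
Proof. exact: mx_lin_cont (linearP (mulmx A)). Qed.
Lemma mx_bilin m n p: bilin_map (fun (X: 'M[R]_(m, n)) (Y: 'M[R]_(n, p))=> X *m Y).
Proof.
apply: fdim_bilin=>[||v|u]; [exact: fmx|exact: fmx| |]. exact: (linearP (mulmxr v)).
exact: (linearP (mulmx u)).
Qed.
Lemma mulmx_cont (T: topologicalType) m n p (f: T -> 'M[R]_(m, n)) (g: T -> 'M[R]_(n, p)) x: {for x, continuous f} -> {for x, continuous g} -> {for x, continuous (fun y=> f y *m g y)}.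
Proof.
move=> cf cg.
have H: {for (f x, g x), continuous (fun u: 'M[R]_(m, n) * 'M[R]_(n, p)=> u.1 *m u.2)}. apply: differentiable_continuous;apply: (diff_bilin (mx_bilin m n p) (f:= fst) (g:= snd) _ _).1.
  by apply: (@linear_differentiable _ _ _ fst);move=>[? ?];exact: cvg_fst. by apply: (@linear_differentiable _ _ _ snd);move=>[? ?];exact: cvg_snd.
by apply: (@continuous_comp _ _ _ (fun y=> (f y, g y)) (fun u: 'M[R]_(m, n) * 'M[R]_(n, p)=> u.1 *m u.2)); [exact: (@cvg_pair _ _ _ _ _ _ _ _ _ f g cf cg)|exact: H].
Qed.
End MatrixMinimization.

(** * Traces of nilpotent matrices *)

Section NilpotentTrace.
Context {R: fieldType}.
(** Over the polynomials [X - N] divides [X ^ k - N ^ k = X ^ k]. Hence the characteristic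
    polynomial is a power of [X], and the trace is its second coefficient up to sign. *)
Lemma nil_tr n (N: 'M[R]_n) k: N ^+ k = 0 -> \tr N = 0.
Proof.
case: n N=>[N _|n N Nk];first by rewrite /mxtrace big_ord0.
pose Np:= map_mx polyC N;pose Xm: 'M[{poly R}]_n.+1:= 'X%:M.
have XN: GRing.comm Xm Np by rewrite /GRing.comm -[LHS]/(_ *m _) -[RHS]/(_ *m _) scalar_mxC.
have Npk: Np ^+ k = 0 by rewrite /Np -rmorphXn/= Nk rmorph0.
have D: char_poly N %| 'X^(k * n.+1). apply/dvdpP;exists (\det (\sum_(i < k) Xm ^+ (k.-1 - i) * Np ^+ i)). have:= congr1 determinant (subrXX_comm k XN);rewrite Npk subr0 det_mulmx=> H.
 rewrite mulrC -[RHS]H /Xm -rmorphXn/= det_scalar -exprM//.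
have: char_poly N %| ('X - 0%:P) ^+ (k * n.+1) by rewrite polyC0 subr0.
move=> /dvdp_exp_XsubCP[j _];rewrite polyC0 subr0=> E.
have: char_poly N = 'X^j by apply/eqP;rewrite -eqp_monic ?char_poly_monic ?monicXn.
move=> E';have:= size_char_poly N;rewrite E' size_polyXn=> -[jn].
have:= char_poly_trace N (ltn0Sn n);rewrite E' coefXn jn/=.
by rewrite ltn_eqF// => /eqP;rewrite eq_sym oppr_eq0=> /eqP.
Qed.
End NilpotentTrace.

(** * Exponentials of diagonalizable matrices *)

Section DiagonalExponential.
Context {R: realType}.

Lemma mx_diagE n (A S: 'M[R]_n) (d: 'rV[R]_n): S \in unitmx -> S *m A = diag_mx d *m S -> A = invmx S *m diag_mx d *m S.
Proof. by move=> uS E;rewrite -mulmxA -E mulmxA mulVmx// mul1mx. Qed.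
Lemma expmx_diag n (A S: 'M[R]_n) (d: 'rV[R]_n): S \in unitmx -> S *m A = diag_mx d *m S -> expmx A = invmx S *m diag_mx (map_mx expR d) *m S.
Proof.
move=> uS E;pose P (i: 'I_n):= invmx S *m diag_mx (delta_mx 0 i) *m S.
have diagE (v: 'rV[R]_n): invmx S *m diag_mx v *m S = \sum_i v 0 i *: P i. rewrite {1}[v]row_sum_delta linear_sum mulmx_sumr mulmx_suml;apply: eq_bigr=> i _.
 by rewrite linearZ/= -scalemxAr -scalemxAl.
have pow k: A ^+ k = \sum_i (d 0 i) ^+ k *: P i. have <- : invmx S *m diag_mx (map_mx (fun x=> x ^+ k) d) *m S = \sum_i (d 0 i) ^+ k *: P i. by rewrite diagE;apply: eq_bigr=> i _;rewrite mxE.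
 elim: k=>[|k IH]. have -> : map_mx (fun x: R=> x ^+ 0) d = const_mx 1 by apply/rowP=> j;rewrite !mxE expr0. by rewrite diag_const_mx mulmx1 mulVmx// expr0.
 rewrite exprS IH [A in LHS](mx_diagE uS E) -[LHS]/(_ *m _) !mulmxA mulmxK//. rewrite -(mulmxA _ (diag_mx d)) mulmx_diag;congr (_ *m diag_mx _ *m _). by apply/rowP=> j;rewrite !mxE exprS.
rewrite /expmx diagE;apply: cvg_lim;first exact: norm_hausdorff.
have -> : series (fun k=> (k`!%:R)^-1 *: A ^+ k) = (fun N=> \sum_i series (exp_coeff (d 0 i)) N *: P i). apply/funext=> N;rewrite /series/=. under eq_bigr=> k _ do rewrite pow scaler_sumr.
 rewrite exchange_big/=;apply: eq_bigr=> i _;rewrite scaler_suml;apply: eq_bigr=> k _. by rewrite scalerA /exp_coeff mulrC.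
have cs (I: Type) (r: seq I) (u: I -> nat -> 'M[R]_n) (l: I -> 'M[R]_n): (forall i, u i @ \oo --> l i) -> (fun N=> \sum_(i <- r) u i N) @ \oo --> \sum_(i <- r) l i.
 move=> ul;elim: r=>[|i r IH]. by under eq_fun do rewrite big_nil;rewrite big_nil;exact: cvg_cst. under eq_fun do rewrite big_cons;rewrite big_cons;apply: cvgD=>//;exact: ul.
apply: cs=> i;rewrite mxE;apply: cvgZr_tmp;exact: is_cvg_series_exp_coeff.
Qed.
End DiagonalExponential.

(** * Simultaneous diagonalization of commuting self-adjoint matrices *)

Section Spectral.
Context {R: realType} {n: nat} (G: 'M[R]_n).
Hypothesis Gs: G^T = G.
Hypothesis Gp: forall v: 'rV[R]_n, v != 0 -> 0 < (v *m G *m v^T) 0 0.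
Local Notation ip v w:= ((v *m G *m w^T) 0 0).

Definition self_adjoint (T: 'M[R]_n): Prop:= T *m G = G *m T^T.

Lemma gram_sym_form (v w: 'rV[R]_n): ip v w = ip w v.
Proof.
have -> : v *m G *m w^T = (w *m G *m v^T)^T by rewrite !trmx_mul trmxK Gs mulmxA.
by rewrite mxE.
Qed.
Lemma gram_formDl (u v w: 'rV[R]_n): ip (u + v) w = ip u w + ip v w.
Proof. by rewrite !mulmxDl mxE. Qed.
Lemma gram_formZl a (v w: 'rV[R]_n): ip (a *: v) w = a * ip v w.
Proof. by rewrite -!scalemxAl mxE. Qed.
Lemma gram_formDr (u v w: 'rV[R]_n): ip w (u + v) = ip w u + ip w v.
Proof. by rewrite !(gram_sym_form w) gram_formDl. Qed.
Lemma gram_formZr a (v w: 'rV[R]_n): ip w (a *: v) = a * ip w v.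
Proof. by rewrite !(gram_sym_form w) gram_formZl. Qed.
Lemma gram_form_nrm (x: 'rV[R]_n): x != 0 -> exists2 c: R, c ^+ 2 * ip x x = 1 & forall v w: 'rV[R]_n, ip (c *: v) (c *: w) = c ^+ 2 * ip v w.
Proof.
move=> x0;exists (Num.sqrt (ip x x))^-1=>[|v w]. by rewrite exprVn sqr_sqrtr ?ltW// ?Gp// mulVf// gt_eqF// Gp.
by rewrite gram_formZl gram_sym_form gram_formZl gram_sym_form mulrA expr2.
Qed.
Lemma gram_form_lin (w: 'rV[R]_n): linear ((fun v=> ip v w): 'rV[R]_n -> R^o).
Proof. by move=> k u v;rewrite gram_formDl gram_formZl. Qed.
Lemma quadratic_le0 (A C: R): (forall s: R, 2 * s * A <= s ^+ 2 * C) -> A = 0.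
Proof.
move=> H;apply/eqP;rewrite eq_le;apply/andP;split;rewrite leNgt;apply/negP=> A0. have C0: 0 < `|C| + 1 by rewrite ltr_wpDl. have:= H (A / (`|C| + 1));rewrite expr2=> H1.
 have: C <= `|C| by exact: ler_norm. set D:= `|C| in C0 H1 *;have AD: A / (D + 1) * (D + 1) = A by rewrite divfK// gt_eqF. have: 0 < A / (D + 1) by rewrite divr_gt0.
 move: H1 AD;set t:= A / (D + 1)=> *;nra.
have C0: 0 < `|C| + 1 by rewrite ltr_wpDl.
have:= H (A / (`|C| + 1));rewrite expr2=> H1.
have: C <= `|C| by exact: ler_norm.
set D:= `|C| in C0 H1 *;have AD: A / (D + 1) * (D + 1) = A by rewrite divfK// gt_eqF.
have: A / (D + 1) < 0 by rewrite pmulr_llt0// invr_gt0.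
move: H1 AD;set t:= A / (D + 1)=> *;nra.
Qed.

(* At a maximum of the Rayleigh quotient on the stable subspace [W]. *)
Lemma self_adjoint_eigv T (W: 'M[R]_n): self_adjoint T -> W != 0 -> stablemx W T -> exists v: 'rV[R]_n, exists l: R, [/\ v != 0, (v <= W)%MS & v *m T = l *: v].
Proof.
move=> sT W0 WT.
have [w0 w0W w00] : exists2 w: 'rV[R]_n, (w <= W)%MS & w != 0. by move: W0;rewrite -submx0=> /row_subPn[i];rewrite submx0=> wi;exists (row i W)=>//;exact: row_sub.
have [c0 c01 c0Z]:= gram_form_nrm w00.
pose w1:= c0 *: w0.
have w1W: (w1 <= W)%MS by exact: scalemx_sub.
have w11: ip w1 w1 = 1 by rewrite c0Z.
pose Q:= [set v: 'rV[R]_n | v *m cokermx W = 0] `&` [set v: 'rV[R]_n | v *m G *m v^T = 1%:M].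
have trc: continuous (trmx: 'M[R]_(1, n) -> 'M[R]_(n, 1)) by exact: mx_lin_cont (linearP trmx).
have qc (B: 'M[R]_n): continuous (fun v: 'rV[R]_n=> v *m B *m v^T: 'M[R]_1). by move=> v;exact: (@mulmx_cont R 'rV[R]_n 1 n 1 (fun v=> v *m B) trmx v (@mulmxr_cont R 1 n n B v) (trc v)).
have cQ: closed Q. apply: closedI;apply: cl_cont_eq;first exact: mulmxr_cont.
 - by move=> v;exact: cst_continuous.
 - exact: qc.
 - by move=> v;exact: cst_continuous.
have Q1: Q w1. split;first by apply/eqP;have:= w1W;rewrite submxE. by rewrite/= [LHS]mx11_scalar w11.
have [k k0 kP]:= pos_form_bounds gram_form_lin gram_sym_form Gp.
have cf: continuous (fun v: 'rV[R]_n=> - (v *m (T *m G) *m v^T: 'M[R]_1) 0 0).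
 move=> v;apply: continuousN;apply: (@continuous_comp _ _ _ (fun v: 'rV[R]_n=> v *m (T *m G) *m v^T: 'M[R]_1) (fun A: 'M[R]_1=> A 0 0)). exact: qc.
 exact: (@fdim_cont R _ _ (mklin (@co_is_lin R 1 1 0 0)) (fmx _ _)).
have [|v [vW v1] vmax]:= rV_min cQ cf Q1. exists k^-1=> x [_ x1] _;have:= kP x;rewrite /ip_norm x1 mxE sqrtr1. by rewrite -ler_pdivlMl// mulr1.
have v1': ip v v = 1 by rewrite v1 mxE.
exists v;pose l:= ip (v *m T) v;exists l.
have sym (x y: 'rV[R]_n): ip (x *m T) y = ip x (y *m T). by rewrite trmx_mul !mulmxA -(mulmxA x) sT mulmxA.
split.
- by apply: contra_eq_neq v1'=> ->;rewrite !mul0mx mxE eq_sym oner_neq0.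
- by rewrite submxE vW.
have key (x: 'rV[R]_n): (x <= W)%MS -> ip (x *m T) x <= l * ip x x. move=> xW;have [->|x0]:= eqVneq x 0;first by rewrite !mul0mx mxE mulr0. have [c c1 cZ]:= gram_form_nrm x0.
 have Qy: Q (c *: x). split;last by rewrite/= [LHS]mx11_scalar cZ c1. have:= xW;rewrite submxE=> /eqP xW'. by rewrite/= -scalemxAl xW' scaler0. have:= vmax _ Qy;rewrite !mulmxA lerN2.
 have -> : c *: x *m T = c *: (x *m T) by rewrite scalemxAl. rewrite cZ -/l=> H. have c20: 0 < c ^+ 2.
  by rewrite lt_neqAle sqr_ge0 andbT;apply: contra_eq_neq c1=> <-;rewrite mul0r eq_sym oner_neq0. by rewrite -(ler_pM2l c20) mulrCA c1 mulr1.
have [z zE] : exists z, z = v *m T - l *: v by exists (v *m T - l *: v).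
have zW: (z <= W)%MS. rewrite zE. have vW': (v <= W)%MS by rewrite submxE vW. apply: addmx_sub;first exact: submx_trans (submxMr T vW') WT. by rewrite eqmx_opp scalemx_sub.
(* The first variation is taken in the direction of the residual [z] itself, so that its vanishing
   says that [z] has norm 0. *)
have: ip (v *m T - l *: v) z = 0. apply: (@quadratic_le0 _ (l * ip z z - ip (z *m T) z))=> s. have vW': (v <= W)%MS by rewrite submxE vW.
 have:= key (v + s *: z);rewrite addmx_sub ?scalemx_sub// => /(_ isT). have -> : (v + s *: z) *m T = v *m T + s *: (z *m T) by rewrite mulmxDl scalemxAl.
 have -> : ip (v *m T - l *: v) z = ip (v *m T) z - l * ip v z. by rewrite gram_formDl -scaleNr gram_formZl mulNr.
 rewrite !gram_formDr !gram_formDl !gram_formZr !gram_formZl v1' (gram_sym_form z v) (sym z v) (gram_sym_form z) -/l.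
 set a:= ip (v *m T) z;set b:= ip v z;set c:= ip (z *m T) z;set e:= ip z z;lra.
have [z0|z0]:= eqVneq z 0. by move=> _;apply/eqP;rewrite -subr_eq0 -zE z0.
by move=> H;have:= Gp z0;rewrite {1}zE H ltxx.
Qed.
(** Induction on the rank: a matrix of [TT] that is not scalar on [W] has a smaller eigenspace in
    [W], which the others preserve because they commute with it. *)
Lemma joint_eigv (TT: set 'M[R]_n) (W: 'M[R]_n): (forall T, TT T -> self_adjoint T) -> (forall T T', TT T -> TT T' -> T *m T' = T' *m T) -> (forall T, TT T -> stablemx W T) -> W != 0 ->
 exists2 v: 'rV[R]_n, v != 0 & (v <= W)%MS /\ forall T, TT T -> exists l, v *m T = l *: v.
Proof.
move=> sT cT;have [k]:= ubnP (\rank W);elim: k W=>// k IH W;rewrite ltnS=> rk WT W0.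
have [H|/existsNP[T /not_implyP[TT1 H]]]:= pselect (forall T, TT T -> exists l, W *m T = l *: W). move: (W0);rewrite -submx0=> /row_subPn[i];rewrite submx0=> wi;exists (row i W)=>//.
 split;first exact: row_sub. by move=> T /H[l E];exists l;rewrite -row_mul E linearZ.
have [v [l [v0 vW vT]]]:= self_adjoint_eigv (sT T TT1) W0 (WT T TT1).
pose W':= (W :&: eigenspace T l)%MS.
have vW': (v <= W')%MS by rewrite sub_capmx vW;apply/eigenspaceP.
have W'0: W' != 0 by apply: contra_neq v0=> E;apply/eqP;rewrite -submx0 -E.
have lt: (\rank W' < \rank W)%N. rewrite ltn_neqAle (mxrankS (capmxSl _ _)) andbT;apply/negP=> /eqP E. have /eigenspaceP E2: (W <= eigenspace T l)%MS.
  have:= mxrank_leqif_sup (capmxSl W (eigenspace T l))=> -[_];rewrite -/W' E eqxx=> /esym WW. exact: submx_trans WW (capmxSr _ _). by apply: H;exists l.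
have [T' T'T|//|u u0 [uW uT]]:= IH W' (leq_trans lt rk).
- rewrite sub_capmx (submx_trans (submxMr T' (capmxSl _ _)) (WT _ T'T))/=. have /eigenspaceP E: (W' <= eigenspace T l)%MS by exact: capmxSr.
 by apply/eigenspaceP;rewrite -mulmxA (cT T' T)// mulmxA E scalemxAl.
- by exists u=>//;split=>//;apply: submx_trans uW (capmxSl _ _).
Qed.
(** An orthonormal eigenbasis grows by one row at a time, found in the orthogonal complement
    [kermx (G *m S^T)] of the rows already present. *)
Lemma joint_eigb (TT: set 'M[R]_n): (forall T, TT T -> self_adjoint T) -> (forall T T', TT T -> TT T' -> T *m T' = T' *m T) -> exists S: 'M[R]_n, [/\ S \in unitmx, S *m G *m S^T = 1%:M &
  forall T, TT T -> exists d, S *m T = diag_mx d *m S].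
Proof.
move=> sT cT.
have H k: (k <= n)%N -> exists S: 'M[R]_(k, n), S *m G *m S^T = 1%:M /\ forall T, TT T -> exists d, S *m T = diag_mx d *m S. elim: k=>[_|k IH kn]. exists 0;split;first by apply/matrixP=> -[].
  by move=> T _;exists 0;apply/matrixP=> -[]. have [S [SS ST]]:= IH (ltnW kn). pose W:= kermx (G *m S^T). have W0: W != 0. rewrite -mxrank_eq0 mxrank_ker -lt0n subn_gt0;apply: leq_ltn_trans kn.
  exact: rank_leq_col. have [T /[dup] /ST[d E] /sT sT1|v v0 [vW vT]]:= joint_eigv sT cT _ W0. apply/sub_kermxP;rewrite -mulmxA (mulmxA T) sT1 -!mulmxA -trmx_mul E trmx_mul.
  by rewrite !mulmxA -(mulmxA _ G) mulmx_ker mul0mx. have [c c1 cZ]:= gram_form_nrm v0;pose u:= c *: v. have uu: u *m G *m u^T = 1%:M by rewrite [LHS]mx11_scalar cZ c1.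
 have uS: u *m G *m S^T = 0. by rewrite -mulmxA -scalemxAl (sub_kermxP vW) scaler0. have Su: S *m G *m u^T = 0. by have:= congr1 trmx uS;rewrite !trmx_mul !trmxK Gs mulmxA trmx0.
 have E1: (col_mx u S) *m G *m (col_mx u S)^T = 1%:M. by rewrite mul_col_mx tr_col_mx mul_col_row uu uS Su SS -scalar_mx_block. exists (col_mx u S);split;first exact: E1.
 move=> T TT1;have [d dE]:= ST T TT1;have [l lE]:= vT T TT1. have E2: col_mx u S *m T = diag_mx (row_mx (const_mx l: 'rV_1) d) *m col_mx u S;last first.
  by exists (row_mx (const_mx l: 'rV_1) d);exact: E2. rewrite mul_col_mx dE diag_mx_row mul_block_col !mul0mx add0r addr0;congr col_mx.
 by rewrite diag_const_mx mul_scalar_mx -scalemxAl lE !scalerA mulrC.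
have [S [SS ST]]:= H n (leqnn n);exists S;split=>//.
by move: SS;rewrite -mulmxA=> /mulmx1_unit[].
Qed.
End Spectral.

(** * Estimates in the maximum norm *)

Section MatrixNorm.
Context {R: realType} {n: nat}.
Implicit Types A B D X: 'M[R]_n.

(** The norm is the largest entry, hence a factor of dimension. Taking [n.+1] keeps it at least 1,
    also in dimension 0. *)
Lemma mulmx_norm m (A: 'M[R]_(m, n)) B: `|A *m B| <= n.+1%:R * `|A| * `|B|.
Proof.
apply: mx_norm_leP=>[|i j];first by rewrite !mulr_ge0.
rewrite mxE;apply: le_trans (ler_norm_sum _ _ _) _.
apply: le_trans (_: \sum_(l < n) `|A| * `|B| <= _). by apply: ler_sum=> l _;rewrite normrM ler_pM// mx_co_le.
rewrite sumr_const card_ord -[leLHS]mulr_natl -mulrA.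
by apply: ler_wpM2r;rewrite ?mulr_ge0// ler_nat.
Qed.
Lemma norm_mx1: `|1%:M: 'M[R]_n| <= 1.
Proof.
by apply: mx_norm_leP=>// i j;rewrite mxE;case: eqP;rewrite ?mulr1n ?mulr0n ?normr1 ?normr0.
Qed.
Lemma mulmx_add1_norm m (A: 'M[R]_(m, n)) X (a: R): n.+1%:R * `|X| <= a -> `|A *m (1%:M + X)| <= (1 + a) * `|A|.
Proof.
move=> Xa;rewrite mulmxDr mulmx1;apply: le_trans (ler_normD _ _) _.
rewrite mulrDl mul1r lerD2l;apply: le_trans (mulmx_norm _ _) _.
by rewrite mulrAC ler_wpM2r.
Qed.
Lemma exp_add1_norm X (a: R) j: n.+1%:R * `|X| <= a -> `|(1%:M + X) ^+ j| <= (1 + a) ^+ j.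
Proof.
move=> Xa;have a0: 0 <= 1 + a. by rewrite addr_ge0//;apply: le_trans Xa;rewrite mulr_ge0.
elim: j=>[|j IH];first by rewrite !expr0 norm_mx1.
rewrite exprSr exprS;apply: le_trans (mulmx_add1_norm _ Xa) _.
by rewrite ler_wpM2l.
Qed.
Lemma binomial_remainder X j (a:= n.+1%:R * `|X|): j%:R * a <= 1 -> `|(1%:M + X) ^+ j - 1%:M - j%:R *: X - (j%:R * (j%:R - 1) / 2) *: (X *m X)| <= (j%:R * a) ^+ 3.
Proof.
have a0: 0 <= a by rewrite mulr_ge0.
have X3: `|X *m X *m X| <= a ^+ 3. have X2: `|X *m X| <= a ^+ 2. apply: le_trans (mulmx_norm _ _) _;rewrite expr2 -/a ler_wpM2l// /a. by rewrite ler_peMl// ler1n.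
 apply: le_trans (mulmx_norm _ _) _;rewrite exprSr. rewrite (_: _ * `|X *m X| * _ = `|X *m X| * a);last by rewrite /a;ring. by rewrite ler_wpM2r.
elim: j=>[|j IH];first by rewrite !expr0 !mul0r !scale0r !subr0 subrr normr0 expr0n.
move=> ja1;set E:= _ - _ in IH.
have ja: j%:R * a <= 1 by apply: le_trans ja1;rewrite ler_wpM2r// ler_nat.
have {}IH:= IH ja.
have -> : (1%:M + X) ^+ j.+1 - 1%:M - j.+1%:R *: X - (j.+1%:R * (j.+1%:R - 1) / 2) *: (X *m X) = E *m (1%:M + X) + (j%:R * (j%:R - 1) / 2) *: (X *m X *m X).
 rewrite /E exprSr -[LHS]/((1%:M + X) ^+ j *m (1%:M + X) - 1%:M - j.+1%:R *: X - (j.+1%:R * (j.+1%:R - 1) / 2) *: (X *m X)). rewrite !mulmxBl mul1mx -!scalemxAl !mulmxDr !mulmx1 !scalerDr.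
 have -> : j.+1%:R * (j.+1%:R - 1) / 2 = j%:R * (j%:R - 1) / 2 + j%:R :> R by rewrite -natr1;field. by rewrite -natr1 !scalerDl scale1r;zmod.
apply: le_trans (ler_normD _ _) _.
apply: le_trans (lerD (mulmx_add1_norm E (lexx _)) (lexx _)) _.
rewrite -/a normrZ.
have [j0|j0]:= posnP j. rewrite j0 !mul0r normr0 mul0r addr0;move: IH;rewrite j0 mul0r expr0n/= => IH. have -> : `|E| = 0 by apply/eqP;rewrite eq_le IH/=. by rewrite mulr0 exprn_ge0// mulr_ge0.
have J1: 1 <= j%:R :> R by rewrite ler1n.
have Jn: `|j%:R * (j%:R - 1) / 2| <= j%:R ^+ 2 / 2 :> R. rewrite ger0_norm;last by rewrite divr_ge0// mulr_ge0// subr_ge0. by rewrite ler_pM2r// expr2 ler_pM2l ?gerBl// ltr0n.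
have H1: (1 + a) * `|E| <= (1 + a) * (j%:R * a) ^+ 3 by rewrite ler_wpM2l// addr_ge0.
have H2: `|j%:R * (j%:R - 1) / 2| * `|X *m X *m X| <= j%:R ^+ 2 / 2 * a ^+ 3 by rewrite ler_pM.
apply: le_trans (lerD H1 H2) _.
set J: R:= j%:R in J1 ja *;have -> : j.+1%:R = J + 1 by rewrite /J natr1.
have -> : (1 + a) * (J * a) ^+ 3 + J ^+ 2 / 2 * a ^+ 3 = (J ^+ 3 + J ^+ 2 * (J * a) + J ^+ 2 / 2) * a ^+ 3 by ring.
rewrite [leRHS]exprMn;apply: ler_wpM2r;first exact: exprn_ge0.
have: J ^+ 2 * (J * a) <= J ^+ 2 * 1 by rewrite ler_wpM2l// sqr_ge0.
have:= sqr_ge0 J;rewrite (_: (J + 1) ^+ 3 = J ^+ 3 + 3 * J ^+ 2 + 3 * J + 1);last by ring.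
lra.
Qed.
End MatrixNorm.

(** * The exponential of a derivation is an automorphism *)

Section DerivationExponential.
Context {R: realType} {n: nat}.
Variable b: 'rV[R]_n -> 'rV[R]_n -> 'rV[R]_n.
Hypothesis bl: forall v, linear (b^~ v).
Hypothesis br: forall u, linear (b u).

(* A cluster point of [(1 + D / k) ^ k]; the defect of multiplicativity of
   [1 + D / k] is of order [k ^ -2]. *)
Lemma exp_der (D: 'M[R]_n): (forall x y, b x y *m D = b (x *m D) y + b x (y *m D)) -> exists Phi: 'M[R]_n, [/\ forall x y, b x y *m Phi = b (x *m Phi) (y *m Phi),
  forall Q: set 'M[R]_n, closed Q -> Q 1%:M -> (forall A c, Q A -> Q (A + c *: (A *m D))) -> Q Phi & n.+1%:R * `|D| <= 1 -> `|Phi - 1%:M - D - 2^-1 *: (D *m D)| <= (n.+1%:R * `|D|) ^+ 3].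
Proof.
move=> Dd;set d:= n.+1%:R * `|D|.
have d0: 0 <= d by rewrite mulr_ge0.
have [b1 b2 [K K0 KP]]:= fdim_bilin (fmx 1 n) (fmx 1 n) bl br.
pose X k:= k.+1%:R^-1 *: D;pose P k:= (1%:M + X k) ^+ k.+1;pose M:= expR d.
have k0 k: 0 < k.+1%:R :> R by rewrite ltr0n.
have Xd k: n.+1%:R * `|X k| <= d / k.+1%:R. by rewrite normrZ gtr0_norm ?invr_gt0// mulrCA mulrC.
have dk k: 0 <= d / k.+1%:R by rewrite divr_ge0// ltW.
have powM k j: (j <= k.+1)%N -> (1 + d / k.+1%:R) ^+ j <= M. move=> jk;apply: le_trans (_: (1 + d / k.+1%:R) ^+ k.+1 <= _). by apply: ler_weXn2l=>//;rewrite lerDl.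
 have -> : M = expR (d / k.+1%:R) ^+ k.+1. by rewrite /M -expRM_natl -mulr_natl [_ * (_ / _)]mulrC divfK// gt_eqF. by apply: lerXn2r;rewrite ?nnegrE ?addr_ge0 ?expR_ge0// expR_ge1Dx.
have PM k: `|P k| <= M by apply: le_trans (exp_add1_norm _ (Xd k)) (powM _ _ (leqnn _)).
have cB: compact [set A: 'M[R]_n | `|A| <= M]. apply: (@mx_cpt _ _ _ _ M)=>//. have -> : [set A: 'M[R]_n | `|A| <= M] = (fun A=> `|A|) @^-1` [set s: R | s <= M] by [].
 by apply: closed_comp; [move=> ? _;exact: norm_continuous|exact: closed_le].
have [Phi [_ PhiC]] : [set A: 'M[R]_n | `|A| <= M] `&` cluster (P @ \oo) !=set0. by apply: cB;exists 0%N=>// k _;exact: PM.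
have near_Phi (e: R) N0: 0 < e -> exists2 k, (N0 <= k)%N & `|P k - Phi| < e. move=> e0;have A1: (P @ \oo) (P @` [set k | (N0 <= k)%N]). by exists N0=>// k/= Nk;exists k.
 have A2: nbhs Phi [set A | `|A - Phi| < e]. by apply/(@nbhs_ltP R 'M[R]_n);exists e. by have [A [[k Nk <-]/= H]]:= PhiC _ _ A1 A2;exists k.
exists Phi;split.
- move=> x y;pose F (A: 'M[R]_n):= b x y *m A - b (x *m A) (y *m A). pose n1: R:= n.+1%:R;have n10: 0 < n1 by rewrite ltr0n.
 have bD u u' v: b (u + u') v = b u v + b u' v by exact: (linearD (mklin (bl v))). have bDr u v v': b u (v + v') = b u v + b u v' by exact: (linearD (mklin (br u))).
 have bZ a u v: b (a *: u) v = a *: b u v by exact: (linearZ_LR (mklin (bl v))). have bZr a u v: b u (a *: v) = a *: b u v by exact: (linearZ_LR (mklin (br u))).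
 (* A further factor [1 + X k] creates only the term [b (x A X) (y A X)], quadratic in [X k]; the
    defect accumulated so far is merely amplified. *)
 have defect k j: (j <= k.+1)%N -> `|F ((1%:M + X k) ^+ j)| <= j%:R * (1 + d / k.+1%:R) ^+ j * (K * (d / k.+1%:R * (M * (n1 * `|x|))) * (d / k.+1%:R * (M * (n1 * `|y|)))).
  set a:= d / k.+1%:R;have a0: 0 <= a by exact: dk. set c:= K * _ * _;have c0: 0 <= c by rewrite !mulr_ge0 ?expR_ge0// ltW.
  elim: j=>[_|j IH jk];first by rewrite expr0 /F !mulmx1 subrr normr0 !mul0r. set A:= (1%:M + X k) ^+ j. have Ab (z: 'rV[R]_n): `|z *m A *m X k| <= a * (M * (n1 * `|z|)).
   apply: le_trans (mulmx_norm _ _) _;rewrite mulrAC;apply: ler_pM;rewrite ?mulr_ge0//. apply: le_trans (mulmx_norm _ _) _;rewrite mulrC;apply: ler_wpM2r;first by rewrite mulr_ge0.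
   by apply: le_trans (exp_add1_norm _ (Xd k)) (powM _ _ (ltnW jk)). have -> : F ((1%:M + X k) ^+ j.+1) = F A *m (1%:M + X k) - b (x *m A *m X k) (y *m A *m X k).
   rewrite /F exprSr -[_ ^+ j * _]/(A *m _) !mulmxA !mulmxDr !mulmx1 mulmxBl. have -> : b (x *m A) (y *m A) *m X k = b (x *m A *m X k) (y *m A) + b (x *m A) (y *m A *m X k).
    rewrite -!scalemxAr Dd scalerDr. by rewrite bZ bZr. by rewrite bDr !bD;zmod. apply: le_trans (ler_normB _ _) _.
  have H1: `|F A *m (1%:M + X k)| <= (1 + a) * `|F A| by exact: mulmx_add1_norm (Xd k). have H2: `|b (x *m A *m X k) (y *m A *m X k)| <= c.
   apply: le_trans (KP _ _) _;rewrite /c -[leLHS](mulrA K) -[leRHS](mulrA K). by apply: ler_wpM2l; [exact: ltW|exact: ler_pM]. apply: le_trans (lerD H1 H2) _;have {}IH:= IH (ltnW jk).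
  have a1: 1 <= (1 + a) ^+ j.+1 by rewrite exprn_ege1// lerDl. have: (1 + a) * `|F A| <= (1 + a) * (j%:R * (1 + a) ^+ j * c) by rewrite ler_wpM2l// addr_ge0.
  have: 1 * c <= (1 + a) ^+ j.+1 * c by rewrite ler_wpM2r. have -> : j.+1%:R = j%:R + 1 :> R by rewrite natr1. rewrite exprS;clearbody c a.
  have Z (u J p f: R): 1 * c <= u * p * c -> u * f <= u * (J * p * c) -> u * f + c <= (J + 1) * (u * p) * c by move=> *;lra. exact: Z.
 pose C:= M * (K * (d * (M * (n1 * `|x|))) * (d * (M * (n1 * `|y|)))). have M0: 0 <= M by exact: expR_ge0. have C0: 0 <= C by rewrite /C !mulr_ge0// ltW. have FP k: `|F (P k)| <= C / k.+1%:R.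
  apply: le_trans (defect k _ (leqnn _)) _;set a:= d / k.+1%:R. have -> : C / k.+1%:R = k.+1%:R * M * (K * (a * (M * (n1 * `|x|))) * (a * (M * (n1 * `|y|)))).
   by rewrite /C /a;field;rewrite gt_eqF. apply: ler_wpM2r;first by rewrite /a !mulr_ge0// ?ltW// divr_ge0// ltW. by rewrite ler_pM2l// powM. have cF: {for Phi, continuous F}.
  have dl (z: 'rV[R]_n): differentiable (fun A: 'M[R]_n=> z *m A) Phi. apply: (@linear_differentiable _ _ _ (mulmx z));exact: (fdim_cont (fmx n n)).
  apply: continuousB;apply: differentiable_continuous;first exact: dl. exact: (diff_bilin (fdim_bilin (fmx 1 n) (fmx 1 n) bl br) (dl x) (dl y)).1.
 apply/eqP;rewrite -subr_eq0 -normr_le0 -/(F Phi);apply/ler_addgt0Pr=> e e0;rewrite add0r. have e20: 0 < e / 2 by rewrite divr_gt0. have [r r0 rP]:= (cont_ltP F Phi).1 cF _ e20.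
 have [k Nk /rP kP]:= near_Phi _ (Num.bound (2 * C / e)) r0;have E1:= ltW kP. have E2: `|F (P k)| <= e / 2. apply: le_trans (FP k) _;rewrite ler_pdivrMr//. have: 2 * C / e < k.+1%:R.
   apply: lt_le_trans (archi_boundP _) _;first by rewrite divr_ge0 ?mulr_ge0// ltW. by rewrite ler_nat leqW. rewrite ltr_pdivrMr//;lra. have -> : F Phi = F (P k) - (F (P k) - F Phi) by zmod.
 by apply: le_trans (ler_normB _ _) _;lra.
(* Closed conditions that are stable under adding multiples of [A *m D] pass to [Phi]. Commuting
   with an involution and preserving a filtration are later obtained in this way. *)
- move=> Q cQ Q1 QD;apply: cQ=> A /(@nbhs_ltP R 'M[R]_n)[e e0 eA]. have [k _ kP]:= near_Phi e 0%N e0;exists (P k);split;last exact: eA.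
 rewrite /P;elim: (k.+1)=>[|j IH];first by rewrite expr0. rewrite exprSr -[_ * _]/(_ *m _) mulmxDr mulmx1 -scalemxAr;exact: QD.
- move=> d1;apply/ler_addgt0Pr=> e e0. pose e':= e / 2;have e'0: 0 < e' by rewrite divr_gt0. pose N0:= Num.bound (`|D *m D| / e). have [k Nk kP]:= near_Phi e' N0 e'0.
 have ED: k.+1%:R *: X k = D by rewrite scalerA mulfV ?gt_eqF// scale1r. have dE: k.+1%:R * (n.+1%:R * (k.+1%:R^-1 * `|D|)) = d by rewrite /d;field;rewrite gt_eqF.
 have:= @binomial_remainder R n (X k) k.+1;rewrite normrZ gtr0_norm ?invr_gt0//= dE ED=> /(_ d1). have -> : (k.+1%:R * (k.+1%:R - 1) / 2) *: (X k *m X k) = (2^-1 - (2 * k.+1%:R)^-1) *: (D *m D).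
  rewrite -scalemxAl -scalemxAr !scalerA;congr (_ *: _). by field;rewrite gt_eqF. rewrite -/(P k) scalerBl=> H.
 have -> : Phi - 1%:M - D - 2^-1 *: (D *m D) = (P k - 1%:M - D - (2^-1 *: (D *m D) - (2 * k.+1%:R)^-1 *: (D *m D))) - (P k - Phi) - (2 * k.+1%:R)^-1 *: (D *m D) by zmod.
 apply: le_trans (ler_normB _ _) _;apply: le_trans (lerD (ler_normB _ _) (lexx _)) _. have H2: `|(2 * k.+1%:R)^-1 *: (D *m D)| <= e'.
  rewrite normrZ gtr0_norm ?invr_gt0 ?mulr_gt0// ler_pdivrMl ?mulr_gt0//. have: `|D *m D| / e < N0%:R by apply: archi_boundP;rewrite divr_ge0// ltW. rewrite ltr_pdivrMr// => H3.
  have: N0%:R <= k.+1%:R :> R by rewrite ler_nat leqW. rewrite /e';move: H3;set t: R:= k.+1%:R;set s: R:= N0%:R=> H3 st. have: s * e <= t * e by rewrite ler_pM2r. lra.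
 rewrite -addrA;apply: lerD=>//. rewrite (_: e = e' + e');last by rewrite /e';field. by apply: lerD=>//;exact: ltW.
Qed.
End DerivationExponential.

Section StrictSums.
Context {R: realType} {V W Z: normedModType R}.

Lemma sdiffD (f g: V -> W) x (L L': {linear V -> W}): sdiff f x L -> sdiff g x L' -> sdiff (fun y=> f y + g y) x (L \+ L').
Proof.
move=> fL gL e e0;have e2: 0 < e / 2 by rewrite divr_gt0.
have [r r0 rP]:= fL _ e2;have [s s0 sP]:= gL _ e2.
exists (Num.min r s)=>[|y z];first by rewrite lt_min r0.
rewrite !lt_min=> /andP[yr ys] /andP[zr zs].
rewrite (_: _ - _ = (f y - f z - L (y - z)) + (g y - g z - L' (y - z)));last by rewrite/=;zmod.
apply: le_trans (ler_normD _ _) _;have:= rP _ _ yr zr;have:= sP _ _ ys zs;lra.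
Qed.
Lemma sd_lin (f: V -> W) x (L: {linear V -> W}) (l: {linear W -> Z}): fdim W -> sdiff f x L -> sdiff (fun y=> l (f y)) x (l \o L).
Proof.
move=> fW fL e e0;have [K K0 KP]:= fdim_bnd fW (linearP l).
have eK: 0 < e / K by rewrite divr_gt0.
have [r r0 rP]:= fL _ eK;exists r=>// y z yr zr.
rewrite/= -!(linearB l);apply: le_trans (KP _) _.
by rewrite -ler_pdivlMl// mulrA [K^-1 * e]mulrC;exact: rP.
Qed.
Lemma sd_sum (I: finType) (f: I -> V -> W) x (L: I -> {linear V -> W}) (M: {linear V -> W}): (forall i, sdiff (f i) x (L i)) -> (forall v, M v = \sum_i L i v) ->
 sdiff (fun y=> \sum_i f i y) x M.
Proof.
move=> fL ME.
have H (r: seq I): exists N: {linear V -> W}, (forall v, N v = \sum_(i <- r) L i v) /\ sdiff (fun y=> \sum_(i <- r) f i y) x N. elim: r=>[|i r [N [NE IH]]].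
  exists \0=> /=;split=>[v|e e0];first by rewrite big_nil. by exists 1=>// y z _ _;rewrite !big_nil !subr0 normr0 mulr_ge0// ltW.
 exists (L i \+ N);split=>[v|];first by rewrite big_cons/= NE. have E: (fun y=> \sum_(j <- i :: r) f j y) = (fun y=> f i y + \sum_(j <- r) f j y). by apply/funext=> y;rewrite big_cons.
 by rewrite E;exact: sdiffD.
have [N [NE]]:= H (index_enum I);apply: sd_eq=> v;by rewrite NE ME.
Qed.
End StrictSums.

Lemma Ck_pair (R: realType) (V W1 W2: normedModType R) k (f: V -> W1) (h: V -> W2) (U: set V): fdim W1 -> fdim W2 -> open U -> Ck k f U -> Ck k h U -> Ck k (fun u=> (f u, h u)) U.
Proof.
move=> f1 f2 oU Cf Ch.
have linl: linear (fun v: W1=> (v, 0): (W1 * W2)%type). by move=> a u v;rewrite -[RHS]/(a *: u + v, a *: 0 + 0) scaler0 addr0.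
have linr: linear (fun v: W2=> (0, v): (W1 * W2)%type). by move=> a u v;rewrite -[RHS]/(a *: 0 + 0, a *: u + v) scaler0 addr0.
have C1:= Ck_lin oU (@fdim_cont R W1 (W1 * W2)%type (@mklin R W1 (W1 * W2)%type _ linl) f1) Cf.
have C2:= Ck_lin oU (@fdim_cont R W2 (W1 * W2)%type (@mklin R W2 (W1 * W2)%type _ linr) f2) Ch.
apply: Ck_ext (CkD oU C1 C2)=>// u _/=.
by rewrite -[LHS]/(f u + 0, 0 + h u) addr0 add0r.
Qed.
Lemma Ck_fst (R: realType) (V W: normedModType R) k (U: set (V * W)): fdim V -> fdim W -> open U -> Ck k (fun u: (V * W)%type=> u.1) U.
Proof.
move=> fV fW oU;have lfst: linear (fun v: (V * W)%type=> v.1) by move=> a u v.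
have:= (@Ck_lin R (V * W)%type (V * W)%type V k (fun x=> x) (@mklin R (V * W)%type V _ lfst) U oU (@fdim_cont R (V * W)%type V (@mklin R (V * W)%type V _ lfst) (fdim_prod fV fW)) (Ck_id k oU));exact.
Qed.
Lemma mx_rV_ext (R: pzSemiRingType) m p (A B: 'M[R]_(m, p)): (forall v: 'rV_m, v *m A = v *m B) -> A = B.
Proof. by move=> AB;apply/row_matrixP=> i;rewrite (rowE i A) (rowE i B). Qed.

(** * The adjoint representation and the Jacobi identity *)

Section LieBracket.
Context {R: realType} {n: nat} {G: groupType} (LG: lie_group R n G).
Local Notation g:= 'rV[R]_n.
Local Notation B:= (killing LG).
Local Notation "[ x , y ]" := (lie_bracket LG x y): ring_scope.
Local Notation c0:= (chart_at LG 1%g).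
Local Notation e0:= (cfun (chart_at LG 1%g) 1%g).
Implicit Types x y z u v w: g.

Lemma Ad_lin h: linear (Ad LG h). Proof. exact: linearP. Qed.
Lemma AdM h k x: Ad LG (h * k)%g x = Ad LG h (Ad LG k x).
Proof.
rewrite !AdE.
have S1:= conj_ch_sd LG k.
have S2:= conj_ch_sd LG h;rewrite -[X in sdiff _ X _](conj_ch_e0 LG k) in S2.
have S:= sd_comp (fmx _ _) (fmx _ _) S1 S2.
have near : \forall u \near e0, (conj_ch LG h \o conj_ch LG k) u = conj_ch LG (h * k)%g u. apply: nbhs_imp (conj_near_dom LG k)=> u [_ cu]. by rewrite /conj_ch/= (cfunK cu) invgM !mulgA.
have:= sd_unique (fmx _ _) (sd_near near S) (conj_ch_sd LG (h * k)%g) x.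
by move=> H;exact: (esym H).
Qed.
Lemma Ad1 x: Ad LG 1%g x = x.
Proof.
rewrite AdE;have near : \forall u \near e0, conj_ch LG 1%g u = u. apply: nbhs_imp (ch_inv_near (c0P LG) (c01 LG))=> u [_ cu]. by rewrite /conj_ch mul1g invg1 mulg1.
have S:= sd_near near (conj_ch_sd LG 1%g).
have SI: sdiff (@id g) e0 idfun by move=> e ep;exists 1=>// y z _ _;rewrite subrr normr0 mulr_ge0// ltW.
exact: (sd_unique (fmx _ _) S SI x).
Qed.
Lemma mul_Ad_mx h x: x *m Ad_mx LG h = Ad LG h x.
Proof. by rewrite /Ad_mx (mul_rV_lin1 (mklin (Ad_lin h))). Qed.

#[local] Opaque Ad Ad_mx.

Lemma Ad_mxM h k: Ad_mx LG (h * k)%g = Ad_mx LG k *m Ad_mx LG h.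
Proof. by apply: mx_rV_ext=> v;have E1:= mul_Ad_mx (h * k)%g v;have E2:= mul_Ad_mx k v;have E3:= mul_Ad_mx h (Ad LG k v);rewrite mulmxA;exact: (etrans E1 (etrans (AdM h k v) (esym (etrans (congr1 (fun w: g=> w *m Ad_mx LG h) E2) E3)))). Qed.
Lemma Ad_mx1: Ad_mx LG 1%g = 1%:M.
Proof. by apply: mx_rV_ext=> v;rewrite mul_Ad_mx Ad1 mulmx1. Qed.

(** Conjugation as a function of both variables. [Ad] is its derivative in the second one, so joint
    smoothness makes [Ad] differentiable in the first. *)
Definition conj2 (p: g * g): g:= conj_ch LG (cinv c0 p.1) p.2.

Lemma conj2_sm: exists U: set (g * g), [/\ open U, U (e0, e0) & smooth_on U conj2].
Proof.
have cp: cdom c0 (cinv c0 (e0, e0).1 * cinv c0 (e0, e0).2)%g by rewrite/= !c0e0 mulg1;exact: c01.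
have [U1 [oU1 U1e U1c C1]]:= lie_mul_smooth (c0P LG) (c0P LG) (c01 LG) (c01 LG) (c0P LG) cp.
have ci: cdom c0 ((cinv c0 e0)^-1%g: G) by rewrite/= c0e0 invg1;exact: c01.
have [U2 [oU2 U2e U2c C2]]:= @lie_inv_smooth _ _ _ LG _ _ (c0P LG) (c01 LG) _ (c0P LG) ci.
pose mulc:= cfun c0 \o (fun u: g * g=> (cinv c0 u.1 * cinv c0 u.2)%g).
pose invc:= cfun c0 \o (fun u=> ((cinv c0 u)^-1)%g).
have fg:= @fmx R 1 n;have fgg:= fdim_prod fg fg.
have ofst: open ((fun v: (g * g)%type=> v.1) @^-1` U2). by apply: open_comp=>// u _;exact: (Ck_cont (@Ck_fst R g g 0 setT fg fg openT)).
pose U3:= U1 `&` ((fun v: (g * g)%type=> v.1) @^-1` U2).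
have oU3: open U3 by exact: openI.
pose h (u: (g * g)%type): (g * g)%type:= (mulc u, invc u.1).
have Ch: smooth_on U3 h. move=> k;apply: Ck_pair=>//;first by apply: Ck_sub (C1 k);exact: subIsetl. apply: (@Ck_comp _ _ _ _ k (fun u: (g * g)%type=> u.1) invc U3 U2)=>//.
 - by move=> u [].
 - exact: Ck_fst.
have he: h (e0, e0) = (e0, e0) by rewrite /h /mulc /invc/= c0e0 mulg1 invg1.
exists (U3 `&` h @^-1` U1);split.
- apply: open_setI_pre=>// u U3u;exact: (Ck_cont (Ch 0%N) U3u).
- by split; [split|rewrite /preimage/= he].
- move=> k;have oU: open (U3 `&` h @^-1` U1). by apply: open_setI_pre=>// u U3u;exact: (Ck_cont (Ch 0%N) U3u). apply: (@Ck_ext _ _ _ _ (mulc \o h))=>//.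
  move=> u [[U1u U2u] U1h];rewrite /conj2 /conj_ch /mulc/= /mulc /invc/=. have:= U1c _ U1u;have:= U2c _ U2u=> /= c2 c1. by rewrite !cfunK.
 apply: (@Ck_comp _ _ _ _ k h mulc _ U1)=>//;first by move=> u []. by apply: Ck_sub (Ch k);exact: subIsetl.
Qed.
Lemma Ad_ch_sd y: sdiff (fun u=> Ad LG (cinv c0 u) y) e0 ('d (fun u=> Ad LG (cinv c0 u) y) e0).
Proof.
have [U [oU Ue CU]]:= conj2_sm;have fg:= @fmx R 1 n;have fgg:= fdim_prod fg fg.
have C1: Ck 1 (fun p=> 'D_((0, y): (g * g)%type) conj2 p) U by exact: (CU 2%N).2.
have [L [_ LP]]:= sd_pairl (C1_sd fgg fg oU Ue C1).
have nU: \forall u \near e0, 'D_((0, y): (g * g)%type) conj2 (u, e0) = Ad LG (cinv c0 u) y. have /nbhs_ltP[r r0 rP]:= open_nbhs_nbhs (conj oU Ue). apply/nbhs_ltP;exists r=>// u ur.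
 have Uu: U (u, e0). apply: rP;rewrite -[_ - _]/(u - e0, e0 - e0) subrr prod_normE/= normr0. by rewrite (max_idPl _). have S:= C1_sd fgg fg oU Uu (CU 1%N). have [L' [L'E L'P]]:= sd_pairr S.
 rewrite AdE;have [_ ->]:= sd_dif fg L'P. by rewrite L'E deriveE//;exact: (CU 1%N).1.
have S:= sd_near nU LP;have [_ E]:= sd_dif fg S.
by apply: sd_eq S=> v;rewrite E.
Qed.
Lemma brkE x y: [x, y] = 'd (fun u=> Ad LG (cinv c0 u) y) e0 x.
Proof.
rewrite /lie_bracket deriveE//.
exact: (sd_dif (fmx _ _) (Ad_ch_sd y)).1.
Qed.

#[local] Opaque lie_bracket.

Lemma bracket_linearl y: linear (lie_bracket LG ^~ y).
Proof. by move=> k u v;rewrite !brkE linearP. Qed.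
Lemma bracket_linearr x: linear (lie_bracket LG x).
Proof.
move=> k u v;rewrite !brkE;have Su:= Ad_ch_sd u;have Sv:= Ad_ch_sd v.
have lk: linear (fun v: g=> k *: v) by move=> a p q;rewrite scalerDr !scalerA mulrC.
have S:= sdiffD (sd_lin (mklin lk) (fmx _ _) Su) Sv.
have E: (fun y=> mklin lk (Ad LG (cinv c0 y) u) + Ad LG (cinv c0 y) v) = (fun y=> Ad LG (cinv c0 y) (k *: u + v)). by apply/funext=> h;rewrite (Ad_lin _ k u v).
by rewrite E in S;have:= sd_unique (fmx _ _) (Ad_ch_sd (k *: u + v)) S x.
Qed.
Lemma mul_ad_mx x y: y *m ad_mx LG x = [x, y].
Proof. by rewrite /ad_mx (mul_rV_lin1 (mklin (bracket_linearr x))). Qed.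

#[local] Opaque ad_mx.

Lemma ad_mx_lin: linear (ad_mx LG).
Proof.
move=> k u v;apply: mx_rV_ext=> w;rewrite [LHS]mul_ad_mx (bracket_linearl w) mulmxDr -scalemxAr.
by congr (_ *: _ + _);rewrite mul_ad_mx.
Qed.
Lemma Ad_mx_sd: sdiff (fun u=> Ad_mx LG (cinv c0 u)) e0 (mklin ad_mx_lin).
Proof.
pose l (i: 'I_n):= fun w: g=> (delta_mx i 0: 'M[R]_(n, 1)) *m w: 'M[R]_n.
have ll i: linear (l i) by move=> k u v;rewrite /l linearP.
have E (M: 'M[R]_n): M = \sum_i l i (row i M). apply/matrixP=> a b;rewrite summxE (bigD1 a)//= big1 ?addr0=>[|c ca]. by rewrite /l mxE big_ord1 !mxE !eqxx mul1r.
 by rewrite /l mxE big_ord1 !mxE eq_sym (negPf ca) mul0r.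
have S i:= sd_lin (mklin (ll i)) (fmx _ _) (Ad_ch_sd (delta_mx 0 i)).
have:= sd_sum (M:= mklin ad_mx_lin) S;have -> : (fun u=> \sum_i mklin (ll i) (Ad LG (cinv c0 u) (delta_mx 0 i))) = (fun u=> Ad_mx LG (cinv c0 u)).
 by apply/funext=> u;rewrite [RHS]E;apply: eq_bigr=> i _;rewrite rowE mul_Ad_mx.
apply=> v;rewrite [LHS]E;apply: eq_bigr=> i _;rewrite rowE mul_ad_mx.
by rewrite/= brkE.
Qed.
Lemma Ad_brk h x y: Ad LG h [x, y] = [Ad LG h x, Ad LG h y].
Proof.
rewrite !brkE.
have S1:= conj_ch_sd LG h.
have S2:= Ad_ch_sd (Ad LG h y);rewrite -[X in sdiff _ X _](conj_ch_e0 LG h) in S2.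
have S:= sd_comp (fmx _ _) (fmx _ _) S1 S2.
have S3:= sd_lin (mklin (Ad_lin h)) (fmx _ _) (Ad_ch_sd y).
have near : \forall u \near e0, ((fun u=> Ad LG (cinv c0 u) (Ad LG h y)) \o conj_ch LG h) u = mklin (Ad_lin h) (Ad LG (cinv c0 u) y). apply: nbhs_imp (conj_near_dom LG h)=> u [_ cu].
 by rewrite /conj_ch/= (cfunK cu) -!AdM mulgVK.
have:= sd_unique (fmx _ _) (sd_near near S) S3 x.
by rewrite (AdE LG h x)=> H;exact: (esym H).
Qed.
Lemma Ad_mx_brk h x y: [x, y] *m Ad_mx LG h = [x *m Ad_mx LG h, y *m Ad_mx LG h].
Proof. by rewrite !mul_Ad_mx Ad_brk. Qed.
(** The derivative at the identity of [Ad h [x, y] = [Ad h x, Ad h y]], by the product rule. *)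
Lemma jacobi x y z: [z, [x, y]] = [[z, x], y] + [x, [z, y]].
Proof.
rewrite (brkE z [x, y]).
have Sx:= Ad_ch_sd x;have Sy:= Ad_ch_sd y.
have [Dx _]:= sd_dif (fmx _ _) Sx.
have [Dy _]:= sd_dif (fmx _ _) Sy.
have bb:= fdim_bilin (fmx 1 n) (fmx 1 n) bracket_linearl bracket_linearr.
have [_ E]:= diff_bilin bb Dx Dy.
have -> : (fun u=> Ad LG (cinv c0 u) [x, y]) = (fun u=>[Ad LG (cinv c0 u) x, Ad LG (cinv c0 u) y]). by apply/funext=> u;rewrite Ad_brk.
transitivity ([ 'd (fun u=> Ad LG (cinv c0 u) x) e0 z, Ad LG (cinv c0 e0) y] + [Ad LG (cinv c0 e0) x, 'd (fun u=> Ad LG (cinv c0 u) y) e0 z]);first exact: (congr1 (fun f=> f z) E).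
by rewrite c0e0 (Ad1 x) (Ad1 y) (brkE z x) (brkE z y).
Qed.
End LieBracket.

(** * Semisimple Lie algebras over the reals *)

Section AbstractLieAlgebra.
Context {R: realType} {n: nat}.
Local Notation g:= 'rV[R]_n.
Variable br: g -> g -> g.

Definition admx (x: g): 'M[R]_n:= lin1_mx (br x).
Definition kform (x y: g): R:= \tr (admx x *m admx y).

(** The geometry of X and of its boundary is developed from these four properties alone; the
    manifold [G] returns only through a homomorphism to automorphisms. *)
Definition lie_axioms: Prop:= [/\ forall y, linear (br ^~ y), forall x, linear (br x), forall x y z, br z (br x y) = br (br z x) y + br x (br z y) & forall x, (forall y, kform x y = 0) -> x = 0].

Hypothesis L: lie_axioms.
Local Notation B:= kform.
Local Notation ad:= admx.
Local Notation "[ x , y ]" := (br x y): ring_scope.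
Implicit Types x y z u v w: g.

Lemma brk_linl y: linear (br ^~ y). Proof. by have [+ _ _ _]:= L;exact. Qed.
Lemma brk_linr x: linear (br x). Proof. by have [_ + _ _]:= L;exact. Qed.
Lemma br_jacobi x y z: [z, [x, y]] = [[z, x], y] + [x, [z, y]].
Proof. by have [_ _ + _]:= L;exact. Qed.
Lemma HG x: (forall y, kform x y = 0) -> x = 0.
Proof. by have [_ _ _ +]:= L;exact. Qed.
Lemma mul_admx x y: y *m ad x = [x, y].
Proof. by rewrite /ad (mul_rV_lin1 (mklin (brk_linr x))). Qed.
Lemma admx_lin: linear ad.
Proof.
move=> k u v;apply: mx_rV_ext=> w;rewrite mulmxDr -scalemxAr !mul_admx.
exact: brk_linl.
Qed.
Lemma brDl x y z: [x + y, z] = [x, z] + [y, z].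
Proof. exact: (linearD (mklin (brk_linl z))). Qed.
Lemma brDr x y z: [z, x + y] = [z, x] + [z, y].
Proof. exact: (linearD (mklin (brk_linr z))). Qed.
Lemma brZl a x z: [a *: x, z] = a *: [x, z].
Proof. exact: (linearZ_LR (mklin (brk_linl z))). Qed.
Lemma brZr a x z: [z, a *: x] = a *: [z, x].
Proof. exact: (linearZ_LR (mklin (brk_linr z))). Qed.
Lemma brNl x z: [- x, z] = - [x, z].
Proof. exact: (linearN (mklin (brk_linl z))). Qed.
Lemma brNr x z: [z, - x] = - [z, x].
Proof. exact: (linearN (mklin (brk_linr z))). Qed.
Lemma adD x y: ad (x + y) = ad x + ad y.
Proof. exact: (linearD (mklin admx_lin)). Qed.
Lemma adN x: ad (- x) = - ad x.
Proof. exact: (linearN (mklin admx_lin)). Qed.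
Lemma adZ a x: ad (a *: x) = a *: ad x.
Proof. exact: (linearZ_LR (mklin admx_lin)). Qed.
Lemma ad0: ad 0 = 0.
Proof. exact: (linear0 (mklin admx_lin)). Qed.
Lemma ad_brk x y: ad [x, y] = ad y *m ad x - ad x *m ad y.
Proof.
apply: mx_rV_ext=> z;rewrite mulmxBr !mulmxA !mul_admx.
by rewrite (br_jacobi y z x) addrK.
Qed.
Lemma kilC x y: B x y = B y x.
Proof. by rewrite /kform mxtrace_mulC. Qed.
Lemma kil_lin y: linear ((fun x=> B x y): g -> R^o).
Proof. by move=> k u v;rewrite /kform adD adZ mulmxDl -scalemxAl linearP. Qed.
Lemma BDl x y z: B (x + y) z = B x z + B y z.
Proof. exact: (linearD (mklin (kil_lin z))). Qed.
Lemma BZl a x z: B (a *: x) z = a * B x z.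
Proof. exact: (linearZ_LR (mklin (kil_lin z))). Qed.
Lemma BNl x z: B (- x) z = - B x z.
Proof. exact: (linearN (mklin (kil_lin z))). Qed.
Lemma B0l z: B 0 z = 0.
Proof. exact: (linear0 (mklin (kil_lin z))). Qed.
Lemma BDr x y z: B z (x + y) = B z x + B z y.
Proof. by rewrite !(kilC z) BDl. Qed.
Lemma BZr a x z: B z (a *: x) = a * B z x.
Proof. by rewrite !(kilC z) BZl. Qed.
Lemma BNr x z: B z (- x) = - B z x.
Proof. by rewrite !(kilC z) BNl. Qed.
Lemma B0r z: B z 0 = 0.
Proof. by rewrite kilC B0l. Qed.
Lemma mxtrB (M N: 'M[R]_n): \tr (M - N) = \tr M - \tr N.
Proof. exact: raddfB. Qed.
Lemma mxtr_sum (I: finType) (f: I -> 'M[R]_n): \tr (\sum_i f i) = \sum_i \tr (f i).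
Proof. exact: raddf_sum. Qed.
Lemma B_ad z x y: B [z, x] y = - B x [z, y].
Proof.
rewrite /kform !ad_brk mulmxBl mulmxBr !mxtrB opprB.
by rewrite -(mulmxA (ad z)) (mxtrace_mulC (ad z)) !mulmxA.
Qed.
Lemma B_suml (I: finType) (f: I -> g) z: B (\sum_i f i) z = \sum_i B (f i) z.
Proof. exact: (linear_sum (mklin (kil_lin z))). Qed.
Lemma B_sumr (I: finType) (f: I -> g) z: B z (\sum_i f i) = \sum_i B z (f i).
Proof. by rewrite kilC B_suml;apply: eq_bigr=> i _;rewrite kilC. Qed.
Lemma ad_sum (I: finType) (f: I -> g): ad (\sum_i f i) = \sum_i ad (f i).
Proof. exact: (linear_sum (mklin admx_lin)). Qed.

Definition Kmx: 'M[R]_n:= \matrix_(i, j) B (delta_mx 0 i) (delta_mx 0 j).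

Lemma kilE x y: B x y = (x *m Kmx *m y^T) 0 0.
Proof.
rewrite {1}[x]row_sum_delta B_suml mxE [y in LHS]row_sum_delta.
under eq_bigr=> i _ do rewrite BZl B_sumr mulr_sumr.
rewrite exchange_big/=;apply: eq_bigr=> j _;rewrite !mxE mulr_suml.
by apply: eq_bigr=> i _;rewrite BZr !mxE;ring.
Qed.
Lemma Kmx_sym: Kmx^T = Kmx.
Proof. by apply/matrixP=> i j;rewrite !mxE kilC. Qed.
Lemma Kmx_unit: Kmx \in unitmx.
Proof.
rewrite -row_free_unit -kermx_eq0;apply/eqP/row_matrixP=> i;rewrite row0.
apply: HG=> y;rewrite kilE.
have /sub_kermxP -> : (row i (kermx Kmx) <= kermx Kmx)%MS by exact: row_sub.
by rewrite mul0mx mxE.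
Qed.
Lemma kil_repr (r z: g): B (r *m invmx Kmx) z = (r *m z^T) 0 0.
Proof. by rewrite kilE mulmxKV// Kmx_unit. Qed.
Lemma kil_inj x y: (forall z, B x z = B y z) -> x = y.
Proof.
by move=> H;apply/eqP;rewrite -subr_eq0;apply/eqP/HG=> z;rewrite BDl BNl H subrr.
Qed.
Lemma ad_inj x y: ad x = ad y -> x = y.
Proof. by move=> E;apply: kil_inj=> z;rewrite /kform E. Qed.
(** By the Jacobi identity [ad [x, y]] is a commutator, hence changes sign with the order, and
    nondegeneracy of the Killing form makes [ad] injective. *)
Lemma brC x y: [x, y] = - [y, x].
Proof.
apply: ad_inj;rewrite adN !ad_brk opprB;by [].
Qed.
Lemma brxx x: [x, x] = 0.
Proof.
have:= brC x x=> /eqP;rewrite -addr_eq0 -mulr2n -scaler_nat scaler_eq0 pnatr_eq0/=.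
by move=> /eqP.
Qed.

Definition aut (phi: 'M[R]_n): Prop:= phi \in unitmx /\ forall x y, [x, y] *m phi = [x *m phi, y *m phi].

Lemma aut1: aut 1%:M.
Proof. by split=>[|x y];rewrite ?unitmx1// !mulmx1. Qed.
Lemma autM phi psi: aut phi -> aut psi -> aut (phi *m psi).
Proof.
by move=>[u1 b1] [u2 b2];split=>[|x y];rewrite ?unitmx_mul ?u1// !mulmxA b1 b2.
Qed.
Lemma autV phi: aut phi -> aut (invmx phi).
Proof.
move=>[u1 b1];split=>[|x y];first by rewrite unitmx_inv.
by rewrite -[LHS](mulmxK u1) -(mulmxA _ _ phi) mulVmx// mulmx1 -{1}[x](mulmxKV u1) -{1}[y](mulmxKV u1) -b1 mulmxK.
Qed.
Lemma ad_aut phi x: aut phi -> ad x *m phi = phi *m ad (x *m phi).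
Proof.
by move=>[_ b];apply: mx_rV_ext=> y;rewrite !mulmxA !mul_admx b.
Qed.
Lemma ad_aut_conj phi x: aut phi -> ad (x *m phi) = invmx phi *m ad x *m phi.
Proof. by move=> a;rewrite -mulmxA (ad_aut x a) mulKmx//;exact: a.1. Qed.
Lemma B_aut phi x y: aut phi -> B (x *m phi) (y *m phi) = B x y.
Proof.
move=> a;rewrite /kform !(ad_aut_conj _ a) !mulmxA mxtrace_mulC !mulmxA mulmxV ?a.1//.
by rewrite mul1mx mulmxK ?a.1.
Qed.
Lemma aut_Kmx phi: aut phi -> phi *m Kmx *m phi^T = Kmx.
Proof.
move=> a;apply/matrixP=> i j.
have:= B_aut (delta_mx 0 i) (delta_mx 0 j) a;rewrite !kilE.
have E (M: 'M[R]_n): ((delta_mx 0 i: g) *m M *m (delta_mx 0 j: g)^T) 0 0 = M i j. by rewrite -rowE trmx_delta -colE !mxE.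
have E2: (delta_mx 0 i: g) *m phi *m Kmx *m ((delta_mx 0 j: g) *m phi)^T = (delta_mx 0 i: g) *m (phi *m Kmx *m phi^T) *m (delta_mx 0 j: g)^T. by rewrite trmx_mul !mulmxA.
by rewrite E2 !E.
Qed.
Lemma aut_inv phi: aut phi -> invmx phi = Kmx *m phi^T *m invmx Kmx.
Proof.
move=> a;have E: phi *m (Kmx *m phi^T *m invmx Kmx) = 1%:M. by rewrite !mulmxA (aut_Kmx a) mulmxV// Kmx_unit.
by rewrite -[LHS]mulmx1 -E mulKmx// a.1.
Qed.
Lemma aut_cl_form phi: (forall x y, [x, y] *m phi = [x *m phi, y *m phi]) -> phi *m Kmx *m phi^T = Kmx -> aut phi.
Proof.
move=> b E;split=>//;have:= Kmx_unit;rewrite -E -mulmxA unitmx_mul=> /andP[]//.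
Qed.

(** The element that pairs with every [z] as [N] pairs with [ad z] in the trace form. Followed by
    [ad], this is a projection onto the inner derivations. *)
Definition ad_proj (N: 'M[R]_n): g:= (\row_i \tr (N *m ad (delta_mx 0 i))) *m invmx Kmx.

Lemma ad_projP N z: B (ad_proj N) z = \tr (N *m ad z).
Proof.
rewrite kil_repr mxE [z in RHS]row_sum_delta.
rewrite ad_sum mulmx_sumr mxtr_sum;apply: eq_bigr=> i _.
by rewrite !mxE adZ -scalemxAr linearZ/= mulrC.
Qed.
Lemma ad_proj_lin: linear ad_proj.
Proof.
move=> k N M;apply: kil_inj=> z;rewrite BDl BZl !ad_projP.
by rewrite mulmxDl -scalemxAl linearP.
Qed.
Lemma ad_proj0: ad_proj 0 = 0.
Proof. exact: (linear0 (mklin ad_proj_lin)). Qed.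
Lemma ad_projB M N: ad_proj (M - N) = ad_proj M - ad_proj N.
Proof. exact: (linearB (mklin ad_proj_lin)). Qed.
Lemma ad_proj_ad x: ad_proj (ad x) = x.
Proof. by apply: kil_inj=> z;rewrite ad_projP. Qed.

(* The defect of [phi - 1] from being inner is quadratic. *)
Lemma aut_defect N x y: aut (N + 1%:M) -> B (x *m (N - ad (ad_proj N))) y = - \tr (N *m ad (x *m N) *m ad y).
Proof.
move=> a;set X:= ad_proj N.
have E: ad (x *m N) = ad x *m N - N *m ad x - N *m ad (x *m N). have:= ad_aut x a;rewrite [x *m _]mulmxDr [x *m 1%:M]mulmx1 adD mulmxDr mulmx1 mulmxDr !mulmxDl !mul1mx.
 move=> /eqP;rewrite -subr_eq0=> /eqP H;apply/eqP;rewrite -subr_eq0 -oppr_eq0 -[X in _ == X]H. by apply/eqP;zmod.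
rewrite mulmxBr BDl BNl mul_admx (brC X x) BNl B_ad !opprK ad_projP.
set r0:= \tr (N *m ad (x *m N) *m ad y).
rewrite {1}/kform E !mulmxBl !mxtrB ad_brk mulmxBr mxtrB.
rewrite -(mulmxA (ad x)) (mxtrace_mulC (ad x)) /r0 -!mulmxA.
set p:= \tr _;set q:= \tr _;set r:= \tr _;zmod.
Qed.
(** The computation of [aut_defect], where a derivation leaves no quadratic term. *)
Lemma der_inner (D: 'M[R]_n): (forall x y, [x, y] *m D = [x *m D, y] + [x, y *m D]) -> D = ad (ad_proj D).
Proof.
move=> Dd;apply/eqP;rewrite -subr_eq0;apply/eqP;apply: mx_rV_ext=> x;rewrite mulmx0.
apply: HG=> y;rewrite mulmxBr BDl BNl mul_admx (brC _ x) BNl B_ad !opprK ad_projP.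
have E: ad (x *m D) = ad x *m D - D *m ad x. apply: mx_rV_ext=> z;rewrite mulmxBr !mulmxA !mul_admx Dd. by rewrite addrK.
rewrite {1}/kform E !mulmxBl !mxtrB ad_brk mulmxBr mxtrB.
rewrite -(mulmxA (ad x)) (mxtrace_mulC (ad x)) -!mulmxA.
set p:= \tr _;set q:= \tr _;zmod.
Qed.
Lemma ad_der u x y: [x, y] *m ad u = [x *m ad u, y] + [x, y *m ad u].
Proof. by rewrite !mul_admx br_jacobi. Qed.

(* [A] stands for the adjoint representation in a chart around the identity. *)
Lemma aut_near_Ad (A0: g -> 'M[R]_n) (e0: g) (dA: {linear g -> 'M[R]_n}): (forall u, aut (A0 u)) -> A0 e0 = 1%:M -> sdiff A0 e0 dA -> dA =1 ad -> exists C: R, 0 < C /\ exists2 r: R, 0 < r &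
 forall phi, aut phi -> `|phi - 1%:M| < r -> exists2 u, `|u - e0| <= C * `|phi - 1%:M| & A0 u = phi.
Proof.
move=> autA Ae0 SA dAE.
have [Kp Kp0 KpP]:= fdim_bnd (fmx n n) ad_proj_lin.
have [Ka Ka0 KaP]:= fdim_bnd (fmx 1 n) admx_lin.
pose T (M M': 'M[R]_n): 'M[R]_n:= (\matrix_(i, j) - \tr (M *m ad (delta_mx 0 i *m M') *m ad (delta_mx 0 j))) *m invmx Kmx.
have Tl M': linear (T^~ M'). move=> k M N;rewrite /T scalemxAl -mulmxDl;congr (_ *m _). by apply/matrixP=> i j;rewrite !mxE !mulmxDl -!scalemxAl linearP/=;ring.
have Tr M: linear (T M). move=> k M' N;rewrite /T scalemxAl -mulmxDl;congr (_ *m _). apply/matrixP=> i j;rewrite !mxE mulmxDr -scalemxAr adD adZ mulmxDr mulmxDl.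
 by rewrite -scalemxAr -scalemxAl linearP/=;ring.
have [_ _ [Kt Kt0 KtP]]:= fdim_bilin (fmx n n) (fmx n n) Tl Tr.
have defectE N: aut (N + 1%:M) -> N - ad (ad_proj N) = T N N. move=> a;apply/row_matrixP=> i;rewrite (rowE i (N - _));apply: kil_inj=> y.
 rewrite (aut_defect _ _ a) /T row_mul kil_repr mxE [y in LHS]row_sum_delta. rewrite ad_sum mulmx_sumr mxtr_sum -sumrN. by apply: eq_bigr=> j _;rewrite !mxE adZ -scalemxAr linearZ/= mulNr mulrC.
(* [f] is tangent to the identity at [e0], so some [u] near [e0] gives [A0 u] and [phi] the same
   projection. It remains to see that this forces them to be equal. *)
pose f u:= e0 + ad_proj (A0 u - 1%:M).
have fe0: f e0 = e0 by rewrite /f Ae0 subrr ad_proj0 addr0.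
have Sf: sdiff f e0 idfun. have S:= sd_lin (mklin ad_proj_lin) (fmx _ _) SA. have S': sdiff (fun u=> ad_proj (A0 u)) e0 idfun. by apply: sd_eq S=> v/=;rewrite dAE ad_proj_ad.
 move=> e ep;have [r r0 rP]:= S' e ep;exists r=>// y z yr zr;rewrite /f. have -> : e0 + ad_proj (A0 y - 1%:M) - (e0 + ad_proj (A0 z - 1%:M)) = ad_proj (A0 y) - ad_proj (A0 z).
  by rewrite !ad_projB;zmod. exact: rP.
have [r1 r10 P1]:= local_surj Sf;rewrite fe0 in P1.
have [KA [KA0 [r2 r20 P2]]]:= sd_lip (fmx _ _) SA.
pose n1: R:= n.+1%:R;have n10: 0 < n1 by rewrite ltr0n.
have [Ki Ki0 KiP] : exists2 Ki: R, 0 < Ki & forall M: 'M[R]_n, `|Kmx *m M^T *m invmx Kmx| <= Ki * `|M|. apply: fdim_bnd (fmx n n) _=> k M N.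
 by rewrite linearP mulmxDr -scalemxAr mulmxDl -scalemxAl.
pose c:= 2 * KA * Kp.
have c0': 0 < c by rewrite !mulr_gt0.
pose c2:= n1 * (Ki * 2) * (1 + c).
have c20: 0 < c2 by rewrite !mulr_gt0// addr_gt0.
pose c5:= Ka * (Kp * (n1 * c)) + Kt * c2.
have c50: 0 < c5 by apply: addr_gt0; [exact: mulr_gt0 Ka0 (mulr_gt0 Kp0 (mulr_gt0 n10 c0'))|exact: mulr_gt0].
exists (2 * Kp);split;first by rewrite mulr_gt0.
pose r:= Num.min (Num.min (r1 / Kp) (r2 / (2 * Kp))) (Num.min c^-1 c5^-1).
have Kp2: 0 < 2 * Kp by exact: mulr_gt0.
exists r=>[|phi a]. rewrite /r !lt_min;apply/andP;split;apply/andP;split; [exact: divr_gt0|exact: divr_gt0| |]. by rewrite invr_gt0;exact: c0'. by rewrite invr_gt0;exact: c50.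
rewrite !lt_min=> /andP[/andP[pr1 pr2] /andP[pc pc5]];set p:= `|phi - 1%:M| in pr1 pr2 pc pc5 *.
have p0: 0 <= p by exact: normr_ge0.
have yE: e0 + ad_proj (phi - 1%:M) - e0 = ad_proj (phi - 1%:M) by rewrite addrC addKr.
have [|u fu ue]:= P1 (e0 + ad_proj (phi - 1%:M)). by rewrite yE;apply: le_lt_trans (KpP _) _;rewrite mulrC -ltr_pdivlMr.
rewrite yE in ue.
have ue': `|u - e0| <= 2 * Kp * p by apply: le_trans ue _;rewrite -mulrA ler_pM2l.
exists u=>//.
have ur2: `|u - e0| < r2. by apply: le_lt_trans ue' _;rewrite mulrC -ltr_pdivlMr// mulr_gt0.
set A:= A0 u in fu *.
have aA: aut A by exact: autA.
have A1: `|A - 1%:M| <= c * p. have:= P2 u e0 ur2 _;rewrite subrr normr0 Ae0=> /(_ r20) H;apply: le_trans H _. by apply: le_trans (_: KA * (2 * Kp * p) <= _); [rewrite ler_pM2l|rewrite /c;lra].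
have cp1: c * p <= 1 by rewrite mulrC -ler_pdivlMr// mul1r ltW.
have An: `|A| <= 2. rewrite -[A](subrK 1%:M);apply: le_trans (ler_normD _ _) _. have:= @norm_mx1 R n;lra.
have piE: ad_proj phi = ad_proj A. move: fu=> /addrI;rewrite !ad_projB=> /addIr ->;by [].
(* The quotient differs from 1 by [N]. The inner part of [N] is small because the projections agree,
   and the rest is small because the defect is quadratic; both are less than a fixed fraction of the
   norm of [N], hence [N = 0]. *)
pose psi:= phi *m invmx A;pose N:= psi - 1%:M.
have apsi: aut (N + 1%:M) by rewrite subrK;apply: autM=>//;exact: autV.
have NA: N *m A = phi - A by rewrite mulmxBl mul1mx mulmxKV// aA.1.
have Nle: `|N| <= c2 * p. have -> : N = (phi - A) *m invmx A by rewrite -NA mulmxK// aA.1. apply: le_trans (mulmx_norm _ _) _;rewrite (aut_inv aA).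
 have H1: `|Kmx *m A^T *m invmx Kmx| <= Ki * 2 by apply: le_trans (KiP A) _;rewrite ler_pM2l. have H2: `|phi - A| <= (1 + c) * p. have -> : phi - A = (phi - 1%:M) - (A - 1%:M) by zmod.
  by apply: le_trans (ler_normB _ _) _;rewrite mulrDl mul1r lerD2l.
 rewrite mulrAC /c2 -/n1 -(mulrA n1);apply: le_trans (_: n1 * `|Kmx *m A^T *m invmx Kmx| * `|phi - A| <= _);first by rewrite lexx. rewrite -!(mulrA n1) !ler_pM2l//. by rewrite -mulrA ler_pM.
clearbody N.
have XE: ad_proj N = - ad_proj (N *m (A - 1%:M)). have H: ad_proj (N *m A) = 0. by rewrite NA ad_projB piE subrr. by rewrite mulmxBr mulmx1 ad_projB H sub0r opprK.
have adX: `|ad (ad_proj N)| <= Ka * (Kp * (n1 * c)) * p * `|N|. have H1: `|N *m (A - 1%:M)| <= n1 * c * p * `|N|. apply: le_trans (mulmx_norm _ _) _.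
  have: n1 * `|N| * `|A - 1%:M| <= n1 * `|N| * (c * p) by rewrite ler_wpM2l// mulr_ge0// ltW. by rewrite (_: n1 * `|N| * (c * p) = n1 * c * p * `|N|)//;ring.
 have H2: `|ad_proj N| <= Kp * (n1 * c * p * `|N|). by rewrite XE normrN;apply: le_trans (KpP _) _;rewrite ler_pM2l.
 have -> : Ka * (Kp * (n1 * c)) * p * `|N| = Ka * (Kp * (n1 * c * p * `|N|)) by ring. by apply: le_trans (KaP _) _;rewrite ler_pM2l.
have EN: `|N - ad (ad_proj N)| <= Kt * c2 * p * `|N|. rewrite (defectE _ apsi);apply: le_trans (KtP _ _) _. by rewrite ler_wpM2r// -mulrA ler_pM2l.
have N0: N = 0. apply/eqP;rewrite -normr_eq0;apply/negPn/negP=> NN. have Npos: 0 < `|N| by rewrite lt_neqAle eq_sym NN/=. have: `|N| <= c5 * p * `|N|.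
  have {1}-> : N = (N - ad (ad_proj N)) + ad (ad_proj N) by rewrite subrK. by apply: le_trans (ler_normD _ _) _;apply: le_trans (lerD EN adX) _;rewrite /c5;lra.
 rewrite -[X in X <= _]mul1r ler_pM2r// leNgt mulrC -ltr_pdivlMr//. by rewrite mul1r pc5.
have:= NA;rewrite N0 mul0mx=> /eqP;rewrite eq_sym subr_eq0=> /eqP ->;by [].
Qed.

Local Notation ppt:= Defs.p_part.

(** * Functions of diagonalizable matrices *)

Section FunctionalCalculus.

(** [f] applied to the matrix whose eigenvectors are the rows of [S], with eigenvalues [d]. *)
Definition fcalc (S: 'M[R]_n) (f: R -> R) (d: 'rV[R]_n): 'M[R]_n:= invmx S *m diag_mx (map_mx f d) *m S.

Lemma fcalc_eig (S A: 'M[R]_n) (d: 'rV[R]_n) f (y: 'rV[R]_n) (l: R): S \in unitmx -> S *m A = diag_mx d *m S -> y *m A = l *: y -> y *m fcalc S f d = f l *: y.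
Proof.
move=> uS SA yA;have [c yc] : exists c, y = c *m S by exists (y *m invmx S);rewrite mulmxKV.
have cd: c *m diag_mx d = l *: c. have: c *m diag_mx d *m S = l *: c *m S by rewrite -mulmxA -SA mulmxA -yc yA -scalemxAl -yc. by move/(congr1 (mulmx^~ (invmx S)));rewrite !mulmxK.
rewrite /fcalc !mulmxA {1}yc mulmxK//.
have -> : c *m diag_mx (map_mx f d) = f l *: c. apply/rowP=> j;have /rowP/(_ j):= cd;rewrite !mul_mx_diag !mxE. have [->|c0]:= eqVneq (c 0 j) 0;first by rewrite !(mul0r, mulr0).
 by rewrite mulrC=> /(mulIf c0) ->;rewrite mulrC.
by rewrite -scalemxAl -yc.
Qed.
Lemma row_eig (S A: 'M[R]_n) (d: 'rV[R]_n) i: S *m A = diag_mx d *m S -> row i S *m A = d 0 i *: row i S.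
Proof.
by move=> E;rewrite -row_mul E mul_diag_mx;apply/rowP=> j;rewrite !mxE.
Qed.
Lemma u_rows_ext (S A A': 'M[R]_n): S \in unitmx -> (forall i, row i S *m A = row i S *m A') -> A = A'.
Proof.
move=> uS H;have: S *m A = S *m A' by apply/row_matrixP=> i;rewrite !row_mul H.
by move/(congr1 (mulmx (invmx S)));rewrite !mulKmx.
Qed.
Lemma row_u_neq0 (S: 'M[R]_n) i: S \in unitmx -> row i S != 0.
Proof.
move=> uS;apply/eqP=> E;have:= mulmxV uS=> /(congr1 (row i)).
rewrite row_mul E mul0mx=> /rowP/(_ i);rewrite !mxE eqxx=> /eqP.
by rewrite eq_sym oner_eq0.
Qed.
Lemma bilin_rows_ext (b b': 'rV[R]_n -> 'rV[R]_n -> 'rV[R]_n) (S: 'M[R]_n): S \in unitmx -> (forall y, linear (b^~ y)) -> (forall x, linear (b x)) ->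
 (forall y, linear (b'^~ y)) -> (forall x, linear (b' x)) -> (forall i j, b (row i S) (row j S) = b' (row i S) (row j S)) -> forall x y, b x y = b' x y.
Proof.
move=> uS b1 b2 b1' b2' H x y.
have E (z: 'rV[R]_n): z = \sum_i (z *m invmx S) 0 i *: row i S. by rewrite -[LHS](mulmxKV uS) mulmx_sum_row.
rewrite (E x) (E y).
have sl (c: 'rV[R]_n -> 'rV[R]_n -> 'rV[R]_n): (forall y, linear (c^~ y)) -> (forall x, linear (c x)) -> c (\sum_i (x *m invmx S) 0 i *: row i S) (\sum_i (y *m invmx S) 0 i *: row i S) =
  \sum_i \sum_j (x *m invmx S) 0 i *: ((y *m invmx S) 0 j *: c (row i S) (row j S)). move=> c1 c2. have s1 I (r: seq I) (f: I -> 'rV[R]_n) v: c (\sum_(i <- r) f i) v = \sum_(i <- r) c (f i) v.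
  exact: (linear_sum (mklin (c1 v))). have s2 I (r: seq I) (f: I -> 'rV[R]_n) v: c v (\sum_(i <- r) f i) = \sum_(i <- r) c v (f i). exact: (linear_sum (mklin (c2 v))).
 have z1 a u v: c (a *: u) v = a *: c u v by exact: (linearZ_LR (mklin (c1 v))). have z2 a u v: c u (a *: v) = a *: c u v by exact: (linearZ_LR (mklin (c2 u))).
 by rewrite s1;apply: eq_bigr=> i _;rewrite s2;apply: eq_bigr=> j _;rewrite z1 z2.
by rewrite !sl//;apply: eq_bigr=> i _;apply: eq_bigr=> j _;rewrite H.
Qed.
End FunctionalCalculus.

(** * Cartan involutions as points of X *)

Section AbstractSymmetricSpace.
Implicit Types (th: 'M[R]_n).

Definition cartan th: Prop:= [/\ forall x y, [x, y] *m th = [x *m th, y *m th], th *m th = 1%:M & forall x, x != 0 -> 0 < - B x (x *m th)].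

(** The positive form attached to the point [th]. Distances, asymptotic rays and stabilizers at
    infinity are all expressed by comparing such forms. *)
Definition qform th z: R:= - B z (z *m th).
Definition gram_of th: 'M[R]_n:= - (Kmx *m th^T).

Lemma gram_ofE th x y: (x *m gram_of th *m y^T) 0 0 = - B x (y *m th).
Proof. by rewrite /gram_of mulmxN mulNmx mxE kilE trmx_mul !mulmxA. Qed.
Lemma cartan_aut th: cartan th -> aut th.
Proof. by move=>[b s _];split=>//;have []:= mulmx1_unit s. Qed.
Lemma cartan_sym th x y: cartan th -> B x (y *m th) = B y (x *m th).
Proof.
move=> C;have [_ s _]:= C;rewrite -(B_aut x (y *m th) (cartan_aut C)) -mulmxA s mulmx1.
exact: kilC.
Qed.
Lemma gram_of_sym th: cartan th -> (gram_of th)^T = gram_of th.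
Proof.
move=> C;have [_ s _]:= C;have a:= aut_Kmx (cartan_aut C).
rewrite /gram_of linearN/= trmx_mul trmxK Kmx_sym;congr (- _).
by rewrite -[in RHS]a -(mulmxA (th *m _)) -(trmx_mul th th) s trmx1 mulmx1.
Qed.
Lemma gram_of_pos th v: cartan th -> v != 0 -> 0 < (v *m gram_of th *m v^T) 0 0.
Proof. by move=>[_ _ p] v0;rewrite gram_ofE p. Qed.
Lemma form_mx_ext (M N: 'M[R]_n): (forall x y, (x *m M *m y^T) 0 0 = (x *m N *m y^T) 0 0) -> M = N.
Proof.
move=> H;apply/matrixP=> i j;have:= H (delta_mx 0 i) (delta_mx 0 j).
by rewrite -!rowE trmx_delta -!colE !mxE.
Qed.
Lemma ad_self_adjoint th v: cartan th -> ppt th v -> self_adjoint (gram_of th) (ad v).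
Proof.
move=> C pv;have [b s _]:= C;apply: form_mx_ext=> x y.
rewrite mulmxA mul_admx gram_ofE B_ad.
rewrite (mulmxA x (gram_of th)) -(mulmxA _ (ad v)^T) -trmx_mul mul_admx gram_ofE.
rewrite b (_: v *m th = - v) ?brNl ?BNr//;exact: pv.
Qed.

Definition frame th (S: 'M[R]_n): Prop:= S \in unitmx /\ S *m gram_of th *m S^T = 1%:M.

Lemma frame_ip th S x y: frame th S ->
 - B x (y *m th) = \sum_i (x *m invmx S) 0 i * (y *m invmx S) 0 i.
Proof.
move=>[uS SS];rewrite -gram_ofE -{1}[x](mulmxKV uS) -{1}[y](mulmxKV uS).
set c:= x *m _;set c':= y *m _.
rewrite trmx_mul !mulmxA -(mulmxA c) -(mulmxA c) SS mulmx1 mxE.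
by apply: eq_bigr=> i _;rewrite !mxE.
Qed.
Lemma frame_q th S z: frame th S -> qform th z = \sum_i (z *m invmx S) 0 i ^+ 2.
Proof. by move=> F;rewrite /qform (frame_ip _ _ F);apply: eq_bigr=> i _;rewrite expr2. Qed.
Lemma frame_row th S i: frame th S -> qform th (row i S) = 1.
Proof.
move=> F;have uS:= F.1;rewrite (frame_q _ F) (bigD1 i)//= big1 ?addr0=>[|j ji]. by rewrite -row_mul mulmxV// !mxE eqxx expr1n.
by rewrite -row_mul mulmxV// !mxE eq_sym (negPf ji) expr0n.
Qed.
Lemma ad_comm v w: [v, w] = 0 -> ad v *m ad w = ad w *m ad v.
Proof.
by move=> E;have:= ad_brk v w;rewrite E ad0=> /esym/eqP;rewrite subr_eq0=> /eqP.
Qed.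
Lemma frame_ex th (A: set g): cartan th -> (forall v, A v -> ppt th v) -> (forall v w, A v -> A w -> [v, w] = 0) -> exists2 S, frame th S & forall v, A v -> exists d, S *m ad v = diag_mx d *m S.
Proof.
move=> C pA cA.
have [||S [uS SS ST]]:= @joint_eigb R n (gram_of th) (gram_of_sym C) (fun v=> gram_of_pos C) (ad @` A).
- by move=> _ [v Av <-];exact: ad_self_adjoint C (pA _ Av).
- by move=> _ _ [v Av <-] [w Aw <-];apply: ad_comm;exact: cA.
exists S=>// v Av;apply: ST;by exists v.
Qed.
Lemma frame1 th v: cartan th -> ppt th v -> exists S d, frame th S /\ S *m ad v = diag_mx d *m S.
Proof.
move=> C pv;have [|a b -> ->|S F H]:= @frame_ex th [set v] C.
- by move=> w ->.
- exact: brxx.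
by have [d dE]:= H v erefl;exists S, d.
Qed.
Lemma fcalc_inv (S: 'M[R]_n) (d: 'rV[R]_n) (f h: R -> R): S \in unitmx -> (forall s, f s * h s = 1) -> fcalc S f d *m fcalc S h d = 1%:M.
Proof.
move=> uS fh;rewrite /fcalc !mulmxA mulmxK// -(mulmxA (invmx S) (diag_mx _) (diag_mx _)) mulmx_diag.
have -> : (\row_j (map_mx f d 0 j * map_mx h d 0 j)) = const_mx 1. by apply/rowP=> j;rewrite !mxE fh.
by rewrite diag_const_mx mulmx1 mulVmx.
Qed.
Lemma fcalc_comp (S: 'M[R]_n) (d: 'rV[R]_n) (f h: R -> R): S \in unitmx -> fcalc S f d *m fcalc S h d = fcalc S (fun s=> f s * h s) d.
Proof.
move=> uS;rewrite /fcalc !mulmxA mulmxK// -(mulmxA (invmx S) (diag_mx _) (diag_mx _)) mulmx_diag.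
by congr (_ *m diag_mx _ *m _);apply/rowP=> j;rewrite !mxE.
Qed.
(** Eigenvalues of [ad v] add under the bracket, and [f] turns sums into products. *)
Lemma fcalc_aut (S: 'M[R]_n) (d: 'rV[R]_n) v (f: R -> R): S \in unitmx -> S *m ad v = diag_mx d *m S -> (forall a b, f (a + b) = f a * f b) -> f 0 = 1 -> aut (fcalc S f d).
Proof.
move=> uS SA fD f0;split. have fN s: f s * f (- s) = 1 by rewrite -fD subrr. by have []:= mulmx1_unit (fcalc_inv d uS fN).
apply: (@bilin_rows_ext (fun x y=>[x, y] *m fcalc S f d) (fun x y=>[x *m fcalc S f d, y *m fcalc S f d]) S uS).
- by move=> y k u w;rewrite brk_linl mulmxDl -scalemxAl.
- by move=> y k u w;rewrite brk_linr mulmxDl -scalemxAl.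
- by move=> y k u w;rewrite mulmxDl -scalemxAl brk_linl.
- by move=> y k u w;rewrite mulmxDl -scalemxAl brk_linr.
move=> i j;have Ei:= row_eig i SA;have Ej:= row_eig j SA.
rewrite (fcalc_eig f uS SA Ei) (fcalc_eig f uS SA Ej) brZl brZr scalerA -fD.
apply: (fcalc_eig f uS SA);rewrite ad_der Ei Ej brZl brZr.
by rewrite scalerDl.
Qed.

Definition aexp v th: 'M[R]_n:= expmx (ad (- v)) *m th *m expmx (ad v).

Lemma expmx_fcalc (S: 'M[R]_n) (d: 'rV[R]_n) v (t: R): S \in unitmx -> S *m ad v = diag_mx d *m S -> expmx (ad (t *: v)) = fcalc S (fun s=> expR (t * s)) d.
Proof.
move=> uS SA;have E: S *m ad (t *: v) = diag_mx (t *: d) *m S. by rewrite adZ -scalemxAr SA linearZ/= -scalemxAl.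
by rewrite (expmx_diag uS E) /fcalc;congr (_ *m diag_mx _ *m _);apply/rowP=> j;rewrite !mxE.
Qed.
Lemma p_eig_th th v x (l: R): cartan th -> ppt th v -> x *m ad v = l *: x -> (x *m th) *m ad v = (- l) *: (x *m th).
Proof.
move=>[b _ _] pv;rewrite !mul_admx=> E.
have -> : [v, x *m th] = - ([v, x] *m th) by rewrite b (_: v *m th = - v) ?brNl ?opprK//;exact: pv.
by rewrite E -scalemxAl scaleNr.
Qed.
(** [th] exchanges the eigenvalues [l] and [- l] of [ad v]. The left exponential can thus be moved
    across [th], where it doubles the right one. *)
Lemma aexpE th S (d: 'rV[R]_n) v (t: R): cartan th -> ppt th v -> S \in unitmx -> S *m ad v = diag_mx d *m S -> aexp (t *: v) th = th *m fcalc S (fun s=> expR (2 * t * s)) d.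
Proof.
move=> C pv uS SA;rewrite /aexp -scaleNr (expmx_fcalc (- t) uS SA) (expmx_fcalc t uS SA).
have -> : fcalc S (fun s=> expR (- t * s)) d *m th = th *m fcalc S (fun s=> expR (t * s)) d. apply: (u_rows_ext uS)=> i;have E:= row_eig i SA.
 rewrite [LHS]mulmxA [RHS]mulmxA (fcalc_eig _ uS SA E) (fcalc_eig _ uS SA (p_eig_th C pv E)) -scalemxAl. by rewrite mulrN mulNr.
rewrite -mulmxA fcalc_comp//;congr (_ *m _).
rewrite /fcalc;congr (_ *m diag_mx _ *m _);apply/rowP=> j;rewrite !mxE -expRD.
by congr expR;ring.
Qed.
Lemma p_partZ th v (t: R): ppt th v -> ppt th (t *: v).
Proof. by move=> pv;rewrite /ppt/= -scalemxAl (_: v *m th = - v) ?scalerN//;exact: pv. Qed.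
Lemma q_aexp_eig th v y (l: R): cartan th -> ppt th v -> y *m ad v = l *: y -> qform (aexp v th) y = expR (- 2 * l) * qform th y.
Proof.
move=> C pv yE;have [S [d [F SA]]]:= frame1 C pv;have uS:= F.1.
rewrite /qform -{1}[v]scale1r (aexpE 1 C pv uS SA) mulmxA.
rewrite (fcalc_eig _ uS SA (p_eig_th C pv yE)) BZr -mulrN;congr (expR _ * _).
by ring.
Qed.
Lemma q_aexp th S (d: 'rV[R]_n) v z (t: R): cartan th -> ppt th v -> frame th S -> S *m ad v = diag_mx d *m S ->
 qform (aexp (t *: v) th) z = \sum_i expR (- 2 * t * d 0 i) * (z *m invmx S) 0 i ^+ 2.
Proof.
move=> C pv F SA;have uS:= F.1;rewrite /qform (aexpE t C pv uS SA).
have -> : th *m fcalc S (fun s=> expR (2 * t * s)) d = fcalc S (fun s=> expR (- 2 * t * s)) d *m th. apply: (u_rows_ext uS)=> i;have E:= row_eig i SA.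
 rewrite [LHS]mulmxA [RHS]mulmxA (fcalc_eig _ uS SA E) (fcalc_eig _ uS SA (p_eig_th C pv E)) -scalemxAl. by congr (expR _ *: _);ring.
rewrite mulmxA (frame_ip _ _ F);apply: eq_bigr=> i _.
rewrite /fcalc !mulmxA mulmxK// mul_mx_diag !mxE;ring.
Qed.
Lemma cartan_aexp th v: cartan th -> ppt th v -> cartan (aexp v th).
Proof.
move=> C pv;have [S [d [F SA]]]:= frame1 C pv;have uS:= F.1;have [b s _]:= C.
have E1: expmx (ad v) = fcalc S (fun s=> expR (1 * s)) d by rewrite -[v]scale1r (expmx_fcalc _ uS SA).
have E2: expmx (ad (- v)) = fcalc S (fun s=> expR (-1 * s)) d by rewrite -scaleN1r (expmx_fcalc _ uS SA).
have EE: expmx (ad v) *m expmx (ad (- v)) = 1%:M. rewrite E1 E2;apply: fcalc_inv=>// x;by rewrite -expRD -mulrDl subrr mul0r expR0.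
have EE': expmx (ad (- v)) *m expmx (ad v) = 1%:M. rewrite E1 E2;apply: fcalc_inv=>// x;by rewrite -expRD -mulrDl addNr mul0r expR0.
have a: aut (aexp v th). rewrite /aexp E1 E2;apply: autM;first (apply: autM;last exact: cartan_aut C). by apply: (fcalc_aut uS SA)=>[x y|];rewrite ?mulr0 ?expR0// mulrDr expRD.
 by apply: (fcalc_aut uS SA)=>[x y|];rewrite ?mulr0 ?expR0// mulrDr expRD.
split;first exact: a.2. by rewrite /aexp !mulmxA -(mulmxA _ (expmx (ad v))) EE mulmx1 -(mulmxA (expmx (ad (- v))) th th) s mulmx1 EE'.
move=> x x0;rewrite -/(qform _ x) -[v]scale1r (q_aexp _ _ C pv F SA).
have: 0 < qform th x by have [_ _]:= C;apply.
rewrite (frame_q _ F)=> H;rewrite lt_neqAle;apply/andP;split. apply: contraTneq H;rewrite -leNgt=> /esym/eqP. rewrite psumr_eq0=>[/allP A|i _];last by rewrite mulr_ge0 ?expR_ge0 ?sqr_ge0.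
 rewrite big1// => i _;have:= A i (mem_index_enum _);rewrite implyTb mulf_eq0 gt_eqF ?expR_gt0//=. by move=> /eqP.
by apply: sumr_ge0=> i _;rewrite mulr_ge0 ?expR_ge0 ?sqr_ge0.
Qed.
End AbstractSymmetricSpace.

(** * Geodesics, distances and rays in X *)

Section AbstractGeometry.
Implicit Types (th: 'M[R]_n) (c: R -> 'M[R]_n).

Lemma qform_ge0 th z: cartan th -> 0 <= qform th z.
Proof.
move=>[_ _ p];rewrite /qform;have [->|z0]:= eqVneq z 0;last exact: ltW (p _ z0).
by rewrite B0l oppr0.
Qed.
Lemma form_aut_cartan th x y: cartan th -> B (x *m th) y = B x (y *m th).
Proof.
move=> C;have [_ s _]:= C;rewrite -(B_aut (x *m th) y (cartan_aut C)).
by rewrite -mulmxA s mulmx1.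
Qed.

(* [th *m th'] is a positive automorphism; half of its logarithm is inner. *)
Lemma cartan_joined th th': cartan th -> cartan th' -> exists2 v, ppt th v & aexp v th = th'.
Proof.
move=> C C';have [b s p]:= C;have [b' s' p']:= C'.
pose P:= th *m th'.
have sP: self_adjoint (gram_of th) P. apply: form_mx_ext=> x y;rewrite mulmxA gram_ofE. rewrite (mulmxA x) -(mulmxA _ P^T) -trmx_mul gram_ofE /P !mulmxA;congr (- _).
 rewrite (form_aut_cartan _ _ C') -!(form_aut_cartan _ _ C). by rewrite -!mulmxA.
have [||S [uS SS ST]]:= @joint_eigb R n (gram_of th) (gram_of_sym C) (fun v=> gram_of_pos C) [set P].
- by move=> _ ->.
- by move=> _ _ -> ->.
have F: frame th S by split.
have [lam lamE]:= ST P erefl.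
have lam0 i: 0 < lam 0 i. have ri:= row_eig i lamE;have xi:= frame_row i F. have: 0 < - B (row i S *m th) (row i S *m th *m th').
  apply: p';apply/eqP=> E;have:= row_u_neq0 i uS=> /eqP;apply. by have:= congr1 (mulmx^~ th) E;rewrite mul0mx -mulmxA s mulmx1.
 rewrite -mulmxA -/P ri BZr (form_aut_cartan _ _ C) -mulrN -/(qform th (row i S)). by rewrite xi mulr1.
pose D:= fcalc S (fun s=> ln s / 2) lam.
have Di i: row i S *m D = (ln (lam 0 i) / 2) *: row i S. exact: (fcalc_eig _ uS lamE (row_eig i lamE)).
have aP: aut P by apply: autM;exact: cartan_aut.
have derD: forall x y, [x, y] *m D = [x *m D, y] + [x, y *m D]. apply: (@bilin_rows_ext (fun x y=>[x, y] *m D) (fun x y=>[x *m D, y] + [x, y *m D]) S uS).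
 - by move=> y k u w;rewrite brk_linl mulmxDl -scalemxAl.
 - by move=> y k u w;rewrite brk_linr mulmxDl -scalemxAl.
 - move=> y k u w;rewrite mulmxDl -scalemxAl !brk_linl scalerDr;zmod.
 - move=> y k u w;rewrite mulmxDl -scalemxAl !brk_linr scalerDr;zmod. move=> i j;rewrite !Di brZl brZr -scalerDl -mulrDl -lnM ?posrE//.
 apply: (fcalc_eig _ uS lamE);rewrite aP.2 (row_eig i lamE) (row_eig j lamE). by rewrite brZl brZr scalerA.
have DE:= der_inner derD;set v:= ad_proj D in DE.
have SD: S *m ad v = diag_mx (map_mx (fun s=> ln s / 2) lam) *m S. by rewrite -DE /D /fcalc !mulmxA mulmxV// mul1mx.
have thP i: row i S *m th *m P = (lam 0 i)^-1 *: (row i S *m th). have E:= row_eig i lamE;rewrite /P !mulmxA -(mulmxA _ th th) s mulmx1. have l0: lam 0 i != 0 by rewrite gt_eqF.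
 have {1}-> : row i S = (lam 0 i)^-1 *: (row i S *m P) by rewrite E scalerA mulVf// scale1r. by rewrite -scalemxAl /P !mulmxA -(mulmxA _ th' th') s' mulmx1.
have pv: ppt th v. apply: ad_inj;rewrite (ad_aut_conj _ (cartan_aut C)) adN -DE. have ith: invmx th = th by rewrite -[LHS]mulmx1 -s mulKmx//;have []:= mulmx1_unit s.
 rewrite ith;apply: (u_rows_ext uS)=> i. have DT:= fcalc_eig (fun s=> ln s / 2) uS lamE (thP i);rewrite -/D in DT.
 rewrite (mulmxA (row i S) (th *m D)) (mulmxA (row i S) th D) DT mulmxN Di lnV ?posrE// -scalemxAl -mulmxA s mulmx1. by rewrite mulNr scaleNr.
exists v=>//;rewrite -[v]scale1r (aexpE 1 C pv uS SD).
have -> : fcalc S (fun s=> expR (2 * 1 * s)) (map_mx (fun s=> ln s / 2) lam) = P. apply: (u_rows_ext uS)=> i;rewrite (fcalc_eig _ uS SD (row_eig i SD)) (row_eig i lamE) mxE.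
 by rewrite mulr1 mulrC divfK// lnK// posrE.
by rewrite /P mulmxA s mul1mx.
Qed.
Lemma aexp_inj th v w: cartan th -> ppt th v -> ppt th w -> aexp v th = aexp w th -> v = w.
Proof.
move=> C pv pw;have [_ s _]:= C.
have [S [d [F SA]]]:= frame1 C pv;have [S' [d' [F' SA']]]:= frame1 C pw.
rewrite -{1}[v]scale1r -{1}[w]scale1r (aexpE 1 C pv F.1 SA) (aexpE 1 C pw F'.1 SA').
move=> /(congr1 (mulmx th));rewrite !(mulmxA th th) s !mul1mx=> E.
apply: ad_inj;apply: (u_rows_ext F.1)=> i.
have E1: S' *m fcalc S' (fun s=> expR (2 * 1 * s)) d' = diag_mx (map_mx (fun s=> expR (2 * 1 * s)) d') *m S'. by rewrite /fcalc !mulmxA mulmxV ?mul1mx//;exact: F'.1.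
have E2: row i S *m fcalc S' (fun s=> expR (2 * 1 * s)) d' = expR (2 * 1 * d 0 i) *: row i S. by rewrite -E (fcalc_eig _ F.1 SA (row_eig i SA)).
have E3:= fcalc_eig (fun s=> ln s / 2) F'.1 E1 E2.
have E4: fcalc S' (fun s=> ln s / 2) (map_mx (fun s=> expR (2 * 1 * s)) d') = ad w. rewrite /fcalc (mx_diagE F'.1 SA');congr (_ *m diag_mx _ *m _).
 by apply/rowP=> j;rewrite !mxE expRK mulr1 mulrC mulKf.
by rewrite -E4 E3 (row_eig i SA) expRK mulr1 mulrC mulKf.
Qed.

Definition distX th th': R:= inf [set Num.sqrt (B v v) | v in [set v | ppt th v /\ aexp v th = th']].

Lemma distXE th v: cartan th -> ppt th v -> distX th (aexp v th) = Num.sqrt (B v v).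
Proof.
move=> C pv;rewrite /distX.
rewrite (_: [set Num.sqrt (B v0 v0) | v0 in _] = [set Num.sqrt (B v v)]) ?inf1//.
apply/seteqP;split=>[_ [w [pw E] <-]|_ ->];last by exists v.
by rewrite (aexp_inj C pw pv E).
Qed.
Lemma kform_frame th S (d: 'rV[R]_n) v: frame th S -> S *m ad v = diag_mx d *m S -> B v v = \sum_i d 0 i ^+ 2.
Proof.
move=> F SA;rewrite /kform (mx_diagE F.1 SA) !mulmxA mulmxK ?F.1// mxtrace_mulC !mulmxA mulmxV ?F.1//.
rewrite mul1mx mulmx_diag mxtrace_diag;apply: eq_bigr=> i _;by rewrite mxE expr2.
Qed.
Lemma distX_q1 th th' z: cartan th -> cartan th' -> qform th' z <= expR (2 * distX th th') * qform th z.
Proof.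
move=> C C';have [v pv <-]:= cartan_joined C C'.
have [S [d [F SA]]]:= frame1 C pv.
rewrite (distXE C pv) -{1}[v]scale1r (q_aexp z 1 C pv F SA) (frame_q z F) mulr_sumr.
apply: ler_sum=> i _;apply: ler_wpM2r;first exact: sqr_ge0.
rewrite ler_expR mulr1 mulNr -mulrN ler_pM2l//;apply: le_trans (ler_norm _) _.
rewrite normrN -sqrtr_sqr ler_sqrt;last by rewrite (kform_frame F SA) sumr_ge0// => j _;exact: sqr_ge0.
by rewrite (kform_frame F SA) (bigD1 i)//= lerDl sumr_ge0// => j _;exact: sqr_ge0.
Qed.
Lemma q_bound_eig th v (K: R): cartan th -> ppt th v -> (forall z, qform (aexp v th) z <= K * qform th z) -> forall y l, y != 0 -> y *m ad v = l *: y -> expR (2 * `|l|) <= K.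
Proof.
move=> C pv H;have [_ s p]:= C.
have key y l: y != 0 -> y *m ad v = l *: y -> expR (- 2 * l) <= K. move=> y0 yE;have:= H y;rewrite (q_aexp_eig C pv yE) ler_pM2r//;exact: p.
move=> y l y0 yE;have [l0|l0]:= leP 0 l. rewrite ger0_norm//;have:= key (y *m th) (- l) _ (p_eig_th C pv yE). rewrite mulrNN;apply;apply: contra_neq y0=> E.
 by have:= congr1 (mulmx^~ th) E;rewrite mul0mx -mulmxA s mulmx1.
by rewrite ltr0_norm// mulrN -mulNr;exact: key yE.
Qed.
Lemma q_bound_dist th th' (K: R): cartan th -> cartan th' -> (forall z, qform th' z <= K * qform th z) -> distX th th' <= n%:R * `|ln K|.
Proof.
move=> C C';have [v pv <-]:= cartan_joined C C'=> H;rewrite (distXE C pv).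
have [S [d [F SA]]]:= frame1 C pv.
have dK i: `|d 0 i| <= `|ln K|. have:= q_bound_eig C pv H (row_u_neq0 i F.1) (row_eig i SA)=> H1. have K0: 0 < K by apply: lt_le_trans H1;exact: expR_gt0.
 have: 2 * `|d 0 i| <= ln K by rewrite -ler_expR lnK. have:= ler_norm (ln K);have:= normr_ge0 (d 0 i);lra.
rewrite (kform_frame F SA) -[leRHS]ger0_norm ?mulr_ge0// -sqrtr_sqr ler_sqrt ?sqr_ge0//.
apply: le_trans (_: \sum_(i < n) `|ln K| ^+ 2 <= _). by apply: ler_sum=> i _;rewrite -[X in X <= _]real_normK ?num_real// lerXn2r ?nnegrE.
rewrite sumr_const card_ord exprMn -[leLHS]mulr_natl;apply: ler_wpM2r;first exact: sqr_ge0.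
by rewrite expr2 -natrM ler_nat;case: (n)=>// k;rewrite leq_pmulr.
Qed.
(** [K] bounds the exponentials of the absolute values of all eigenvalues, since these come in pairs
    [l], [- l]; so a bound in one direction serves in both. *)
Lemma q_bound_sym th th' (K: R): cartan th -> cartan th' -> (forall z, qform th' z <= K * qform th z) -> forall z, qform th z <= K * qform th' z.
Proof.
move=> C C';have [v pv <-]:= cartan_joined C C'=> H z.
have [S [d [F SA]]]:= frame1 C pv.
rewrite -{1}[v]scale1r (q_aexp z 1 C pv F SA) (frame_q z F) mulr_sumr.
apply: ler_sum=> i _;rewrite mulrA ler_peMl ?sqr_ge0//.
have H1:= q_bound_eig C pv H (row_u_neq0 i F.1) (row_eig i SA).
apply: le_trans (_: expR (2 * `|d 0 i|) * expR (- 2 * 1 * d 0 i) <= _);last first. by rewrite ler_wpM2r// expR_ge0.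
rewrite mulr1 -expRD -[leLHS]expR0 ler_expR;have:= ler_norm (d 0 i);lra.
Qed.

Definition rayX c: Prop:= (forall t, 0 <= t -> cartan (c t)) /\ (forall s t, 0 <= s -> 0 <= t -> distX (c s) (c t) = `|s - t|).
Definition asymX c c': Prop:= exists C: R, forall t, 0 <= t -> distX (c t) (c' t) <= C.
Definition rend c: set (R -> 'M[R]_n):= [set c' | rayX c' /\ asymX c c'].

(** Asymptotic rays are those with uniformly comparable forms. In this shape symmetry and
    transitivity are immediate, without a triangle inequality in X. *)
Lemma asymXP c c': rayX c -> rayX c' -> asymX c c' <-> exists K: R, forall t z, 0 <= t -> qform (c' t) z <= K * qform (c t) z.
Proof.
move=>[Cc _] [Cc' _];split=>[[A AP]|[K KP]]. exists (expR (2 * A))=> t z t0;apply: le_trans (distX_q1 z (Cc t t0) (Cc' t t0)) _.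
 by apply: ler_wpM2r; [exact: qform_ge0 (Cc t t0)|rewrite ler_expR ler_pM2l// AP].
exists (n%:R * `|ln K|)=> t t0;apply: q_bound_dist; [exact: Cc|exact: Cc'|].
by move=> z;exact: KP.
Qed.
Lemma asymX_refl c: rayX c -> asymX c c.
Proof. by move=> r;apply/asymXP=>//;exists 1=> t z _;rewrite mul1r. Qed.
Lemma asymX_sym c c': rayX c -> rayX c' -> asymX c c' -> asymX c' c.
Proof.
move=> r r' /(asymXP r r')[K KP];apply/asymXP=>//;exists K=> t z t0.
by apply: q_bound_sym=>[||y]; [exact: r.1|exact: r'.1|exact: KP].
Qed.
Lemma asymX_trans c c' c'': rayX c -> rayX c' -> rayX c'' -> asymX c c' -> asymX c' c'' -> asymX c c''.
Proof.
move=> r r' r'' /(asymXP r r')[K KP] /(asymXP r' r'')[K' KP'];apply/asymXP=>//.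
exists (`|K'| * K)=> t z t0;apply: le_trans (KP' t z t0) _.
apply: le_trans (_: `|K'| * qform (c' t) z <= _). by rewrite ler_wpM2r ?ler_norm// qform_ge0//;exact: r'.1.
by rewrite -mulrA ler_wpM2l// KP.
Qed.
Lemma rend_eq c c': rayX c -> rayX c' -> (rend c = rend c') <-> asymX c c'.
Proof.
move=> r r';split=>[E|a]. have: rend c' c' by split=>//;exact: asymX_refl. by rewrite -E=> -[].
apply/seteqP;split=> e [re ae];split=>//. exact: asymX_trans (asymX_sym r r' a) ae.
exact: asymX_trans a ae.
Qed.
Lemma aexp_p th v (t: R): cartan th -> ppt th v -> ppt (aexp (t *: v) th) v.
Proof.
move=> C pv;have [S [d [F SA]]]:= frame1 C pv.
rewrite /ppt/= (aexpE t C pv F.1 SA) mulmxA (_: v *m th = - v);last exact: pv.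
have E: v *m ad v = 0 *: v by rewrite mul_admx brxx scale0r.
by rewrite mulNmx (fcalc_eig _ F.1 SA E) mulr0 expR0 scale1r.
Qed.
Lemma aexpD th v (s t: R): cartan th -> ppt th v -> aexp (t *: v) (aexp (s *: v) th) = aexp ((s + t) *: v) th.
Proof.
move=> C pv;have [S [d [F SA]]]:= frame1 C pv.
have C': cartan (aexp (s *: v) th) by apply: cartan_aexp=>//;exact: p_partZ.
rewrite (aexpE t C' (aexp_p s C pv) F.1 SA) (aexpE s C pv F.1 SA) (aexpE _ C pv F.1 SA).
rewrite -mulmxA fcalc_comp ?F.1//;congr (_ *m _).
rewrite /fcalc;congr (_ *m diag_mx _ *m _);apply/rowP=> j;rewrite !mxE -expRD.
by congr expR;ring.
Qed.

Definition geo th v: R -> 'M[R]_n:= fun t=> aexp (t *: v) th.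

Lemma rayX_geo th v: cartan th -> ppt th v -> B v v = 1 -> rayX (geo th v).
Proof.
move=> C pv v1;split=>[t _|s t _ _];first by apply: cartan_aexp=>//;exact: p_partZ.
have Cs: cartan (geo th v s) by apply: cartan_aexp=>//;exact: p_partZ.
have -> : geo th v t = aexp ((t - s) *: v) (geo th v s). by rewrite /geo (aexpD s (t - s) C pv) addrC subrK.
rewrite (distXE Cs);last by apply: p_partZ;exact: aexp_p.
rewrite BZl BZr v1 mulr1 -expr2 sqrtr_sqr distrC;by [].
Qed.

Definition conjX (phi: 'M[R]_n) th: 'M[R]_n:= invmx phi *m th *m phi.

Lemma cartan_conjX phi th: aut phi -> cartan th -> cartan (conjX phi th).
Proof.
move=> a C;have [b s p]:= C;have u:= a.1;split.
- by have:= autM (autM (autV a) (cartan_aut C)) a;move=>[].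
- by rewrite /conjX !mulmxA mulmxK// -(mulmxA (invmx phi)) s mulmx1 mulVmx.
- move=> x x0;rewrite /conjX !mulmxA -(B_aut _ _ (autV a)) mulmxK//;apply: p. by apply: contra_neq x0=> E;rewrite -[x](mulmxKV u) E mul0mx.
Qed.
Lemma qform_conjX phi th z: aut phi -> qform (conjX phi th) z = qform th (z *m invmx phi).
Proof.
by move=> a;rewrite /qform /conjX !mulmxA -(B_aut _ _ (autV a)) mulmxK// a.1.
Qed.
Lemma p_part_conjX phi th v: aut phi -> ppt th v -> ppt (conjX phi th) (v *m phi).
Proof.
move=> a pv;rewrite /ppt/= /conjX !mulmxA mulmxK ?a.1// (_: v *m th = - v) ?mulNmx//;exact: pv.
Qed.
Lemma aexp_conjX phi th v: aut phi -> cartan th -> ppt th v -> aexp (v *m phi) (conjX phi th) = conjX phi (aexp v th).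
Proof.
move=> a C pv;have [S [d [F SA]]]:= frame1 C pv;have u:= a.1.
have uS': S *m phi \in unitmx by rewrite unitmx_mul F.1.
have SA': (S *m phi) *m ad (v *m phi) = diag_mx d *m (S *m phi). by rewrite -mulmxA -(ad_aut _ a) mulmxA SA mulmxA.
rewrite -{1}[v *m phi]scale1r -{2}[v]scale1r.
rewrite (aexpE 1 (cartan_conjX a C) (p_part_conjX a pv) uS' SA') (aexpE 1 C pv F.1 SA).
rewrite /conjX /fcalc !mulmxA;congr (_ *m _).
have -> : invmx (S *m phi) = invmx phi *m invmx S. apply: (can_inj (mulKmx uS'));rewrite mulmxV// !mulmxA mulmxK// mulmxV//;exact: F.1.
by rewrite !mulmxA mulmxK.
Qed.
Lemma distX_conjX phi th th': aut phi -> cartan th -> cartan th' -> distX (conjX phi th) (conjX phi th') = distX th th'.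
Proof.
move=> a C C';have [v pv <-]:= cartan_joined C C'.
rewrite -(aexp_conjX a C pv) (distXE (cartan_conjX a C) (p_part_conjX a pv)) (distXE C pv).
by rewrite (B_aut _ _ a).
Qed.
Lemma rayX_conjX phi c: aut phi -> rayX c -> rayX (conjX phi \o c).
Proof.
move=> a [Cc dc];split=>[t t0|s t s0 t0];first exact: cartan_conjX (Cc t t0).
by rewrite/= distX_conjX//; [exact: dc|exact: Cc|exact: Cc].
Qed.
Lemma asymX_conjX phi c c': aut phi -> rayX c -> rayX c' -> asymX c c' -> asymX (conjX phi \o c) (conjX phi \o c').
Proof.
move=> a r r' [A AP];exists A=> t t0;rewrite/= distX_conjX//; [exact: AP|exact: r.1|exact: r'.1].
Qed.
Lemma conjXK phi th: phi \in unitmx -> conjX (invmx phi) (conjX phi th) = th.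
Proof. by move=> u;rewrite /conjX invmxK !mulmxA mulmxV// mul1mx mulmxK. Qed.
Lemma conjXKV phi th: phi \in unitmx -> conjX phi (conjX (invmx phi) th) = th.
Proof. by move=> u;rewrite /conjX invmxK !mulmxA mulVmx// mul1mx mulmxKV. Qed.
Lemma rend_conjX phi c: aut phi -> rayX c -> [set conjX phi \o e | e in rend c] = rend (conjX phi \o c).
Proof.
move=> a r;apply/seteqP;split=>[_ [e [re ae] <-]|e [re ae]]. by split; [exact: rayX_conjX|exact: asymX_conjX].
have aV:= autV a;have r':= rayX_conjX a r.
exists (conjX (invmx phi) \o e);last by apply/funext=> t;rewrite/= conjXKV// a.1.
split;first exact: rayX_conjX.
have:= asymX_conjX aV r' re ae;congr (asymX _ _).
by apply/funext=> t;rewrite/= conjXK// a.1.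
Qed.
End AbstractGeometry.

(** * Eigenvalue filtrations and parabolic subgroups *)

Section Filtrations.
Implicit Types (H: g) (th phi: 'M[R]_n) (P: R -> Prop).

(** No eigenbasis is chosen, so that automorphisms transport it at once. For positive eigenvalues it
    is the nilradical attached to [v], for nonnegative ones the parabolic subalgebra. *)
Definition gfilt v P z: Prop:= exists k (x: 'I_k -> g) (l: 'I_k -> R), [/\ z = \sum_i x i, forall i, x i *m ad v = l i *: x i & forall i, x i != 0 -> P (l i)].

Lemma eig_co S (d: 'rV[R]_n) (A: 'M[R]_n) x (l: R) j: S \in unitmx -> S *m A = diag_mx d *m S -> x *m A = l *: x -> (x *m invmx S) 0 j != 0 -> l = d 0 j.
Proof.
move=> uS SA xA;have E: x *m invmx S *m diag_mx d = l *: (x *m invmx S). apply: (can_inj (mulmxK uS));rewrite -(mulmxA _ (diag_mx d)) -SA mulmxA mulmxKV// xA. by rewrite -scalemxAl mulmxKV.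
have /rowP/(_ j):= E;rewrite mul_mx_diag !mxE=> E1 c0.
by move: E1;rewrite mulrC=> /(mulIf c0).
Qed.
Lemma gfiltP S (d: 'rV[R]_n) v P z: S \in unitmx -> S *m ad v = diag_mx d *m S -> gfilt v P z <-> forall i, (z *m invmx S) 0 i != 0 -> P (d 0 i).
Proof.
move=> uS SA;split=>[[k [x [l [-> xl lP]]]] j|H]. rewrite mulmx_suml summxE=> H;have [i xi] : exists i, (x i *m invmx S) 0 j != 0.
  apply/existsP;apply: contraNT H;rewrite negb_exists=> /forallP H. by rewrite big1// => i _;apply/eqP;have:= H i;rewrite negbK. rewrite -(eig_co uS SA (xl i) xi);apply: lP.
 by apply: contra_neq xi=> ->;rewrite mul0mx mxE.
exists n, (fun i=> (z *m invmx S) 0 i *: row i S), (fun i=> d 0 i);split.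
- by rewrite -mulmx_sum_row mulmxKV.
- by move=> i;rewrite -scalemxAl (row_eig i SA) !scalerA mulrC.
- by move=> i xi;apply: H;apply: contra_neq xi=> ->;rewrite scale0r.
Qed.
Lemma gfilt_eig v P x (l: R): x *m ad v = l *: x -> P l -> gfilt v P x.
Proof.
move=> xl Pl;exists 1%N, (fun=> x), (fun=> l);split=>//.
by rewrite big_ord1.
Qed.
Lemma gfilt_aut phi v P z: aut phi -> gfilt v P z -> gfilt (v *m phi) P (z *m phi).
Proof.
move=> a [k [x [l [-> xl lP]]]];exists k, (fun i=> x i *m phi), l;split.
- by rewrite mulmx_suml.
- by move=> i;rewrite -mulmxA -(ad_aut _ a) mulmxA xl scalemxAl.
- by move=> i xi;apply: lP;apply: contra_neq xi=> ->;rewrite mul0mx.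
Qed.

(** On automorphisms, the parabolic subgroup fixing the end of the ray with direction [v]; this is
    [pres_asymX] with [asymX_pres]. *)
Definition pres v phi: Prop:= forall nu z, gfilt v (fun s=> nu <= s) z -> gfilt v (fun s=> nu <= s) (z *m phi).

Lemma presP S (d: 'rV[R]_n) v phi: S \in unitmx -> S *m ad v = diag_mx d *m S -> pres v phi <-> forall i j, d 0 j < d 0 i -> (S *m phi *m invmx S) i j = 0.
Proof.
move=> uS SA;split=>[H i j dij|H nu z]. have /H: gfilt v (fun s=> d 0 i <= s) (row i S) by apply: gfilt_eig (row_eig i SA) _. move/(gfiltP _ _ uS SA)/(_ j);rewrite -!row_mul mxE=> H1.
 by apply/eqP;apply/negPn/negP=> /H1;rewrite leNgt dij.
move=> /(gfiltP _ _ uS SA) zP;apply/(gfiltP _ _ uS SA)=> j.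
have -> : z *m phi *m invmx S = (z *m invmx S) *m (S *m phi *m invmx S). by rewrite !mulmxA mulmxKV.
rewrite mxE;apply: contra_neqP=> /negP;rewrite -ltNge=> dj.
apply: big1=> i _;have [->|ci]:= eqVneq ((z *m invmx S) 0 i) 0;first by rewrite mul0r.
by rewrite H ?mulr0//;apply: lt_le_trans dj (zP i ci).
Qed.
Lemma pres_cl th v: cartan th -> ppt th v -> closed [set phi | pres v phi].
Proof.
move=> C pv;have [S [d [F SA]]]:= frame1 C pv.
have -> : [set phi | pres v phi] = \bigcap_(p in [set p: 'I_n * 'I_n | d 0 p.2 < d 0 p.1]) [set phi: 'M[R]_n | (S *m phi *m invmx S) p.1 p.2 = 0 :> R^o].
 apply/seteqP;split=>[phi /(presP _ F.1 SA) H p|phi H];first exact: H. by apply/(presP _ F.1 SA)=> i j dij;exact: (H (i, j)).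
apply: closed_bigI=> p _;apply: cl_cont_eq;last by move=> ?;exact: cst_continuous.
have lin: linear (fun phi: 'M[R]_n=> (S *m phi *m invmx S) p.1 p.2: R^o). by move=> k M N;rewrite mulmxDr -scalemxAr mulmxDl -scalemxAl !mxE.
exact: (@fdim_cont R _ _ (mklin lin) (fmx n n)).
Qed.
Lemma pres1 v: pres v 1%:M. Proof. by move=> nu z;rewrite mulmx1. Qed.
Lemma sum_sqr_le (a: 'I_n -> R): (\sum_i a i) ^+ 2 <= n%:R * \sum_i a i ^+ 2.
Proof.
rewrite expr2 big_distrlr/=;apply: le_trans (_: \sum_i \sum_j (a i ^+ 2 + a j ^+ 2) / 2 <= _). apply: ler_sum=> i _;apply: ler_sum=> j _;have:= sqr_ge0 (a i - a j). rewrite sqrrB;lra.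
set s:= \sum_i a i ^+ 2.
have E i: \sum_j (a i ^+ 2 + a j ^+ 2) / 2 = (a i ^+ 2 * n%:R + s) / 2. by rewrite -big_distrl/= big_split/= sumr_const card_ord mulr_natr.
rewrite (eq_bigr _ (fun i _=> E i)) -big_distrl/= big_split/= -big_distrl/= -/s sumr_const card_ord -mulr_natr;lra.
Qed.
(** Only the entries with [d 0 i <= d 0 j] survive, and the ratios of exponential weights that go
    with them along the ray are at most 1. *)
Lemma pres_q_bound th v phi: cartan th -> ppt th v -> pres v phi -> exists K: R, forall t z, 0 <= t -> qform (geo th v t) (z *m phi) <= K * qform (geo th v t) z.
Proof.
move=> C pv pp;have [S [d [F SA]]]:= frame1 C pv.
move/(presP _ F.1 SA): pp=> M0;set M:= S *m phi *m invmx S in M0.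
exists (n%:R * (n%:R * `|M| ^+ 2))=> t z t0;rewrite /geo !(q_aexp _ t C pv F SA).
have -> : z *m phi *m invmx S = (z *m invmx S) *m M by rewrite /M !mulmxA mulmxKV// F.1.
set c:= z *m invmx S;set s:= \sum_i expR (-2 * t * d 0 i) * c 0 i ^+ 2.
apply: le_trans (_: \sum_(j < n) n%:R * `|M| ^+ 2 * s <= _);last first. by rewrite sumr_const card_ord -[leLHS]mulr_natl !mulrA.
apply: ler_sum=> j _;rewrite mxE.
apply: le_trans (_: expR (-2 * t * d 0 j) * (n%:R * \sum_i (c 0 i * M i j) ^+ 2) <= _). by rewrite ler_wpM2l ?expR_ge0// sum_sqr_le.
rewrite mulrCA -(mulrA n%:R) ler_wpM2l// /s !mulr_sumr;apply: ler_sum=> i _.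
have Z (a b m N y: R): 0 <= a -> a <= b -> `|m| <= N -> a * (y * m) ^+ 2 <= N ^+ 2 * (b * y ^+ 2). move=> a0 ab mN;have -> : a * (y * m) ^+ 2 = m ^+ 2 * (a * y ^+ 2) by ring.
 apply: ler_pM;rewrite ?ler_wpM2r ?sqr_ge0//;first by rewrite mulr_ge0 ?sqr_ge0. by rewrite -[leLHS]real_normK ?num_real// lerXn2r ?nnegrE// (le_trans _ mN).
have [->|Mij]:= eqVneq (M i j) 0. by rewrite mulr0 expr0n mulr0;apply: mulr_ge0; [exact: sqr_ge0|apply: mulr_ge0; [exact: expR_ge0|exact: sqr_ge0]].
have dij: d 0 i <= d 0 j by rewrite leNgt;apply: contra_neqN Mij;exact: M0.
apply: Z; [exact: expR_ge0| |exact: mx_co_le].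
by rewrite ler_expR !mulNr lerN2 ler_wpM2l// mulr_ge0.
Qed.
(** A coordinate that falls out of the filtration would grow exponentially along the ray, against
    the bound [K]. *)
Lemma q_bound_pres th v phi (K: R): cartan th -> ppt th v -> (forall t z, 0 <= t -> qform (geo th v t) (z *m phi) <= K * qform (geo th v t) z) -> pres v phi.
Proof.
move=> C pv H;have [S [d [F SA]]]:= frame1 C pv.
move=> nu z /(gfiltP _ _ F.1 SA) zP;apply/(gfiltP _ _ F.1 SA)=> j cj.
rewrite leNgt;apply/negP=> dj;set c':= (z *m phi *m invmx S) 0 j in cj.
have c2: 0 < c' ^+ 2 by rewrite exprn_even_gt0.
pose s:= \sum_i (z *m invmx S) 0 i ^+ 2;pose K':= `|K| * s.
have s0: 0 <= s by apply: sumr_ge0=> i _;exact: sqr_ge0.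
have K'0: 0 <= K' by rewrite mulr_ge0.
have key t: 0 <= t -> expR (2 * t * (nu - d 0 j)) * c' ^+ 2 <= K'. move=> t0;have:= H t z t0;rewrite /geo !(q_aexp _ t C pv F SA)=> H1.
 have H2: expR (-2 * t * d 0 j) * c' ^+ 2 <= \sum_i expR (-2 * t * d 0 i) * (z *m phi *m invmx S) 0 i ^+ 2. by rewrite (bigD1 j)//= lerDl sumr_ge0// => i _;rewrite mulr_ge0 ?expR_ge0 ?sqr_ge0.
 have H3: \sum_i expR (-2 * t * d 0 i) * (z *m invmx S) 0 i ^+ 2 <= expR (-2 * t * nu) * s. rewrite mulr_sumr;apply: ler_sum=> i _;have [->|ci]:= eqVneq ((z *m invmx S) 0 i) 0.
   by rewrite expr0n !mulr0. rewrite ler_wpM2r ?sqr_ge0// ler_expR !mulNr lerN2 ler_wpM2l ?mulr_ge0//;exact: zP. have H4: expR (-2 * t * d 0 j) * c' ^+ 2 <= `|K| * (expR (-2 * t * nu) * s).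
  apply: le_trans H2 (le_trans H1 _);apply: le_trans (_: `|K| * \sum_i expR (-2 * t * d 0 i) * (z *m invmx S) 0 i ^+ 2 <= _).
   by rewrite ler_wpM2r ?ler_norm// sumr_ge0// => i _;rewrite mulr_ge0 ?expR_ge0 ?sqr_ge0. by rewrite ler_wpM2l. have -> : 2 * t * (nu - d 0 j) = - (-2 * t * nu) + -2 * t * d 0 j by ring.
 rewrite expRD expRN -mulrA ler_pdivrMl ?expR_gt0//;apply: le_trans H4 _. by rewrite /K' mulrCA.
have Z (e c k: R): 0 < e -> 0 < c -> 0 <= k -> (forall t, 0 <= t -> expR (2 * t * e) * c <= k) -> False. move=> e0 c0 k0 /(_ (k / (2 * e * c)));have ec: 0 < 2 * e * c by rewrite !mulr_gt0.
 move=> /(_ (divr_ge0 k0 (ltW ec)));apply/negP;rewrite -ltNge. apply: lt_le_trans (_: (1 + 2 * (k / (2 * e * c)) * e) * c <= _);last by rewrite ler_wpM2r ?(ltW c0)// expR_ge1Dx.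
 rewrite (_: _ * c = c + k) ?ltrDr//;field;rewrite ?gt_eqF//.
by apply: Z key;rewrite ?subr_gt0.
Qed.
(** The condition is turned into a comparison of forms, which [q_bound_sym] reverses, and is then
    read back. *)
Lemma pres_inv th v phi: cartan th -> ppt th v -> aut phi -> pres v phi -> pres v (invmx phi).
Proof.
move=> C pv a pp;have [K KP]:= pres_q_bound C pv pp;have u:= a.1.
apply: (@q_bound_pres th v _ K)=>// t z t0.
have Ct: cartan (geo th v t) by apply: cartan_aexp=>//;exact: p_partZ.
have aV:= autV a;have H: forall z, qform (conjX (invmx phi) (geo th v t)) z <= K * qform (geo th v t) z. by move=> y;rewrite (qform_conjX _ _ aV) invmxK;exact: KP.
have:= q_bound_sym Ct (cartan_conjX aV Ct) H (z *m invmx phi).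
by rewrite (qform_conjX _ _ aV) invmxK mulmxKV.
Qed.
Lemma pres_asymX th v phi: cartan th -> ppt th v -> B v v = 1 -> aut phi -> pres v phi -> asymX (geo th v) (conjX phi \o geo th v).
Proof.
move=> C pv v1 a pp;have r:= rayX_geo C pv v1.
apply/(asymXP r (rayX_conjX a r)).
have [K KP]:= pres_q_bound C pv (pres_inv C pv a pp);exists K=> t z t0.
by rewrite/= (qform_conjX _ _ a);exact: KP.
Qed.
Lemma asymX_pres th v phi: cartan th -> ppt th v -> B v v = 1 -> aut phi -> asymX (geo th v) (conjX phi \o geo th v) -> pres v phi.
Proof.
move=> C pv v1 a;have r:= rayX_geo C pv v1.
move/(asymXP r (rayX_conjX a r))=>[K KP].
rewrite -[phi]invmxK;apply: (pres_inv C pv (autV a)).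
apply: (@q_bound_pres th v _ K)=>// t z t0.
by rewrite -(qform_conjX _ _ a);exact: KP.
Qed.
(** Eigenvalues of [ad v] add under the bracket. *)
Lemma gfilt_ad P Q T v u z: (forall s t, P s -> Q t -> T (s + t)) -> gfilt v P u -> gfilt v Q z -> (exists th, cartan th /\ ppt th v) -> gfilt v T (z *m ad u).
Proof.
move=> PQT Hu Hz [th [C pv]];have [S [d [F SA]]]:= frame1 C pv;have uS:= F.1.
apply/(gfiltP _ _ uS SA)=> j.
have coord y: y = \sum_i (y *m invmx S) 0 i *: row i S by rewrite -mulmx_sum_row mulmxKV.
move/(gfiltP _ _ uS SA): Hu=> Hu;move/(gfiltP _ _ uS SA): Hz=> Hz.
rewrite {1}(coord z) !mulmx_suml summxE;apply: contra_neqP=> nT.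
apply: big1=> i _;have [->|zi]:= eqVneq ((z *m invmx S) 0 i) 0;first by rewrite scale0r !mul0mx mxE.
rewrite mul_admx {1}(coord u) -mul_admx ad_sum mulmx_sumr mulmx_suml summxE.
apply: big1=> k _;have [->|uk]:= eqVneq ((u *m invmx S) 0 k) 0;first by rewrite scale0r ad0 mulmx0 mul0mx mxE.
rewrite mul_admx brZl brZr -!scalemxAl.
set w:= [row k S, row i S];have wE: w *m ad v = (d 0 k + d 0 i) *: w. by rewrite ad_der (row_eig k SA) (row_eig i SA) brZl brZr scalerDl.
suff: (w *m invmx S) 0 j = 0. by move=> E;rewrite mxE [X in _ * X]mxE E !mulr0.
apply/eqP;apply/negPn/negP=> wj;have:= eig_co uS SA wE wj=> E.
by apply: nT;rewrite -E;apply: PQT; [exact: Hu|exact: Hz].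
Qed.
End Filtrations.

(** * Tests for the first and second variation *)

Section Variation.

Lemma small_le0 (X A r: R): 0 < r -> 0 <= A -> (forall t, 0 < t -> t < r -> X <= t * A) -> X <= 0.
Proof.
move=> r0 A0 H;rewrite leNgt;apply/negP=> X0.
have A1: 0 < 2 * (A + 1) by lra.
pose t:= Num.min (r / 2) (X / (2 * (A + 1))).
have t0: 0 < t by rewrite lt_min !divr_gt0.
have tr: t < r by rewrite gt_min;apply/orP;left;lra.
have:= H t t0 tr;rewrite leNgt=> /negP;apply.
apply: le_lt_trans (_: X / (2 * (A + 1)) * A < _). by rewrite ler_wpM2r// ge_min lexx orbT.
rewrite mulrAC ltr_pdivrMr//;nra.
Qed.
Lemma second_order (X Y C r: R): 0 < r -> 0 <= C -> (forall s, `|s| < r -> s * X + s ^+ 2 * Y <= C * `|s| ^+ 3) -> X = 0 /\ Y <= 0.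
Proof.
move=> r0 C0 H;have A0: 0 <= `|Y| + C * r by rewrite addr_ge0 ?mulr_ge0 ?(ltW r0).
have YA: - Y <= `|Y| by rewrite -normrN ler_norm.
have key t X': 0 < t -> t < r -> t * X' + t ^+ 2 * Y <= C * t ^+ 3 -> X' <= t * (`|Y| + C * r). move=> t0 tr H1;rewrite -(ler_pM2l t0).
 have h3: t ^+ 2 * (C * t) <= t ^+ 2 * (C * r) by rewrite ler_wpM2l ?sqr_ge0// ler_wpM2l// ltW. have h4: t ^+ 2 * (- Y) <= t ^+ 2 * `|Y| by rewrite ler_wpM2l ?sqr_ge0.
 move: H1 h3 h4;move: `|Y| => y;rewrite [t ^+ 3]exprS;lra.
have X0: X = 0. apply/eqP;rewrite eq_le -[0 <= X]oppr_le0;apply/andP;split. apply: (small_le0 r0 A0)=> t t0 tr;apply: key=>//. by have:= H t;rewrite (gtr0_norm t0);apply.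
 apply: (small_le0 r0 A0)=> t t0 tr;apply: key=>//. by have:= H (- t);rewrite normrN (gtr0_norm t0) sqrrN mulNr mulrN;apply.
split=>//;apply: (small_le0 r0 C0)=> t t0 tr.
have:= H t;rewrite X0 mulr0 add0r (gtr0_norm t0) [t ^+ 3]exprSr mulrA mulrC=> /(_ tr).
by rewrite [C * _]mulrC -mulrA [leLHS]mulrC ler_pM2l ?exprn_gt0// mulrC.
Qed.
Lemma u_near1 (N: 'M[R]_n): n.+1%:R * `|N| < 1 -> 1%:M + N \in unitmx.
Proof.
move=> N1;rewrite -row_free_unit -kermx_eq0;apply/rowV0P=> x /sub_kermxP.
rewrite mulmxDr mulmx1=> /eqP;rewrite addr_eq0=> /eqP xN.
apply/eqP;rewrite -normr_le0.
have: `|x| <= n.+1%:R * `|N| * `|x|. by rewrite {1}xN normrN (le_trans (mulmx_norm x N))// mulrAC.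
move=> h;rewrite leNgt;apply/negP=> x0;move: h;apply/negP;rewrite -ltNge.
by rewrite gtr_pMl.
Qed.
End Variation.

(** * Parabolic subgroups act transitively on X *)

Section BaseChange.
Implicit Types (H: g) (th phi: 'M[R]_n) (P: R -> Prop).

(** [Phi] plays the role of the exponential of [s *: ad u]. It is chosen for each [s] separately, so
    the expansion to second order and the stability clause are all that later arguments may use. *)
Lemma inner_flow u: exists C r: R, [/\ 0 <= C, 0 < r & forall s, `|s| < r -> exists Phi, [/\ aut Phi, forall Q: set 'M[R]_n, closed Q -> Q 1%:M ->
   (forall A c, Q A -> Q (A + c *: (A *m ad u))) -> Q Phi, `|Phi - 1%:M| <= C * `|s| & `|Phi - 1%:M - s *: ad u - (s ^+ 2 / 2) *: (ad u *m ad u)| <= C * `|s| ^+ 3]].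
Proof.
set N: R:= n.+1%:R;have N1: 1 <= N by rewrite ler1n.
have N0: 0 < N by apply: lt_le_trans N1.
set b:= N * `|ad u|;have b0: 0 <= b by rewrite mulr_ge0// ltW.
have Q0: 0 < 4 * N * (b + 1) by rewrite !mulr_gt0// ltr_wpDl.
exists (b ^+ 3 + 2 * b + b ^+ 3), (4 * N * (b + 1))^-1;split=>[||s sr].
- by rewrite !addr_ge0 ?exprn_ge0 ?mulr_ge0.
- by rewrite invr_gt0.
have a1: 4 * N * (b * `|s|) < 1. have s0:= normr_ge0 s;move: sr;rewrite -[X in _ < X]div1r ltr_pdivlMr// => sr. apply: le_lt_trans sr;rewrite mulrA [leRHS]mulrC ler_wpM2r// ler_wpM2l ?lerDl//.
 by rewrite mulr_ge0// ltW.
have a0: 0 <= b * `|s| by rewrite mulr_ge0.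
have nD: n.+1%:R * `|s *: ad u| = b * `|s| by rewrite normrZ /b -/N mulrCA mulrC.
have a2: b * `|s| <= 4^-1. rewrite -[leRHS]div1r ler_pdivlMr//;apply: le_trans (ltW a1). by move: a0 N1;move: (b * `|s|)=> a;clear -L;nra.
have [Phi [PM PQ /(_ _)PN]]:= @exp_der R n br brk_linl brk_linr (s *: ad u) (fun x y=> ltac:(by rewrite -!scalemxAr ad_der brZl brZr scalerDr)).
have {}PN: `|Phi - 1%:M - s *: ad u - (s ^+ 2 / 2) *: (ad u *m ad u)| <= (b * `|s|) ^+ 3. rewrite -nD;have -> : (s ^+ 2 / 2) *: (ad u *m ad u) = 2^-1 *: (s *: ad u *m (s *: ad u)).
  by rewrite -scalemxAl -scalemxAr !scalerA;congr (_ *: _);ring. by apply: PN;rewrite nD;lra.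
have a3: (b * `|s|) ^+ 3 <= b * `|s| * 16^-1. rewrite exprS ler_wpM2l//;apply: le_trans (_: 4^-1 ^+ 2 <= _);last by lra. by rewrite lerXn2r ?nnegrE//;lra.
have Phi1: N * `|Phi - 1%:M| <= (1 + 2^-1 + N * 16^-1) * (b * `|s|). have -> : Phi - 1%:M = (Phi - 1%:M - s *: ad u - (s ^+ 2 / 2) *: (ad u *m ad u)) + (s *: ad u + (s ^+ 2 / 2) *: (ad u *m ad u)).
  by zmod. apply: le_trans (_: N * ((b * `|s|) ^+ 3 + (`|s *: ad u| + `|(s ^+ 2 / 2) *: (ad u *m ad u)|)) <= _). by rewrite ler_wpM2l ?(ltW N0)// (le_trans (ler_normD _ _))// lerD// ler_normD.
 have h1: N * `|(s ^+ 2 / 2) *: (ad u *m ad u)| <= (b * `|s|) ^+ 2 / 2. rewrite normrZ normrM normrX (ger0_norm (_: 0 <= 2^-1 :> R))//. have:= mulmx_norm (ad u) (ad u);rewrite -/N -/b=> h.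
  have -> : (b * `|s|) ^+ 2 / 2 = N * (`|s| ^+ 2 / 2 * (b * `|ad u|)) by rewrite exprMn /b;ring. by rewrite ler_wpM2l ?(ltW N0)// ler_wpM2l// mulr_ge0 ?sqr_ge0.
 have h2: N * ((b * `|s|) ^+ 3) <= N * (b * `|s| * 16^-1) by rewrite ler_wpM2l// ltW. rewrite !mulrDr nD;move: h1 h2 a2 a0;move: (N * `|_|) (N * _ ^+ 3)=> p q. by move: (b * `|s|)=> a;nra.
have aP: aut Phi. split=>//;have -> : Phi = 1%:M + (Phi - 1%:M) by zmod. apply: u_near1;apply: le_lt_trans Phi1 _. by move: a1 N1 a0;move: (b * `|s|)=> a;nra.
exists Phi;split=>//.
- move=> Q cQ Q1 QS;apply: PQ=>// A c QA;rewrite -scalemxAr scalerA;exact: QS.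
- apply: le_trans (_: (1 + 2^-1 + N * 16^-1) * (b * `|s|) / N <= _). by rewrite ler_pdivlMr// mulrC. rewrite ler_pdivrMr//;apply: le_trans (_: 2 * b * `|s| * N <= _);last first.
  rewrite ler_wpM2r ?(ltW N0)// ler_wpM2r// -addrA addrCA lerDl. by rewrite addr_ge0// exprn_ge0. by rewrite -(mulrA 2);move: a0 N1;move: (b * `|s|)=> a;nra.
apply: le_trans PN _;rewrite exprMn ler_wpM2r ?exprn_ge0// lerDr addr_ge0 ?exprn_ge0//.
by rewrite mulr_ge0.
Qed.

(** By [energyE], the sum of the form of [th'] over the image of any orthonormal frame of [th]. The
    trace shows continuity in [phi] and that the frame does not matter. *)
Definition energy th th' phi: R:= \tr (phi *m gram_of th' *m phi^T *m invmx (gram_of th)).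

Lemma energyE th th' phi S: frame th S -> energy th th' phi = \sum_i qform th' (row i S *m phi).
Proof.
move=>[uS SG];have GE: invmx (gram_of th) = S^T *m S. have uG: gram_of th \in unitmx. have: S *m gram_of th *m S^T \in unitmx by rewrite SG unitmx1. by rewrite !unitmx_mul=> /andP[/andP[]].
 apply: (can_inj (mulmxK uG));rewrite mulVmx//. apply: (can_inj (mulKmx uS));rewrite mulmx1 !mulmxA.
 by apply: (can_inj (mulmxK (_: S^T \in unitmx)));rewrite ?unitmx_tr// -!mulmxA (mulmxA S (gram_of _)) SG mulmx1.
rewrite /energy GE mulmxA mxtrace_mulC !mulmxA -(mulmxA (S *m phi *m _)) -trmx_mul.
rewrite /mxtrace;apply: eq_bigr=> i _;rewrite -row_mul.
have -> z: qform th' z = (z *m gram_of th' *m z^T) 0 0 by rewrite gram_ofE.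
rewrite -row_mul [LHS]mxE [RHS]mxE;apply: eq_bigr=> j _;congr (_ * _). by rewrite [RHS]mxE.
by rewrite [LHS]mxE [RHS]mxE [RHS]mxE.
Qed.
Lemma energy_min th th' (Q: set 'M[R]_n): cartan th -> cartan th' -> closed Q -> Q 1%:M -> exists2 phi, Q phi & forall psi, Q psi -> energy th th' phi <= energy th th' psi.
Proof.
move=> C C' cQ Q1;apply: (mx_min cQ) Q1 _. move=> phi;apply: (@continuous_comp _ _ _ (fun phi=> phi *m gram_of th' *m phi^T *m invmx (gram_of th)) (@mxtrace R n)).
  apply: mulmx_cont;last exact: cst_continuous. apply: mulmx_cont;first exact: mulmxr_cont. by apply: mx_lin_cont=> k M N;rewrite linearD linearZ.
 have lin: linear (@mxtrace R n: 'M[R]_n -> R^o) by move=> k M N;rewrite mxtraceD mxtraceZ. exact: (@fdim_cont R _ _ (mklin lin) (fmx n n)).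
have [S F _]:= frame_ex (A:= set0) C (fun _ f=> False_ind _ f) (fun _ _ f=> False_ind _ f).
have [S' F' _]:= frame_ex (A:= set0) C' (fun _ f=> False_ind _ f) (fun _ _ f=> False_ind _ f).
set E:= energy th th' 1%:M.
exists (n.+1%:R * (n.+1%:R * `|invmx S| * (E + 1)) * `|S'|)=> phi _ H.
have {}H i j: `|(S *m phi *m invmx S') i j| <= E + 1. have h: (S *m phi *m invmx S') i j ^+ 2 <= E. apply: le_trans H;rewrite (energyE _ _ F) (bigD1 i)//=.
  apply: le_trans (_: qform th' (row i S *m phi) <= _);last first. by rewrite lerDl sumr_ge0// => k _;exact: qform_ge0.
  rewrite (frame_q _ F') (bigD1 j)//= -!row_mul [X in _ <= X ^+ 2 + _]mxE lerDl sumr_ge0// => k _. exact: sqr_ge0. have E0: 0 <= E by apply: le_trans h;exact: sqr_ge0.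
 move: h;rewrite -[X in X <= E]real_normK ?num_real//;have:= normr_ge0 ((S *m phi *m invmx S') i j);nra.
have E1: 0 <= E + 1. rewrite /E (energyE _ _ F) addr_ge0// sumr_ge0// => k _;exact: qform_ge0.
have {}H: `|S *m phi *m invmx S'| <= E + 1. exact: mx_norm_leP.
have -> : phi = invmx S *m (S *m phi *m invmx S') *m S'. by rewrite !mulmxA mulVmx ?F.1// mul1mx mulmxKV// F'.1.
apply: le_trans (mulmx_norm _ _) _;rewrite ler_wpM2r// ler_wpM2l// (le_trans (mulmx_norm _ _))//.
by rewrite ler_wpM2l// mulr_ge0.
Qed.
(** Invertibility is not a closed condition. Preserving the Killing form is one, and it implies
    invertibility. *)
Lemma aut_cl: closed [set phi | aut phi].
Proof.
have -> : [set phi | aut phi] = (\bigcap_(p in setT) [set phi: 'M[R]_n | [p.1, p.2] *m phi = [p.1 *m phi, p.2 *m phi]]) `&` [set phi | phi *m Kmx *m phi^T = Kmx].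
 apply/seteqP;split=>[phi [u a]|phi [a K]]. by split=>[p _|]; [exact: a|exact: aut_Kmx]. by apply: aut_cl_form=>// x y;exact: (a (x, y)).
apply: closedI. apply: closed_bigI=> p _;apply: cl_cont_eq;first exact: mulmxl_cont. move=> phi. have -> : (fun M: 'M[R]_n=>[p.1 *m M, p.2 *m M]) = (fun M=> p.2 *m M *m ad (p.1 *m M)).
  by apply/funext=> M;rewrite mul_admx. apply: (@mulmx_cont R 'M[R]_n 1 n n (fun M=> p.2 *m M) (fun M=> ad (p.1 *m M)));first exact: mulmxl_cont.
 apply: mx_lin_cont=> k M N;rewrite mulmxDr -scalemxAr;exact: admx_lin.
apply: cl_cont_eq;last by move=> ?;exact: cst_continuous.
move=> phi;apply: (@mulmx_cont R 'M[R]_n n n n (fun M=> M *m Kmx) trmx);first exact: mulmxr_cont.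
by apply: mx_lin_cont=> k M N;rewrite linearD linearZ.
Qed.
Lemma tr_ad0 th v: cartan th -> ppt th v -> \tr (ad v) = 0.
Proof.
move=> C pv;have [_ tt _]:= C;have E: ad v *m th = - (th *m ad v). by rewrite (ad_aut _ (cartan_aut C)) pv adN mulmxN.
have: \tr (ad v) = - \tr (ad v). by rewrite -[in LHS](mulmx1 (ad v)) -tt mulmxA E mulNmx linearN/= mxtrace_mulC mulmxA tt mul1mx.
lra.
Qed.

(* The energy of [psi] is a sum of the [exp (-2 d i)], where [d i] are the eigenvalues of the displacement [v] of
   [th], and it decreases along the part [u] of [2 v] that lies in the parabolic subalgebra of [H0], as [u] differs
   from [v] by an element that fixes the base point. *)
Lemma base_change th th' H0 (A: set g): cartan th -> cartan th' -> ppt th' H0 -> (forall H, A H -> [/\ ppt th' H, [H0, H] = 0 & forall x (a b: R), x != 0 ->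
   x *m ad H0 = a *: x -> x *m ad H = b *: x -> 0 <= a -> 0 <= b]) -> exists phi, [/\ aut phi, conjX phi th' = th & forall H, A H -> pres H phi].
Proof.
move=> C C' p0 HA.
pose Q:= [set phi | aut phi /\ forall H, A H -> pres H phi].
have cQ: closed Q. have -> : Q = [set phi | aut phi] `&` \bigcap_(H in A) [set phi | pres H phi] by []. apply: closedI;first exact: aut_cl.
 by apply: closed_bigI=> H /HA[pH _ _];exact: (pres_cl C' pH).
have Q1: Q 1%:M by split=>[|H _]; [exact: aut1|exact: pres1].
have [psi [ap pp] pm]:= energy_min C C' cQ Q1.
have aV:= autV ap;have [th2 th2E] : exists t, t = conjX (invmx psi) th' by exists (conjX (invmx psi) th').
have C2: cartan th2 by rewrite th2E;exact: cartan_conjX.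
have [v pv vE]:= cartan_joined C C2.
have [S [d [F Sd]]]:= frame1 C pv.
have E1: aexp v th = th *m fcalc S (fun s=> expR (2 * 1 * s)) d. by rewrite -(aexpE 1 C pv F.1 Sd) scale1r.
have p2: ppt th2 v by rewrite -vE -[v in aexp v _]scale1r;exact: aexp_p.
pose H2:= H0 *m invmx psi;have pH2: ppt th2 H2 by rewrite th2E;exact: (p_part_conjX aV p0).
have [S2 [d2 [F2 Sd2]]]:= frame1 C2 pH2.
(* [f] is the sign of [ad H2]. It anticommutes with [th2], so [k] is fixed by [th2], while
   [u = v + k] has lost all components with negative eigenvalue. This splits [v] into an isotropy
   part and a parabolic part. *)
have [f fE] : exists f: 'M[R]_n, forall x (a: R), x *m ad H2 = a *: x -> x *m f = Num.sg a *: x. by exists (fcalc S2 Num.sg d2)=> x a;exact: (fcalc_eig _ F2.1 Sd2).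
have fth: f *m th2 = - (th2 *m f). apply: (u_rows_ext F2.1)=> i;have Ei:= row_eig i Sd2. rewrite mulmxA (fE _ _ Ei) mulmxN mulmxA (fE _ _ (p_eig_th C2 pH2 Ei)).
 by rewrite -scalemxAl sgrN scaleNr opprK.
set k:= v *m f;have kth: k *m th2 = k by rewrite /k -mulmxA fth mulmxN mulmxA p2 mulNmx opprK.
pose u:= v + k.
have filt H: A H -> gfilt (H *m invmx psi) (fun s=> 0 <= s) u. move=> AH;have [pH c0 HP]:= HA _ AH;set H':= H *m invmx psi. have pH': ppt th2 H' by rewrite th2E;exact: (p_part_conjX aV pH).
 have c2: [H2, H'] = 0 by rewrite -aV.2 c0 mul0mx. have []:= frame_ex (A:= [set H2; H']) C2.
 - by move=> w [->|->].
 - by move=> w w' [->|->] [->|->];rewrite ?brxx//;rewrite brC c2 oppr0. move=> S3 F3 S3P;have [a aE]:= S3P _ (or_introl erefl);have [b bE]:= S3P _ (or_intror erefl).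
 apply/(gfiltP _ _ F3.1 bE)=> i;have Ea:= row_eig i aE;have Eb:= row_eig i bE. have sf: S3 *m f = diag_mx (map_mx Num.sg a) *m S3.
  apply/row_matrixP=> j;rewrite row_mul (fE _ _ (row_eig j aE)) row_mul row_diag_mx -scalemxAl -rowE. by rewrite mxE. have -> : (u *m invmx S3) 0 i = (v *m invmx S3) 0 i * (1 + Num.sg (a 0 i)).
  have -> : u *m invmx S3 = v *m invmx S3 + (v *m invmx S3) *m diag_mx (map_mx Num.sg a). rewrite mulmxDl;congr (_ + _);apply: (can_inj (mulmxK F3.1)).
   by rewrite mulmxKV ?F3.1// -(mulmxA _ (diag_mx _)) -sf mulmxA mulmxKV// F3.1. by rewrite mxE mul_mx_diag [X in _ + X]mxE [map_mx _ _ _ _]mxE mulrDr mulr1. move=> nz;have a0: 0 <= a 0 i.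
  by rewrite leNgt;apply: contra_neqN nz=> a0;rewrite ltr0_sg// addrN mulr0. have n0: row i S3 *m psi != 0.
  apply: contra_neq (row_u_neq0 i F3.1)=> E;by rewrite -[row i S3](mulmxK ap.1) E mul0mx. apply: (HP (row i S3 *m psi) (a 0 i))=>//;rewrite scalemxAl -(Ea, Eb).
  by rewrite -[H0](mulmxKV ap.1) -/H2 -mulmxA -(ad_aut _ ap) mulmxA. by rewrite -[H](mulmxKV ap.1) -/H' -mulmxA -(ad_aut _ ap) mulmxA.
have q2 z: qform th' (z *m psi) = qform th2 z by rewrite th2E (qform_conjX _ _ aV) invmxK.
have ip2 i z: B z (row i S *m th2) = expR (- 2 * d 0 i) * B z (row i S *m th). have -> : row i S *m th2 = expR (- 2 * d 0 i) *: (row i S *m th).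
  rewrite -vE E1 mulmxA (fcalc_eig _ F.1 Sd (p_eig_th C pv (row_eig i Sd))). by congr (expR _ *: _);ring. by rewrite BZr.
(* This is the first variation of the energy at its minimum along [inner_flow u]. The part [k]
   contributes nothing, being skew for the form of [th2]. *)
have D0: \sum_i expR (- 2 * d 0 i) * d 0 i = 0. pose bm (M N: 'M[R]_n): R^o:= \sum_i - B (row i S *m M) (row i S *m N *m th2). have bmDl M N T: bm (M + N) T = bm M T + bm N T.
  by rewrite -big_split;apply: eq_bigr=> i _;rewrite mulmxDr BDl opprD. have bmDr M N T: bm T (M + N) = bm T M + bm T N.
  by rewrite -big_split;apply: eq_bigr=> i _;rewrite mulmxDr mulmxDl BDr opprD. have bmZl a M N: bm (a *: M) N = a * bm M N.
  by rewrite /bm mulr_sumr;apply: eq_bigr=> i _;rewrite -scalemxAr BZl mulrN. have bmZr a M N: bm M (a *: N) = a * bm M N.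
  by rewrite /bm mulr_sumr;apply: eq_bigr=> i _;rewrite -scalemxAr -scalemxAl BZr mulrN. have bmC M N: bm M N = bm N M. by apply: eq_bigr=> i _;rewrite (cartan_sym _ _ C2).
 have [K K0 KP] : exists2 K: R, 0 <= K & forall M N, `|bm M N| <= K * `|M| * `|N|. have [_ _ [K K0 KP]] : bilin_map bm. apply: (fdim_bilin (fmx n n) (fmx n n)).
    by move=> N a M M';rewrite bmDl bmZl. by move=> N a M M';rewrite bmDr bmZr. by exists K=>//;exact: ltW. have en phi: energy th th' (phi *m psi) = bm phi phi.
  by rewrite (energyE _ _ F);apply: eq_bigr=> i _;rewrite mulmxA q2. have [Cf [r [C0 r0 flow]]]:= inner_flow u.
 have Dv i: - B (row i S *m 1%:M) (row i S *m ad u *m th2) = expR (- 2 * d 0 i) * d 0 i. rewrite mulmx1 (cartan_sym _ _ C2) adD mulmxDr BDl. have -> : B (row i S *m ad k) (row i S *m th2) = 0.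
   suff: B (row i S *m ad k) (row i S *m th2) = - B (row i S *m ad k) (row i S *m th2) by lra. rewrite {1}mul_admx B_ad -{1}kth;have [Ca _ _]:= C2;rewrite -Ca -mul_admx.
   by rewrite (cartan_sym _ _ C2). have fr: - B (row i S) (row i S *m th) = 1 by exact: (frame_row i F). by rewrite addr0 (row_eig i Sd) BZl ip2 -[RHS]mulr1 -fr;ring.
 have DE: bm 1%:M (ad u) = \sum_i expR (- 2 * d 0 i) * d 0 i by apply: eq_bigr=> i _;exact: Dv. rewrite -DE;set X:= bm _ _;pose DD:= ad u *m ad u.
 pose C2':= 2 * (K * `|1%:M: 'M[R]_n| * (`|DD| + Cf * r)) + K * Cf * Cf. suff HS s: `|s| < r -> s * (- (2 * X)) + s ^+ 2 * (- C2') <= 0 * `|s| ^+ 3.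
  have [+ _]:= second_order r0 (lexx 0) HS;by move=> /eqP;rewrite oppr_eq0 mulf_eq0 pnatr_eq0=> /eqP. move=> sr. have [Phi [aP PQ P1 P2]]:= flow s sr;rewrite mul0r. have QP: Q (Phi *m psi).
  split=>[|H AH];first exact: autM. have [pH _ _]:= HA _ AH;have pH': ppt th2 (H *m invmx psi) by rewrite th2E;exact: (p_part_conjX aV pH). have pPhi: pres (H *m invmx psi) Phi.
   apply: PQ; [exact: (pres_cl C2 pH')|exact: pres1|move=> M c MP nu z zf]. have [S3 [d3 [F3 Sd3]]]:= frame1 C2 pH'.
   have h1:= MP nu z zf;have h2: gfilt (H *m invmx psi) (fun s=> nu <= s) (z *m M *m ad u). by apply: (gfilt_ad _ (filt H AH) h1); [move=> a b;lra|exists th2].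
   move/(gfiltP _ _ F3.1 Sd3): h1=> h1;move/(gfiltP _ _ F3.1 Sd3): h2=> h2. apply/(gfiltP _ _ F3.1 Sd3)=> j;rewrite mulmxDr -scalemxAr mulmxDl -scalemxAl mulmxA.
   rewrite mxE [X in _ + X]mxE=> nz. have [z1|/h1//]:= eqVneq ((z *m M *m invmx S3) 0 j) 0;apply: h2. by apply: contra_neq nz=> z2;rewrite z1 z2 mulr0 addr0.
  move=> nu z zf;have h1:= pp H AH nu z zf;have h2:= gfilt_aut aV h1. rewrite mulmxK ?ap.1// in h2;have h3:= gfilt_aut ap (pPhi _ _ h2). by rewrite mulmxA;rewrite mulmxKV ?ap.1// in h3.
 have:= pm _ QP;rewrite en -[psi in energy _ _ psi]mul1mx en. set N:= Phi - 1%:M - s *: ad u;set M:= Phi - 1%:M. have PE: Phi = 1%:M + M by rewrite /M;zmod.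
 have ME: M = s *: ad u + N by rewrite /N /M;zmod. have NB: `|N| <= (`|DD| + Cf * r) * s ^+ 2. have -> : N = (Phi - 1%:M - s *: ad u - (s ^+ 2 / 2) *: DD) + (s ^+ 2 / 2) *: DD by rewrite /N;zmod.
  apply: le_trans (ler_normD _ _) _;rewrite normrZ normrM normrX (ger0_norm (_: 0 <= 2^-1 :> R))//. rewrite real_normK ?num_real//;have h: Cf * `|s| ^+ 3 <= Cf * r * s ^+ 2.
   by rewrite exprS real_normK ?num_real// mulrA ler_wpM2r ?sqr_ge0// ler_wpM2l// ltW. rewrite mulrDl [leRHS]addrC;apply: lerD;first exact: le_trans P2 h.
  by rewrite [leRHS]mulrC ler_wpM2r//;have:= sqr_ge0 s;lra. have b1: bm 1%:M N <= K * `|1%:M: 'M[R]_n| * ((`|DD| + Cf * r) * s ^+ 2).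
  by apply: le_trans (ler_norm _) (le_trans (KP _ _) _);rewrite ler_wpM2l// mulr_ge0. have b2: bm M M <= K * (Cf * `|s|) * (Cf * `|s|). apply: le_trans (ler_norm _) (le_trans (KP _ _) _).
  by apply: ler_pM=>//; [rewrite mulr_ge0|rewrite ler_wpM2l]. clearbody M N. have e1: bm Phi Phi = bm 1%:M 1%:M + 2 * bm 1%:M M + bm M M.
  by rewrite PE bmDl !bmDr (bmC M 1%:M) mulr_natl mulr2n !addrA. have e2: bm 1%:M M = s * X + bm 1%:M N by rewrite ME bmDr bmZr. rewrite e1 e2 /C2';move: b1 b2.
 have -> : K * (Cf * `|s|) * (Cf * `|s|) = K * Cf * Cf * s ^+ 2. by rewrite -[s ^+ 2]real_normK ?num_real//;ring.
 have Z (a b c e x k1 p t k2: R): b <= k1 * (p * t) -> c <= k2 * t -> a <= a + 2 * (e * x + b) + c -> e * (- (2 * x)) + t * (- (2 * (k1 * p) + k2)) <= 0 by lra. exact: Z.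
(* As the [d 0 i] sum to 0, the nonnegative terms [(1 - expR (- 2 * d 0 i)) * d 0 i] sum to 0 as
   well, and every one of them vanishes. *)
have d0 i: d 0 i = 0. have T0: \sum_i d 0 i = 0. have:= tr_ad0 C pv;rewrite (mx_diagE F.1 Sd) -mulmxA mxtrace_mulC (mulmxK F.1). by rewrite mxtrace_diag.
 have H j: 0 <= (1 - expR (- 2 * d 0 j)) * d 0 j. have [d0|/ltW d0]:= leP 0 (d 0 j). by rewrite mulr_ge0// subr_ge0 -[leRHS]expR0 ler_expR;lra.
  by rewrite mulr_le0// subr_le0 -[leLHS]expR0 ler_expR;lra. have: \sum_i (1 - expR (- 2 * d 0 i)) * d 0 i = 0.
  transitivity (\sum_i d 0 i - \sum_i expR (- 2 * d 0 i) * d 0 i);last by rewrite T0 D0 subr0. by rewrite -sumrB;apply: eq_bigr=> j _;rewrite mulrBl mul1r.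
 move/eqP;rewrite psumr_eq0// => /allP/(_ i (mem_index_enum _))/=. rewrite mulf_eq0=> /orP[|/eqP//];rewrite subr_eq0=> /eqP/esym/eqP. by rewrite -[X in _ == X]expR0=> /eqP/expR_inj;lra.
have v0: v = 0. apply: ad_inj;rewrite ad0;apply: (u_rows_ext F.1)=> i. by rewrite (row_eig i Sd) d0 scale0r mulmx0.
exists (invmx psi);split=>//. rewrite -th2E -vE E1 -[RHS]mulmx1;congr (_ *m _);apply: (u_rows_ext F.1)=> i. by rewrite (fcalc_eig _ F.1 Sd (row_eig i Sd)) d0 mulr0 expR0 scale1r mulmx1.
by move=> H AH;have [pH _ _]:= HA _ AH;apply: (pres_inv C' pH ap);exact: pp.
Qed.
End BaseChange.

(** * Simplices and chambers as cones of directions *)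

Section Cones.
Implicit Types (H K: g) (th phi: 'M[R]_n) (a b: {vspace g}).

(** The closed simplex spanned by [H0], with joint eigenvectors in place of roots. It refers to no
    maximal flat; [csimpE] identifies it with the simplex in each flat whose direction space
    contains [H0]. *)
Definition cone th H0: set g:= [set H | [/\ ppt th H, B H H = 1, [H0, H] = 0 & forall x (s t: R), x != 0 -> x *m ad H0 = s *: x -> x *m ad H = t *: x -> (0 < s -> 0 <= t) /\ (s = 0 -> t = 0)]].

Lemma cone_refl th H0: ppt th H0 -> B H0 H0 = 1 -> cone th H0 H0.
Proof.
move=> p0 b0;split=>//;first exact: brxx.
move=> x s t x0 -> /eqP;rewrite -subr_eq0 -scalerBl scaler_eq0 (negPf x0) orbF subr_eq0=> /eqP ->.
by split=>// /ltW.
Qed.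
Lemma cone_ge0 th H0 H x (s t: R): cone th H0 H -> x != 0 -> x *m ad H0 = s *: x -> x *m ad H = t *: x -> 0 <= s -> 0 <= t.
Proof.
move=>[_ _ _ HP] x0 xs xt;have [h1 h2]:= HP x s t x0 xs xt.
by rewrite le_eqVlt=> /orP[/eqP/esym/h2->|/h1].
Qed.

Definition abelian_in_p th b:= (forall x, x \in b -> ppt th x) /\ (forall x y, x \in b -> y \in b -> [x, y] = 0).

Definition max_ab th a: Prop:= abelian_in_p th a /\ forall b, abelian_in_p th b -> (a <= b)%VS -> b = a.

Definition is_root a h: Prop:= [/\ h \in a, h != 0 & exists2 x: g, x != 0 & forall H, H \in a -> [H, x] = B h H *: x].

Definition usphere a: set g:= [set H | H \in a /\ B H H = 1].

Definition csimp a (H0: g): set g:= [set H | usphere a H /\ forall h, is_root a h -> (0 < B h H0 -> 0 <= B h H) /\ (B h H0 = 0 -> B h H = 0)].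

Definition is_reg a (H0: g): Prop:= usphere a H0 /\ forall h, is_root a h -> B h H0 != 0.

Lemma p_partD th x y: ppt th x -> ppt th y -> ppt th (x + y).
Proof. by move=> px py;rewrite /ppt/= mulmxDl px py opprD. Qed.
Lemma max_ab_ex th b: abelian_in_p th b -> exists2 a, max_ab th a & (b <= a)%VS.
Proof.
move=> bP;pose P k:= `[< exists a, [/\ abelian_in_p th a, (b <= a)%VS & \dim a = k] >].
have exP: exists k, P k by exists (\dim b);apply/asboolP;exists b.
have bdP k: P k -> (k <= \dim {:g})%N. by move=> /asboolP[a [_ _ <-]];apply: dimvS;exact: subvf.
case: (ex_maxnP exP bdP)=> k /asboolP[a [aP ba <-]] kmax;exists a=>//;split=>// c cP ac.
apply/esym/eqP;rewrite eqEdim ac/=;apply: kmax;apply/asboolP;exists c;split=>//.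
exact: subv_trans ba ac.
Qed.
Lemma max_ab_mem th a H: max_ab th a -> ppt th H -> (forall K, K \in a -> [H, K] = 0) -> H \in a.
Proof.
move=>[[ap ac] am] pH Hc;have <- : (a + <[H]>)%VS = a. apply: am;last exact: addvSl. split=>[x /memv_addP[y ya [_ /vlineP[k ->] ->]]|]. by apply: p_partD; [exact: ap|exact: p_partZ].
 move=> x y /memv_addP[x1 x1a [_ /vlineP[k1 ->] ->]] /memv_addP[y1 y1a [_ /vlineP[k2 ->] ->]]. rewrite !brDl !brDr !brZl !brZr brxx Hc// (brC x1 H) Hc// (ac _ _ x1a y1a).
 by rewrite oppr0 !scaler0 !addr0.
by apply: (subvP (addvSr _ _));exact: memv_line.
Qed.
Lemma ab_pair th H K: ppt th H -> ppt th K -> [H, K] = 0 -> abelian_in_p th (<[H]> + <[K]>)%VS.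
Proof.
move=> pH pK HK;split=>[x /memv_addP[_ /vlineP[k ->] [_ /vlineP[l ->] ->]]|]. by apply: p_partD;exact: p_partZ.
move=> x y /memv_addP[_ /vlineP[k1 ->] [_ /vlineP[l1 ->] ->]] /memv_addP[_ /vlineP[k2 ->] [_ /vlineP[l2 ->] ->]].
rewrite !brDl !brDr !brZl !brZr !brxx HK (brC K H) HK.
by rewrite oppr0 !scaler0 !addr0.
Qed.
Lemma nonzero_co S x: S \in unitmx -> x != 0 -> exists j, (x *m invmx S) 0 j != 0.
Proof.
move=> uS x0;apply/existsP;apply: contraNT x0;rewrite negb_exists=> /forallP H.
rewrite -[x](mulmxKV uS) (_: x *m invmx S = 0) ?mul0mx//.
by apply/rowP=> j;rewrite [RHS]mxE;apply/eqP;have:= H j;rewrite negbK.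
Qed.

Section Apartment.
Variables (th: 'M[R]_n) (a: {vspace g}).
Hypotheses (C: cartan th) (am: max_ab th a).

(* The functionals [fun H => D H 0 j] on [a] are the restricted roots and zero. *)
Lemma root_frame: exists S (D: g -> 'rV[R]_n), [/\ frame th S, forall H, H \in a -> S *m ad H = diag_mx (D H) *m S, forall s t H K, D (s *: H + t *: K) = s *: D H + t *: D K,
 forall h, is_root a h -> exists j, forall H, H \in a -> B h H = D H 0 j & forall j K, K \in a -> D K 0 j != 0 -> exists2 h, is_root a h & forall H, H \in a -> B h H = D H 0 j].
Proof.
have [[ap ac] amax]:= am.
have [S F SP]:= @frame_ex th [set H | H \in a] C ap ac.
pose D H: 'rV[R]_n:= \row_j (S *m ad H *m invmx S) j j.
have SD H: H \in a -> S *m ad H = diag_mx (D H) *m S. move=> Ha;have [d dE]:= SP _ Ha;suff -> : D H = d by []. by apply/rowP=> j;rewrite mxE dE mulmxK ?F.1// mxE eqxx mulr1n.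
exists S, D;split=>//.
- move=> s t H K;apply/rowP=> j;rewrite [RHS]mxE [X in _ = X + _]mxE [X in _ = _ + X]mxE /D [LHS]mxE. rewrite [X in _ = s * X + _]mxE [X in _ = _ + t * X]mxE.
 by rewrite adD !adZ mulmxDr mulmxDl -!scalemxAr -!scalemxAl [LHS]mxE [X in X + _ = _]mxE [X in _ + X = _]mxE.
- move=> h [_ _ [x x0 xP]];have [j xj]:= nonzero_co F.1 x0;exists j=> H Ha. by apply: (eig_co F.1 (SD _ Ha) _ xj);rewrite mul_admx xP.
move=> j K Ka Kj;set x:= row j S;have xE H: H \in a -> [H, x] = D H 0 j *: x. by move=> Ha;rewrite -mul_admx (row_eig j (SD _ Ha)).
have xt H: H \in a -> [H, x *m th] = - D H 0 j *: (x *m th). by move=> Ha;rewrite -mul_admx (p_eig_th C (ap _ Ha) (row_eig j (SD _ Ha))).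
(* For a unit eigenvector [x], the vector [- [x, x *m th]] lies in [a] and represents the root. *)
have hB H: H \in a -> B (- [x, x *m th]) H = D H 0 j. move=> Ha;rewrite BNl B_ad (brC x H) xE// !BNr opprK BZr kilC. by rewrite -mulrN (_: - _ = 1) ?mulr1//;exact: (frame_row j F).
have [Ct tt _]:= C.
have pB: ppt th (- [x, x *m th]). by rewrite /ppt/= mulNmx Ct -mulmxA tt mulmx1 (brC (x *m th)) opprK.
exists (- [x, x *m th])=>//;split.
- apply: (max_ab_mem am pB)=> H Ha;rewrite brC brNr opprK br_jacobi (xE H Ha) (xt H Ha). by rewrite brZl brZr -scalerDl addrN scale0r.
- apply: contra_neq Kj=> h0;by rewrite -hB// h0 B0l.
exists x;first exact: (row_u_neq0 j F.1).
by move=> H Ha;rewrite xE// hB.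
Qed.
Lemma csimpE H0: H0 \in a -> csimp a H0 = cone th H0.
Proof.
move=> H0a;have [S [D [F SD Dl rD Dr]]]:= root_frame;have [[ap ac] amax]:= am.
apply/seteqP;split=>[H [[Ha H1] HP]|H [pH H1 c0 HP]]. split=>//; [exact: ap|exact: ac|move=> x s t x0 xs xt]. have [j xj]:= nonzero_co F.1 x0.
 rewrite (eig_co F.1 (SD _ H0a) xs xj) (eig_co F.1 (SD _ Ha) xt xj). have [D0|[K Ka Kj]] : (forall K, K \in a -> D K 0 j = 0) \/ exists2 K, K \in a & D K 0 j != 0.
 - have [?|/existsNP[K /not_implyP[Ka /eqP Kj]]]:= pselect (forall K, K \in a -> D K 0 j = 0);first by left. by right;exists K.
 - by rewrite !D0// ltxx. by have [h hr hE]:= Dr _ _ Ka Kj;rewrite -!hE//;exact: HP.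
(* An element of [a] has only components on which [ad H0] is 0, and there [ad H] is 0 too. So [H]
   commutes with [a], and maximality applies. *)
have Ha: H \in a. apply: (max_ab_mem am pH)=> K Ka. have []:= @frame_ex th [set H0; H] C.
 - by move=> w [->|->]//;exact: ap.
 - by move=> w w' [->|->] [->|->];rewrite ?brxx//;rewrite brC c0 oppr0. move=> T FT TP;have [d dE]:= TP _ (or_introl erefl);have [e eE]:= TP _ (or_intror erefl).
 have K0: K *m ad H0 = 0 *: K by rewrite scale0r mul_admx ac. have KE: K = \sum_i (K *m invmx T) 0 i *: row i T by rewrite -mulmx_sum_row mulmxKV// FT.1.
 rewrite -mul_admx KE mulmx_suml big1// => i _;rewrite -scalemxAl (row_eig i eE). have [->|Ki]:= eqVneq ((K *m invmx T) 0 i) 0;first by rewrite scale0r.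
 have [_ ->]:= HP _ _ _ (row_u_neq0 i FT.1) (row_eig i dE) (row_eig i eE). by rewrite scale0r scaler0. by rewrite -(eig_co FT.1 dE K0 Ki).
split=>// h [ha h0 [x x0 xP]].
by apply: (HP x)=>//;rewrite mul_admx xP.
Qed.
Lemma finite_pos (I: finType) (e: I -> R): (forall i, 0 < e i) -> exists2 t: R, 0 < t & forall i, t <= e i.
Proof.
move=> e0;have s0: 0 <= \sum_i (e i)^-1 by apply: sumr_ge0=> i _;rewrite invr_ge0 ltW.
exists (1 + \sum_i (e i)^-1)^-1;first by rewrite invr_gt0 ltr_pwDl.
move=> i;rewrite -[leRHS]invrK lef_pV2 ?posrE ?invr_gt0 ?ltr_pwDl//.
by rewrite (bigD1 i)//= addrCA lerDl addr_ge0// sumr_ge0// => k _;rewrite invr_ge0 ltW.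
Qed.
(** Among the directions that keep the nonzero signs of [V], one with the fewest zero coordinates is
    regular: otherwise a small perturbation along some [K] would remove another zero and disturb no
    sign. *)
Lemma csimp_reg V: V \in a -> V != 0 -> exists2 H, is_reg a H & csimp a V `<=` csimp a H.
Proof.
move=> Va V0;have [S [D [F SD Dl rD Dr]]]:= root_frame;have [[ap ac] amax]:= am.
pose ok H:= forall j, (0 < D V 0 j -> 0 < D H 0 j) /\ (D V 0 j < 0 -> D H 0 j < 0).
pose P k:= `[< exists H, [/\ H \in a, ok H & #|[pred j | D H 0 j == 0]| = k] >].
have exP: exists k, P k by eexists;apply/asboolP;exists V;split=>//.
case: (ex_minnP exP)=> k /asboolP[H [Ha Hok Hk]] kmin.
have Hreg j K: K \in a -> D K 0 j != 0 -> D H 0 j != 0. move=> Ka Kj;apply/negP=> /eqP Hj. have [|t t0 tP]:= finite_pos (e:= fun i=> if D H 0 i == 0 then 1 else `|D H 0 i| / (`|D K 0 i| + 1)).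
  by move=> i;case: eqP=>// /eqP Hi;rewrite divr_gt0 ?normr_gt0// ltr_wpDl. pose H':= 1 *: H + t *: K;have DE i: D H' 0 i = D H 0 i + t * D K 0 i by rewrite Dl scale1r !mxE.
 have small i: D H 0 i != 0 -> `|t * D K 0 i| < `|D H 0 i|. move=> Hi;have:= tP i;rewrite (negPf Hi) ler_pdivlMr ?ltr_wpDl// => h.
  rewrite normrM (gtr0_norm t0);apply: lt_le_trans h;rewrite ltr_pM2l// ltrDl//. have sgn i: (0 < D H 0 i -> 0 < D H' 0 i) /\ (D H 0 i < 0 -> D H' 0 i < 0).
  rewrite DE;split=> Hi;have:= small i;rewrite ?(gt_eqF Hi) ?(lt_eqF Hi)=> /(_ isT). by rewrite (gtr0_norm Hi) ltr_norml=> /andP[];lra. by rewrite (ltr0_norm Hi) ltr_norml=> /andP[];lra.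
 have H'a: H' \in a by rewrite memvD// memvZ. have /kmin: P #|[pred i | D H' 0 i == 0]|. apply/asboolP;exists H';split=>// i;have [h1 h2]:= Hok i;have [h3 h4]:= sgn i.
  by split=>[/h1/h3|/h2/h4]. rewrite leqNgt -Hk=> /negP;apply;apply: proper_card;apply/properP;split. apply/fintype.subsetP=> i;rewrite !inE;apply: contraTT=> Hi;have [h3 h4]:= sgn i.
  by move: Hi;rewrite neq_lt=> /orP[/h4|/h3]; [move/lt_eqF|move/gt_eqF]=> ->. by exists j;rewrite !inE ?Hj// DE Hj add0r mulf_neq0// gt_eqF.
have BH: 0 < B H H. have: B V V != 0. apply: contra_neq V0=> V0;have Cq: qform th V = 0 by rewrite /qform ap// BNr opprK.
  by apply/eqP;apply: contraTT isT=> nV;have [_ _ /(_ V nV)]:= C;rewrite -[- _]/(qform th V) Cq ltxx. rewrite (kform_frame F (SD _ Va)) (kform_frame F (SD _ Ha))=> sV.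
 rewrite lt_def sumr_ge0 ?andbT;last by move=> i _;exact: sqr_ge0. apply: contra_neq sV=> /eqP;rewrite psumr_eq0=>[/allP sH|i _];last exact: sqr_ge0.
 apply: big1=> i _;have:= sH i (mem_index_enum _);rewrite/= sqrf_eq0=> /eqP Hi. suff -> : D V 0 i = 0 by rewrite expr0n. have [h1 h2]:= Hok i;move: h1 h2;rewrite Hi ltxx.
 by case: (ltgtP (D V 0 i) 0)=>// _ h1 h2; [have:= h2 isT|have:= h1 isT].
pose c:= (Num.sqrt (B H H))^-1;have c0: 0 < c by rewrite invr_gt0 sqrtr_gt0.
pose Hr:= c *: H;have Hra: Hr \in a by rewrite memvZ.
have HrU: usphere a Hr. split=>//;rewrite BZl BZr mulrA -expr2 exprVn sqr_sqrtr ?ltW// mulVf// gt_eqF//.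
exists Hr. split=>// h hr;have [j jE]:= rD h hr;rewrite BZr;apply: mulf_neq0;first by rewrite gt_eqF. rewrite jE//. have [ha h0 _]:= hr;apply: (Hreg j h ha);rewrite -jE//.
 have Bh: 0 < - B h (h *m th) by have [_ _]:= C;apply. by move: Bh;rewrite (ap _ ha) BNr opprK=> /lt0r_neq0.
move=> K [Ku KP];split=>// h hr;have [j jE]:= rD h hr;have [h1 h2]:= Hok j.
rewrite BZr jE//;have:= KP h hr;rewrite jE// jE ?(proj1 Ku)// => -[k1 k2].
have [ha h0 _]:= hr;have Hj: D H 0 j != 0. apply: (Hreg j h ha);rewrite -jE//. have Bh: 0 < - B h (h *m th) by have [_ _]:= C;apply. by move: Bh;rewrite (ap _ ha) BNr opprK=> /lt0r_neq0.
split=>[|/eqP];last by rewrite mulf_eq0 (negPf Hj) gt_eqF.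
rewrite pmulr_rgt0// => Hp;case: (ltgtP (D V 0 j) 0)=>[/h2|/k1//|/k2 ->//].
by rewrite ltNge (ltW Hp).
Qed.
End Apartment.

(** For unit directions at one point, this says that they lie in a common closed chamber; see
    [compat_chamber]. *)
Definition compat H K:= [H, K] = 0 /\ forall x (s t: R), x != 0 -> x *m ad H = s *: x -> x *m ad K = t *: x -> 0 <= s * t.

Lemma compat_chamber th H K: cartan th -> ppt th H -> ppt th K -> B H H = 1 -> B K K = 1 -> compat H K -> exists a Hr, [/\ max_ab th a, is_reg a Hr,
  cone th H `<=` csimp a Hr & cone th K `<=` csimp a Hr].
Proof.
move=> C pH pK H1 K1 [HK sg].
have [a am ba]:= max_ab_ex (ab_pair pH pK HK).
have Ha: H \in a by apply: (subvP ba);apply: (subvP (addvSl _ _));exact: memv_line.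
have Ka: K \in a by apply: (subvP ba);apply: (subvP (addvSr _ _));exact: memv_line.
have [S [D [F SD Dl rD Dr]]]:= root_frame C am.
have sD j: 0 <= D H 0 j * D K 0 j. by apply: (sg (row j S)); [exact: (row_u_neq0 j F.1)|exact: (row_eig j (SD _ _))|exact: (row_eig j (SD _ _))].
(* The coordinates of [H] and [K] never have opposite signs, so nothing cancels in [V], and a
   chamber that contains the simplex of [V] contains both of theirs. *)
pose V:= 1 *: H + 1 *: K;have Va: V \in a by rewrite memvD// memvZ.
have DV j: D V 0 j = D H 0 j + D K 0 j by rewrite Dl !scale1r !mxE.
have V0: V != 0. apply/negP=> /eqP V0;have: B V V = 0 by rewrite V0 B0l. rewrite (kform_frame F (SD _ Va))=> /eqP;rewrite psumr_eq0=>[/allP sV|i _];last exact: sqr_ge0.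
 have:= H1;rewrite (kform_frame F (SD _ Ha)) big1=>[/eqP|i _];first by rewrite eq_sym oner_eq0. have:= sV i (mem_index_enum _);rewrite/= sqrf_eq0 DV=> /eqP;have:= sD i;nra.
have [Hr reg VH]:= csimp_reg C am Va V0.
have sub H': H' \in a -> (forall j, (0 < D V 0 j -> 0 <= D H' 0 j) /\ (D V 0 j = 0 -> D H' 0 j = 0)) -> csimp a H' `<=` csimp a Hr.
 move=> H'a sV T [Tu TP];apply: VH;split=>// h hr;have [j jE]:= rD h hr. have [t1 t2]:= TP h hr;rewrite !jE ?(proj1 Tu)// in t1 t2 *;have [s1 s2]:= sV j.
 by split=>[/s1|/s2/t2//];rewrite le_eqVlt=> /orP[/eqP/esym/t2->|/t1].
exists a, Hr;split=>//.
- rewrite -(csimpE C am Ha);apply: sub=>// j;rewrite DV;have:= sD j. by move: (D H 0 j) (D K 0 j)=> s t;nra.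
rewrite -(csimpE C am Ka);apply: sub=>// j;rewrite DV;have:= sD j.
by move: (D H 0 j) (D K 0 j)=> s t;nra.
Qed.
End Cones.

(** * Traces of block triangular nilpotent matrices *)

Section BlockTrace.

(** The diagonal blocks [M0] of a block triangular nilpotent matrix are nilpotent, and multiplying
    each block by its scalar [a i] keeps them so. The sum is the trace of the result. *)
Lemma block_tr (M: 'M[R]_n) (a: 'I_n -> R) k: M ^+ k = 0 -> (forall i j, M i j != 0 -> a i <= a j) -> \sum_i a i * M i i = 0.
Proof.
move=> Mk Ma;pose M0: 'M[R]_n:= \matrix_(i, j) if a i == a j then M i j else 0.
have powS (A: 'M[R]_n) l: A ^+ l.+1 = A *m A ^+ l by rewrite exprS.
have M0E i j: M0 i j = if a i == a j then M i j else 0 by rewrite mxE.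
have tri l i j: (M ^+ l) i j != 0 -> a i <= a j. elim: l i=>[|l IH] i;first by rewrite expr0 mxE;case: (eqVneq i j)=>[->//|_];rewrite eqxx.
 rewrite powS mxE=> H;have [k1 kP] : exists k1, M i k1 * (M ^+ l) k1 j != 0. apply/existsP;apply: contraNT H;rewrite negb_exists=> /forallP H.
  by rewrite big1// => k1 _;apply/eqP;have:= H k1;rewrite negbK. move: kP;rewrite mulf_eq0 negb_or=> /andP[/Ma h1 /IH h2];exact: le_trans h1 h2.
have M0P l i j: (M0 ^+ l) i j = if a i == a j then (M ^+ l) i j else 0. elim: l i=>[|l IH] i;first by rewrite !expr0 mxE;case: (eqVneq i j)=>[->|_];rewrite ?eqxx// if_same.
 rewrite !powS !mxE;case: ifPn=> aij. apply: eq_bigr=> k1 _;rewrite M0E IH;have [ik|ik]:= eqVneq (a i) (a k1). by rewrite -ik aij. rewrite mul0r;apply/esym/eqP;rewrite mulf_eq0;apply/orP.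
  case: (boolP (M i k1 == 0))=>[_|/Ma h1];first by left. case: (boolP ((M ^+ l) k1 j == 0))=>[_|/tri h2];first by right. by case/negP: ik;rewrite eq_le h1 (eqP aij).
 apply: big1=> k1 _;rewrite M0E IH;case: eqP=>[ik|];last by rewrite mul0r. by rewrite -ik (negPf aij) mulr0.
pose N: 'M[R]_n:= \matrix_(i, j) (a i * M0 i j).
have NP l i j: (N ^+ l) i j = a i ^+ l * (M0 ^+ l) i j. elim: l i=>[|l IH] i;first by rewrite !expr0 mul1r. rewrite !powS !mxE mulr_sumr;apply: eq_bigr=> k1 _;rewrite IH [N _ _]mxE M0E.
 by case: eqP=>[->|_];rewrite ?mulr0 ?mul0r ?mulr0// exprS;ring.
have Nk: N ^+ k = 0. by apply/matrixP=> i j;rewrite NP M0P Mk !mxE;case: ifP;rewrite mulr0.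
transitivity (\tr N);last exact: nil_tr Nk.
apply: eq_bigr=> i _.
by rewrite [RHS]mxE M0E eqxx.
Qed.
End BlockTrace.

(** * Moving two directions into one chamber *)

Section Alignment.
Implicit Types (H K: g) (th phi: 'M[R]_n).

Lemma frame_co th S z i: frame th S -> (z *m invmx S) 0 i = - B z (row i S *m th).
Proof.
move=> F;have dE j: (row i S *m invmx S) 0 j = (j == i)%:R. by rewrite -row_mul mulmxV ?F.1// row1 mxE eqxx.
rewrite (frame_ip _ _ F) (bigD1 i)//= big1=>[|j ji]. by rewrite dE eqxx mulr1 addr0.
by rewrite dE (negPf ji) mulr0.
Qed.
Lemma gfilt_orth th H w: cartan th -> ppt th H -> (forall u, gfilt H (fun s=> 0 < s) u -> B u w = 0) -> gfilt H (fun s=> 0 <= s) w.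
Proof.
move=> C pH Hw;have [S [d [F SA]]]:= frame1 C pH.
apply/(gfiltP _ _ F.1 SA)=> i ci;rewrite leNgt;apply/negP=> di.
have E:= p_eig_th C pH (row_eig i SA).
move: ci;rewrite (frame_co _ _ F) kilC Hw ?oppr0 ?eqxx//.
by apply: (gfilt_eig E);rewrite oppr_gt0.
Qed.
Lemma frame_ad S w i j: (S *m ad w *m invmx S) i j = (row i S *m ad w *m invmx S) 0 j.
Proof. by rewrite -!row_mul [RHS]mxE. Qed.
(** [ad w] strictly raises the eigenvalue of [ad H], of which there are at most [n]. *)
Lemma gfilt_nil th H w: cartan th -> ppt th H -> gfilt H (fun s=> 0 < s) w -> ad w ^+ n.+1 = 0.
Proof.
move=> C pH Hw;have [S [d [F SA]]]:= frame1 C pH;have uS:= F.1.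
pose M:= S *m ad w *m invmx S;pose rk j:= #|[pred l | d 0 l < d 0 j]|.
have Mij i j: M i j != 0 -> d 0 i < d 0 j. rewrite frame_ad=> nz;have h: gfilt H (fun s=> d 0 i <= s) (row i S) by apply: gfilt_eig (row_eig i SA) _.
 have: gfilt H (fun s=> d 0 i < s) (row i S *m ad w). by apply: (gfilt_ad _ Hw h); [move=> a b;lra|exists th]. by move/(gfiltP _ _ uS SA)/(_ j nz).
have powS (A: 'M[R]_n) l: A ^+ l.+1 = A ^+ l *m A by rewrite exprSr.
have pk k i j: (M ^+ k) i j != 0 -> (k <= rk j)%N. elim: k j=>[//|k IH] j;rewrite powS mxE=> nz. have [l lP] : exists l, (M ^+ k) i l * M l j != 0.
  apply/existsP;apply: contraNT nz;rewrite negb_exists=> /forallP nz. by rewrite big1// => l _;apply/eqP;have:= nz l;rewrite negbK.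
 move: lP;rewrite mulf_eq0 negb_or=> /andP[/IH h1 /Mij h2];apply: (leq_ltn_trans h1). apply: proper_card;apply/properP;split. by apply/fintype.subsetP=> m;rewrite !inE=> /lt_trans;apply.
 by exists l;rewrite !inE ?ltxx.
have Mn: M ^+ n.+1 = 0. apply/matrixP=> i j;rewrite [RHS]mxE;apply/eqP/negPn/negP=> /pk. by rewrite leqNgt ltnS -[X in (_ <= X)%N]card_ord max_card.
have E k: ad w ^+ k = invmx S *m M ^+ k *m S. elim: k=>[|k IH];first by rewrite !expr0 mulmx1 mulVmx. by rewrite !powS IH /M !mulmxA mulmxKV// mulmxK.
by rewrite E Mn mulmx0 mul0mx.
Qed.
(** The nilradical of [K] lies in the parabolic subalgebra of [H] and acts nilpotently, so
    [block_tr] makes it orthogonal to [H]; applying [th], so is the opposite nilradical. Hence [H]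
    commutes with [K]. A joint eigenvector [x] with eigenvalues of opposite sign is excluded by
    pairing it with [x *m th]. *)
Lemma opposite_compat th H K: cartan th -> ppt th H -> ppt th K -> (forall u w, gfilt H (fun s=> 0 < s) u -> gfilt K (fun s=> 0 < s) w -> B u w = 0) -> compat H K.
Proof.
move=> C pH pK HK;have [S [d [F SA]]]:= frame1 C pH;have [T [e [FT TA]]]:= frame1 C pK.
have BHw w: gfilt K (fun s=> 0 < s) w -> B H w = 0. move=> Kw;have Hw: gfilt H (fun s=> 0 <= s) w by apply: (gfilt_orth C pH)=> u Hu;exact: HK. pose M:= S *m ad w *m invmx S.
 have -> : B H w = \sum_i d 0 i * M i i. rewrite /kform (mx_diagE F.1 SA) -!mulmxA mxtrace_mulC !mulmxA. have -> : diag_mx d *m S *m ad w *m invmx S = diag_mx d *m M by rewrite /M !mulmxA.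
  by clearbody M;apply: eq_bigr=> i _;rewrite mul_diag_mx mxE. apply: (@block_tr M (fun i=> d 0 i) n.+1)=>[|i j]. have E k: M ^+ k = S *m ad w ^+ k *m invmx S.
   elim: k=>[|k IH];first by rewrite !expr0 mulmx1 mulmxV// F.1. by rewrite !exprS -!mulmxE IH /M !mulmxA mulmxKV// F.1. by rewrite E (gfilt_nil C pK Kw) mulmx0 mul0mx.
 rewrite /M frame_ad=> nz;have h: gfilt H (fun s=> d 0 i <= s) (row i S) by apply: gfilt_eig (row_eig i SA) _. have: gfilt H (fun s=> d 0 i <= s) (row i S *m ad w).
  by apply: (gfilt_ad _ Hw h); [move=> a b;lra|exists th]. by move/(gfiltP _ _ F.1 SA)/(_ j nz).
have pos x: x != 0 -> 0 < - B x (x *m th) by have [_ _]:= C;apply.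
split. rewrite brC -mul_admx (mx_diagE FT.1 TA) !mulmxA. rewrite (_: _ *m diag_mx e = 0) ?mul0mx ?oppr0//;apply/rowP=> i;rewrite mul_mx_diag mxE [RHS]mxE.
 have [|ei|->]:= ltgtP (e 0 i) 0;last by rewrite mulr0. move=> ei;rewrite (frame_co _ _ FT) BHw ?oppr0 ?mul0r//. by apply: (gfilt_eig (p_eig_th C pK (row_eig i TA)));rewrite oppr_gt0.
 rewrite (frame_co _ _ FT) -(form_aut_cartan _ _ C) pH BNl opprK BHw ?mul0r//. exact: (gfilt_eig (row_eig i TA)).
move=> x s t x0 xs xt;rewrite leNgt;apply/negP=> st.
have [s0|s0|s0]:= ltgtP s 0;last by rewrite s0 mul0r ltxx in st. have t0: 0 < t by nra. have:= pos x x0;rewrite kilC (HK (x *m th) x) ?oppr0 ?ltxx//.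
  by apply: (gfilt_eig (p_eig_th C pH xs));rewrite oppr_gt0. exact: (gfilt_eig xt).
have t0: t < 0 by nra.
have:= pos x x0;rewrite (HK x (x *m th)) ?oppr0 ?ltxx//;first exact: (gfilt_eig xs).
by apply: (gfilt_eig (p_eig_th C pK xt));rewrite oppr_gt0.
Qed.
(** An isotropy preserves the positive form of [th], so its entries in an orthonormal frame are at
    most 1. *)
Lemma isotropy_bound th: cartan th -> exists M: R, forall phi, aut phi -> phi *m th = th *m phi -> `|phi| <= M.
Proof.
move=> C;have [S F _]:= frame_ex (A:= set0) C (fun _ f=> False_ind _ f) (fun _ _ f=> False_ind _ f).
exists (n.+1%:R * (n.+1%:R * `|invmx S| * 1) * `|S|)=> phi a ct.
have {}H i j: `|(S *m phi *m invmx S) i j| <= 1. rewrite -(@ler_pXn2r _ 2)// ?nnegrE// expr1n real_normK ?num_real//. have: qform th (row i S *m phi) = 1.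
  by rewrite -(frame_row i F) /qform -mulmxA ct mulmxA (B_aut _ _ a). rewrite (frame_q _ F) (bigD1 j)//= -!row_mul [X in X ^+ 2 + _]mxE=> <-;rewrite lerDl sumr_ge0// => k _. exact: sqr_ge0.
have -> : phi = invmx S *m (S *m phi *m invmx S) *m S. by rewrite !mulmxA mulVmx ?F.1// mul1mx mulmxKV// F.1.
apply: le_trans (mulmx_norm _ _) _;rewrite ler_wpM2r// ler_wpM2l// (le_trans (mulmx_norm _ _))//.
by rewrite ler_wpM2l ?mulr_ge0//;exact: mx_norm_leP.
Qed.

(* The Killing form [B (Hx phi) Hy] is maximal on the isotropy group; its first variation gives commutation, its second
   one along [Z = x + x th] the sign condition. *)
Lemma align th Hx Hy (J: 'M[R]_n -> Prop): cartan th -> ppt th Hx -> ppt th Hy -> J 1%:M -> (forall phi psi, J phi -> J psi -> J (phi *m psi)) ->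
 (exists2 r: R, 0 < r & forall phi, aut phi -> `|phi - 1%:M| < r -> J phi) -> exists phi, [/\ aut phi, phi *m th = th *m phi, J phi & compat (Hx *m phi) Hy].
Proof.
move=> C px py J1 JM [rJ rJ0 Jnear].
pose Q:= [set phi | [/\ aut phi, phi *m th = th *m phi & J phi]].
have [Mb MP]:= isotropy_bound C.
have cA: closed ([set phi | aut phi] `&` [set phi | phi *m th = th *m phi]). apply: closedI;first exact: aut_cl. by apply: cl_cont_eq; [exact: mulmxr_cont|exact: mulmxl_cont].
(* [J] is not assumed closed. But a limit of members differs from a nearby member by an automorphism
   close to 1, which [J] contains. *)
have cQ: closed Q. move=> phi cphi;have [a ct] : ([set phi | aut phi] `&` [set phi | phi *m th = th *m phi]) phi. by apply: cA=> U /cphi[psi [[]]];exists psi.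
 have e0: 0 < rJ / (n.+1%:R * (`|Mb| + 1)) by rewrite divr_gt0// mulr_gt0// ltr_wpDl. have [psi [[ap cp Jp] bp]]:= cphi _ (nbhsx_ballx phi _ e0).
 split=>//;rewrite -[phi](mulKVmx ap.1);apply: JM=>//;apply: Jnear. by apply: autM=>//;exact: autV.
 have -> : invmx psi *m phi - 1%:M = invmx psi *m (phi - psi) by rewrite mulmxBr mulVmx// ap.1. apply: le_lt_trans (mulmx_norm _ _) _. have cV: invmx psi *m th = th *m invmx psi.
  by apply: (can_inj (mulKmx ap.1));rewrite mulKVmx ?ap.1// mulmxA cp mulmxK// ap.1. have nV:= le_trans (MP _ (autV ap) cV) (ler_norm Mb).
 move: bp;rewrite -ball_normE/= ltr_pdivlMr ?mulr_gt0 ?ltr_wpDl// => bp. apply: le_lt_trans bp;rewrite [leRHS]mulrC ler_wpM2r// ler_wpM2l// (le_trans nV)// lerDl//.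
have lin: linear (fun M: 'M[R]_n=> - B (Hx *m M) Hy: R^o). by move=> k M N;rewrite mulmxDr -scalemxAr BDl BZl opprD -mulrN.
have linC:= @fdim_cont R _ _ (mklin lin) (fmx n n).
have [|||phi [a ct Jp] pm]:= @mx_min R n n Q (fun phi=> - B (Hx *m phi) Hy) 1%:M cQ.
- exact: linC.
- by split=>//; [exact: aut1|rewrite mul1mx mulmx1].
- by exists Mb=> psi [ap cp _] _;exact: MP.
exists phi;split=>//;set H1:= Hx *m phi.
have pH1: ppt th H1 by rewrite /ppt/= /H1 -mulmxA ct mulmxA px mulNmx.
have lin1: linear (fun M: 'M[R]_n=> B (H1 *m M) Hy: R^o). by move=> k M N;rewrite mulmxDr -scalemxAr BDl BZl.
have [K K0 KP]:= fdim_bnd (fmx n n) lin1.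
have var Z: Z *m th = Z -> B [Z, H1] Hy = 0 /\ B [Z, [Z, H1]] Hy <= 0. move=> Zt;have [Cf [r [C0 r0 flow]]]:= inner_flow Z.
 have r1: 0 < Num.min r (rJ / (Cf + 1)) by rewrite lt_min r0 divr_gt0// ltr_wpDl. suff HS s: `|s| < Num.min r (rJ / (Cf + 1)) ->
   s * B [Z, H1] Hy + s ^+ 2 * (B [Z, [Z, H1]] Hy / 2) <= K * Cf * `|s| ^+ 3. by have [|-> h]:= second_order r1 _ HS; [rewrite mulr_ge0// ltW|split=>//;lra].
 rewrite lt_min=> /andP[sr sJ];have [Phi [aP PQ P1 P2]]:= flow s sr. have cP: Phi *m th = th *m Phi. apply: (PQ [set M | M *m th = th *m M]).
  - by apply: cl_cont_eq; [exact: mulmxr_cont|exact: mulmxl_cont].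
  - by rewrite/= mul1mx mulmx1. move=> M c/= cM;rewrite mulmxDl mulmxDr cM -scalemxAl -scalemxAr;congr (_ + _ *: _). by rewrite -mulmxA (ad_aut _ (cartan_aut C)) Zt mulmxA cM mulmxA.
 have JP: J Phi. apply: Jnear=>//;apply: le_lt_trans P1 _;move: sJ;rewrite ltr_pdivlMr ?ltr_wpDl//. by apply: le_lt_trans;rewrite mulrC ler_wpM2l// lerDl. have QP: Q (phi *m Phi).
  by split; [exact: autM|rewrite -mulmxA cP mulmxA ct mulmxA|exact: JM]. have:= pm _ QP;rewrite mulmxA -/H1 lerN2. set N:= Phi - 1%:M - s *: ad Z - (s ^+ 2 / 2) *: (ad Z *m ad Z).
 have PE: Phi = 1%:M + s *: ad Z + (s ^+ 2 / 2) *: (ad Z *m ad Z) + N by rewrite /N;zmod. have NB: - (K * Cf * `|s| ^+ 3) <= B (H1 *m N) Hy.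
  rewrite lerNl;apply: le_trans (ler_norm _) _;rewrite normrN;apply: le_trans (KP N) _. by rewrite -mulrA ler_wpM2l// ltW.
 clearbody N;rewrite PE !mulmxDr -!scalemxAr mulmx1 !BDl !BZl mulmxA !mul_admx. by move: NB;move: (B _ _) (B _ _) (B _ _) (B _ _) (K * _ * _)=> b1 b2 b3 b4 b5;lra.
have comm: [H1, Hy] = 0. set Z:= [H1, Hy];have Zt: Z *m th = Z. by have [-> _ _]:= C;rewrite pH1 py brNl brNr opprK.
 have [h _]:= var Z Zt;apply/eqP/negPn/negP=> Z0;have [_ _ /(_ Z Z0)]:= C. by rewrite Zt;move: h;rewrite (brC Z H1) BNl B_ad opprK -/Z=> ->;rewrite oppr0 ltxx.
split=>// x s t x0 xs xt.
have [_ tt pos]:= C;pose Z:= x + x *m th;have Zt: Z *m th = Z by rewrite mulmxDl -mulmxA tt mulmx1 addrC.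
have [_]:= var Z Zt.
have br1 H (k: R): ppt th H -> x *m ad H = k *: x -> [Z, H] = - k *: (x - x *m th). move=> pH xk;rewrite brC brDr -!mul_admx xk (p_eig_th C pH xk). by rewrite scalerBr !scaleNr opprD !opprK.
rewrite B_ad (br1 _ _ pH1 xs) (br1 _ _ py xt) BZl BZr.
have [e|nx]:= eqVneq (x - x *m th) 0. move: (p_eig_th C pH1 xs);rewrite (_: x *m th = x);last by apply/eqP;rewrite eq_sym -subr_eq0 e.
 rewrite xs=> /eqP;rewrite -subr_eq0 -scalerBl scaler_eq0 (negPf x0) orbF=> /eqP s0 _. by rewrite (_: s = 0) ?mul0r//;lra.
have: 0 < B (x - x *m th) (x - x *m th). have yt: (x - x *m th) *m th = - (x - x *m th) by rewrite mulmxBl -mulmxA tt mulmx1 opprB. by have:= pos _ nx;rewrite yt BNr opprK.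
move: (B _ _)=> b b0 h;rewrite -(pmulr_lge0 _ b0);lra.
Qed.
End Alignment.

(** * The building at infinity and types *)

Section Building.
Context {G: groupType} (A: G -> 'M[R]_n).
Hypotheses (Aaut: forall h, aut (A h)) (A1: A 1%g = 1%:M) (AM: forall h k, A (h * k)%g = A k *m A h).
Local Notation ideal:= (set (R -> 'M[R]_n)).
Implicit Types (H: g) (th phi: 'M[R]_n) (s: set ideal) (xi eta: ideal).

Definition actX (h: G) th: 'M[R]_n:= A h^-1%g *m th *m A h.
Definition bdry: set ideal:= [set rend c | c in rayX].
Definition act_id (h: G) xi: ideal:= [set actX h \o c | c in xi].
Definition orb_id xi: set ideal:= [set act_id h xi | h in [set: G]].
Definition ends th (S: set g): set ideal:= [set rend (fun t=> aexp (t *: H) th) | H in S].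
Definition is_simp s: Prop:= exists th a H0, [/\ cartan th, max_ab th a, usphere a H0 & s = ends th (csimp a H0)].
Definition is_chamber s: Prop:= exists th a H0, [/\ cartan th, max_ab th a, is_reg a H0 & s = ends th (csimp a H0)].
Definition act_simp (h: G) s: set ideal:= [set act_id h xi | xi in s].
Hypothesis once: forall xi, bdry xi -> forall s, is_chamber s -> exists! eta, s eta /\ orb_id xi eta.
Definition eq_type s s': Prop:= [set orb_id xi | xi in s] = [set orb_id xi | xi in s'].

Lemma AV h: A h^-1%g = invmx (A h).
Proof.
have u:= (Aaut h).1;apply: (can_inj (mulmxK u)).
by rewrite mulVmx// -AM mulgV A1.
Qed.
Lemma actXE h th: actX h th = conjX (A h) th. Proof. by rewrite /actX AV. Qed.
Lemma act_idE h c: rayX c -> act_id h (rend c) = rend (conjX (A h) \o c).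
Proof.
move=> rc;rewrite -(rend_conjX (Aaut h) rc) /act_id.
by congr (image _ _);apply/funext=> e;apply/funext=> t;rewrite/= actXE.
Qed.
Lemma act_id1 xi: act_id 1%g xi = xi.
Proof.
rewrite /act_id (_: (fun c=> _) = id) ?image_id//;apply/funext=> c;apply/funext=> t/=.
by rewrite /actX invg1 A1 mul1mx mulmx1.
Qed.
Lemma act_idM h k xi: act_id (h * k)%g xi = act_id h (act_id k xi).
Proof.
rewrite /act_id image_comp;congr (image _ _);apply/funext=> c;apply/funext=> t/=.
by rewrite /actX invgM !AM !mulmxA.
Qed.
Lemma act_simp1 s: act_simp 1%g s = s.
Proof. by rewrite /act_simp (_: (fun xi=> _) = id) ?image_id//;apply/funext=> xi;exact: act_id1. Qed.
Lemma act_simpM h k s: act_simp (h * k)%g s = act_simp h (act_simp k s).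
Proof. by rewrite /act_simp image_comp;congr (image _ _);apply/funext=> xi;exact: act_idM. Qed.
Lemma orb_id_act h xi: orb_id (act_id h xi) = orb_id xi.
Proof.
apply/seteqP;split=>[_ [k _ <-]|_ [k _ <-]];first by exists (k * h)%g=>//;rewrite act_idM.
by exists (k * h^-1)%g=>//;rewrite -act_idM -mulgA mulVg mulg1.
Qed.
Lemma orb_id_eq xi eta: orb_id xi = orb_id eta -> orb_id xi eta.
Proof. by move=> ->;exists 1%g=>//;exact: act_id1. Qed.
Lemma simp_cone s: is_simp s -> exists th H, [/\ cartan th, ppt th H, B H H = 1 & s = ends th (cone th H)].
Proof.
move=>[th [a [H [C am [Ha H1] ->]]]];exists th, H;split=>//;first by have [[ap _] _]:= am;exact: ap.
by rewrite (csimpE C am Ha).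
Qed.
Lemma cone_is_simp th H: cartan th -> ppt th H -> B H H = 1 -> is_simp (ends th (cone th H)).
Proof.
move=> C pH H1;have [a am ba]:= max_ab_ex (ab_pair pH pH (brxx H)).
have Ha: H \in a by apply: (subvP ba);apply: (subvP (addvSl _ _));exact: memv_line.
by exists th, a, H;split=>//;rewrite (csimpE C am Ha).
Qed.
Lemma ends_ray th H xi: cartan th -> ppt th H -> ends th (cone th H) xi -> exists2 K, cone th H K & xi = rend (geo th K) /\ rayX (geo th K).
Proof. by move=> C pH [K KP <-];exists K=>//;split=>//;have [pK K1 _ _]:= KP;exact: rayX_geo. Qed.
Lemma cone_conj phi th H: aut phi -> cone th H `<=` [set K | cone (conjX phi th) (H *m phi) (K *m phi)].
Proof.
move=> a K [pK K1 c0 KP];split.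
- exact: (p_part_conjX a pK).
- by rewrite (B_aut _ _ a).
- by rewrite -a.2 c0 mul0mx.
move=> x s t x0 xs xt;apply: (KP (x *m invmx phi)).
- by apply: contra_neq x0=> E;rewrite -[x](mulmxKV a.1) E mul0mx.
- have:= ad_aut (H *m phi) (autV a);rewrite mulmxK ?a.1// => E. by rewrite -mulmxA -E mulmxA xs -scalemxAl.
have:= ad_aut (K *m phi) (autV a);rewrite mulmxK ?a.1// => E.
by rewrite -mulmxA -E mulmxA xt -scalemxAl.
Qed.
Lemma cone_conjE phi th H: aut phi -> cone (conjX phi th) (H *m phi) = [set K *m phi | K in cone th H].
Proof.
move=> a;apply/seteqP;split=>[K KP|_ [K KP <-]];last exact: cone_conj KP.
have:= cone_conj (autV a) KP;rewrite (conjXK _ a.1) (mulmxK a.1)/= => h.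
by exists (K *m invmx phi)=>//;rewrite (mulmxKV a.1).
Qed.
Lemma act_simp_ends h th H: cartan th -> ppt th H -> act_simp h (ends th (cone th H)) = ends (conjX (A h) th) (cone (conjX (A h) th) (H *m A h)).
Proof.
move=> C pH;have a:= Aaut h.
have E K: cone th H K -> act_id h (rend (geo th K)) = rend (geo (conjX (A h) th) (K *m A h)). move=>[pK K1 _ _];rewrite act_idE;last exact: rayX_geo.
 congr (rend _);apply/funext=> t/=;rewrite /geo scalemxAl (aexp_conjX a C)//;exact: p_partZ.
rewrite (cone_conjE _ _ a) /ends /act_simp !image_comp.
apply/seteqP;split=> _ [K KP <-];exists K=>//; [exact: esym (E _ KP)|exact: E _ KP].
Qed.
Lemma act_simp_simp h s: is_simp s -> is_simp (act_simp h s).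
Proof.
move=> /simp_cone[th [H [C pH H1 ->]]];rewrite act_simp_ends//;apply: cone_is_simp.
- exact: (cartan_conjX (Aaut h)).
- exact: (p_part_conjX (Aaut h) pH).
- by rewrite (B_aut _ _ (Aaut h)).
Qed.
Lemma act_simp_type h s s': eq_type s s' -> eq_type (act_simp h s) s'.
Proof.
rewrite /eq_type=> <-;apply/seteqP;split=>[_ [_ [xi sx <-] <-]|_ [xi sx <-]]. by exists xi=>//;rewrite orb_id_act.
by exists (act_id h xi); [exists xi|rewrite orb_id_act].
Qed.
Lemma chamber_of th H K: cartan th -> ppt th H -> ppt th K -> B H H = 1 -> B K K = 1 -> compat H K -> exists c, [/\ is_chamber c, ends th (cone th H) `<=` c & ends th (cone th K) `<=` c].
Proof.
move=> C pH pK H1 K1 cHK;have [a [Hr [am reg sH sK]]]:= compat_chamber C pH pK H1 K1 cHK.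
exists (ends th (csimp a Hr));split;first by exists th, a, Hr. by move=> _ [X XP <-];exists X=>//;exact: sH.
by move=> _ [X XP <-];exists X=>//;exact: sK.
Qed.
Lemma compat_refl H: compat H H.
Proof.
split;first exact: brxx.
move=> x s t x0 -> /eqP;rewrite -subr_eq0 -scalerBl scaler_eq0 (negPf x0) orbF subr_eq0=> /eqP ->.
by rewrite -expr2 sqr_ge0.
Qed.
Lemma chamber_point_unique c xi eta: is_chamber c -> bdry xi -> c xi -> c eta -> orb_id xi eta -> xi = eta.
Proof.
move=> cc bx cx ce o;have [z [_ zu]]:= once bx cc.
by rewrite -(zu xi) ?(zu eta)//;split=>//;exact: orb_id_eq.
Qed.
(** Both simplices lie in one chamber, which meets every orbit once; having the same orbits, they
    have the same points. *)
Lemma compat_simp_eq th H K: cartan th -> ppt th H -> ppt th K -> B H H = 1 -> B K K = 1 -> compat H K -> eq_type (ends th (cone th H)) (ends th (cone th K)) ->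
 ends th (cone th H) = ends th (cone th K).
Proof.
move=> C pH pK H1 K1 cHK ty;have [c [cc sH sK]]:= chamber_of C pH pK H1 K1 cHK.
have key H' K': ppt th H' -> ends th (cone th H') `<=` c -> ends th (cone th K') `<=` c -> eq_type (ends th (cone th H')) (ends th (cone th K')) -> ends th (cone th H') `<=` ends th (cone th K').
 move=> pH' sH' sK' ty' xi hx;have [X XP [xE rX]]:= ends_ray C pH' hx. have [eta ke oe] : [set orb_id xi | xi in ends th (cone th K')] (orb_id xi) by rewrite -ty';exists xi.
 rewrite (chamber_point_unique cc _ (sH' _ hx) (sK' _ ke))//;first by exists (geo th X). exact: orb_id_eq.
by apply/seteqP;split; [exact: key|apply: key=>//;exact/esym].
Qed.
(** A chamber has no two points in one orbit, so an element that preserves a simplex fixes it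
    pointwise. Fixing the end of the ray along [H] is membership in the parabolic subgroup. *)
Lemma stab_pres h th H: cartan th -> ppt th H -> B H H = 1 -> act_simp h (ends th (cone th H)) = ends th (cone th H) -> pres H (A h).
Proof.
move=> C pH H1 hE;have [c [cc sH _]]:= chamber_of C pH pH H1 H1 (compat_refl H).
have r:= rayX_geo C pH H1.
have sx: ends th (cone th H) (rend (geo th H)) by exists H=>//;exact: cone_refl.
have hx: ends th (cone th H) (act_id h (rend (geo th H))) by rewrite -hE;exists (rend (geo th H)).
have E: rend (geo th H) = act_id h (rend (geo th H)). apply: (chamber_point_unique cc _ (sH _ sx) (sH _ hx));first by exists (geo th H). by exists h.
apply: (asymX_pres C pH H1 (Aaut h));apply/(rend_eq r (rayX_conjX (Aaut h) r)).
by rewrite {1}E act_idE.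
Qed.
(** Every simplex can be seen from every base point: [base_change] is applied to all directions of
    the cone at once, so one [phi] keeps all their ends. *)
Lemma rebase th th' H: cartan th -> cartan th' -> ppt th' H -> B H H = 1 -> exists phi, [/\ aut phi, conjX phi th' = th, pres H phi & ends th' (cone th' H) = ends th (cone th (H *m phi))].
Proof.
move=> C C' pH H1.
have [K KP|phi [a E P]]:= @base_change th th' H (cone th' H) C C' pH. by have [pK _ c _]:= KP;split=>// x l t x0 xl xt l0;exact: cone_ge0 KP x0 xl xt l0.
exists phi;split=>//;first by apply: P;exact: cone_refl.
have key K: cone th' H K -> rend (geo th' K) = rend (geo th (K *m phi)). move=> KP;have [pK K1 _ _]:= KP;have r:= rayX_geo C' pK K1. have E2: geo th (K *m phi) = conjX phi \o geo th' K.
  by apply/funext=> t/=;rewrite -E /geo scalemxAl (aexp_conjX a C')//;exact: p_partZ. by rewrite E2;apply/(rend_eq r (rayX_conjX a r));apply: (pres_asymX C' pK K1 a);exact: P.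
rewrite -E (cone_conjE _ _ a) E /ends image_comp.
by apply: eq_imagel=> K KP;move: (key K KP);rewrite /geo /comp=> ->.
Qed.
Lemma gfilt_pos_conj th H phi w: cartan th -> ppt th H -> aut phi -> pres H phi -> gfilt (H *m phi) (fun l: R=> 0 < l) w -> gfilt H (fun l: R=> 0 < l) w.
Proof.
move=> C pH a pp Hw;have:= gfilt_aut (autV a) Hw;rewrite (mulmxK a.1).
have [S [d [F SA]]]:= frame1 C pH;move/(gfiltP _ _ F.1 SA)=> H1.
have [i|t t0 tP]:= finite_pos (e:= fun i=> if 0 < d 0 i then d 0 i else 1);first by case: ifP.
have: gfilt H (fun l: R=> t <= l) (w *m invmx phi). by apply/(gfiltP _ _ F.1 SA)=> i /H1 di;have:= tP i;rewrite di.
move/pp;rewrite (mulmxKV a.1)=> /(gfiltP _ _ F.1 SA) H2;apply/(gfiltP _ _ F.1 SA)=> i /H2.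
exact: lt_le_trans.
Qed.
Lemma opposite_simp_eq th th' H K: cartan th -> cartan th' -> ppt th H -> ppt th' K -> B H H = 1 -> B K K = 1 -> eq_type (ends th (cone th H)) (ends th' (cone th' K)) ->
 (forall u w, gfilt H (fun l: R=> 0 < l) u -> gfilt K (fun l: R=> 0 < l) w -> B u w = 0) -> ends th (cone th H) = ends th' (cone th' K).
Proof.
move=> C C' pH pK H1 K1;have [phi [a E P ->]]:= rebase C C' pK K1=> ty HK.
have pK': ppt th (K *m phi) by rewrite -E;exact: (p_part_conjX a pK).
apply: compat_simp_eq=>//;first by rewrite (B_aut _ _ a).
apply: (opposite_compat C pH pK')=> u w Hu Kw;apply: HK=>//.
exact: (gfilt_pos_conj C' pK a P).
Qed.
(** Seen from one base point, the two simplices become compatible after an isotropy provided by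
    [align]. It may be taken in [J'], which contains the small automorphisms and is stable under
    products. Compatible simplices of one type coincide. *)
Lemma simp_joined (J: set ideal -> set ideal -> Prop) s s': (forall s, J s s) -> (forall s1 s2 s3, J s1 s2 -> J s2 s3 -> J s1 s3) ->
 (exists2 r: R, 0 < r & forall phi, aut phi -> `|phi - 1%:M| < r -> exists2 h, A h = phi & forall s, is_simp s -> eq_type s s' -> J s (act_simp h s)) ->
 is_simp s -> is_simp s' -> eq_type s s' -> J s s'.
Proof.
move=> J1 JT [r r0 Jr] ss ss' ty.
have [th [H [C pH H1 sE]]]:= simp_cone ss;have [th' [K [C' pK K1 sE']]]:= simp_cone ss'.
have [phi [a E P E2]]:= rebase C C' pK K1.
have pK': ppt th (K *m phi) by rewrite -E;exact: (p_part_conjX a pK).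
pose J' psi:= exists2 h, A h = psi & forall s, is_simp s -> eq_type s s' -> J s (act_simp h s).
have [|f1 f2 [h1 hE1 h1P] [h2 hE2 h2P]||psi [ap cp [h hE hJ] comp]]:= @align th H (K *m phi) J' C pH pK'.
- by exists 1%g=>// t _ _;rewrite act_simp1.
- exists (h2 * h1)%g=>[|t ts tt];first by rewrite AM hE1 hE2. rewrite act_simpM;apply: (JT _ (act_simp h1 t));first exact: h1P. by apply: h2P; [exact: act_simp_simp|exact: act_simp_type].
- by exists r.
apply: (JT _ (act_simp h s));first exact: hJ.
suff -> : act_simp h s = s' by exact: J1.
have cE: conjX psi th = th by rewrite /conjX -mulmxA -cp mulmxA mulVmx ?mul1mx// ap.1.
rewrite sE' E2 sE act_simp_ends// hE cE;apply: compat_simp_eq=>//.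
- by rewrite -{1}cE;exact: (p_part_conjX ap pH).
- by rewrite (B_aut _ _ ap).
- by rewrite (B_aut _ _ a).
have:= act_simp_type h ty;rewrite sE act_simp_ends// hE cE /eq_type=> ->.
by rewrite sE' E2.
Qed.
End Building.

(** * Nilradicals and the derivative of the orbit map *)

Section Isotropy.
Implicit Types (H K: g) (th phi: 'M[R]_n).

Lemma eig_pairing H x y (s t: R): x *m ad H = s *: x -> y *m ad H = t *: y -> s + t != 0 -> B x y = 0.
Proof.
move=> xs yt st;have: (s + t) * B x y = 0. rewrite mulrDl -BZl -xs -BZr -yt !mul_admx B_ad;ring.
by move=> /eqP;rewrite mulf_eq0 (negPf st)=> /eqP.
Qed.
Lemma gfilt_pairing H u w: gfilt H (fun l=> 0 < l) u -> gfilt H (fun l=> 0 <= l) w -> B u w = 0.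
Proof.
move=>[k [x [l [-> xl lP]]]] [k' [y [l' [-> yl lP']]]];rewrite B_suml big1// => i _.
rewrite B_sumr big1// => j _.
have [->|x0]:= eqVneq (x i) 0;first by rewrite B0l.
have [->|y0]:= eqVneq (y j) 0;first by rewrite B0r.
apply: (eig_pairing (xl i) (yl j));rewrite gt_eqF// ltr_pwDl//; [exact: lP|exact: lP'].
Qed.
(** Evaluate at [H] itself, which has eigenvalue 0: the components of its bracket with [u] are those
    of [u] times their eigenvalues. *)
Lemma pres_ad th H u: cartan th -> ppt th H -> pres H (ad u) -> gfilt H (fun l=> 0 <= l) u.
Proof.
move=> C pH pu;have [S [d [F SA]]]:= frame1 C pH.
have: gfilt H (fun l=> 0 <= l) H. by apply: (@gfilt_eig H _ H 0)=>//;rewrite scale0r mul_admx brxx.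
move/pu;rewrite mul_admx brC -mul_admx=> /(gfiltP _ _ F.1 SA) h.
apply/(gfiltP _ _ F.1 SA)=> j uj;have [-> //|dj]:= eqVneq (d 0 j) 0;apply: h.
have -> : - (u *m ad H) *m invmx S = - (u *m invmx S *m diag_mx d). by rewrite (mx_diagE F.1 SA) !mulmxA mulNmx mulmxK// F.1.
by rewrite mul_mx_diag mxE [X in - X]mxE oppr_eq0 mulf_neq0.
Qed.
(** The form [B u] vanishes on the parabolic subalgebra, hence on the kernel of [Dx], and so factors
    through [Dx]. Since [B] is invariant, [B (u *m phi) z] is [B u] at the preimage of [z], whose
    image under [Dx] is at most [C / E] times [z]. *)
Lemma contraction H m (Dx: {linear g -> 'rV[R]_m}) (P: {linear 'rV[R]_m -> g}) (N: 'rV[R]_m -> R) (c: R) u :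
 (forall w: 'rV[R]_m, Dx (P w) = w) -> (forall v, Dx v = 0 -> gfilt H (fun l=> 0 <= l) v) -> 0 < c -> (forall w: 'rV[R]_m, `|w| <= c * N w) -> gfilt H (fun l=> 0 < l) u ->
 exists2 K: R, 0 < K & forall phi (E C: R), aut phi -> 0 < E -> 0 <= C -> (forall v, E * N (Dx v) <= C * `|v *m phi|) -> `|u *m phi| <= K * C / E.
Proof.
move=> PD ker c0 cN Hu.
have lin: linear (fun w: 'rV[R]_m=> B u (P w): R^o) by move=> k v w;rewrite linearP BDr BZr.
have [K K0 KP]:= fdim_bnd (fmx 1 m) lin.
have b v: `|B u v| <= K * (c * N (Dx v)). have -> : B u v = B u (P (Dx v)). have: B u (v - P (Dx v)) = 0 by apply: (gfilt_pairing Hu);apply: ker;rewrite linearB/= PD subrr.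
  by rewrite BDr BNr=> /eqP;rewrite subr_eq0=> /eqP. by apply: le_trans (KP _) _;rewrite ler_wpM2l// ltW.
set I:= invmx Kmx.
exists (K * c * (n.+1%:R * `|I| + 1)). by rewrite !mulr_gt0// ltr_wpDl// mulr_ge0.
move=> phi E C a E0 C0 EP.
have Bz z: `|B (u *m phi) z| <= K * c * C / E * `|z|. have -> : B (u *m phi) z = B u (z *m invmx phi) by rewrite -(B_aut (u) _ a) mulmxKV// a.1.
 apply: le_trans (b _) _;have -> : K * c * C / E * `|z| = K * (c * (C * `|z| / E)) by ring. rewrite ler_wpM2l ?(ltW K0)// ler_wpM2l ?(ltW c0)// ler_pdivlMr// mulrC.
 by have:= EP (z *m invmx phi);rewrite mulmxKV ?a.1.
apply: mx_norm_leP=>[|i j]. by rewrite divr_ge0 ?mulr_ge0 ?addr_ge0 ?mulr_ge0// ltW.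
have -> : (u *m phi) i j = B (u *m phi) (delta_mx 0 j *m I). rewrite kilC kil_repr ord1;move: (u *m phi)=> x. by rewrite -rowE [RHS]mxE [RHS]mxE.
apply: le_trans (Bz _) _.
have -> : K * c * (n.+1%:R * `|I| + 1) * C / E = K * c * C / E * (n.+1%:R * `|I| + 1) by ring.
apply: ler_wpM2l;first by rewrite divr_ge0 ?mulr_ge0// ltW.
apply: le_trans (mulmx_norm _ _) _;apply: le_trans (_: n.+1%:R * `|I| <= _);last by rewrite lerDl.
rewrite ler_wpM2r// ler_piMr// mx_norm_leP// => k l.
by rewrite mxE;case: (_ && _);rewrite ?normr1 ?normr0.
Qed.

Section Kernel.
Context {G: groupType} (A: G -> 'M[R]_n) (ex: g -> G) (e0: g) (dA: {linear g -> 'M[R]_n}).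
Hypotheses (Aaut: forall h, aut (A h)) (A1: A 1%g = 1%:M) (AM: forall h k, A (h * k)%g = A k *m A h) (ex0: ex e0 = 1%g) (sA: sdiff (fun u=> A (ex u)) e0 dA) (dAE: dA =1 ad).
Context {X: Type} (act: G -> X -> X) (x0: X).
Hypotheses (act1: forall x: X, act 1%g x = x) (actM: forall h k (x: X), act (h * k)%g x = act h (act k x)).

(* If [u] is in the kernel, then [exp (s u)] differs from an element [k] of the stabilizer by [o(s)]. *)
Lemma orb_kernel th H m (orb: g -> 'rV[R]_m) (Dx: {linear g -> 'rV[R]_m}) (Cs rs: R) u: cartan th -> ppt th H -> (forall k, act k x0 = x0 -> pres H (A k)) ->
 sdiff orb e0 Dx -> 0 < Cs -> 0 < rs -> (forall v, `|v - e0| < rs -> exists2 w, `|w - e0| <= Cs * `|orb v - orb e0| & act (ex w) x0 = act (ex v) x0) -> Dx u = 0 -> gfilt H (fun l=> 0 <= l) u.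
Proof.
move=> C pH stab sO Cs0 rs0 sec u0;apply: (pres_ad C pH).
have [S [d [F SA]]]:= frame1 C pH;apply/(presP _ F.1 SA)=> i j dij.
have lin: linear (fun M: 'M[R]_n=> (S *m M *m invmx S) i j: R^o). by move=> k M N;rewrite mulmxDr -scalemxAr mulmxDl -scalemxAl !mxE.
pose l (M: 'M[R]_n): R:= (S *m M *m invmx S) i j.
have [Kl Kl0 KlP] : exists2 K: R, 0 < K & forall M, `|l M| <= K * `|M|. exact: (fdim_bnd (fmx n n) lin).
have l1: l 1%:M = 0. by rewrite /l mulmx1 mulmxV ?F.1// mxE;case: eqVneq dij=>// ->;rewrite ltxx.
have [Ka [Ka0 [ra ra0 raP]]]:= sd_lip (fmx 1 n) sA.
have A0: A (ex e0) = 1%:M by rewrite ex0.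
have [N N0 NE] : exists2 N: R, 0 < N & n.+1%:R = N by exists n.+1%:R.
have [U U0 uU] : exists2 U: R, 0 < U & `|u| <= U by exists (`|u| + 1);rewrite ?ltr_wpDl ?lerDl.
apply/eqP;rewrite -normr_le0 -/(l (ad u)).
pose T:= Kl * (U + N * 4 * (Ka * (Cs * U))).
have T0: 0 <= T by rewrite /T;apply: ltW;rewrite mulr_gt0// addr_gt0// !mulr_gt0.
have NKC: 0 < N * Ka * Cs * U by rewrite !mulr_gt0.
suff He (e: R): 0 < e -> `|l (ad u)| <= e * T by apply: (@small_le0 _ T 1)=>// e ep _;exact: He.
move=> ep.
have [r1 r10 r1P]:= (sA: sdiff _ _ _) e ep;have [r2 r20 r2P]:= (sO: sdiff _ _ _) e ep.
pose M1:= Num.min (Num.min rs ra) (Num.min r1 r2).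
have M10: 0 < M1 by rewrite !lt_min rs0 ra0 r10.
(* [s] will be the inverse of [D + 1]; the summands of [D] are what the smallness conditions [h1] to
   [h4] ask for. *)
pose D:= U * (Ka + 1) + e * Cs * U / Num.min ra 1 + e * N * Ka * Cs * U * 2 + U / M1.
have m10: 0 < Num.min ra 1 by rewrite lt_min ra0 ltr01.
have p1: 0 <= U * (Ka + 1) by rewrite mulr_ge0 ?addr_ge0// ltW.
have p2: 0 <= e * Cs * U / Num.min ra 1 by rewrite divr_ge0 ?mulr_ge0// ltW.
have p3: 0 <= e * N * Ka * Cs * U * 2 by rewrite !mulr_ge0// ltW.
have p4: 0 <= U / M1 by rewrite divr_ge0// ltW.
pose s:= (D + 1)^-1.
have D0: 0 < D + 1. by rewrite /D;lra.
have s0: 0 < s by rewrite invr_gt0.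
have sD a: 0 <= a -> a <= D -> s * a < 1. by move=> a0 aD;rewrite mulrC ltr_pdivrMr// mul1r ltr_pwDr.
have h1: s * (U * (Ka + 1)) < 1 by apply: sD=>//;rewrite /D;lra.
have h2: s * (e * Cs * U) < Num.min ra 1. by have: s * (e * Cs * U / Num.min ra 1) < 1; [apply: sD=>//;rewrite /D;lra|rewrite mulrA ltr_pdivrMr// mul1r].
have h3: s * (e * N * Ka * Cs * U * 2) < 1 by apply: sD=>//;rewrite /D;lra.
have h4: s * U < M1. by have: s * (U / M1) < 1; [apply: sD=>//;rewrite /D;lra|rewrite mulrA ltr_pdivrMr// mul1r].
clearbody s D.
set v:= e0 + s *: u;have vE: v - e0 = s *: u by rewrite /v;zmod.
have nu: `|v - e0| <= s * U by rewrite vE normrZ gtr0_norm// ler_wpM2l// ltW.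
have vM: `|v - e0| < M1 by exact: le_lt_trans h4.
have e0M (r: R): 0 < r -> `|e0 - e0| < r by rewrite subrr normr0.
move: vM;rewrite /M1 !lt_min=> /andP[/andP[vs va] /andP[v1 v2]].
have ov: `|orb v - orb e0| <= e * (s * U). have:= r2P v e0 v2 (e0M _ r20);rewrite vE linearZ_LR u0 scaler0 subr0 -vE=> /le_trans;apply. by rewrite ler_wpM2l// ltW.
have [w wv wx]:= sec v vs.
have ws: `|w - e0| <= s * (e * Cs * U). apply: le_trans wv _;have -> : s * (e * Cs * U) = Cs * (e * (s * U)) by ring. by rewrite ler_wpM2l// ltW.
have wa: `|w - e0| < ra by apply: le_lt_trans ws _;move: h2;rewrite lt_min=> /andP[].
pose k:= ((ex w)^-1 * ex v)%g.
have kx: act k x0 = x0 by rewrite /k actM -wx -actM mulVg act1.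
have AkQ: A k *m A (ex w) = A (ex v) by rewrite -AM /k mulVKg.
have lk: l (A k) = 0 by have:= stab k kx=> /(presP _ F.1 SA)/(_ i j dij).
have Q1: `|A (ex w) - 1%:M| <= Ka * (s * (e * Cs * U)). by rewrite -A0;apply: le_trans (raP w e0 wa (e0M _ ra0)) _;rewrite ler_wpM2l// ltW.
have P1: `|A (ex v) - 1%:M| <= Ka * (s * U). by rewrite -A0;apply: le_trans (raP v e0 va (e0M _ ra0)) _;rewrite ler_wpM2l// ltW.
have P2: `|A (ex v) - 1%:M - s *: ad u| <= e * (s * U). have:= r1P v e0 v1 (e0M _ r10);rewrite A0 dAE vE adZ -vE=> /le_trans;apply. by rewrite ler_wpM2l// ltW.
set Q:= A (ex w) - 1%:M in Q1;set P:= A (ex v) in AkQ P1 P2.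
have KE: A k = P - A k *m Q by rewrite /Q mulmxBr mulmx1 AkQ;zmod.
have KQ: `|A k *m Q| <= N * `|A k| * (Ka * (s * (e * Cs * U))). by apply: le_trans (mulmx_norm _ _) _;rewrite NE ler_wpM2l// mulr_ge0// ltW.
have nP: `|P| <= 2. have -> : P = (P - 1%:M) + 1%:M by zmod. apply: le_trans (ler_normD _ _) _;have:= @norm_mx1 R n;move: P1 h1 s0 U0 Ka0. by move: `|_| `|_| => a b;nra.
have nK: `|A k| <= 4. have: `|A k| <= `|P| + `|A k *m Q| by rewrite {1}KE (le_trans (ler_normB _ _)). have:= normr_ge0 (A k);move: KQ h3 nP;move: `|A k| `|P| `|A k *m Q| => a b c.
 have -> : N * a * (Ka * (s * (e * Cs * U))) = a * (s * (e * N * Ka * Cs * U)) by ring. have -> : s * (e * N * Ka * Cs * U * 2) = 2 * (s * (e * N * Ka * Cs * U)) by ring. by move: (s * _)=> f;nra.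
have lE: s * l (ad u) = - l (A k - 1%:M - s *: ad u). have lD M M': l (M - M') = l M - l M' by rewrite /l mulmxBr mulmxBl mxE [X in _ + X]mxE.
 have lZ a M: l (a *: M) = a * l M by rewrite /l -scalemxAr -scalemxAl mxE. by rewrite !lD lk l1 lZ;ring.
have fin: `|A k - 1%:M - s *: ad u| <= s * e * (U + N * 4 * (Ka * (Cs * U))). have -> : A k - 1%:M - s *: ad u = (P - 1%:M - s *: ad u) - A k *m Q by rewrite {1}KE;zmod.
 apply: le_trans (ler_normB _ _) _. have: N * `|A k| * (Ka * (s * (e * Cs * U))) <= N * 4 * (Ka * (s * (e * Cs * U))). by apply: ler_wpM2r; [apply: ltW;rewrite !mulr_gt0|rewrite ler_wpM2l// ltW].
 move=> h5;apply: le_trans (lerD P2 (le_trans KQ h5)) _. by rewrite le_eqVlt;apply/orP;left;apply/eqP;ring.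
rewrite -(ler_pM2l s0) -[X in X * `|_|](gtr0_norm s0) -normrM lE normrN.
apply: le_trans (KlP _) _;apply: le_trans (_: Kl * (s * e * (U + N * 4 * (Ka * (Cs * U)))) <= _). by rewrite ler_wpM2l// ltW.
by rewrite /T le_eqVlt;apply/orP;left;apply/eqP;ring.
Qed.
End Kernel.
End Isotropy.
End AbstractLieAlgebra.

Local Notation ppt:= Defs.p_part.

Lemma decay_constant_ge0 {R: realType} (l k k' a d: R): 0 < l -> 0 < k -> 0 < k' -> 0 <= a -> 0 < d -> 0 <= l * (k * a) * (k' * a / d).
Proof.
move=> l0 k0 k0' a0 d0.
by rewrite !mulr_ge0 ?divr_ge0 ?mulr_ge0 ?invr_ge0 ?(ltW l0) ?(ltW k0) ?(ltW k0') ?(ltW d0).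
Qed.
Lemma decay_bound {R: realType} (z l k k' a d t p p': R): 0 < l -> 0 <= p -> 0 <= p' -> z <= l * p * p' -> p <= k * a / t^-1 -> p' <= k' * a / d -> z <= t * (l * (k * a) * (k' * a / d)).
Proof.
move=> l0 p0 p0' zp;rewrite invrK=> h1 h2;apply: le_trans zp _.
have -> : t * (l * (k * a) * (k' * a / d)) = l * (k * a * t) * (k' * a / d) by ring.
apply: ler_pM=>//;first by rewrite mulr_ge0// ltW.
by rewrite ler_wpM2l// ltW.
Qed.

(** * Flag manifolds *)

Section FlagManifold.
Context {R: realType} {n: nat} {G: groupType} (LG: lie_group R n G) (HG: semisimple LG) (Htype: orbits_meet_chambers_once LG) (D: model LG) {m: nat} (F: manifold R m (Flag D))
 (HF: homogeneous_structure F).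
Local Notation br:= (lie_bracket LG).
Local Notation A:= (Ad_mx LG).
Local Notation c0:= (chart_at LG 1%g).
Local Notation e0:= (cfun (chart_at LG 1%g) 1%g).

Lemma lie_algebra: lie_axioms br.
Proof.
split; [exact: bracket_linearl|exact: bracket_linearr|exact: jacobi|exact: HG].
Qed.
Local Notation L:= lie_algebra.

Lemma Ad_aut h: aut br (A h).
Proof.
split;last exact: Ad_mx_brk.
have E: A h *m A h^-1%g = 1%:M by rewrite -Ad_mxM mulVg Ad_mx1.
exact: (proj1 (mulmx1_unit E)).
Qed.
Lemma flag_simp (x: Flag D): is_simp br (val x).
Proof. by have:= set_valP x=> -[]. Qed.
Lemma flag_type (x: Flag D): eq_type A (val x) (ends_at LG (mod_th D) (tau_mod D)).
Proof. by have:= set_valP x=> -[]. Qed.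
Lemma act_FlagE h (x: Flag D): val (act_Flag h x) = act_simplex LG h (val x).
Proof.
rewrite /act_Flag val_insubd;case: ifPn=>// /negP[];rewrite inE;split. exact: (act_simp_simp L Ad_aut (Ad_mx1 LG) (Ad_mxM LG) h (flag_simp x)).
exact: (act_simp_type (Ad_mxM LG) h (flag_type x)).
Qed.
Lemma act_Flag1 x: act_Flag 1%g x = x :> Flag D.
Proof. by apply: val_inj;rewrite act_FlagE;exact: (act_simp1 (Ad_mx1 LG)). Qed.
Lemma act_FlagM h k (x: Flag D): act_Flag (h * k)%g x = act_Flag h (act_Flag k x).
Proof.
apply: val_inj;rewrite (act_FlagE (h * k)%g x) (act_FlagE h (act_Flag k x)) (act_FlagE k x).
exact: (act_simpM (Ad_mxM LG)).
Qed.
Lemma Ad_ch0: A (cinv c0 e0) = 1%:M.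
Proof. by rewrite cfunK ?Ad_mx1//;exact: mem_chart_at. Qed.
Lemma flag_joined (x y: Flag D): joined F x y.
Proof.
have [rj rj0 jP]:= orb_joined act_Flag1 HF.
have [C [C0 [r r0 nearP]]]:= aut_near_Ad L (fun u=> Ad_aut (cinv c0 u)) Ad_ch0 (Ad_mx_sd LG) (fun=> erefl).
(* The first alternative makes [J] reflexive also on sets that are not simplices of this type. *)
pose J (s s': set (set (R -> 'M[R]_n))):= s = s' \/ exists x y: Flag D, [/\ val x = s, val y = s' & joined F x y].
have [] : J (val x) (val y).
- apply: (simp_joined L Ad_aut (Ad_mx1 LG) (Ad_mxM LG) Htype) (flag_simp x) (flag_simp y) _.
 + by move=> s;left.
 + move=> s1 s2 s3 [->//|[x1 [x2 [E1 E2 j12]]]] [<-|[x3 [x4 [E3 E4 j34]]]];first by right;exists x1, x2. right;exists x1, x4;split=>//;apply: joined_trans j12 _.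
  by rewrite (_: x2 = x3)//;apply: val_inj;rewrite E2 E3.
 + exists (Num.min r (rj / C));first by rewrite lt_min r0 divr_gt0. move=> phi a;rewrite lt_min=> /andP[ar arj];have [u uC uE]:= nearP phi a ar. exists (cinv c0 u)=>// s ss st;right.
  have sF: Flag D s by split; [exact: ss|exact: (etrans st (flag_type y))]. pose z: Flag D:= SigSub (mem_set sF). exists z, (act_Flag (cinv c0 u) z);split=>//;first exact: act_FlagE.
  by apply: jP;apply: le_lt_trans uC _;rewrite mulrC -ltr_pdivlMr. exact: (etrans (flag_type x) (esym (flag_type y))).
- by move/val_inj=> ->;exact: joined_refl.
by move=>[x' [y' [/val_inj -> /val_inj -> ]]].
Qed.

Variable q: riemannian_metric F.
Local Notation N:= (tangent_norm q).
Local Notation orb:= (orb_ch LG F (@act_Flag R n G LG D)).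

(** The derivative of [h] carries the orbit derivative at [x] in direction [v] to the one at
    [act_Flag h x] in direction [Ad h v]. Expansion bounds this from below by [E], and [C] bounds it
    from above, as [contraction] requires. *)
Lemma flag_contraction (x: Flag D): exists th H, [/\ cartan br th, ppt th H, kform br H H = 1, val x = ends br th (cone br th H) &
 forall u, gfilt br H (fun l=> 0 < l) u -> exists2 K: R, 0 < K & forall h (E C: R), 0 < E -> 0 <= C -> (forall v, N (act_Flag h x) ('d (orb (act_Flag h x)) e0 v) <= C * `|v|) ->
  E <= expansion_factor q (act_Flag h) x -> `|u *m A h| <= K * C / E].
Proof.
have [th [H [cth pH H1 xE]]]:= simp_cone L (flag_simp x).
exists th, H;split=>// u Hu.
have [P PD]:= orb_ch_onto act_Flag1 HF x.
have [Cs [Cs0 [rs rs0 sec]]]:= local_section act_Flag1 HF x.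
have ker v: 'd (orb x) e0 v = 0 -> gfilt br H (fun l=> 0 <= l) v. have [r1 r10 r1P] : exists2 r: R, 0 < r & forall v, `|v - e0| < r ->
   cdom (chart_at F x) (act_Flag (cinv c0 v) x) /\ `|orb x v - orb x e0| < rs. have h:= ch_nbhs (chart_atP F x) (mem_chart_at F x) rs0. have /nbhs_ltP[r1 r10 r1P]:= orb_near act_Flag1 HF (x:= x) h.
  by exists r1=>// w /r1P[cw sw];split=>//;rewrite (orb_ch_e0 LG F act_Flag1). have ex0: cinv c0 e0 = 1%g by rewrite cfunK//;exact: mem_chart_at.
 apply: (orb_kernel L (Ad_mx1 LG) (Ad_mxM LG) ex0 (Ad_mx_sd LG) (fun=> erefl) act_Flag1 act_FlagM (x0:= x) (orb:= orb x) cth pH _ (orb_ch_sd act_Flag1 HF x) Cs0 r10 _).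
  move=> k kx;apply: (stab_pres L Ad_aut (Ad_mx1 LG) (Ad_mxM LG) Htype cth pH H1). by rewrite -xE -[RHS](congr1 val kx) act_FlagE. move=> w /r1P[cw sw].
 have [|u' h1 h2]:= sec _ cw;first by move: sw;rewrite (orb_ch_e0 LG F act_Flag1). by exists u'; [rewrite (orb_ch_e0 LG F act_Flag1 x);exact: h1|exact: h2].
have [k [k0 [c c0' NP]]]:= tnorm_equiv q x.
have k0': 0 < k^-1 by rewrite invr_gt0.
have kN w: `|w| <= k^-1 * N x w by rewrite ler_pdivlMl//;have /andP[]:= NP w.
have [K K0 KP]:= contraction L PD ker k0' kN Hu.
exists K=>// h E C E0 C0 NC EE;apply: KP=>//;first exact: Ad_aut.
move=> v;have [_ /(_ v) dE]:= act_ch_sd act_Flag1 act_FlagM HF h x.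
have e:= etrans (congr1 ('d (orb (act_Flag h x)) e0) (mul_Ad_mx LG h v)) (esym dE).
have Z (a b d f: R): a <= b -> d = b -> d <= f -> a <= f by move=> ab ->;exact: le_trans ab.
refine (Z _ _ _ _ _ (congr1 (N (act_Flag h x)) e) (NC (v *m A h))).
move: ('d (orb x) e0 v)=> w;have [->|w0]:= eqVneq w 0. by rewrite tnorm0 mulr0 tnorm_ge0.
by apply: le_trans (expn_factor_le _ q h x w0);rewrite ler_wpM2r// tnorm_ge0.
Qed.
Lemma flag_unique (x y: Flag D) (C c: R) (h: nat -> G): 0 <= C -> 0 < c -> (forall k v, N (act_Flag (h k) x) ('d (orb (act_Flag (h k) x)) e0 v) <= C * `|v|) ->
 (forall k v, N (act_Flag (h k) y) ('d (orb (act_Flag (h k) y)) e0 v) <= C * `|v|) ->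
 (forall T: R, exists k, T <= expansion_factor q (act_Flag (h k)) x /\ c <= expansion_factor q (act_Flag (h k)) y) -> x = y.
Proof.
move=> C0 c0' Nx Ny HE.
have [th [H [cth pH H1 xE xP]]]:= flag_contraction x.
have [th' [H' [cth' pH' H1' yE yP]]]:= flag_contraction y.
apply: val_inj;rewrite xE yE.
have ty: eq_type A (ends br th (cone br th H)) (ends br th' (cone br th' H')). by rewrite -xE -yE;exact: (etrans (flag_type x) (esym (flag_type y))).
apply: (opposite_simp_eq L (Ad_mx1 LG) Htype cth cth' pH pH' H1 H1' ty).
move=> u w Hu Hw;have [K K0 KP]:= xP u Hu;have [K' K0' KP']:= yP w Hw.
have [_ _ [b b0 bP]] : bilin_map (fun u w=> kform br u w: R^o). apply: (fdim_bilin (fmx 1 n) (fmx 1 n));first exact: (kil_lin L). by move=> z a v v';rewrite (BDr L) (BZr L).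
suff: `|kform br u w| <= 0 by move: (kform br u w)=> z;rewrite normr_le0=> /eqP.
apply: (small_le0 ltr01 (decay_constant_ge0 b0 K0 K0' C0 c0'))=> t t0 _.
have [k [h1 h2]]:= HE t^-1.
have ti: 0 < t^-1 by rewrite invr_gt0.
have bb: `|kform br u w| <= b * `|u *m A (h k)| * `|w *m A (h k)|. exact: (eq_ind _ (fun z=> `|z| <= b * `|u *m A (h k)| * `|w *m A (h k)|) (bP _ _) _ (B_aut L u w (Ad_aut (h k)))).
exact: (decay_bound b0 (normr_ge0 _) (normr_ge0 _) bb (KP (h k) _ C ti C0 (Nx k) h1) (KP' (h k) _ C c0' C0 (Ny k) h2)).
Qed.
End FlagManifold.

(** * Word metrics *)

Section WordMetricTheory.
Context {Gam: groupType}.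
Local Open Scope group_scope.
Implicit Types (S: seq Gam) (x y z: Gam).

Lemma word_cat S k l x y: word_ball S k x -> word_ball S l y -> word_ball S (k + l) (x * y).
Proof.
move=>[w [Sw wk ->]] [v [Sv vl ->]];exists (w ++ v);split.
- by rewrite /is_word all_cat;apply/andP.
- by rewrite size_cat leq_add.
by elim: w {Sw wk}=>[|a w IH]/=;rewrite ?mul1g// -mulgA IH.
Qed.
Lemma word_inv S k x: word_ball S k x -> word_ball S k x^-1.
Proof.
move=>[w [Sw wk ->]];elim: w k Sw wk=>[|a w IH] k/=. by move=> _ _;exists [::];rewrite invg1.
case/andP=> Sa Sw;case: k=>// k wk;rewrite invgM -addn1;apply: word_cat;first exact: IH.
by exists [:: a^-1];split=>//=;rewrite ?mulg1// invgK orbC Sa.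
Qed.

Section Generators.
Variable S: seq Gam.
Hypothesis HS: generates S.
Local Notation wd:= (word_dist S).
Local Notation wl:= (word_length S).

Lemma word_lenP x: word_ball S (wl x) x /\ forall k, word_ball S k x -> (wl x <= k)%N.
Proof.
rewrite /word_length;case: pselect=>[e|[]]. case: ex_minnP=> k /asboolP kx kmin;split=>// l lx;exact/kmin/asboolP.
by have [k kx]:= HS x;exists k;apply/asboolP.
Qed.
Lemma wd_refl x: wd x x = 0%N.
Proof.
apply/eqP;rewrite -leqn0;apply: (word_lenP _).2;rewrite mulVg.
by exists [::].
Qed.
Lemma wdC x y: wd x y = wd y x.
Proof.
have H a b: (wd a b <= wd b a)%N. apply: (word_lenP _).2;have -> : a^-1 * b = (b^-1 * a)^-1 by rewrite invgM invgK. by apply: word_inv;exact: (word_lenP _).1.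
by apply/eqP;rewrite eqn_leq !H.
Qed.
Lemma wdT y x z: (wd x z <= wd x y + wd y z)%N.
Proof.
apply: (word_lenP _).2;have -> : x^-1 * z = (x^-1 * y) * (y^-1 * z) by rewrite -mulgA mulVKg.
exact: word_cat (word_lenP _).1 (word_lenP _).1.
Qed.
Lemma wd_eq0 x y: wd x y = 0%N -> x = y.
Proof.
rewrite /word_dist=> E;have:= (word_lenP (x^-1 * y)).1;rewrite E=> -[[|a w] [_//= _ h]].
by rewrite -[y](mulVKg x) h mulg1.
Qed.
Lemma wd_gen x s: s \in S -> (wd x (x * s) <= 1)%N.
Proof.
move=> Ss;apply: (word_lenP _).2;rewrite mulKg;exists [:: s].
by split=>//=;rewrite ?mulg1 ?Ss.
Qed.
Lemma word_geod x y: exists r: nat -> Gam, [/\ r 0%N = x, r (wd x y) = y & forall i j, (i <= j)%N -> (j <= wd x y)%N -> wd (r i) (r j) = (j - i)%N].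
Proof.
have [[w [Sw wn wE]] _]:= word_lenP (x^-1 * y);rewrite -/(wd x y) in wn.
pose r i:= x * foldr *%g 1 (take i w);have rn: r (wd x y) = y. by rewrite /r take_oversize// -wE mulVKg.
have r0: r 0%N = x by rewrite /r take0 mulg1.
have step i: (wd (r i) (r i.+1) <= 1)%N. rewrite /r word_distM;have [iw|iw]:= ltnP i (size w);last by rewrite !take_oversize ?wd_refl// ltnW. rewrite (take_nth 1)// -cats1;set a:= nth 1 w i.
 have -> : foldr *%g 1 (take i w ++ [:: a]) = foldr *%g 1 (take i w) * a. by elim: (take i w)=>[|b s IH]/=;rewrite ?mulg1 ?mul1g// IH mulgA.
 apply: (word_lenP _).2;rewrite mulKg;exists [:: a];split=>//=;rewrite ?mulg1// andbT. by have /allP/(_ a (mem_nth 1 iw)):= Sw.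
have up i j: (i <= j)%N -> (wd (r i) (r j) <= j - i)%N. move=> ij;rewrite -(subnKC ij);elim: (j - i)%N=>[|k IH];first by rewrite addn0 wd_refl.
 by have:= wdT (r (i + k)%N) (r i) (r (i + k.+1)%N);have:= step (i + k)%N;rewrite addnS;move: IH;lia.
exists r;split=>// i j ij jn;have:= up i j ij;have:= up 0%N i (leq0n i);have:= up j _ jn.
have:= wdT (r i) (r 0%N) (r (wd x y));have:= wdT (r j) (r i) (r (wd x y)).
by rewrite r0 rn;lia.
Qed.
Lemma wd_between x y k: (k <= wd x y)%N -> exists z, wd x z = k /\ wd z y = (wd x y - k)%N.
Proof.
by move=> kn;have [r [r0 rn rP]]:= word_geod x y;exists (r k);have:= rP 0%N k (leq0n k) kn;have:= rP k _ kn (leqnn _);rewrite r0 rn subn0.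
Qed.
Lemma word_ball_finite k: exists s: seq Gam, forall x, (wd 1 x <= k)%N -> x \in s.
Proof.
pose T:= 1 :: S ++ [seq x^-1 | x <- S].
suff [s sP] : exists s: seq Gam, forall x w, is_word S w -> (size w <= k)%N -> x = foldr *%g 1 w -> x \in s. exists s=> x xk;have [[w [Sw wn wE]] _]:= word_lenP (1^-1 * x).
 by apply: (sP x w)=>//; [exact: leq_trans xk|rewrite -wE invg1 mul1g].
elim: k=>[|k [s sP]];first by exists [:: 1]=> x [|a w]//= _ _ ->;rewrite inE.
exists [seq a * b | a <- T, b <- s]=> x w Sw wk ->;apply/allpairsP;case: w Sw wk=>[|a w] Sw wk. by exists (1, 1);split;rewrite ?mulg1 ?inE ?eqxx//;exact: (sP _ [::]).
case/andP: Sw=> Sa Sw;exists (a, foldr *%g 1 w);split=>//;last exact: (sP _ w).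
rewrite inE mem_cat;apply/orP;right;case/orP: Sa=> Sa;apply/orP;first by left.
by right;apply/mapP;exists a^-1;rewrite ?invgK.
Qed.
End Generators.

Lemma wd_compare S S': generates S -> generates S' -> exists K, forall x y, (word_dist S x y <= K * word_dist S' x y)%N.
Proof.
move=> HS HS';pose K:= (\sum_(s <- S') word_length S s)%N;exists K=> x y.
have gen s: (s \in S') || (s^-1 \in S') -> (word_dist S 1 s <= K)%N. have gen1 t: t \in S' -> (word_dist S 1 t <= K)%N. by move=> tS;rewrite /word_dist invg1 mul1g /K (big_rem t)//= leq_addr.
 case/orP=>[|/gen1];first exact: gen1. by rewrite -(word_distM _ s) mulg1 mulgV wdC.
have [[w [Sw wn wE]] _]:= word_lenP HS' (x^-1 * y);rewrite -/(word_dist S' x y) in wn.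
apply: leq_trans (_: K * size w <= _)%N;last by rewrite leq_mul2l wn orbT.
have -> : word_dist S x y = word_dist S 1 (foldr *%g 1 w) by rewrite -wE /word_dist invg1 mul1g.
elim: w Sw {wn wE}=>[|a w IH]/=;first by rewrite wd_refl.
case/andP=> Sa Sw;apply: leq_trans (wdT HS a _ _) _.
by rewrite mulnS leq_add ?gen// -{1}[a]mulg1 word_distM IH.
Qed.
End WordMetricTheory.

(** * Gromov products and stability of quasigeodesics *)

Section Hyperbolic.
Context {Gam: groupType} (S: seq Gam) (HS: generates S) (delta: nat).
Local Open Scope nat_scope.
Local Notation d:= (word_dist S).
Hypothesis four_point: forall x y z w, d x y + d z w <= maxn (d x z + d y w) (d x w + d y z) + delta.*2.
Implicit Types (x y z o a b c: Gam) (p u v: nat -> Gam).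

(* Twice the Gromov product. *)
Definition gp o a b: nat:= d a o + d b o - d a b.

Lemma gpE o a b: gp o a b + d a b = d a o + d b o.
Proof. by rewrite /gp subnK// (wdC HS b o) wdT. Qed.
Lemma gpC o a b: gp o a b = gp o b a.
Proof. by rewrite /gp addnC (wdC HS a b). Qed.
Lemma gp_ultra o a b c: minn (gp o a b) (gp o b c) <= gp o a c + delta.*2.
Proof.
have:= four_point a c b o;have:= gpE o a b;have:= gpE o b c;have:= gpE o a c.
rewrite (wdC HS c b);lia.
Qed.
Lemma gp_le o a b: gp o a b <= 2 * d a o.
Proof. have:= gpE o a b;have:= wdT HS a b o;rewrite (wdC HS b a);lia. Qed.
Lemma gp_self o a: gp o a a = 2 * d a o.
Proof. by rewrite /gp wd_refl// subn0 mul2n addnn. Qed.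
Lemma gpM g o a b: gp (g * o)%g (g * a)%g (g * b)%g = gp o a b.
Proof. by rewrite /gp !word_distM. Qed.
(** Bisection: a chain of [2 ^ N] steps that stays away from [x] costs only [N] uses of the
    ultrametric inequality [gp_ultra]. *)
Lemma gp_chain p x R K N i j: i <= j -> j - i <= 2 ^ N -> (forall k, i <= k <= j -> R <= d (p k) x) -> (forall k, d (p k) (p k.+1) <= K) -> 2 * R <= gp x (p i) (p j) + K + N * delta.*2.
Proof.
move=> ij jN far step;elim: N i j ij jN far=>[|N IH] i j ij jN far. have [E|ne]:= eqVneq i j. by rewrite E gp_self;have:= far j;rewrite E leqnn=> /(_ isT);lia.
 have E: j = i.+1 by move: jN;rewrite expn0;lia. subst j;have h1:= far i ltac:(lia);have h2:= far i.+1 ltac:(lia). by have:= gpE x (p i) (p i.+1);have:= step i;lia.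
pose k:= i + (j - i)./2.
have h1:= IH i k _ _ _;have h2:= IH k j _ _ _;have:= gp_ultra x (p i) (p k) (p j).
rewrite expnS in jN.
have k1: i <= k by rewrite /k;lia.
have k2: k <= j by rewrite /k;lia.
have {}h1: 2 * R <= gp x (p i) (p k) + K + N * delta.*2. by apply: IH=>//; [rewrite /k;lia|move=> l lk;apply: far;lia].
have {}h2: 2 * R <= gp x (p k) (p j) + K + N * delta.*2. by apply: IH=>//; [rewrite /k;lia|move=> l lk;apply: far;lia].
move: h1 h2;lia.
Qed.
(** [N] is at most logarithmic in [R], so that the first inequality fails for large [R]. *)
Lemma log_bound (a b: nat): exists R0, forall R N, R <= a * N.+1 -> 2 ^ N.-1 < b * R.+1 -> R <= R0.
Proof.
pose N0:= 4 * (b * (2 * a + 1) + 2);exists (a * N0.+1)=> R N RN Nb.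
have [h|h]:= leqP N N0;first by apply: leq_trans RN _;rewrite leq_mul2l ltnS h orbT.
have sq k: (k.+1) ^ 2 <= 2 ^ (2 * k). by rewrite mulnC expnM leq_exp2r// ltn_expl.
pose k:= N.-1./2;have h1: 2 ^ (2 * k) <= 2 ^ N.-1 by rewrite leq_exp2l// /k;lia.
have h2: N <= 2 * k.+1 by rewrite /k;lia.
have h3:= sq k;have: b * R.+1 <= b * (2 * a + 1) * N. rewrite -mulnA leq_mul2l;apply/orP;right;move: RN h;rewrite /N0;nia.
have h4: b * (2 * a + 1) * 4 <= N by move: h;rewrite /N0;lia.
move: h1 h3 Nb;rewrite expnS expn1=> h1 h3 Nb h5;move: (b * (2 * a + 1)) h4 h5=> c h4 h5.
have: b * R.+1 < b * R.+1. apply: leq_ltn_trans Nb;apply: leq_trans h5 _;apply: leq_trans h1;apply: leq_trans h3;nia.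
by rewrite ltnn.
Qed.

Definition qpath K p n:= forall i j, i <= j <= n -> d (p i) (p j) <= K * (j - i) /\ j - i <= K * d (p i) (p j) + K.

(** [R] is the largest distance from a point on a geodesic between the ends to the path. The path
    goes around the worst point [y] at distance at least [R], in a number of steps linear in [R]; by
    [gp_chain] such a detour forces [R] to be logarithmic in its own length. *)
Lemma qpath_near K: exists R0, forall p n, (forall k, d (p k) (p k.+1) <= K) -> qpath K p n -> forall y, d (p 0) y + d y (p n) = d (p 0) (p n) -> exists2 k, k <= n & d y (p k) <= R0.
Proof.
have [R0 R0P]:= log_bound (K + 4 * delta + 1) (7 * K + 2);exists R0=> p n st qp y0 y0b.
pose far R:= `[< exists y, d (p 0) y + d y (p n) = d (p 0) (p n) /\ forall k, k <= n -> R <= d y (p k) >].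
have bd R: far R -> R <= d (p 0) (p n). by move=> /asboolP[y [yb /(_ 0)]];rewrite (wdC HS y (p 0))=> /(_ isT);lia.
have ex: exists R, far R by exists 0;apply/asboolP;exists y0.
case: (ex_maxnP ex bd)=> R /asboolP[y [yb yR]] Rmax.
have near z: d (p 0) z + d z (p n) = d (p 0) (p n) -> exists2 k, k <= n & d z (p k) <= R. move=> zb;apply: contrapT=> H;suff /Rmax: far R.+1 by rewrite ltnn.
 by apply/asboolP;exists z;split=>// k kn;rewrite ltnNge;apply/negP=> zk;apply: H;exists k.
have [k1 k1n y0k]:= near y0 y0b;exists k1=>//;apply: leq_trans y0k _.
(* [a] and [b] will be points at distance [2 * R] before and after [y], or the ends of the path if
   these come sooner. *)
pose l:= minn (2 * R) (d (p 0) y);pose l':= minn (2 * R) (d y (p n)).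
have [a [a1 a2]]:= @wd_between _ S HS (p 0) y (d (p 0) y - l) ltac:(lia).
have [b [b1 b2]]:= @wd_between _ S HS y (p n) l' ltac:(lia).
have ab1: d (p 0) a + d a (p n) = d (p 0) (p n). have:= wdT HS y a (p n);have:= wdT HS a (p 0) (p n);rewrite /l in a1 a2;lia.
have ab2: d (p 0) b + d b (p n) = d (p 0) (p n). have:= wdT HS y (p 0) b;have:= wdT HS b (p 0) (p n);rewrite /l' in b1 b2;lia.
have dab: d a b = l + l'. have:= wdT HS y a b;have:= wdT HS a (p 0) b;have:= wdT HS b (p 0) (p n). by rewrite /l /l' in a1 a2 b1 b2 *;lia.
have [i iN ai] : exists2 i, i <= n & d a (p i) <= R /\ 2 * R <= gp y a (p i). have ya k: k <= n -> R <= d (p k) y by move=> kn;rewrite (wdC HS);exact: yR. have [h|h]:= leqP (2 * R) (d (p 0) y).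
  have [k kn ak]:= near a ab1;exists k=>//;split=>//;have:= gpE y a (p k);have:= ya k kn. by rewrite /l in a2;lia. have a0: a = p 0 by apply/esym;apply: (wd_eq0 HS);rewrite a1 /l;lia.
 by exists 0=>//;rewrite a0 wd_refl// gp_self;split=>//;have:= ya 0;lia.
have [j jN bj] : exists2 j, j <= n & d b (p j) <= R /\ 2 * R <= gp y b (p j). have yb' k: k <= n -> R <= d (p k) y by move=> kn;rewrite (wdC HS);exact: yR.
 have [h|h]:= leqP (2 * R) (d y (p n)). have [k kn bk]:= near b ab2;exists k=>//;split=>//;have:= gpE y b (p k);have:= yb' k kn. by rewrite /l' in b1;rewrite (wdC HS b y);lia.
 have bn: b = p n by apply: (wd_eq0 HS);rewrite b2 /l';lia. by exists n=>//;rewrite bn wd_refl// gp_self;split=>//;have:= yb' n (leqnn n);lia.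
have dij: d (p i) (p j) <= 6 * R. have:= wdT HS a (p i) (p j);have:= wdT HS b a (p j). by rewrite (wdC HS (p i) a);rewrite /l /l' in dab;lia.
have chain s t: s <= t <= n -> d (p s) (p t) <= 6 * R -> 2 * R <= gp y (p s) (p t) + K + up_log 2 (t - s) * delta.*2. move=> /andP[st' tn] _;apply: gp_chain=>//;first by rewrite up_logP.
 by move=> k kst;rewrite (wdC HS);apply: yR;lia.
pose M:= maxn (i - j) (j - i).
have MK: M <= K * (6 * R) + K. rewrite /M;case/orP: (leq_total i j)=> h. have [_ h2]:= qp i j ltac:(lia);have:= leq_mul (leqnn K) dij;lia.
 have [_ h2]:= qp j i ltac:(lia);rewrite (wdC HS) in h2;have:= leq_mul (leqnn K) dij;lia.
have c1: 2 * R <= gp y (p i) (p j) + K + up_log 2 M * delta.*2. rewrite /M;case/orP: (leq_total i j)=> h. rewrite (_: maxn _ _ = j - i);last by lia. by apply: chain=>//;rewrite h.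
 rewrite (_: maxn _ _ = i - j);last by lia. by rewrite gpC;apply: chain; [rewrite h|rewrite (wdC HS)].
have u1:= gp_ultra y a (p i) (p j);have u2:= gp_ultra y a (p j) b.
have ab0: gp y a b = 0 by have:= gpE y a b;rewrite (wdC HS b y) a2 b1 dab;rewrite /l;lia.
apply: (R0P R (up_log 2 M)). have h: 2 * R <= K + up_log 2 M * delta.*2 + 4 * delta. by move: c1 u1 u2 ai.2 bj.2;rewrite ab0 (gpC y b (p j));clear;lia.
 by move: h;move: (up_log 2 M)=> N;clear;rewrite -!muln2;nia.
have [M0|M1]:= leqP M 1;first last. have:= @up_log_gtn 2 M isT M1;move=> h;apply: leq_trans h _;apply: leq_trans MK _;lia.
have -> : up_log 2 M = 0 by case: (M) M0=>[|[|]].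
by rewrite expn0;clear;nia.
Qed.
(** A small product at [p j] says that [p j] is almost between [p i] and [p k]. In this form the
    lemma can be used without choosing geodesics. *)
Lemma morse K: exists D, forall p n, (forall k, d (p k) (p k.+1) <= K) -> qpath K p n -> forall i j k, i <= j -> j <= k -> k <= n -> gp (p j) (p i) (p k) <= D.
Proof.
have [R0 R0P]:= qpath_near K;pose T:= K * (2 * R0 + 1) + K;exists (2 * (K * T + R0)).
move=> p n st qp i j k ij jk kn.
pose p' l:= p (i + l);pose m:= k - i;pose s:= j - i.
have qp': qpath K p' m by move=> a b ab;have:= qp (i + a) (i + b);rewrite subnDl;apply;rewrite /m in ab;lia.
have st' l: d (p' l) (p' l.+1) <= K by rewrite /p' addnS.
have near := R0P p' m st' qp'.
suff [y [yb yj]] : exists y, d (p' 0) y + d y (p' m) = d (p' 0) (p' m) /\ d (p' s) y <= K * T + R0. have e0: p' 0 = p i by rewrite /p' addn0. have em: p' m = p k by rewrite /p' /m subnKC//;lia.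
 have es: p' s = p j by rewrite /p' /s subnKC. rewrite e0 em es in yb yj;have:= gpE (p j) (p i) (p k). have:= wdT HS y (p i) (p j);have:= wdT HS y (p k) (p j).
 rewrite (wdC HS y (p j)) (wdC HS (p k) y);lia.
have sm: s <= m by rewrite /s /m;lia.
have close (a b: nat): a <= s -> s <= b -> b <= m -> d (p' a) (p' b) <= 2 * R0 + 1 -> d (p' s) (p' a) <= K * T.
 move=> as' sb bm dab;have [_ h]:= qp' a b ltac:(lia);have [h2 _]:= qp' a s ltac:(lia). rewrite (wdC HS);apply: leq_trans h2 _;rewrite leq_mul2l;apply/orP;right.
 by rewrite /T;have:= leq_mul (leqnn K) dab;lia.
(* Take the last level at which the geodesic is near the path up to time [s]. One step further it is
   near the path after [s]. The two times are then close to each other, and [s] lies between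
   them. *)
pose ok t:= `[< exists y, [/\ d (p' 0) y + d y (p' m) = d (p' 0) (p' m), d (p' 0) y = t & exists2 a, a <= s & d y (p' a) <= R0] >].
have bd t: ok t -> t <= d (p' 0) (p' m) by move=> /asboolP[y [yb <- _]];lia.
have ex: exists t, ok t. exists 0;apply/asboolP;exists (p' 0);split;rewrite ?wd_refl//. by exists 0=>//;rewrite wd_refl.
case: (ex_maxnP ex bd)=> t /asboolP[y [yb yt [a as' ya]]] tmax.
have fin (b: nat): s <= b -> b <= m -> d (p' a) (p' b) <= 2 * R0 + 1 -> exists y, d (p' 0) y + d y (p' m) = d (p' 0) (p' m) /\ d (p' s) y <= K * T + R0.
 move=> sb bm dab;exists y;split=>//;have:= close a b as' sb bm dab. by have:= wdT HS (p' a) (p' s) y;rewrite (wdC HS y (p' a)) in ya;lia.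
have [E|ne]:= eqVneq (d y (p' m)) 0. apply: (fin m)=>//;rewrite -(wd_eq0 HS E) (wdC HS);lia.
have [y' [y'1 y'2]]:= @wd_between _ S HS y (p' m) 1 ltac:(lia).
have y'b: d (p' 0) y' + d y' (p' m) = d (p' 0) (p' m). have:= wdT HS y (p' 0) y';have:= wdT HS y' (p' 0) (p' m);lia.
have [b bm yb']:= near y' y'b.
have [bs|sb]:= leqP b s. suff /tmax: ok t.+1 by rewrite ltnn. apply/asboolP;exists y';split=>//;last by exists b. have:= wdT HS y (p' 0) y';have:= wdT HS y' (p' 0) (p' m);lia.
apply: (fin b)=>//;first exact: ltnW.
have:= wdT HS y (p' a) (p' b);have:= wdT HS y' y (p' b).
by rewrite (wdC HS (p' a) y);lia.
Qed.
End Hyperbolic.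

(** * Limits along ultrafilters *)

Section UltraLimits.
Local Open Scope classical_set_scope.

Lemma ultra_meet (T: Type) (U: set_system T) (A B: set T): UltraFilter U -> U A -> U B -> exists t, A t /\ B t.
Proof. by move=> UF UA UB;exact: (@filter_ex _ U _ _ (filterI UA UB)). Qed.
Lemma ultra_pick (T: Type) (U: set_system T) (X: eqType) (f: T -> X) (s: seq X): UltraFilter U -> (forall t, f t \in s) -> exists x, U [set t | f t = x].
Proof.
move=> UF fs;apply: contrapT=> H;suff: U [set t | f t \notin s]. move/filter_ex=>[t];by rewrite/= fs.
elim: s {fs}=>[|x s IH];first by apply: filterS filterT.
have nx: U (~` [set t | f t = x]). by have [h|//]:= @in_ultra_setVsetC _ U [set t | f t = x] _;case: H;exists x.
apply: filterS (filterI IH nx)=> t [/= ts tx];rewrite inE negb_or ts andbT.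
by apply/eqP.
Qed.
(** One ultrafilter fixes the limits of all sequences in play, which spares the successive
    extraction of subsequences. *)
Lemma ultra_limit (T: Type) (U: set_system T) (X: eqType) (f: T -> nat -> X): UltraFilter U -> (forall i, exists s: seq X, forall t, f t i \in s) ->
 exists h, forall i, U [set t | forall j, (j <= i)%N -> f t j = h j].
Proof.
move=> UF fs;have /choice[h hP] : forall i, exists x, U [set t | f t i = x]. by move=> i;have [s sP]:= fs i;exact: ultra_pick sP.
exists h;elim=>[|i IH];first by apply: filterS (hP 0%N)=> t ? [|].
apply: filterS (filterI IH (hP i.+1))=> t [h1 h2] j;rewrite leq_eqVlt=> /orP[/eqP->//|];exact: h1.
Qed.
Lemma ultra_cpt (T: Type) (M: topologicalType) (U: set_system T) (A: set M) (x: T -> M): UltraFilter U ->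
 compact A -> (forall t, A (x t)) -> exists2 y, A y & forall W, nbhs y W -> U [set t | W (x t)].
Proof.
move=> UF cA Ax;have [y [Ay yc]]:= cA (x @ U) _ (@filterE _ U _ _ Ax);exists y=>// W Wy.
have [//|nW]:= @in_ultra_setVsetC _ U [set t | W (x t)] _.
by have [z [/= h1 h2]]:= yc [set z | ~ W z] W nW Wy.
Qed.
Lemma ultra_nat: exists2 U: set_system nat, UltraFilter U & forall k, U [set n | (k <= n)%N].
Proof.
have [U [UF sU]]:= @ultraFilterLemma nat (nbhs \oo) _;exists U=>// k;apply: sU;exact: nbhs_infty_ge.
Qed.
End UltraLimits.

Lemma exp_unbnd {R: realType} (a T: R): 1 < a -> exists n, T <= a ^+ n.
Proof.
move=> a1;have b n: n%:R * (a - 1) <= a ^+ n. elim: n=>[|n IH];first by rewrite mul0r expr0. have h: 1 <= a ^+ n by rewrite exprn_ege1// ltW.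
 rewrite exprS -natr1;have:= ler_wpM2r (_: 0 <= a - 1) h;rewrite subr_ge0 ltW// => /(_ isT);nra.
have a0: 0 < a - 1 by rewrite subr_gt0.
exists (Num.bound `|T / (a - 1)|);apply: le_trans (b _).
rewrite -ler_pdivrMr//;apply: le_trans (ler_norm _) _;exact/ltW/archi_boundP/normr_ge0.
Qed.

(** * Codes of an expanding action *)

Section Codes.
Context {R: realType} {M: topologicalType} (d: M -> M -> R) (Md: metr_for d).
Context {Gam: groupType} (rho: Gam -> M -> M) (Lam: set M) (E: @datum R M Gam).
Hypotheses (adm: admissible d rho Lam) (ED: expansion_datum d rho Lam E).
Local Notation del:= (ddelta E).
Local Notation lam:= (dlam E).
Local Notation L:= (dL E).
Local Notation Sig:= (dSigma E).
Implicit Types (alpha: nat -> dI E) (x y z: M).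

Lemma metr_ge0 x y: 0 <= d x y.
Proof. by have [d0 dp _ _ _]:= Md;have [->|/dp/ltW//]:= pselect (x = y);rewrite d0. Qed.
Lemma action1 x: rho 1%g x = x. Proof. by have [[]]:= adm. Qed.
Lemma actionM g h x: rho (g * h)%g x = rho g (rho h x). Proof. by have [[]]:= adm. Qed.
Lemma action_near g x (e: R): 0 < e -> exists2 r, 0 < r & forall y, d x y < r -> d (rho g x) (rho g y) < e.
Proof.
have [[_ _ /(_ g)[gc _ _]] _ _ _ _]:= adm;have [_ _ _ _ nP]:= Md=> e0.
have: nbhs x (rho g @^-1` mball d e (rho g x)) by apply: gc;apply/nP;exists e.
by move/nP.
Qed.

Fixpoint prefix alpha k: Gam:= if k is k'.+1 then (prefix alpha k' * ds (alpha k'))%g else 1%g.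

(** A code satisfies the ball condition from [k = 1] on; here it holds for [k = 0] too. [Ray_full]
    and [Ray_cons] pass between the two by removing or adding the first letter. *)
Definition full_code x alpha:= forall k, mball d del (rho (prefix alpha k)^-1%g x) `<=` dU (alpha k).

Lemma datum_bounds: [/\ 0 < del, 1 < lam, lam <= L & 0 < L].
Proof. by have [_ /andP[l1 lL] [d0 _] _ _]:= ED;split=>//;apply: lt_le_trans lL;apply: lt_trans l1. Qed.
Lemma pfx_in x alpha k: Lam x -> Lam (rho (prefix alpha k)^-1%g x).
Proof. by have [_ _ _ inv _]:= adm;exact: inv. Qed.
Lemma code_pointE x alpha k: code_point rho x alpha k = rho (prefix alpha k)^-1%g x.
Proof. by elim: k=>[|k IH];rewrite/= ?invg1 ?action1// IH invgM actionM. Qed.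
Lemma code_rayE alpha k: code_ray alpha k = prefix alpha k.+1.
Proof. by elim: k=>[|k IH];rewrite/= ?mul1g// IH. Qed.
Lemma pfx_shift alpha l k: prefix alpha (l + k) = (prefix alpha l * prefix (fun i=> alpha (l + i)%N) k)%g.
Proof. by elim: k=>[|k IH];rewrite ?addn0 ?mulg1// addnS/= IH mulgA. Qed.
Lemma full_code_shift x alpha l: full_code x alpha -> full_code (rho (prefix alpha l)^-1%g x) (fun i=> alpha (l + i)%N).
Proof. by move=> fc k;have:= fc (l + k)%N;rewrite pfx_shift invgM actionM. Qed.
(** [del] is only bounded by the supremum of the Lebesgue numbers. If no set contained the ball, one
    witness per index would lie within some radius [e < del], as there are finitely many indices;
    but some Lebesgue number exceeds [e]. *)
Lemma ball_in_cover x: Lam x -> exists i: dI E, mball d del x `<=` dU i.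
Proof.
move=> Lx;apply: contrapT=> H;have [_ _ [d0 dle] _ _]:= ED.
have /choice[y yP] : forall i: dI E, exists y, mball d del x y /\ ~ dU i y. move=> i;apply: contrapT=> Hi;apply: H;exists i=> y By;apply: contrapT=> ny;apply: Hi;by exists y.
pose e:= \big[Order.max/0]_(i: dI E) d x (y i).
have ed: e < del by rewrite /e;elim/big_ind: _=>// [a b|i _]; [rewrite gt_max=> -> ->|exact: (yP i).1].
have: (e%:E < sup_lebesgue_number d (@dU _ _ _ E) Lam)%E by apply: lt_le_trans dle;rewrite lte_fin.
move=> /ereal_sup_gt[_ [b [b0 bP] <-]];rewrite lte_fin=> eb;have [i iP]:= bP x Lx.
have [_ []]:= yP i;apply: iP;apply: le_lt_trans eb;rewrite /e (bigD1 i)//= le_max lexx//.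
Qed.
Lemma full_code_ex x: Lam x -> exists alpha, full_code x alpha.
Proof.
move=> Lx;have [i0 _]:= ball_in_cover Lx.
have /choice[f fP] : forall y, exists i: dI E, Lam y -> mball d del y `<=` dU i. by move=> y;have [Ly|nL]:= pselect (Lam y); [have [i]:= ball_in_cover Ly;exists i|exists i0].
pose p:= fix p k:= if k is k'.+1 then rho (ds (f (p k')))^-1%g (p k') else x.
exists (fun k=> f (p k))=> k.
have -> : rho (prefix (fun k=> f (p k)) k)^-1%g x = p k. by elim: k=>[|k IH]/=;rewrite ?invg1 ?action1// invgM actionM IH.
apply: fP;elim: k=>//= k;have [_ _ _ inv _]:= adm;exact: inv.
Qed.
(** The inclusion in [expanding_map_delta], at radius [del / lam], provides an inverse branch of
    each letter on the ball of radius [del]. Each branch contracts by [lam] and returns into that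
    ball. *)
Lemma pfx_contract x alpha k y z: full_code x alpha -> d (rho (prefix alpha k)^-1%g x) y < del -> d (rho (prefix alpha k)^-1%g x) z < del ->
 lam ^+ k * d (rho (prefix alpha k) y) (rho (prefix alpha k) z) <= d y z.
Proof.
move=> fc;have [d0 l1 _ _]:= datum_bounds;have l0: 0 < lam by apply: lt_trans l1.
elim: k y z=>[|k IH] y z/=;first by rewrite !action1 expr0 mul1r.
rewrite invgM [rho (_ * _^-1)%g x]actionM;set p:= rho (prefix alpha k)^-1%g x=> py pz.
have [_ _ _ /(_ (alpha k))[_ [ex exd]] _]:= ED.
have dl: del / lam <= del by rewrite ler_pdivrMr// ler_peMr// ltW.
have pull w: d (rho (ds (alpha k))^-1%g p) w < del -> [/\ d p (rho (ds (alpha k)) w) < del / lam, dU (alpha k) (rho (ds (alpha k)) w) & rho (ds (alpha k))^-1%g (rho (ds (alpha k)) w) = w].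
 move=> pw;have dl0: 0 < del / lam by rewrite divr_gt0. have sub: mball d (del / lam) p `<=` dU (alpha k) by move=> u pu;apply: (fc k);apply: lt_le_trans dl.
 have [u pu uw] : (rho (ds (alpha k))^-1%g @` mball d (del / lam) p) w. by apply: (exd p (del / lam))=>//;rewrite /mball/= mulrC divfK// gt_eqF.
 have uE: rho (ds (alpha k)) w = u by rewrite -uw -actionM mulgV action1. by rewrite uE;split=>//;exact: sub.
have [y1 yU yE]:= pull _ py;have [z1 zU zE]:= pull _ pz.
have h:= ex _ _ yU zU;rewrite yE zE in h;apply: le_trans h.
rewrite exprS -mulrA ler_wpM2l ?(ltW l0)// (actionM _ _ y) (actionM _ _ z).
by apply: IH;apply: lt_le_trans dl.
Qed.
Lemma pfx_small x alpha k y: full_code x alpha -> d (rho (prefix alpha k)^-1%g x) y < del -> lam ^+ k * d x (rho (prefix alpha k) y) < del.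
Proof.
move=> fc py;have [d0 _ _ _]:= datum_bounds;have [dd _ _ _ _]:= Md.
have:= @pfx_contract x alpha k (rho (prefix alpha k)^-1%g x) y fc;rewrite dd=> /(_ d0 py).
by rewrite -actionM mulgV action1=> h;exact: le_lt_trans py.
Qed.
Lemma Sig_gen: generates Sig. Proof. by have [_ _ _ _ []]:= ED. Qed.
Lemma Sig_letter a: (a \in Sig) || (a^-1%g \in Sig) -> exists j: dI E, a = ds j.
Proof.
have [_ _ _ _ [sym _]]:= ED;move=> /orP[] /codomP[i iE];first by exists i.
by have [j jE]:= sym i;exists j;rewrite jE -iE invgK.
Qed.
(** Letters are Lipschitz only near [Lam]. The smallness of the distances keeps all intermediate
    images in that neighbourhood. *)
Lemma word_lip m b x y z: word_ball Sig m b -> Lam x -> L ^+ m * d x y < del -> L ^+ m * d x z < del -> d (rho b y) (rho b z) <= L ^+ m * d y z.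
Proof.
move=>[w [ww wm ->]] Lx;have [d0 l1 lL L0]:= datum_bounds;have L1: 1 <= L by apply: le_trans lL;apply: ltW.
have wk u v: L ^+ size w * d u v <= L ^+ m * d u v by rewrite ler_wpM2r ?metr_ge0// ler_weXn2l.
move=> my mz;apply: le_trans (wk y z);have {my}:= le_lt_trans (wk x y) my;have {mz wk wm}:= le_lt_trans (wk x z) mz.
have [d00 _ _ _ _]:= Md;have [_ _ _ inv _]:= adm.
elim: w ww y z=>[|a w IH]/=;first by move=> _ y z;rewrite expr0 !action1 !mul1r.
move=> /andP[aS ww] y z mz my;rewrite !actionM.
have small u: L ^+ (size w).+1 * d x u < del -> L ^+ size w * d x u < del. by apply: le_lt_trans;rewrite exprS -mulrA ler_peMl// mulr_ge0 ?metr_ge0// exprn_ge0// ltW.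
have near u: L ^+ (size w).+1 * d x u < del -> nbhd_of d del Lam (rho (foldr *%g 1%g w) u). move=> mu;exists (rho (foldr *%g 1%g w) x);first exact: inv.
 apply: le_lt_trans (small _ mu);apply: IH=>//;first exact: small. by rewrite d00 mulr0.
have [j] : exists j: dI E, a^-1%g = ds j by apply: Sig_letter;rewrite invgK orbC.
move/(congr1 (fun u=> u^-1%g));rewrite invgK=> aE.
have [_ _ _ /(_ j)[lip _] _]:= ED;rewrite aE;apply: le_trans (lip _ _ (near y my) (near z mz)) _.
by rewrite exprS -mulrA ler_wpM2l ?(ltW L0)//;apply: IH=>//;exact: small.
Qed.
(** A prefix of length [k] expands by [lam ^ k] backwards, while a word of length [m] distorts by at
    most [L ^ m]. Measured on a point next to one of [Lam], which exists as [Lam] has no isolated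
    points of [M], this gives [lam ^ k <= L ^ m <= lam ^ (A * m)]. *)
Lemma pfx_dist: exists A: nat, forall x alpha i j, Lam x -> full_code x alpha -> (i <= j)%N -> (word_dist Sig (prefix alpha i) (prefix alpha j) <= j - i)%N /\
 (j - i <= A * word_dist Sig (prefix alpha i) (prefix alpha j))%N.
Proof.
have [d0 l1 lL L0]:= datum_bounds;have l0: 0 < lam by apply: lt_trans l1.
have HS:= Sig_gen;have [dd dp _ _ _]:= Md.
have [A LA] : exists A, L <= lam ^+ A. exact: exp_unbnd.
exists A=> x alpha i j Lx fc ij;rewrite -(subnKC ij) addKn pfx_shift.
set be:= fun k=> _;set k:= (j - i)%N;have fb:= @full_code_shift x alpha i fc;have Lp:= @pfx_in x alpha i Lx.
set p:= rho (prefix alpha i)^-1%g x in fb Lp.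
have -> : word_dist Sig (prefix alpha i) (prefix alpha i * prefix be k)%g = word_dist Sig 1%g (prefix be k). by rewrite -{1}[prefix alpha i]mulg1 word_distM.
split. elim: (k)=>[|k' IH]/=;first by rewrite wd_refl. apply: leq_trans (wdT HS (prefix be k') _ _) _;rewrite -(addn1 k') leq_add//. by apply: wd_gen=>//;exact: codom_f.
set h:= prefix be k;have [wh _]:= word_lenP HS h;rewrite /word_dist invg1 mul1g;set m:= word_length Sig h in wh *.
have [_ _ _ inv iso]:= adm;have Lh: Lam (rho h^-1%g p) by exact: inv.
have e0: 0 < del / L ^+ m by rewrite divr_gt0// exprn_gt0.
have L1: 1 <= L by apply: le_trans lL;apply: ltW.
have [y ynx yh]:= iso _ Lh _ e0;have y0: 0 < d (rho h^-1%g p) y by apply: dp=> E';exact: ynx.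
have yd: d (rho h^-1%g p) y < del by apply: lt_le_trans yh _;rewrite ler_pdivrMr ?exprn_gt0// ler_peMr ?exprn_ege1// ltW.
have c:= @pfx_contract p be k (rho h^-1%g p) y fb;rewrite -/h dd in c;have {c}:= c d0 yd.
rewrite -actionM mulgV action1=> c.
have wV: word_ball Sig m h^-1%g by exact: word_inv.
have lk1: 1 <= lam ^+ k by rewrite exprn_ege1// ltW.
have cc: d p (rho h y) <= d (rho h^-1%g p) y by apply: le_trans c;rewrite ler_peMl ?metr_ge0.
have small: L ^+ m * d p (rho h y) < del. by move: yh;rewrite /mball/= ltr_pdivlMr ?exprn_gt0// mulrC;apply: le_lt_trans;rewrite ler_wpM2l// exprn_ge0// ltW.
have:= @word_lip m h^-1%g p p (rho h y) wV Lp;rewrite dd mulr0=> /(_ d0 small).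
rewrite -[rho h^-1%g (rho h y)]actionM mulVg action1=> h2.
have h3: lam ^+ k <= lam ^+ (A * m). rewrite exprM;apply: (@le_trans _ _ (L ^+ m));last by rewrite lerXn2r ?nnegrE ?exprn_ge0// ltW.
 rewrite -(ler_pM2r (lt_le_trans y0 h2));apply: (@le_trans _ _ (L ^+ m * (lam ^+ k * d p (rho h y)))). by rewrite mulrCA. rewrite ler_wpM2l ?exprn_ge0 ?(ltW L0)//;apply: le_trans c _. done.
by move: h3;rewrite ler_eXn2l.
Qed.
Lemma expd_near m x alpha k h: Lam x -> full_code x alpha -> (word_dist Sig (prefix alpha k) h <= m)%N -> exists2 r, 0 < r & forall y z, d x y < r -> d x z < r ->
  lam ^+ k / L ^+ m * d y z <= d (rho h^-1%g y) (rho h^-1%g z).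
Proof.
move=> Lx fc hm;have [d0 l1 lL L0]:= datum_bounds;set g:= prefix alpha k in hm.
have [r1 r10 r1P]:= @action_near g^-1%g x _ d0.
have e0: 0 < del / L ^+ m by rewrite divr_gt0// exprn_gt0.
have [r2 r20 r2P]:= @action_near h^-1%g x _ e0.
exists (Order.min r1 r2);first by rewrite lt_min r10.
move=> y z;rewrite !lt_min=> /andP[y1 y2] /andP[z1 z2].
have wb: word_ball Sig m (g^-1 * h)%g. have [[w [ww ws we]] _]:= word_lenP Sig_gen (g^-1 * h)%g. by exists w;split=>//;exact: leq_trans hm.
have [_ _ _ inv _]:= adm;have s w: d x w < r2 -> L ^+ m * d (rho h^-1%g x) (rho h^-1%g w) < del. by move=> /r2P;rewrite ltr_pdivlMr ?exprn_gt0// mulrC.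
have:= word_lip wb (inv h^-1%g _ Lx) (s y y2) (s z z2);rewrite -!actionM mulgK=> h1.
have:= pfx_contract fc (r1P y y1) (r1P z z1);rewrite -/g -!actionM mulgV !action1=> h2.
rewrite mulrAC ler_pdivrMr ?exprn_gt0//;apply: le_trans h2 _;by rewrite mulrC.
Qed.
(** The balls are open: a point in the ball of the limit lies in the balls of all points near
    enough. *)
Lemma full_code_limit (T: Type) (U: set_system T) (x: T -> M) y (al: T -> nat -> dI E) alpha :
 UltraFilter U -> (forall e, 0 < e -> U [set t | d y (x t) < e]) -> (forall t, full_code (x t) (al t)) -> (forall i, U [set t | forall j, (j <= i)%N -> al t j = alpha j]) -> full_code y alpha.
Proof.
move=> UF xy fc aP k z;rewrite /mball/= => yz.
have e0: 0 < del - d (rho (prefix alpha k)^-1%g y) z by rewrite subr_gt0.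
have [r r0 rP]:= action_near (prefix alpha k)^-1%g y e0;have [t [/= /rP h1/= h2]]:= ultra_meet UF (xy r r0) (aP k).
rewrite -(h2 k)//;apply: fc.
have -> : prefix (al t) k = prefix alpha k. elim: k h2 {yz e0 rP h1}=>//= k IH h;rewrite IH ?h// => j jk;exact/h/leqW.
have [_ _ dsym dtri _]:= Md;rewrite /mball/=;apply: le_lt_trans (dtri (rho (prefix alpha k)^-1%g y) _ _) _.
by rewrite dsym -ltrBrDr.
Qed.
Lemma Ray_cons x alpha j: full_code x alpha -> Ray d rho E del (rho (@ds _ _ _ E j) x) (translate (@ds _ _ _ E j) (prefix alpha)).
Proof.
move=> fc;pose be k:= if k is k'.+1 then alpha k' else j.
have pE k: prefix be k.+1 = (ds j * prefix alpha k)%g by have:= pfx_shift be 1 k;rewrite [prefix be 1]/= mul1g.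
exists be;last by apply/funext=> k;rewrite code_rayE pE.
by move=>[//|k] _;rewrite code_pointE pE invgM actionM -[rho (ds j)^-1%g _]actionM mulVg action1;exact: fc.
Qed.
Lemma Ray_full x c: Lam x -> Ray d rho E del x c -> exists j alpha, full_code (rho (@ds _ _ _ E j)^-1%g x) alpha /\ c = translate (ds j) (prefix alpha).
Proof.
move=> Lx [al alP <-];exists (al 0%N), (fun k=> al k.+1).
have pE k: prefix al k.+1 = (ds (al 0%N) * prefix (fun k=> al k.+1) k)%g. by rewrite -add1n pfx_shift/= mul1g.
split;last by apply/funext=> k;rewrite code_rayE pE.
by move=> k;have:= alP k.+1 isT;rewrite code_pointE pE invgM actionM.
Qed.
End Codes.

(** * The Gromov boundary, defined by [S], with hyperbolicity known for [S0] *)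

Section Boundary.
Context {Gam: groupType} (S0 S: seq Gam) (HS0: generates S0) (HS: generates S) (delta: nat).
Local Open Scope nat_scope.
Local Notation d:= (word_dist S0).
Local Notation dS:= (word_dist S).
Local Notation gp:= (gp S0).
Local Notation bd:= (gromov_boundary S).
Hypothesis four_point: forall x y z w, d x y + d z w <= maxn (d x z + d y w) (d x w + d y z) + delta.*2.
Variables (Kc: nat).
Hypotheses (dKS: forall x y, d x y <= Kc * dS x y) (SKd: forall x y, dS x y <= Kc * d x y).
Implicit Types (x y z o a b c: Gam) (p r u v: nat -> Gam) (xi eta: bd).

Definition qray K p:= forall i j, i <= j -> d (p i) (p j) <= K * (j - i) /\ j - i <= K * d (p i) (p j) + K.

(** Unfolding [gp], the path from [o] to [c] through [a] is longer than a geodesic by at most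
    [D]. *)
Definition track D o a c:= 2 * d a o <= gp o a c + D.

Lemma track_close D o a b c: track D o a c -> track D o b c -> d a b <= (d a o - d b o) + (d b o - d a o) + D + delta.*2.
Proof.
have:= gp_ultra HS0 four_point o a c b;have:= gpE HS0 o a b;have:= gpC HS0 o b c.
rewrite /track;lia.
Qed.
Lemma track_trans D E o a b c: track D o a b -> 2 * d a o <= gp o b c + E -> track (maxn D E + delta.*2) o a c.
Proof. have:= gp_ultra HS0 four_point o a b c;rewrite /track;lia. Qed.
Lemma level p K o j t: (forall k, d (p k) (p k.+1) <= K) -> t <= d (p j) o -> exists2 i, i <= j & t <= d (p i) o /\ d (p i) o <= maxn (t + K) (d (p 0) o).
Proof.
move=> st tj;have ex: exists i, t <= d (p i) o by exists j.
case: (ex_minnP ex)=> i ti im;exists i;first exact: im.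
split=>//;case: i ti im=>[|i] ti im;first by rewrite leq_maxr.
rewrite leq_max;apply/orP;left;have: ~~ (t <= d (p i) o) by apply/negP=> /im;rewrite ltnn.
by have:= wdT HS0 (p i) (p i.+1) o;have:= st i;rewrite (wdC HS0 (p i.+1) (p i));lia.
Qed.
Lemma qray_track K: exists D, forall p o i j, qray K p -> i <= j -> track (D + 2 * d o (p 0)) o (p i) (p j).
Proof.
have [D DP]:= morse HS0 four_point K;exists D=> p o i j qp ij.
have st k: d (p k) (p k.+1) <= K by have []:= qp k k.+1 (leqnSn k);rewrite subSnn muln1.
have:= DP p j st (fun (a b: nat) ab=> qp a b ltac:(lia)) 0 i j (leq0n i) ij (leqnn j).
have:= gpE HS0 o (p i) (p j);have:= gpE HS0 (p i) (p 0) (p j);have:= wdT HS0 (p 0) (p i) o.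
have:= wdT HS0 (p 0) (p j) o;rewrite /track (wdC HS0 (p i) (p 0)) (wdC HS0 (p j) (p i)) (wdC HS0 (p j) (p 0)) (wdC HS0 o).
have:= wdT HS0 o (p 0) (p j);rewrite (wdC HS0 o (p j));lia.
Qed.
Lemma geod_qray r: geodesic_ray S r -> qray Kc r.
Proof.
move=> gr i j ij;have:= gr i j;rewrite (maxn_idPr ij) (minn_idPl ij)=> E.
by rewrite -E dKS;split=>//;apply: leq_trans (SKd _ _) (leq_addr _ _).
Qed.
Lemma geod_from1 r k: geodesic_ray S r -> r 0 = 1%g -> dS 1%g (r k) = k.
Proof. by move=> gr r0;rewrite -r0 gr max0n min0n subn0. Qed.
Lemma qray_far K p o T: qray K p -> exists k0, forall k, k0 <= k -> T <= d (p k) o.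
Proof.
move=> qp;exists (K * (T + d (p 0) o) + K).+1=> k kk;have [_ h]:= qp 0 k (leq0n k).
rewrite leqNgt;apply/negP=> kT;have:= wdT HS0 o (p 0) (p k).
rewrite (wdC HS0 o);have: k <= K * d (p 0) (p k) + K by rewrite -{1}[k]subn0.
move=> h2 h3;have: K * d (p 0) (p k) <= K * (T + d (p 0) o) by rewrite leq_mul2l;apply/orP;right;lia.
lia.
Qed.
Lemma word_ball_seq k: exists s: seq Gam, forall x, dS 1%g x <= k -> x \in s.
Proof. exact: word_ball_finite. Qed.
Lemma geod_limit (T: Type) (U: set_system T) (f: T -> nat -> Gam): UltraFilter U -> (forall t k, dS 1%g (f t k) <= k) -> exists r, forall i, U [set t | forall j, j <= i -> f t j = r j].
Proof.
move=> UF fb;apply: ultra_limit=> i;have [s sP]:= word_ball_seq i;exists s=> t;exact: sP.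
Qed.

(* A quasigeodesic ray is close to a geodesic ray from 1: the limit of the geodesics from 1 to its points. *)
Lemma shadow K e: exists N, forall p, qray K p -> d 1%g (p 0) <= e -> exists r, [/\ geodesic_ray S r, r 0 = 1%g, forall k, exists l, dS (p l) (r k) <= N & forall l, exists k, dS (p l) (r k) <= N].
Proof.
have [D DP]:= qray_track K;have [D1 D1P]:= morse HS0 four_point Kc.
pose D2:= maxn (D + 2 * e) D1.
exists (Kc * (K + Kc + e + D2 + delta.*2))=> p qp pe.
have /choice[f fP]:= fun n=> word_geod HS 1%g (p n).
pose len n:= dS 1%g (p n);pose F n i:= f n (minn i (len n)).
have F0 n: F n 0 = 1%g by rewrite /F min0n;have []:= fP n.
have FE n i j: i <= j -> j <= len n -> dS (F n i) (F n j) = j - i. move=> ij jn;rewrite /F (minn_idPl jn) (minn_idPl (leq_trans ij jn)). by have [_ _ h]:= fP n;exact: h.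
have Fb n k: dS 1%g (F n k) <= k. have:= FE n 0 (minn k (len n)) (leq0n _) (geq_minr _ _);rewrite F0 /F -minnA minnn subn0=> ->. exact: geq_minl.
have Fl n: F n (len n) = p n by rewrite /F minnn;have []:= fP n.
have [U UF Uoo]:= ultra_nat;have [r rP]:= geod_limit UF Fb.
have lenoo k: exists n0, forall n, n0 <= n -> k <= len n. have [n0 n0P]:= qray_far 1%g (Kc * k).+1 qp;exists n0=> n /n0P;rewrite (wdC HS0) /len=> h.
 rewrite leqNgt;apply/negP=> lk;have:= dKS 1%g (p n);have: Kc * dS 1%g (p n) <= Kc * k by rewrite leq_mul2l ltnW ?orbT. lia.
have pick k n1: exists n, [/\ n1 <= n, k <= len n & forall j, j <= k -> F n j = r j]. have [n0 n0P]:= lenoo k;have [n [h1 h2]]:= ultra_meet UF (rP k) (Uoo (maxn n0 n1)).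
 by exists n;split=>//; [move: h2=> /=;lia|apply: n0P;move: h2=> /=;lia].
have r0: r 0 = 1%g by have [n [_ _ <-//]]:= pick 0 0.
have gr: geodesic_ray S r. suff H i j: i <= j -> dS (r i) (r j) = j - i. move=> i j;case/orP: (leq_total i j)=> h;first by rewrite H// (maxn_idPr h) (minn_idPl h).
  by rewrite (wdC HS) H// (maxn_idPl h) (minn_idPr h). move=> ij;have [n [_ jn nE]]:= pick j 0;rewrite -!nE//;exact: FE.
have trk k n: k <= len n -> (forall j, j <= k -> F n j = r j) -> track D2 1%g (r k) (p n). move=> kn nE;have st i: d (F n i) (F n i.+1) <= Kc.
  have [h|h]:= leqP i.+1 (len n);first by apply: leq_trans (dKS _ _) _;rewrite FE// subSnn muln1. by rewrite /F !(minn_idPr _) ?wd_refl// ltnW. have qF: qpath S0 Kc (F n) (len n).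
  move=> i j /andP[ij jn];have:= dKS (F n i) (F n j);have:= SKd (F n i) (F n j);rewrite FE// => h1 h2. by split=>//;apply: leq_trans h1 (leq_addr _ _).
 have:= D1P _ _ st qF 0 k (len n) (leq0n k) kn (leqnn _);rewrite F0 Fl nE//. have:= gpE HS0 1%g (r k) (p n);have:= gpE HS0 (r k) 1%g (p n).
 by rewrite /track /D2 (wdC HS0 1%g (r k)) (wdC HS0 (p n) (r k)) (wdC HS0 1%g (p n));lia.
have ptrk l n: l <= n -> track D2 1%g (p l) (p n). by move=> ln;have:= DP p 1%g l n qp ln;rewrite /track /D2;lia.
have stp k: d (p k) (p k.+1) <= K by have []:= qp k k.+1 (leqnSn k);rewrite subSnn muln1.
have str k: d (r k) (r k.+1) <= Kc by have []:= geod_qray gr (leqnSn k);rewrite subSnn muln1.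
exists r;split=>// [k|l]. have [n0 n0P]:= qray_far 1%g (d (r k) 1%g) qp;have [n [n1 kn nE]]:= pick k n0. have [l ln [l1 l2]]:= level stp (n0P n n1);exists l.
 have:= track_close (ptrk l n ln) (trk k n kn nE);apply: contra_leq;move=> h. rewrite ltnNge;apply/negP=> h2;move: h;rewrite ltnNge=> /negP;apply.
 apply: leq_trans (SKd _ _) _;rewrite leq_mul2l;apply/orP;right. by move: h2 l1 l2 pe;rewrite (wdC HS0 1%g);lia.
have [n0 n0P]:= qray_far 1%g (d (p l) 1%g) (geod_qray gr).
have [k kn [k1 k2]]:= level str (n0P n0 (leqnn _));exists k.
have [n [n1 kn' nE]]:= pick k l.
apply: leq_trans (SKd _ _) _;rewrite leq_mul2l;apply/orP;right.
have:= track_close (ptrk l n n1) (trk k n kn' nE);move: k1 k2;rewrite r0 wd_refl//;lia.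
Qed.
Lemma asym_sym r r': asymptotic S r r' -> asymptotic S r' r.
Proof. by move=>[C H];exists C=> k;rewrite (wdC HS). Qed.
Lemma asym_trans r r' r'': asymptotic S r r' -> asymptotic S r' r'' -> asymptotic S r r''.
Proof.
move=>[C H] [C' H'];exists (C + C')=> k.
by apply: leq_trans (wdT HS (r' k) _ _) _;rewrite leq_add.
Qed.
Lemma in_classP xi r: in_class xi r -> geodesic_ray S r /\ forall r', in_class xi r' <-> geodesic_ray S r' /\ asymptotic S r r'.
Proof.
case: xi=> xi xiP;rewrite /in_class/=;have:= xiP;rewrite inE=> -[r0 g0 <-] [gr ar].
split=>// r';split=> -[gr' ar'];split=>//;last exact: asym_trans ar ar'.
exact: asym_trans (asym_sym ar) ar'.
Qed.
Lemma in_class_inj xi eta r r': in_class xi r -> in_class eta r' -> asymptotic S r r' -> xi = eta.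
Proof.
move=> xr er rr';have [gr rP]:= in_classP xr;have [gr' rP']:= in_classP er.
apply: val_inj;apply/seteqP;split=> z. by move/(rP z)=>[gz az];apply/(rP' z);split=>//;exact: asym_trans (asym_sym rr') az.
by move/(rP' z)=>[gz az];apply/(rP z);split=>//;exact: asym_trans rr' az.
Qed.
Lemma class_ex r: geodesic_ray S r -> exists xi, in_class xi r.
Proof.
move=> gr;have h: ray_class S r \in boundary_set S by rewrite inE;exists r.
by exists (exist (fun s: set (nat -> Gam)=> s \in boundary_set S) _ h);split=>//;exists 0=> k;rewrite wd_refl.
Qed.

Definition ray1 xi r:= in_class xi r /\ r 0 = 1%g.

Lemma close_asym N p r: geodesic_ray S p -> geodesic_ray S r -> (forall k, exists l, dS (p l) (r k) <= N) -> asymptotic S p r.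
Proof.
move=> gp' gr H;exists (2 * N + dS (p 0) (r 0))=> k;have [l lN]:= H k.
have:= gp' 0 l;rewrite max0n min0n subn0=> el;have:= gr 0 k;rewrite max0n min0n subn0=> ek.
have:= gp' k l=> ekl;have:= wdT HS (p l) (p k) (r k).
have:= wdT HS (r 0) (p 0) (p l);have:= wdT HS (r k) (r 0) (p l).
have:= wdT HS (p 0) (r 0) (r k);have:= wdT HS (p l) (p 0) (r k).
rewrite (wdC HS (r k) (p l)) (wdC HS (r 0) (p 0)) ekl;lia.
Qed.
Lemma ray1_ex xi: exists r, ray1 xi r.
Proof.
have [p xp] : exists p, in_class xi p. case: xi=> xi xiP;have:= xiP;rewrite inE=> -[r0 g0 E];exists r0;rewrite /in_class/= -E;split=>//. by exists 0=> k;rewrite wd_refl.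
have [gpp pP]:= in_classP xp;have [N NP]:= shadow Kc (d 1%g (p 0)).
have [r [gr r0 h _]]:= NP p (geod_qray gpp) (leqnn _);exists r;split=>//;apply/pP;split=>//.
exact: close_asym gpp gr h.
Qed.
Lemma ray1_geod xi r: ray1 xi r -> geodesic_ray S r. Proof. by case=> /in_classP[]. Qed.
Lemma dist_from1 r k: geodesic_ray S r -> r 0 = 1%g -> d (r k) 1%g <= Kc * k.
Proof. by move=> gr r0;rewrite (wdC HS0) -{2}(geod_from1 k gr r0) dKS. Qed.
Lemma geod_step r k: geodesic_ray S r -> d (r k) (r k.+1) <= Kc.
Proof. by move=> /geod_qray/(_ k k.+1 (leqnSn k))[];rewrite subSnn muln1. Qed.
(** Both [r k] and the point of [r'] on the same level track [r' j], so [track_close] bounds their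
    distance. *)
Lemma fellow E: exists C, forall r r' k i j, geodesic_ray S r -> geodesic_ray S r' -> r 0 = 1%g -> r' 0 = 1%g -> k <= i -> 2 * d (r k) 1%g <= gp 1%g (r i) (r' j) + E -> dS (r k) (r' k) <= C.
Proof.
have [D DP]:= qray_track Kc;pose D':= maxn D E + delta.*2.
exists (2 * (Kc * (E + Kc + D' + delta.*2)))=> r r' k i j gr gr' r0 r0' ki H.
have tr:= DP r 1%g;rewrite r0 wd_refl// muln0 addn0 in tr.
have tr':= DP r' 1%g;rewrite r0' wd_refl// muln0 addn0 in tr'.
have t1: track D' 1%g (r k) (r' j). have h1:= tr k i (geod_qray gr) ki;have:= gp_ultra HS0 four_point 1%g (r k) (r i) (r' j). by move: h1 H;rewrite /track /D';lia.
have h2: d (r k) 1%g - E <= d (r' j) 1%g by have:= gp_le HS0 1%g (r' j) (r i);rewrite (gpC HS0);lia.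
have [l lj [l1 l2]]:= level (fun k=> geod_step k gr') h2;rewrite r0' wd_refl// in l2.
have t2: track D' 1%g (r' l) (r' j). by have:= tr' l j (geod_qray gr') lj;rewrite /track /D';lia.
have h3:= track_close t1 t2;have h4: dS (r k) (r' l) <= Kc * (E + Kc + D' + delta.*2). by apply: leq_trans (SKd _ _) _;rewrite leq_mul2l;apply/orP;right;lia.
have:= wdT HS (r' l) (r k) (r' k);rewrite (gr' l k).
have:= geod_from1 k gr r0;have:= geod_from1 l gr' r0'.
have:= wdT HS (r k) 1%g (r' l);have:= wdT HS (r' l) 1%g (r k).
rewrite (wdC HS (r' l) (r k));lia.
Qed.
Lemma fellow_gp: exists C, forall r r' k i j, geodesic_ray S r -> geodesic_ray S r' -> r 0 = 1%g -> r' 0 = 1%g -> 2 * (Kc * k) < gp 1%g (r i) (r' j) -> dS (r k) (r' k) <= C.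
Proof.
have [C CP]:= fellow 0;exists C=> r r' k i j gr gr' r0 r0' ij;apply: (CP r r' k i j)=>//.
 have:= gp_le HS0 1%g (r i) (r' j);have:= dist_from1 i gr r0;rewrite leqNgt=> h1 h2;apply/negP=> ik. by have: Kc * i <= Kc * k; [rewrite leq_mul2l;apply/orP;right;lia|lia].
by have:= dist_from1 k gr r0;lia.
Qed.
Lemma gp_bnd (a b: bd) u v: a <> b -> in_class a u -> in_class b v -> u 0 = 1%g -> v 0 = 1%g -> exists T, forall i j, gp 1%g (u i) (v j) < T.
Proof.
move=> ab au bv u0 v0;apply: contrapT=> H;apply: ab;have [C CP]:= fellow_gp.
have [gu _]:= in_classP au;have [gv _]:= in_classP bv.
apply: (in_class_inj au bv);exists C=> k;apply: contrapT=> HX;apply: H;exists (2 * (Kc * k)).+1=> i j.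
by rewrite ltnS leqNgt;apply/negP=> h;apply: HX;exact: CP h.
Qed.
Lemma asym_close: exists C, forall r r' k, geodesic_ray S r -> geodesic_ray S r' -> r 0 = 1%g -> r' 0 = 1%g -> asymptotic S r r' -> dS (r k) (r' k) <= C.
Proof.
have [C CP]:= fellow 0;exists C=> r r' k gr gr' r0 r0' [A AP].
have [n0 n0P]:= qray_far 1%g (d (r k) 1%g + Kc * A) (geod_qray gr).
apply: (CP r r' k (maxn n0 k) (maxn n0 k))=>//;first exact: leq_maxr.
set n:= maxn n0 k;have h1:= n0P n (leq_maxl _ _);have h2:= dKS (r n) (r' n).
have h3: Kc * dS (r n) (r' n) <= Kc * A by rewrite leq_mul2l AP orbT.
have:= gpE HS0 1%g (r n) (r' n);have:= wdT HS0 (r' n) (r n) 1%g;lia.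
Qed.
Lemma translate_geod g r: geodesic_ray S r -> geodesic_ray S (translate g r).
Proof. by move=> gr k l;rewrite /translate word_distM gr. Qed.
Lemma act_class g xi r: in_class xi r -> in_class (act_boundary g xi) (translate g r).
Proof. by move=> xr;exists r. Qed.
Lemma act_bd1 xi: act_boundary 1%g xi = xi.
Proof.
have [r [xr r0]]:= ray1_ex xi;apply: (in_class_inj (act_class 1%g xr) xr);exists 0=> k.
by rewrite /translate mul1g wd_refl.
Qed.
Lemma act_bdM g h xi: act_boundary (g * h)%g xi = act_boundary g (act_boundary h xi).
Proof.
have [r [xr r0]]:= ray1_ex xi;apply: (in_class_inj (act_class _ xr) (act_class g (act_class h xr))).
by exists 0=> k;rewrite /translate mulgA wd_refl.
Qed.
Lemma limit_ray (T: Type) (U: set_system T) (f: T -> nat -> Gam): UltraFilter U -> (forall t, geodesic_ray S (f t) /\ f t 0 = 1%g) -> exists xi r, ray1 xi r /\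
  forall i, U [set t | forall j, j <= i -> f t j = r j].
Proof.
move=> UF fP;have fb t k: dS 1%g (f t k) <= k by have [g1 f0]:= fP t;rewrite geod_from1.
have [r rP]:= geod_limit UF fb.
have gr: geodesic_ray S r. move=> i j;have [t [h _]]:= ultra_meet UF (rP (maxn i j)) (rP 0). by rewrite -!h ?leq_maxl ?leq_maxr//;have [g1 _]:= fP t;exact: g1.
have r0: r 0 = 1%g by have [t [h _]]:= ultra_meet UF (rP 0) (rP 0);rewrite -h//;have []:= fP t.
by have [xi xr]:= class_ex gr;exists xi, r.
Qed.
Lemma ray_cvg (T: Type) (U: set_system T) (th: T -> bd) (f: T -> nat -> Gam) xi r: UltraFilter U ->
 (forall t, ray1 (th t) (f t)) -> ray1 xi r -> (forall i, U [set t | forall j, j <= i -> f t j = r j]) -> forall W: set bd, open W -> W xi -> U [set t | W (th t)].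
Proof.
move=> UF fP [xr r0] rP W oW Wx;have [k kP]:= oW xi r Wx xr r0;apply: filterS (rP k)=> t/= h.
by have [er e0]:= fP t;exact: kP er e0 h.
Qed.
Lemma bd_cpt: compact [set: bd].
Proof.
rewrite compact_ultra=> U UF UT;have /choice[f fP]:= ray1_ex.
have fP' t: geodesic_ray S (f t) /\ f t 0 = 1%g by split; [exact: ray1_geod (fP t)|have []:= fP t].
have [xi [r [xr rP]]]:= limit_ray UF fP';exists xi;split=>// V;rewrite nbhsE=> -[W [oW Wx] WV].
by apply: filterS (ray_cvg UF fP xr rP oW Wx).
Qed.

(* If neither product with the ends is small at [g^-1], the two ends are close to each other. *)
Lemma fellow_one_of_two T N: exists C, forall (a b: bd) u v, ray1 a u -> ray1 b v -> (forall i j, gp 1%g (u i) (v j) < T) -> forall r k g, geodesic_ray S r -> r 0 = 1%g -> dS g (r k) <= N ->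
 exists2 w, ray1 (act_boundary g a) w \/ ray1 (act_boundary g b) w & forall m, m <= k -> dS (r m) (w m) <= C.
Proof.
have [D DP]:= qray_track Kc;have [C CP]:= fellow (T + 2 * delta.*2 + D + 4 * (Kc * N)).
exists C=> a b u v au bv TP r k g gr r0 gN.
have gN': d g (r k) <= Kc * N by apply: leq_trans (dKS _ _) _;rewrite leq_mul2l gN orbT.
have key (c: bd) w0: ray1 c w0 -> exists w n0, ray1 (act_boundary g c) w /\ forall n, n0 <= n -> gp 1%g g^-1%g (w0 n) < T + delta.*2 -> forall m, m <= k -> dS (r m) (w m) <= C.
 move=>[cw0 w00];have [w gw]:= ray1_ex (act_boundary g c);have [gcw w0']:= gw. have gw':= ray1_geod gw. have [_ /(_ w)[/(_ gcw)[_ [A AP]] _]]:= in_classP (act_class g cw0).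
 have [n0 n0P]:= qray_far 1%g (d g 1%g + Kc * A) (geod_qray gw'). exists w, n0;split=>// n /n0P nn H m mk. have h0: dS (g * w0 n)%g (w n) <= A by exact: AP.
 have h1: d (g * w0 n)%g (w n) <= Kc * A by apply: leq_trans (dKS _ _) _;rewrite leq_mul2l h0 orbT. have h2: 2 * d g 1%g <= gp 1%g (g * w0 n)%g (w n).
  have:= gpE HS0 1%g (g * w0 n)%g (w n);have:= wdT HS0 (g * w0 n)%g (w n) 1%g. by rewrite (wdC HS0 (w n) (g * w0 n)%g);lia. have h3: 2 * d g 1%g <= gp 1%g g (g * w0 n)%g + T + delta.*2.
  have:= gpM S0 g g^-1%g 1%g (w0 n);rewrite mulgV mulg1=> E. have:= gpE HS0 1%g g^-1%g (w0 n);have:= gpE HS0 g^-1%g 1%g (w0 n);rewrite -E.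
  have -> : d g^-1%g 1%g = d g 1%g by rewrite -(word_distM _ g) mulgV mulg1 (wdC HS0). rewrite (wdC HS0 1%g g^-1%g) (_: d g^-1%g 1%g = d g 1%g);last first.
   by rewrite -(word_distM _ g) mulgV mulg1 (wdC HS0). by rewrite (wdC HS0 (w0 n) g^-1%g) (wdC HS0 1%g (w0 n));lia. have h4:= gp_ultra HS0 four_point 1%g g (g * w0 n)%g (w n).
 apply: (CP r w m k n)=>//;have:= DP r 1%g m k (geod_qray gr) mk. rewrite /track r0 wd_refl// muln0 addn0.
 have:= gpE HS0 1%g (r m) (r k);have:= gpE HS0 1%g (r k) (w n);have:= gpE HS0 1%g g (w n). have:= wdT HS0 g (r k) (w n);have:= wdT HS0 (r k) g 1%g;have:= wdT HS0 g (r k) 1%g.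
 have:= wdT HS0 (r k) (r m) 1%g. by rewrite (wdC HS0 (r k) g);lia.
have [w [n1 [aw wP]]]:= key a u au;have [w' [n2 [bw wP']]]:= key b v bv.
pose n:= maxn n1 n2;have:= gp_ultra HS0 four_point 1%g (u n) g^-1%g (v n);have:= TP n n.
have [h _ _|h1 h2 h3]:= ltnP (gp 1%g g^-1%g (u n)) (T + delta.*2). by exists w; [left|apply: (wP n)=>//;rewrite leq_maxl].
exists w'; [by right|apply: (wP' n);first by rewrite leq_maxr].
by move: h1 h2 h3;rewrite (gpC HS0 1%g (u n) g^-1%g);lia.
Qed.

(** * Stabilizers of boundary points are virtually cyclic *)

Section Stabilizer.
Variables (xi: bd) (r: nat -> Gam).
Hypothesis xr: ray1 xi r.

(* [g] shifts [r] by [b - a], up to [C]. *)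
Definition shifts C g (a b: nat):= exists k1, forall k, k1 <= k -> dS (g * r (k + a))%g (r (k + b)) <= C.

Lemma rr i j: dS (r i) (r j) = maxn i j - minn i j. Proof. exact: (ray1_geod xr). Qed.
Lemma shiftsM C C' g h (a b a' b': nat): shifts C g a b -> shifts C' h a' b' -> shifts (C + C') (g * h)%g (a + a') (b + b').
Proof.
move=>[k1 H1] [k2 H2];exists (k1 + k2)=> k kk.
have:= H2 (k + a) ltac:(lia);have:= H1 (k + b') ltac:(lia).
rewrite -(word_distM _ g (h * _)%g) mulgA -!addnA (addnC b' a) (addnC b' b)=> h1 h2.
by apply: leq_trans (wdT HS (g * r (k + (a + b')))%g _ _) _;rewrite addnC leq_add.
Qed.
Lemma shiftsV C g (a b: nat): shifts C g a b -> shifts C g^-1%g b a.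
Proof.
by move=>[k1 H1];exists k1=> k kk;rewrite -(word_distM _ g) mulVKg (wdC HS);exact: H1.
Qed.
Lemma shifts_cmp C C' g (a b a' b': nat): shifts C g a b -> shifts C' g a' b' -> a + b' <= a' + b + (C + C').
Proof.
move=>[k1 H1] [k2 H2];pose k:= k1 + k2.
have:= H1 (k + a') ltac:(rewrite /k;lia);have:= H2 (k + a) ltac:(rewrite /k;lia).
have:= wdT HS (g * r (k + a + a'))%g (r (k + a + b')) (r (k + a' + b)).
rewrite (wdC HS (r (k + a + b')) (g * _)%g) (_: k + a' + a = k + a + a') ?rr;lia.
Qed.
Lemma shifts_exist: exists C, forall g, act_boundary g xi = xi -> exists a b: nat, shifts C g a b.
Proof.
have gr:= ray1_geod xr;have [xr' r0]:= xr.
have [D DP]:= qray_track Kc;pose C1:= Kc * (Kc + D + 3 * delta.*2 + delta.*2);exists (3 * C1)=> g gx.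
have gg:= translate_geod g gr;have gq:= geod_qray gg.
have [_ /(_ r)[+ _]]:= in_classP (act_class g xr');rewrite gx=> /(_ xr')[_ [A AP]].
have [k0 k0P]:= qray_far g (d 1%g g + D + delta.*2).+1 gq.
have near k: k0 <= k -> exists l, dS (g * r k)%g (r l) <= C1. move=> /k0P kk;set x:= (g * r k)%g;rewrite /translate -/x in kk.
 have [n1 n1P]:= qray_far 1%g (d x 1%g + Kc * A) (geod_qray gr);pose n:= maxn n1 k. have t0:= DP _ g k n gq (leq_maxr _ _);rewrite /track /translate r0 mulg1 wd_refl// -/x in t0.
 have t1: track (D + delta.*2) 1%g x (g * r n)%g. have:= gp_ultra HS0 four_point x g 1%g (g * r n)%g. have:= gpE HS0 x g 1%g;have:= gpE HS0 x 1%g (g * r n)%g;have:= gpE HS0 x g (g * r n)%g.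
  have:= gpE HS0 g x (g * r n)%g;have:= gpE HS0 1%g x (g * r n)%g;rewrite /track. have:= wdT HS0 1%g x g;rewrite (wdC HS0 g x) (wdC HS0 1%g x).
  rewrite (wdC HS0 (g * r n)%g x) (wdC HS0 g (g * r n)%g) (wdC HS0 1%g (g * r n)%g) (wdC HS0 g 1%g). by move: t0 kk;lia.
 have h1:= n1P n (leq_maxl _ _);have h0: dS (g * r n)%g (r n) <= A by exact: AP. have h3: d (g * r n)%g (r n) <= Kc * A by apply: leq_trans (dKS _ _) _;rewrite leq_mul2l h0 orbT.
 have h2: 2 * d x 1%g <= gp 1%g (g * r n)%g (r n) + 0. have:= gpE HS0 1%g (g * r n)%g (r n);have:= wdT HS0 (g * r n)%g (r n) 1%g. by rewrite (wdC HS0 (r n) (g * r n)%g);lia.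
 have t2:= track_trans t1 h2. have [l ln [l1 l2]]:= level (fun k=> geod_step k gr) (leq_trans (leq_addr (Kc * A) _) h1).
 exists l;have t3:= DP r 1%g l n (geod_qray gr) ln;rewrite r0 wd_refl// in t3 l2. have t3': track (maxn (D + delta.*2) 0 + delta.*2) 1%g (r l) (r n) by move: t3;rewrite /track;lia.
 have:= track_close t2 t3';rewrite /C1=> h4;apply: leq_trans (SKd _ _) _. by rewrite leq_mul2l;apply/orP;right;lia.
have [l0 l0P]:= near k0 (leqnn _);exists k0, l0, (2 * C1 + l0).+1=> k kk.
have [l lP]:= near (k + k0) (leq_addl _ _).
have:= wdT HS (r l) (g * r (k + k0))%g (r (k + l0)).
have:= wdT HS (g * r (k + k0))%g (r l) (r l0);have:= wdT HS (g * r k0)%g (g * r (k + k0))%g (r l0).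
have:= wdT HS (r l) (g * r (k + k0))%g (g * r k0)%g;have:= wdT HS (r l0) (r l) (g * r k0)%g.
rewrite !word_distM (wdC HS (r l) (g * r k0)%g) (wdC HS (r l) (g * r (k + k0))%g) (wdC HS (r l0) (g * r k0)%g) !rr;clearbody C1;clear -kk lP l0P;lia.
Qed.
(** Far along the ray, an element that shifts by at most [M] takes [r m] into one of [2 * M + 1]
    balls of radius [C] around points [r (m + e - M)]. This bounds the number of such elements. *)
Lemma shifts_finite C M: exists s: seq Gam, forall g (a b: nat), shifts C g a b -> a <= b + M -> b <= a + M -> g \in s.
Proof.
have [ball ballP]:= word_ball_seq C;pose P:= (2 * M).+1 * size ball.
pose fib g:= exists a b: nat, [/\ shifts C g a b, a <= b + M & b <= a + M].
pose Q k:= `[< exists gs: seq Gam, [/\ uniq gs, size gs = k & forall g, g \in gs -> fib g] >].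
have bd k: Q k -> k <= P. move=> /asboolP[gs [ugs <- gsP]]. have [m mP] : exists m0, forall m, m0 <= m -> forall g, g \in gs -> exists2 e, e <= 2 * M & dS (g * r m)%g (r (m + e - M)) <= C.
  elim: gs gsP {ugs}=>[|g gs IH] gsP;first by exists 0. have [m1 m1P]:= IH (fun h hs=> gsP h (mem_behead (s:= g :: gs) hs)).
  have [a [b [[k1 k1P] ab ba]]]:= gsP g (mem_head _ _);exists (m1 + k1 + a + M)=> m mm h. rewrite inE=> /orP[/eqP->|hs];last by apply: m1P=>//;lia. exists (b + M - a);first by lia.
  have e1: m - a + a = m by lia. have e2: m + (b + M - a) - M = m - a + b by lia. by have:= k1P (m - a) ltac:(lia);rewrite e1 e2. have {mP}:= mP m (leqnn m)=> mP.
 rewrite -(size_map (fun g=> g * r m)%g) /P -(size_iota 0 (2 * M).+1) -(size_allpairs (fun e x=> r (m + e - M) * x)%g). apply: uniq_leq_size;first by rewrite map_inj_uniq//;exact: mulIg.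
 move=> _ /mapP[g gg ->];have [e eM he]:= mP g gg;apply/allpairsP. exists (e, ((r (m + e - M))^-1 * (g * r m))%g);split;first by rewrite mem_iota.
  by apply: ballP=> /=;rewrite -(word_distM _ (r (m + e - M))) mulg1 mulVKg (wdC HS). by rewrite/= mulVKg.
have ex: exists k, Q k by exists 0;apply/asboolP;exists [::].
case: (ex_maxnP ex bd)=> k /asboolP[gs [ugs gk gsP]] kmax;exists gs=> g a b h1 h2 h3.
apply: contrapT=> /negP ng;have /kmax: Q k.+1;last by rewrite ltnn.
apply/asboolP;exists (g :: gs);split=> /=;rewrite ?ng ?gk// => h.
by rewrite inE=> /orP[/eqP->|/gsP//];exists a, b.
Qed.
(** If all shifts are bounded, the stabilizer is finite. Otherwise some [s0] has a shift larger than
    the ambiguity [4 * C], and dividing by powers of [s0] brings every element of the stabilizer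
    into a finite set. *)
Lemma stab_vc (F0: seq Gam): (forall x, exists2 f, f \in F0 & act_boundary (f^-1 * x)%g xi = xi) -> virtually_cyclic Gam.
Proof.
move=> HF;have [C CP]:= shifts_exist.
have fixM g h: act_boundary g xi = xi -> act_boundary h xi = xi -> act_boundary (g * h)%g xi = xi. by move=> E1 E2;rewrite act_bdM E2.
have fixV g: act_boundary g xi = xi -> act_boundary g^-1%g xi = xi. by move=> E;rewrite -{1}E -act_bdM mulVg act_bd1.
have [H|]:= pselect (forall g (a b: nat), act_boundary g xi = xi -> shifts C g a b -> a <= b + 4 * C /\ b <= a + 4 * C).
 have [s sP]:= shifts_finite C (4 * C);exists 1%g, [seq (f * h)%g | f <- F0, h <- s]=> x. have [f fF fx]:= HF x;exists x;last by exists 0;left;rewrite expg0 mulg1.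
 apply/allpairsP;exists (f, (f^-1 * x)%g);split=>//=;last by rewrite mulVKg. by have [a [b ab]]:= CP _ fx;have [h1 h2]:= H _ _ _ fx ab;exact: sP ab h1 h2.
move=> H;have [s0 [a [b [fs ab ltab]]]] : exists s0 (a b: nat), [/\ act_boundary s0 xi = xi, shifts C s0 a b & a + 4 * C < b].
 apply: contrapT=> N;apply: H=> g a b fg gab;split;rewrite leqNgt;apply/negP=> h;apply: N. by exists g^-1%g, b, a;split=>//; [exact: fixV|exact: shiftsV]. by exists g, a, b.
pose M:= (b - a) + 4 * C;have [s sP]:= shifts_finite C M.
have pos m: forall h (a' b': nat), act_boundary h xi = xi -> shifts C h a' b' -> a' <= b' + M -> b' <= a' + m -> exists f j, f \in s /\ h = (f * s0 ^+ j)%g. elim: m=>[|m IH] h a' b' fh h1 h2 h3.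
  by exists h, 0;rewrite expg0 mulg1;split=>//;apply: sP h1 h2 _;lia. have [h4|h4]:= leqP b' (a' + M);first by exists h, 0;rewrite expg0 mulg1;split=>//;exact: sP h1 h2 h4.
 have f1:= fixM _ _ fh (fixV _ fs);have [a2 [b2 h5]]:= CP _ f1. have h6:= shiftsM h1 (shiftsV ab);have h7:= shifts_cmp h5 h6;have h8:= shifts_cmp h6 h5.
 have [f [j [fsj E]]]:= IH _ a2 b2 f1 h5 ltac:(rewrite /M in h4 *;lia) ltac:(rewrite /M in h4 *;lia). by exists f, j.+1;split=>//;rewrite expgSr mulgA -E mulgVK.
have neg m: forall h (a' b': nat), act_boundary h xi = xi -> shifts C h a' b' -> b' <= a' + M -> a' <= b' + m -> exists f j, f \in s /\ h = (f * (s0 ^+ j)^-1)%g.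
 elim: m=>[|m IH] h a' b' fh h1 h2 h3. by exists h, 0;rewrite expg0 invg1 mulg1;split=>//;apply: sP h1 _ h2;lia.
 have [h4|h4]:= leqP a' (b' + M);first by exists h, 0;rewrite expg0 invg1 mulg1;split=>//;exact: sP h1 h4 h2. have f1:= fixM _ _ fh fs;have [a2 [b2 h5]]:= CP _ f1.
 have h6:= shiftsM h1 ab;have h7:= shifts_cmp h5 h6;have h8:= shifts_cmp h6 h5. have [f [j [fsj E]]]:= IH _ a2 b2 f1 h5 ltac:(rewrite /M in h4 *;lia) ltac:(rewrite /M in h4 *;lia).
 by exists f, j.+1;split=>//;rewrite expgS invgM mulgA -E mulgK.
exists s0, [seq (f * h)%g | f <- F0, h <- s]=> x;have [f fF fx]:= HF x.
have [a' [b' ab']]:= CP _ fx.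
have fin y: y \in s -> (f * y)%g \in [seq (f * h)%g | f <- F0, h <- s]. by move=> ys;apply/allpairsP;exists (f, y).
have [h|h]:= leqP a' b'. have [y [j [ys E]]]:= pos b' _ _ _ fx ab' ltac:(lia) ltac:(lia). by exists (f * y)%g; [exact: fin|exists j;left;rewrite -mulgA -E mulVKg].
have [y [j [ys E]]]:= neg a' _ _ _ fx ab' ltac:(lia) ltac:(lia).
by exists (f * y)%g; [exact: fin|exists j;right;rewrite -mulgA -E mulVKg].
Qed.
End Stabilizer.

Lemma fellow_limit U th r C (eta: nat -> bd) (w: nat -> nat -> Gam): UltraFilter U -> (forall k, U [set n | k <= n]) ->
 ray1 th r -> (forall k, ray1 (eta k) (w k) /\ forall m, m <= k -> dS (r m) (w k m) <= C) -> exists2 w', ray1 th w' & forall i, U [set k | forall j, j <= i -> w k j = w' j].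
Proof.
move=> UF Uoo [tr r0] wP.
have wP' k: geodesic_ray S (w k) /\ w k 0 = 1%g by have [wk _]:= wP k;split; [exact: ray1_geod wk|have []:= wk].
have [xi [w' [[xw w0] w'P]]]:= limit_ray UF wP';exists w'=>//;split=>//.
suff -> : th = xi by [].
apply: (in_class_inj tr xw);exists C=> m;have [k [h1 h2]]:= ultra_meet UF (w'P m) (Uoo m).
by rewrite -h1//;have [_]:= wP k;exact.
Qed.

Hypothesis nonelem: ~ virtually_cyclic Gam.

(** By [stab_vc], finitely many cosets of the stabilizer of [xi] do not cover the group. This yields
    [g] moving [xi], and then [h] taking it to a third point. *)
Lemma three_points xi: exists a b: bd, [/\ a <> xi, b <> xi & a <> b].
Proof.
have [r xr]:= ray1_ex xi;have move1 (F0: seq Gam): exists x, forall f, f \in F0 -> act_boundary (f^-1 * x)%g xi <> xi. apply: contrapT=> H;apply: nonelem;apply: (stab_vc xr (F0:= F0))=> x.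
 apply: contrapT=> Hx;apply: H;exists x=> f fF E;apply: Hx;by exists f.
have [g gP]:= move1 [:: 1%g];have [h hP]:= move1 [:: 1%g;g].
exists (act_boundary g xi), (act_boundary h xi).
have:= gP 1%g (mem_head _ _);have:= hP 1%g (mem_head _ _);rewrite invg1 !mul1g=> h1 h2;split=>// E.
have:= hP g;rewrite !inE eqxx orbT=> /(_ isT);apply.
by rewrite act_bdM -E -act_bdM mulVg act_bd1.
Qed.
(** At most one of [th], [b], [c] is sent to [th] by [r k]. One of the images of the other two
    follows [r] up to level [k] by [fellow_one_of_two], and so tends to [th] while differing from
    it. *)
Lemma perfect th (W: set bd): open W -> W th -> exists2 eta, eta <> th & W eta.
Proof.
move=> oW Wt;have [b [c [bt ct bc]]]:= three_points th.
have [u u1]:= ray1_ex th;have [v v1]:= ray1_ex b;have [w w1]:= ray1_ex c.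
have bnd (x y: bd) p q: x <> y -> ray1 x p -> ray1 y q -> exists T, forall i j, gp 1%g (p i) (q j) < T. by move=> xy [? ?] [? ?];exact: gp_bnd xy _ _ _ _.
have [T1 TP1]:= bnd _ _ _ _ (nesym bt) u1 v1;have [T2 TP2]:= bnd _ _ _ _ (nesym ct) u1 w1.
have [T3 TP3]:= bnd _ _ _ _ bc v1 w1;have [C CP]:= fellow_one_of_two (T1 + T2 + T3) 0.
have [r tr]:= ray1_ex th;have [gr r0] : geodesic_ray S r /\ r 0 = 1%g by split; [exact: ray1_geod tr|have []:= tr].
have /choice[f fP] : forall k, exists e: bd * (nat -> Gam), [/\ e.1 <> th, ray1 e.1 e.2 & forall m, m <= k -> dS (r m) (e.2 m) <= C].
 move=> k;have two (x y: bd) p q: ray1 x p -> ray1 y q -> (forall i j, gp 1%g (p i) (q j) < T1 + T2 + T3) ->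
   act_boundary (r k) x <> th -> act_boundary (r k) y <> th -> exists e: bd * (nat -> Gam), [/\ e.1 <> th, ray1 e.1 e.2 & forall m, m <= k -> dS (r m) (e.2 m) <= C].
  move=> xp yq pq x1 y1;have [z zz h]:= CP x y p q xp yq pq r k (r k) gr r0 ltac:(by rewrite wd_refl). by case: zz=> zz; [exists (act_boundary (r k) x, z)|exists (act_boundary (r k) y, z)].
 have inj (x y: bd): x <> y -> act_boundary (r k) x = th -> act_boundary (r k) y <> th. move=> xy E E';apply: xy;by rewrite -(act_bd1 x) -(act_bd1 y) -(mulVg (r k)) !act_bdM E E'.
 have [E|n1]:= pselect (act_boundary (r k) th = th). by apply: (two b c v w)=>//; [move=> i j;have:= TP3 i j;lia|exact: inj (nesym bt) E|exact: inj (nesym ct) E].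
 have [E|n2]:= pselect (act_boundary (r k) b = th). by apply: (two th c u w)=>//; [move=> i j;have:= TP2 i j;lia|exact: inj bc E]. by apply: (two th b u v)=>// i j;have:= TP1 i j;lia.
have [U UF Uoo]:= ultra_nat;have [w' tw w'P]:= @fellow_limit U th r C (fun k=> (f k).1) (fun k=> (f k).2) UF Uoo tr (fun k=> let: And3 _ h1 h2:= fP k in conj h1 h2).
have UW:= @ray_cvg _ U (fun k=> (f k).1) (fun k=> (f k).2) th w' UF (fun k=> let: And3 _ h1 _:= fP k in h1) tw w'P W oW Wt.
by have [k [h _]]:= ultra_meet UF UW UW;exists (f k).1=>//;have []:= fP k.
Qed.
(** The group is infinite, and geodesics from 1 of growing length have a limit. *)
Lemma bd_nonempty: exists xi: bd, True.
Proof.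
have [[n H]|H]:= pselect (exists n, forall x, dS 1%g x <= n). have [s sP]:= word_ball_seq n;exfalso;apply: nonelem;exists 1%g, s=> x;exists x;first exact: sP.
 by exists 0;left;rewrite expg0 mulg1.
have /choice[x xP] : forall n, exists x, n < dS 1%g x. by move=> n;apply: contrapT=> N;apply: H;exists n=> x;rewrite leqNgt;apply/negP=> h;apply: N;exists x.
have /choice[f fP]:= fun n=> word_geod HS 1%g (x n).
pose F n i:= f n (minn i (dS 1%g (x n))).
have FE n i j: i <= j -> j <= n -> dS (F n i) (F n j) = j - i. move=> ij jn;have:= xP n;rewrite /F=> h;rewrite !(minn_idPl _);try lia. by have [_ _ h']:= fP n;apply: h';lia.
have F0 n: F n 0 = 1%g by rewrite /F min0n;have []:= fP n.
have [U UF Uoo]:= ultra_nat;have [r rP] : exists r, forall i, U [set n | forall j, j <= i -> F n j = r j].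
 apply: geod_limit=> n k;have [h0 _ h]:= fP n;rewrite /F -{1}h0 h ?leq0n ?geq_minr// subn0 geq_minl//.
suff gr: geodesic_ray S r by have [xi _]:= class_ex gr;exists xi.
suff H' i j: i <= j -> dS (r i) (r j) = j - i. move=> i j;case/orP: (leq_total i j)=> h;first by rewrite H'// (maxn_idPr h) (minn_idPl h). by rewrite (wdC HS) H'// (maxn_idPl h) (minn_idPr h).
by move=> ij;have [n [h1 h2]]:= ultra_meet UF (rP j) (Uoo j);rewrite -!h1//;exact: FE.
Qed.
Lemma rep_unique xi eta p: represents xi p -> represents eta p -> xi = eta.
Proof.
move=>[r [N [xr [h1 _]]]] [r' [N' [er [_ h2]]]];have [gr _]:= in_classP xr;have [gr' _]:= in_classP er.
apply: (in_class_inj xr er);apply: (close_asym (N:= N + N'))=>// k;have [j jN]:= h2 k.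
have [l lN]:= h1 j;exists l;apply: leq_trans (wdT HS (p j) _ _) _.
by rewrite (wdC HS (r l)) leq_add.
Qed.
Lemma rep_translate g xi p: represents xi p -> represents (act_boundary g xi) (translate g p).
Proof.
move=>[r [N [xr [h1 h2]]]];exists (translate g r), N;split;first exact: act_class.
by split=> k; [have [l]:= h1 k|have [l]:= h2 k];exists l;rewrite /translate word_distM.
Qed.
Lemma rep_tail xi p: represents xi (fun k=> p k.+1) -> represents xi p.
Proof.
move=>[r [N [xr [h1 h2]]]];exists r, (dS (p 0) (p 1) + N);split=>//;split=>[[|k]|l].
- have [l lN]:= h1 0;exists l;apply: leq_trans (wdT HS (p 1) _ _) _;exact: leq_add.
- by have [l lN]:= h1 k;exists l;apply: leq_trans lN (leq_addl _ _).
- by have [k kN]:= h2 l;exists k.+1;apply: leq_trans kN (leq_addl _ _).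
Qed.

(** * Codes and the boundary *)

Section Dynamics.
Context {R: realType} {M: topologicalType} (dM: M -> M -> R) (Md: metr_for dM) (rho: Gam -> M -> M).
Context (Lam: set M) (E: @datum R M Gam) (adm: admissible dM rho Lam) (ED: expansion_datum dM rho Lam E).
Local Notation Sig:= (dSigma E).
Local Notation full_code:= (full_code dM rho).
Local Notation del:= (ddelta E).

Lemma Lam_inv g (x: M): Lam x -> Lam (rho g x). Proof. by have [_ _ _ inv _]:= adm;exact: inv. Qed.
Lemma pfx_shadow e: exists N, forall (x: M) (al: nat -> dI E) g, Lam x -> full_code x al -> d 1%g g <= e -> exists xi r, ray1 xi r /\ hausdorff_close S N (translate g (prefix al)) r.
Proof.
have [A AP]:= pfx_dist Md adm ED;have HSig:= Sig_gen ED.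
have [K1 K1P]:= wd_compare HS0 HSig;have [K2 K2P]:= wd_compare HSig HS0.
have [N NP]:= shadow (maxn K1 (A * K2)) e;exists N=> x al g Lx fc ge.
have [|/=|r [gr r0 h1 h2]]:= NP (translate g (prefix al)).
- move=> i j ij;rewrite /translate word_distM;have [h1 h2]:= AP x al i j Lx fc ij. have:= K1P (prefix al i) (prefix al j);have:= K2P (prefix al i) (prefix al j);split;nia.
- by rewrite /translate mulg1.
have [xi xr]:= class_ex gr;exists xi, r;split=>//;split=>// l;exact: h2.
Qed.

(** * Codes at points of an embedded boundary *)

Section Embedded.
Variable phi: bd -> M.
Hypotheses (phc: continuous phi) (phE: forall g xi, phi (act_boundary g xi) = rho g (phi xi)).
Hypotheses (phI: injective phi) (phL: forall xi, Lam (phi xi)).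

Lemma mball_phi_open xi (e: R): (0 < e)%R -> exists W: set bd, [/\ open W, W xi & forall eta, W eta -> (dM (phi xi) (phi eta) < e)%R].
Proof.
move=> e0;have [_ _ _ _ nP]:= Md;have: nbhs xi (phi @^-1` mball dM e (phi xi)) by apply: phc;apply/nP;exists e.
by rewrite nbhsE=> -[W [oW Wx] WV];exists W;split=>// eta /WV.
Qed.
(** If the bounds grew without limit, a limit [x] of the points [th T] would have, by [perfect],
    another point [eta] nearby whose ray has unbounded product with those of the [th T]; then [eta]
    would be [x]. *)
Lemma uniform_pair: exists T, forall th, exists eta u v, [/\ (dM (phi th) (phi eta) < del)%R, ray1 th u, ray1 eta v & forall i j, gp 1%g (u i) (v j) < T].
Proof.
have [C CP]:= fellow_gp;have [d0 _ _ _]:= datum_bounds ED;have [_ _ dsym dtri _]:= Md.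
apply: contrapT=> N;have /choice[th thP] : forall T, exists th, forall eta u v, (dM (phi th) (phi eta) < del)%R -> ray1 th u -> ray1 eta v -> exists i j, T <= gp 1%g (u i) (v j).
 move=> T;apply: contrapT=> HT;apply: N;exists T=> th;apply: contrapT=> Hth;apply: HT;exists th=> eta u v h1 h2 h3.
 apply: contrapT=> Hij;apply: Hth;exists eta, u, v;split=>// i j;rewrite ltnNge;apply/negP=> h. by apply: Hij;exists i, j.
have /choice[f fP]:= fun T=> ray1_ex (th T);have [U UF Uoo]:= ultra_nat.
have [|x [r [xr rP]]]:= @limit_ray nat U f UF;first by move=> t;split; [exact: ray1_geod (fP t)|have []:= fP t].
have d2: (0 < del / 2)%R by rewrite divr_gt0.
have [W [oW Wx WP]]:= mball_phi_open x d2;have [eta ex We]:= perfect oW Wx.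
have [v ev]:= ray1_ex eta;have [xr' r0]:= xr;have [ev' v0]:= ev.
apply: ex;apply: (in_class_inj ev' xr');exists C=> k;rewrite (wdC HS).
have [t [[h1 h2] h3]]:= ultra_meet UF (filterI (rP k) (ray_cvg UF fP xr rP oW Wx)) (Uoo (2 * (Kc * k)).+1).
have close: (dM (phi (th t)) (phi eta) < del)%R. have:= dtri (phi x) (phi (th t)) (phi eta);rewrite (dsym (phi (th t)) (phi x));move: (WP _ We) (WP _ h2);lra.
have [i [j ij]]:= thP t eta (f t) v close (fP t) ev.
have [_ f0]:= fP t;rewrite -(h1 k)//;apply: (CP _ _ k i j)=>//; [exact: ray1_geod (fP t)|exact: ray1_geod ev|exact: leq_trans ij].
Qed.

(* The points [g_l eta] with [phi eta] close to [phi (g_l^-1 xi)] converge to [xi], because the branches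
   of the code contract; but either they or [xi] itself follow the shadow of the code. *)
Lemma code_endpoint xi (al: nat -> dI E): full_code (phi xi) al -> represents xi (prefix al).
Proof.
move=> fc;have [N NP]:= pfx_shadow 0;have [T TP]:= uniform_pair;have [C CP]:= fellow_one_of_two T N.
have [z [r [zr close]]]:= NP _ _ 1%g (phL xi) fc ltac:(by rewrite wd_refl).
have tr1: translate 1%g (prefix al) = prefix al by apply/funext=> k;rewrite /translate mul1g.
rewrite tr1 in close;have [h1 h2]:= close;have [zr' r0]:= zr;have gr:= ray1_geod zr.
suff -> : xi = z by exists r, N.
have [A AP]:= pfx_dist Md adm ED;have [K KP]:= wd_compare HS (Sig_gen ED).
have /choice[l lP] : forall k, exists l, dS (prefix al l) (r k) <= N by move=> k;have [l]:= h2 k;exists l.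
have loo k: k <= K * l k + N. have:= geod_from1 k gr r0;have:= wdT HS (prefix al (l k)) 1%g (r k);have:= lP k. have [+ _]:= AP _ _ 0 (l k) (phL xi) fc (leq0n _);rewrite/= subn0=> a1.
 have:= KP 1%g (prefix al (l k));have: K * word_dist Sig 1%g (prefix al (l k)) <= K * l k by rewrite leq_mul2l a1 orbT. lia.
have [d0 l1 lL L0]:= datum_bounds ED;have l0: (0 < dlam E)%R by apply: lt_trans l1.
have /choice[f fP] : forall k, exists e: bd * (nat -> Gam), [/\ ray1 e.1 e.2, forall m, m <= k -> dS (r m) (e.2 m) <= C & (dlam E ^+ l k * dM (phi xi) (phi e.1) < del)%R].
 move=> k;set g:= prefix al (l k);have [eta [u [v [h3 tu ev uv]]]]:= TP (act_boundary g^-1%g xi). have [w ww wC]:= CP _ _ u v tu ev uv r k g gr r0 (lP k);have [dd _ _ _ _]:= Md.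
 case: ww=> ww; [exists (xi, w)|exists (act_boundary g eta, w)];split=>//=.
 - by rewrite -[xi in ray1 xi]act_bd1 -(mulgV g) act_bdM.
 - by rewrite dd mulr0.
 - by rewrite phE;apply: (pfx_small Md adm ED fc);rewrite -/g -phE.
have [U UF Uoo]:= ultra_nat;have [w' zw w'P]:= @fellow_limit U z r C (fun k=> (f k).1) (fun k=> (f k).2) UF Uoo zr (fun k=> let: And3 h3 h4 _:= fP k in conj h3 h4).
apply: phI;apply: contrapT=> /(_ _)/= ne;have [_ dp dsym dtri _]:= Md.
have e0: (0 < dM (phi xi) (phi z) / 2)%R by rewrite divr_gt0// dp.
have [W [oW Wz WP]]:= mball_phi_open z e0.
have UW:= @ray_cvg _ U (fun k=> (f k).1) (fun k=> (f k).2) z w' UF (fun k=> let: And3 h3 _ _:= fP k in h3) zw w'P W oW Wz.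
have [n nP]:= exp_unbnd (del / (dM (phi xi) (phi z) / 2)) l1.
have [k [kW kn]]:= ultra_meet UF UW (Uoo (K * n + N).+1);have [_ _ h3]:= fP k;have {kW}:= WP _ kW=> h4.
have nl: n <= l k by have:= loo k;move: kn=> /=;nia.
have h5: (dlam E ^+ n <= dlam E ^+ l k)%R by rewrite ler_eXn2l.
rewrite ler_pdivrMr// in nP;have:= dtri (phi (f k).1) (phi xi) (phi z);rewrite (dsym (phi (f k).1))=> h6.
by have:= exprn_gt0 n l0;nra.
Qed.
(** Every ray at [x] is shadowed by a geodesic ray from 1 to [pi x], with a constant independent of
    [x], and any two such geodesic rays are uniformly close. *)
Lemma emb_S_hyp (pi: M -> bd): (forall x: M, Lam x -> phi (pi x) = x) -> postal_map dM rho Lam E pi /\ exists N, S_hyperbolic_with dM rho Lam E N.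
Proof.
move=> piK;have post: postal_map dM rho Lam E pi. move=> x Lx p /(Ray_full adm Lx)[j [al [fc ->]]]. rewrite -[pi x]act_bd1 -(mulgV (ds j)) act_bdM;apply: rep_translate;apply: code_endpoint.
 by rewrite phE piK.
split=>//;have HSig:= Sig_gen ED;have [K1 K1P]:= wd_compare HS0 HSig.
have [N NP]:= pfx_shadow K1;have [C CP]:= asym_close;have [K KP]:= wd_compare HSig HS.
exists (K * (N + C + N)).+1;split=>// x Lx.
have sh p: Ray dM rho E del x p -> exists r, ray1 (pi x) r /\ hausdorff_close S N p r. move=> px;have [j [al [fc pE]]]:= Ray_full adm Lx px.
 have [||z [r [zr h]]]:= NP _ al (ds j) _ fc;first exact: Lam_inv. have:= wd_gen HSig 1%g (codom_f (@ds _ _ _ E) j);rewrite mul1g=> h.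
  by apply: leq_trans (K1P _ _) _;rewrite -[leqRHS]muln1 leq_mul2l h orbT. exists r;rewrite pE;split=>//;suff <- : z = pi x by [].
 by apply: (rep_unique (p:= p)); [rewrite pE;exists r, N;have []:= zr|exact: post].
move=> p p' /sh[r [xr [a1 a2]]] /sh[r' [xr' [b1 b2]]].
have [[xr1 r0] [xr1' r0']]:= (xr, xr');have [_ /(_ r')[/(_ xr1')[_ as1] _]]:= in_classP xr1.
have cl k: dS (r k) (r' k) <= C by apply: CP=>//; [exact: ray1_geod xr|exact: ray1_geod xr'].
have fin y z k: dS y (r k) <= N -> dS z (r' k) <= N -> word_dist Sig y z <= (K * (N + C + N)).+1. move=> h1 h2;apply: leq_trans (KP _ _) _;apply: leqW;rewrite leq_mul2l;apply/orP;right.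
 have:= wdT HS (r k) y z;have:= wdT HS (r' k) (r k) z;have:= cl k. by rewrite (wdC HS (r' k) z);lia.
split=> k;first by have [l h]:= a1 k;have [m h']:= b2 l;exists m;exact: fin h h'.
by have [l h]:= b1 k;have [m h']:= a2 l;exists m;exact: fin h' h.
Qed.
End Embedded.

(** * The inverse of an injective postal map *)

Section Postal.
Variable pi: M -> bd.
Hypotheses (post: postal_map dM rho Lam E pi).

Lemma post_full (x: M) (al: nat -> dI E): Lam x -> full_code x al -> represents (pi x) (prefix al) /\ forall j: dI E, pi (rho (ds j) x) = act_boundary (ds j) (pi x).
Proof.
move=> Lx fc;have rx: represents (pi x) (prefix al). apply: rep_tail;apply: post=>//;exists al;first by move=> k _;rewrite (code_pointE adm);exact: fc.
 by apply/funext=> k;rewrite code_rayE.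
split=>// j;have:= rep_translate (ds j)^-1%g (post (Lam_inv (ds j) Lx) (Ray_cons adm j fc)).
rewrite (_: translate _ (translate _ _) = prefix al);last by apply/funext=> k;rewrite /translate mulKg.
by move=> h;rewrite -(rep_unique h rx) -act_bdM mulgV act_bd1.
Qed.
Lemma post_equi g (x: M): Lam x -> pi (rho g x) = act_boundary g (pi x).
Proof.
move=> Lx;have [k [w [ww _ ->]]]:= Sig_gen ED g;elim: w ww=>[|a w IH]/=. by rewrite (action1 adm) act_bd1.
move=> /andP[/(Sig_letter ED)[j ->] /IH {}IH];rewrite (actionM adm) act_bdM -IH.
have Lw:= Lam_inv (foldr *%g 1%g w) Lx;have [al fc]:= full_code_ex adm ED Lw.
by have [_ ->]:= post_full Lw fc.
Qed.
(** The graph of the postal map is closed. Codes use finitely many letters, so those of [x t]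
    converge along the ultrafilter to a code of [y], and the rays that they shadow agree with it on
    longer and longer pieces. *)
Lemma post_cl (T: Type) (U: set_system T) (x: T -> M) (y: M) (f: T -> nat -> Gam) xi r: UltraFilter U ->
 (forall t, Lam (x t) /\ ray1 (pi (x t)) (f t)) -> Lam y -> (forall W, nbhs y W -> U [set t | W (x t)]) -> ray1 xi r -> (forall i, U [set t | forall j, j <= i -> f t j = r j]) -> pi y = xi.
Proof.
move=> UF xP Ly xy xr rP;have [_ _ _ _ nP]:= Md.
have /choice[al alP]:= fun t=> full_code_ex adm ED (xP t).1.
have [be beP] : exists be, forall i, U [set t | forall j, j <= i -> al t j = be j]. by apply: ultra_limit=> i;exists (enum (dI E))=> t;rewrite mem_enum.
have fy: full_code y be. by apply: (full_code_limit Md adm UF (x:= x) (al:= al))=>// e e0;apply: (xy (mball dM e y));apply/nP;exists e.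
have [N NP]:= pfx_shadow 0;have [C CP]:= asym_close;have [A AP]:= pfx_dist Md adm ED.
have [K KP]:= wd_compare (Sig_gen ED) HS.
have tr1 (q: nat -> Gam): translate 1%g q = q by apply/funext=> k;rewrite /translate mul1g.
have sh (z: M) (q: nat -> dI E): Lam z -> full_code z q -> exists s, ray1 (pi z) s /\ hausdorff_close S N (prefix q) s.
 move=> Lz fz;have [z0 [s [zs h]]]:= NP z q 1%g Lz fz ltac:(by rewrite wd_refl);rewrite tr1 in h;exists s;split=>//.
 suff <- : z0 = pi z by [];apply: (rep_unique (p:= prefix q));last exact: (post_full Lz fz).1. by exists s, N;have []:= zs.
have [s [ys [s1 s2]]]:= sh _ _ Ly fy;have [ys' s0]:= ys;have [xr' r0]:= xr.
apply: (in_class_inj ys' xr');apply: (close_asym (N:= N + N + C)); [exact: ray1_geod ys|exact: ray1_geod xr|move=> k].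
(* By [pfx_dist], only the first [B] letters of a code can come within [N] of level [k]. *)
pose B:= A * (K * (N + k));have [t [h1 h2]]:= ultra_meet UF (rP k) (beP B);have [Lt ft]:= xP t.
have [s' [xs' [_ s2']]]:= sh _ _ Lt (alP t);have [[ft' f0] [xs1 s0']]:= (ft, xs').
have [_ /(_ (f t))[/(_ ft')[_ as1] _]]:= in_classP xs1.
have:= CP s' (f t) k (ray1_geod xs') (ray1_geod ft) s0' f0 as1;rewrite h1// => h3.
have [l lN]:= s2' k;have lB: l <= B. have [_ +]:= AP _ _ 0 l Lt (alP t) (leq0n _);rewrite subn0/= => h4;apply: leq_trans h4 _;rewrite leq_mul2l;apply/orP;right.
 apply: leq_trans (KP _ _) _;rewrite leq_mul2l;apply/orP;right. have:= wdT HS (s' k) 1%g (prefix (al t) l);rewrite (geod_from1 k (ray1_geod xs') s0'). by rewrite (wdC HS (s' k));lia.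
have pE: prefix (al t) l = prefix be l. by elim: l lB {lN}=>//= l IH lB;rewrite IH ?h2//;exact: ltnW.
have [m mN]:= s1 l;exists m;rewrite pE in lN.
have:= wdT HS (prefix be l) (s m) (r k);have:= wdT HS (s' k) (prefix be l) (r k).
by rewrite (wdC HS (s m) (prefix be l));lia.
Qed.

Hypothesis piI: forall x y: M, Lam x -> Lam y -> pi x = pi y -> x = y.

(** Some [x], [y] have different images, as otherwise all of [Gam] would fix one boundary point. For
    each [k] the image of a translate of [x] or [y] by [r k] follows the ray to [th]; a limit of
    these translates in the compact [Lam] is mapped to [th]. *)
Lemma post_onto th: exists2 x: M, Lam x & pi x = th.
Proof.
have [_ [x Lx] cL _ _]:= adm.
have [y Ly xy] : exists2 y: M, Lam y & pi x <> pi y. apply: contrapT=> H;apply: nonelem;have [r xr]:= ray1_ex (pi x). apply: (stab_vc xr (F0:= [:: 1%g]))=> g;exists 1%g;first exact: mem_head.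
 rewrite invg1 mul1g -post_equi//;apply: contrapT=> h;apply: H;exists (rho g x);first exact: Lam_inv. exact: nesym.
have [[u xu] [v yv]]:= (ray1_ex (pi x), ray1_ex (pi y)).
have [T TP]:= gp_bnd xy xu.1 yv.1 xu.2 yv.2;have [C CP]:= fellow_one_of_two T 0;have [r tr]:= ray1_ex th.
have /choice[f fP] : forall k, exists e: M * (nat -> Gam), [/\ Lam e.1, ray1 (pi e.1) e.2 & forall m, m <= k -> dS (r m) (e.2 m) <= C].
 move=> k;have [w ww wC]:= CP _ _ u v xu yv TP r k (r k) (ray1_geod tr) tr.2 ltac:(by rewrite wd_refl).
 by case: ww=> ww; [exists (rho (r k) x, w)|exists (rho (r k) y, w)];split=>//=;rewrite ?post_equi//;exact: Lam_inv.
have [U UF Uoo]:= ultra_nat;have [w' tw w'P]:= @fellow_limit U th r C (fun k=> pi (f k).1) (fun k=> (f k).2) UF Uoo tr (fun k=> let: And3 _ h1 h2:= fP k in conj h1 h2).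
have [z Lz zP]:= @ultra_cpt _ _ U Lam (fun k=> (f k).1) UF cL (fun k=> let: And3 h _ _:= fP k in h).
exists z=>//;apply: (@post_cl _ U (fun k=> (f k).1) z (fun k=> (f k).2) th w' UF)=>// t;by have []:= fP t.
Qed.
Lemma post_inverse: exists psi: bd -> M, [/\ continuous psi, forall g xi, psi (act_boundary g xi) = rho g (psi xi),
 forall xi, Lam (psi xi) /\ pi (psi xi) = xi & forall x: M, Lam x -> psi (pi x) = x].
Proof.
have /choice[psi psiP] : forall th, exists x: M, Lam x /\ pi x = th by move=> th;have [x ? ?]:= post_onto th;exists x.
have psiK (x: M): Lam x -> psi (pi x) = x by move=> Lx;have [h1 h2]:= psiP (pi x);exact: piI.
exists psi;split=>// [|g xi];last first. by have [h1 h2]:= psiP xi;rewrite -{1}h2 -post_equi// psiK//;exact: Lam_inv.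
apply/continuousP=> W oW;have [_ _ cL _ _]:= adm;suff: boundary_open (psi @^-1` W) by [].
move=> th r Wt tr r0;apply: contrapT=> H.
have /choice[f fP] : forall k, exists e: bd * (nat -> Gam), [/\ ray1 e.1 e.2, forall i, i <= k -> e.2 i = r i & ~ W (psi e.1)].
 move=> k;apply: contrapT=> Hk;apply: H;exists k=> th' r' t' r0' rr;apply: contrapT=> nW;apply: Hk;by exists (th', r').
have [U UF Uoo]:= ultra_nat.
have [z Lz zP]:= @ultra_cpt _ _ U Lam (fun k=> psi (f k).1) UF cL (fun k=> (psiP _).1).
have zt: pi z = th. apply: (@post_cl _ U (fun k=> psi (f k).1) z (fun k=> (f k).2) th r UF)=>// [t|i]. by have [h1 h2]:= psiP (f t).1;rewrite h2;have []:= fP t.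
 by apply: filterS (Uoo i)=> k ik j ji;have [_ h _]:= fP k;apply: h;exact: leq_trans ik.
have Wz: W z by rewrite -(psiK z Lz) zt.
have UW:= zP W (open_nbhs_nbhs (conj oW Wz));have [k [h _]]:= ultra_meet UF UW UW.
by have [_ _]:= fP k;apply.
Qed.
(** The inverse of a prefix of length [l] expands by [lam ^ l], and passing to a group element
    within distance [m] loses a factor [L ^ m]. That every [r k] is near a prefix gives the uniform
    bound; that every prefix is near some [r k] gives arbitrarily large ones. *)
Lemma post_expd (x: M) r: Lam x -> ray1 (pi x) r -> let expanding (c: R) k:= exists2 e: R, (0 < e)%R & forall y z: M, (dM x y < e)%R -> (dM x z < e)%R ->
  (c * dM y z <= dM (rho (r k)^-1%g y) (rho (r k)^-1%g z))%R in (exists2 c: R, (0 < c)%R & forall k, expanding c k) /\ forall c: R, exists k, expanding c k.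
Proof.
move=> Lx xr expanding;have [al fc]:= full_code_ex adm ED Lx;have [d0 l1 lL L0]:= datum_bounds ED.
have [[s [N [xs [a1 a2]]]] _]:= post_full Lx fc;have [_ /(_ r)[/(_ xr.1)[_ [B BP]] _]]:= in_classP xs.
have [K KP]:= wd_compare (Sig_gen ED) HS;pose m:= K * (N + B).
have Lm: (0 < dL E ^+ m)%R by rewrite exprn_gt0.
have near (l k: nat): dS (prefix al l) (s k) <= N -> word_dist Sig (prefix al l) (r k) <= m. move=> h;apply: leq_trans (KP _ _) _;rewrite leq_mul2l;apply/orP;right.
 by apply: leq_trans (wdT HS (s k) _ _) _;rewrite leq_add.
have ex (c: R) (l k: nat): (c * dL E ^+ m <= dlam E ^+ l)%R -> dS (prefix al l) (s k) <= N -> expanding c k.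
 move=> h /near/(expd_near Md adm ED Lx fc)[e e0 eP];exists e=>// y z xy xz;apply: le_trans (eP y z xy xz). by rewrite ler_wpM2r ?(metr_ge0 Md)// ler_pdivlMr.
split=>[|c]. exists (dL E ^+ m)^-1%R=>[|k];first by rewrite invr_gt0. by have [l h]:= a2 k;apply: ex h;rewrite mulVf ?gt_eqF// exprn_ege1// ltW.
have [n nP]:= exp_unbnd (c * dL E ^+ m) l1;have [k h]:= a1 n;exists k;exact: ex nP h.
Qed.
End Postal.
End Dynamics.
End Boundary.

Lemma fin_min {R: realType} (I: finType) (f: I -> R): (forall i, 0 < f i) -> exists2 r, 0 < r & forall i, r <= f i.
Proof.
move=> f0;exists (\big[Order.min/1]_i f i)=>[|i];last exact: bigmin_le_cond.
by elim/big_ind: _=>// a b;rewrite lt_min=> -> ->.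
Qed.
Lemma fin_max {R: realType} (I: finType) (f: I -> R) (c: R): exists2 r, c <= r & forall i, f i <= r.
Proof.
exists (\big[Order.max/c]_i f i)=>[|i];last exact: le_bigmax_cond.
by elim/big_rec: _=>// i x _ cx;rewrite le_max cx orbT.
Qed.
Lemma cpt_finite_cover (M: topologicalType) (K: set M) (V: M -> set M): (forall x, open (V x)) ->
 (forall x, V x x) -> compact K -> exists2 s: seq M, (forall y, y \in s -> K y) & forall x, K x -> exists y, y \in s /\ V y x.
Proof.
move=> oV Vx /compact_near_coveringP cK.
pose F: set_system (seq M):= [set A: set (seq M) | exists2 s0: seq M, (forall y, y \in s0 -> K y) & forall s: seq M, {subset s0 <= s} -> A s].
have FF: Filter F. split;first by exists [::]. move=> A B [s sK sA] [s' sK' sB];exists (s ++ s')=>[y|t st];first by rewrite mem_cat=> /orP[/sK|/sK'].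
  by split; [apply: sA|apply: sB]=> y ys;apply: st;rewrite mem_cat ys ?orbT. by move=> A B AB [s sK sA];exists s=>// t /sA/AB.
have [x Kx|s sK sP]:= cK _ F (fun s x=> exists y, y \in s /\ V y x) FF;last first. by exists s=>// x Kx;exact: sP.
exists (V x, [set s: seq M | x \in s]);first split=> /=.
- by apply: open_nbhs_nbhs;split; [exact: oV|exact: Vx].
- by exists [:: x]=>[y|s]; [rewrite inE=> /eqP->|apply;rewrite mem_head].
by move=>[x' s] [/= h1 h2];exists x.
Qed.

(** * Expansion data from pointwise expansion *)

Section ExpansionDatum.
Context {R: realType} {M: topologicalType} (d: M -> M -> R) (Md: metr_for d).
Hypothesis ball_connected: forall x r, connected (mball d r x).
Context {Gam: groupType} (rho: Gam -> M -> M).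
Hypotheses (act1: forall x, rho 1%g x = x) (actM: forall g h x, rho (g * h)%g x = rho g (rho h x)).
Hypothesis act_cont: forall g, continuous (rho g).
Hypothesis act_lip: forall g x, exists L: R, 0 < L /\ exists2 r: R, 0 < r & forall y z, d x y < r -> d x z < r -> d (rho g y) (rho g z) <= L * d y z.

Lemma dist_pos x y: 0 <= d x y. Proof. exact: metr_ge0. Qed.
Lemma mball_open x r: open (mball d r x).
Proof.
have [_ _ _ dtri nP]:= Md;rewrite openE=> y xy;apply/nP;exists (r - d x y);first by rewrite subr_gt0.
by move=> z;rewrite /mball/= ltrBrDl;apply: le_lt_trans.
Qed.
(** In a sequence of counterexamples the pairs converge. A common limit contradicts the local
    Lipschitz bound there; two distinct limits contradict the boundedness of the images. *)
Lemma lip_near K g: compact K -> exists e L: R, [/\ 0 < e, 0 < L & lipschitz_at_most d L (nbhd_of d e K) (rho g)].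
Proof.
move=> cK;have [dd dp dsym dtri nP]:= Md;apply: contrapT=> H.
have /choice[f fP] : forall n: nat, exists f: M * M * (M * M), [/\ K f.1.1, K f.1.2, d f.1.1 f.2.1 < n.+1%:R^-1, d f.1.2 f.2.2 < n.+1%:R^-1 &
  n.+1%:R * d f.2.1 f.2.2 < d (rho g f.2.1) (rho g f.2.2)]. move=> n;apply: contrapT=> Hn;apply: H;exists n.+1%:R^-1, n.+1%:R;split;rewrite ?invr_gt0// => y z [a Ka ay] [b Kb bz].
 by rewrite leNgt;apply/negP=> yz;apply: Hn;exists ((a, b), (y, z)).
have [U UF Uoo]:= ultra_nat.
have [a Ka aP]:= @ultra_cpt _ _ U K (fun n=> (f n).1.1) UF cK (fun n=> let: And5 h _ _ _ _:= fP n in h).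
have [b Kb bP]:= @ultra_cpt _ _ U K (fun n=> (f n).1.2) UF cK (fun n=> let: And5 _ h _ _ _:= fP n in h).
have small (e: R): 0 < e -> exists n0: nat, forall n: nat, (n0 <= n)%N -> n.+1%:R^-1 < e.
 move=> e0;exists (Num.bound e^-1)=> n nn;rewrite invf_plt ?posrE//;apply: lt_le_trans (archi_boundP _) _. by rewrite invr_ge0 ltW. by rewrite ler_nat leqW.
have near (e: R) (n1: nat): 0 < e -> exists n: nat, [/\ (n1 <= n)%N, d a (f n).2.1 < e & d b (f n).2.2 < e]. move=> e0;have e2: 0 < e / 2 by rewrite divr_gt0.
 have nb x: nbhs x (mball d (e / 2) x) by apply/nP;exists (e / 2). have [n0 n0P]:= small _ e2. have [n [[h1 h2] h3]]:= ultra_meet UF (filterI (aP _ (nb a)) (bP _ (nb b))) (Uoo (n0 + n1)%N).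
 move: h1 h2;rewrite /mball/= => h1 h2;have/= h4:= h3;have {}n0P:= n0P n ltac:(lia);have [_ _ /lt_trans/(_ n0P) h5 /lt_trans/(_ n0P) h6 _]:= fP n. exists n;split;first by lia.
  by have:= dtri (f n).1.1 a (f n).2.1;lra. by have:= dtri (f n).1.2 b (f n).2.2;lra.
have [ab|ab]:= pselect (a = b). have [L [L0 [r r0 rP]]]:= act_lip g a;have [n [nn h1 h2]]:= near r (Num.bound L) r0;rewrite -ab in h2.
 have [_ _ _ _]:= fP n;apply/negP;rewrite -leNgt;apply: le_trans (rP _ _ h1 h2) _;rewrite ler_wpM2r ?dist_pos//. apply/ltW/(lt_le_trans (archi_boundP (ltW L0)));by rewrite ler_nat leqW.
have ab0:= dp _ _ ab;pose B:= d (rho g a) (rho g b) + 2.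
have ball x: exists2 r: R, 0 < r & forall y, d x y < r -> d (rho g x) (rho g y) < 1. have /nP[r r0 rP] : nbhs x (rho g @^-1` mball d 1 (rho g x)) by apply: act_cont;apply/nP;exists 1.
 by exists r=>// y /rP.
have [r1 r10 r1P]:= ball a;have [r2 r20 r2P]:= ball b.
have e0: 0 < Order.min (d a b / 4) (Order.min r1 r2) by rewrite !lt_min r10 r20 divr_gt0.
have [n [nn]]:= near _ (Num.bound (2 * B / d a b)) e0;rewrite !lt_min=> /and3P[a1 /r1P a2 _] /and3P[b1 _ /r2P b2].
have [_ _ _ _]:= fP n;apply/negP;rewrite -leNgt;apply: (@le_trans _ _ B). have:= dtri (rho g a) (rho g (f n).2.1) (rho g (f n).2.2);have:= dtri (rho g b) (rho g a) (rho g (f n).2.2).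
 by rewrite (dsym _ (rho g a)) /B;lra.
have h1: d a b / 2 <= d (f n).2.1 (f n).2.2. have:= dtri (f n).2.1 a b;have:= dtri (f n).2.2 (f n).2.1 b;rewrite (dsym (f n).2.2 b);lra.
have h2: 2 * B / d a b <= n.+1%:R. apply: le_trans (ler_norm _) _;rewrite ger0_norm;last by rewrite divr_ge0 ?mulr_ge0 ?addr_ge0 ?dist_pos.
 apply/ltW/(lt_le_trans (archi_boundP _));first by rewrite divr_ge0 ?mulr_ge0 ?addr_ge0 ?dist_pos. by rewrite ler_nat leqW.
rewrite ler_pdivrMr// in h2;have:= ler_wpM2l (ler0n R n.+1) h1;lra.
Qed.
Lemma LHomeo_act g: LHomeo d (rho g).
Proof.
have gK h: cancel (rho h) (rho h^-1%g) by move=> x;rewrite -actM mulVg act1.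
split;first exact: act_cont. by exists (rho g^-1%g); [split=>// x;have:= gK g^-1%g x;rewrite invgK|exact: act_cont].
move=> K cK;have [e [L [e0 L0 h]]]:= lip_near g cK.
have cgK: compact (rho g @` K) by apply: continuous_compact cK;exact/continuous_subspaceT/act_cont.
have [e' [L' [e0' L0' h']]]:= lip_near g^-1%g cgK;have [dd _ _ _ _]:= Md.
have inK (A: set M) r x: 0 < r -> A x -> nbhd_of d r A x by exists x=>//;rewrite /mball/= dd.
exists (Order.max L L');first by rewrite lt_max L0.
move=> x y Kx Ky;apply/andP;split;last first. apply: le_trans (h x y (inK _ _ _ e0 Kx) (inK _ _ _ e0 Ky)) _;by rewrite ler_wpM2r ?dist_pos// le_max lexx.
rewrite ler_pdivrMl;last by rewrite lt_max L0.
have:= h' (rho g x) (rho g y) (inK _ _ _ e0' (ex_intro2 _ _ x Kx erefl)) (inK _ _ _ e0' (ex_intro2 _ _ y Ky erefl)).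
by rewrite !gK=> h2;apply: le_trans h2 _;rewrite ler_wpM2r ?dist_pos// le_max lexx orbT.
Qed.

(* In the connected ball around [rho g x], the image of the ball around [x] is open, and it is closed
   because expansion bounds the distance of preimages from [x]. *)
Lemma expd_ball g (lam e: R) (U: set M): 0 < lam -> expanding_map d lam U (rho g) -> expanding_map_delta d lam U e (rho g).
Proof.
move=> l0 ex;split=>// x eta eta0 _ sub;have [dd _ _ _ nP]:= Md;set B:= mball d (lam * eta) (rho g x).
have gK h: cancel (rho h) (rho h^-1%g) by move=> y;rewrite -actM mulVg act1.
have gVK y: rho g (rho g^-1%g y) = y by have:= gK g^-1%g y;rewrite invgK.
have Bx: mball d eta x x by rewrite /mball/= dd.
have Ux:= sub _ Bx;suff <- : B `&` rho g @` mball d eta x = B by move=> y [].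
have imE: rho g @` mball d eta x = rho g^-1%g @^-1` mball d eta x. by apply/seteqP;split=>[_ [y xy <-]|y xy]; [rewrite /preimage/= gK|exists (rho g^-1%g y)].
apply: ball_connected.
- by exists (rho g x);split; [rewrite /B /mball/= dd mulr_gt0|exists x].
- by exists (rho g @` mball d eta x)=>//;rewrite imE;apply: open_comp (mball_open _ _)=> y _;exact: act_cont.
exists [set y | lam * d x (rho g^-1%g y) <= d (rho g x) y]. have dc h z: continuous (fun y=> d z (rho h y): R).
  move=> y;apply/cvgrPdist_lt=> e' e'0;have /nP[r r0 rP] : nbhs y (rho h @^-1` mball d e' (rho h y)) by apply: act_cont;apply/nP;exists e'. have: nbhs y (mball d r y) by apply/nP;exists r.
  apply: filterS=> u /rP;rewrite /preimage /mball/= => yu;have [_ _ dsym dtri _]:= Md.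
  have:= dtri (rho h y) z (rho h u);have:= dtri (rho h u) z (rho h y);rewrite (dsym (rho h u) (rho h y)) ltr_norml;lra. have dc1 z: continuous (fun y=> d z y: R).
  by move=> y;have:= dc 1%g z y;rewrite (_: (fun y=> d z (rho 1%g y)) = d z)//;apply/funext=> u;rewrite act1.
 rewrite (_: mkset _ = (fun y=> d (rho g x) y - lam * d x (rho g^-1%g y)) @^-1` [set t: R | 0 <= t]);last first. by apply/seteqP;split=> y/=;rewrite subr_ge0.
 refine (@preimage_closed _ _ _ [set t: R | 0 <= t] _ (@closed_ge R 0))=> y _;apply: cvgB;first exact: dc1. by apply: cvgM; [exact: cvg_cst|exact: dc].
apply/seteqP;split=> y [By];last first. move=> h;split=>//;rewrite imE /preimage /mball/=;move: By h;rewrite /B /mball/= => By h. by rewrite -(ltr_pM2l l0);exact: le_lt_trans By.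
by move=>[z xz zy];split=>//=;rewrite -zy gK;apply: ex=>//;exact: sub.
Qed.
Lemma expn_datum_ex (S: seq Gam) (Lam: set M): generates S -> compact Lam -> (forall x, Lam x -> exists g, exists2 r: R, 0 < r & forall y z, d x y < r -> d x z < r ->
   2 * d y z <= d (rho g y) (rho g z)) -> exists E, expansion_datum d rho Lam E.
Proof.
move=> HS cL H;have [dd dp dsym dtri nP]:= Md.
have /choice[f fP] : forall x, exists f: Gam * R, 0 < f.2 /\ (Lam x -> forall y z, d x y < f.2 -> d x z < f.2 -> 2 * d y z <= d (rho f.1 y) (rho f.1 z)).
 move=> x;have [Lx|nL]:= pselect (Lam x);last by exists (1%g, 1);split. by have [g [r r0 rP]]:= H x Lx;exists (g, r).
have [D DL cov]:= cpt_finite_cover (fun x=> mball_open x ((f x).2 / 2)) (fun x=> ltac:(by rewrite /mball/= dd divr_gt0// (fP x).1)) cL.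
(* The points of [D] carry the cover, and their letters are inverses because the datum expands by
   inverses of letters. All generators, the expanding elements and their inverses are added with
   empty sets, which makes the letters symmetric and generating at no cost. *)
pose T:= S ++ [seq (f x).1 | x <- D];pose A:= T ++ [seq g^-1%g | g <- T].
pose I: finType:= (seq_sub D + seq_sub A)%type.
pose s (i: I):= match i with inl x=> (f (ssval x)).1^-1%g | inr a=> ssval a end.
pose U (i: I):= match i with inl x=> mball d (f (ssval x)).2 (ssval x) | inr a=> set0 end.
have /choice[p pP] : forall i: I, exists p: R * R, [/\ 0 < p.1, 0 < p.2 & lipschitz_at_most d p.2 (nbhd_of d p.1 Lam) (rho (s i)^-1%g)].
 by move=> i;have [e [L h]]:= lip_near (s i)^-1%g cL;exists (e, L).
have [r1 r10 r1P]:= fin_min (f:= fun i=> (p i).1) (fun i=> let: And3 h _ _:= pP i in h).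
have [r2 r20 r2P] : exists2 r: R, 0 < r & forall x: seq_sub D, r <= (f (ssval x)).2 / 2. by apply: fin_min=> x;rewrite divr_gt0// (fP _).1.
have [L L2 LP]:= fin_max (fun i=> (p i).2) 2;pose del:= Order.min r1 r2.
have del0: 0 < del by rewrite lt_min r10.
have inA a: a \in A -> exists i: I, s i = a by move=> aA;exists (inr (SeqSub aA)).
have Lx (x: seq_sub D): Lam (ssval x) by apply: DL;exact: ssvalP.
exists (@Datum R M Gam I U s del L 2);split=> /=.
- split=>[[x|a]|x /cov[y [yD xy]]]; [exact: mball_open|exact: open0|]. exists (inl (SeqSub yD))=>//=;apply: lt_le_trans xy _;have:= (fP y).1;lra.
- by rewrite L2 ltr1n.
- split=>//;apply: ereal_sup_ubound;exists del=>//;split=>// x /cov[y [yD xy]]. exists (inl (SeqSub yD))=> z/= xz;apply: le_lt_trans (dtri x _ _) _.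
 have h2: del <= (f y).2 / 2 by apply: le_trans (r2P (SeqSub yD));rewrite ge_min lexx orbT. by move: xy xz;rewrite /mball/=;lra.
- move=> i;have [p1 p2 pl]:= pP i;split. move=> y z [a La ay] [b Lb bz];have dr: del <= (p i).1 by apply: le_trans (r1P i);rewrite ge_min lexx.
  apply: le_trans (pl y z _ _) _; [by exists a=>//;apply: lt_le_trans dr|by exists b=>//;apply: lt_le_trans dr|]. by rewrite ler_wpM2r ?dist_pos.
 apply: expd_ball=>//;case: i {p1 p2 pl}=>[x|a] y z//= h1 h2;rewrite invgK;exact: (fP _).2.
split=>[[x|[a aA]]|x]/=.
- apply: inA;rewrite invgK /A mem_cat /T mem_cat (map_f (fun x=> (f x).1)) ?orbT//;exact: ssvalP.
- apply: inA;move: (aA);rewrite {1}/A mem_cat=> /orP[aT|/mapP[t tT ->]];rewrite /A mem_cat;last by rewrite invgK tT. by rewrite (map_f _ aT) orbT.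
have [k [w [ww wk ->]]]:= HS x;exists k, w;split=>//;apply: sub_all ww=> a.
have SA b: b \in S -> b \in codom s by move=> bS;have [|i <-]:= inA b; [rewrite /A /T !mem_cat bS|exact: codom_f].
by move=> /orP[/SA->//|/SA h];apply/orP;right.
Qed.
End ExpansionDatum.

(** * The three conditions on a flag manifold *)

Section FlagActions.
Context {R: realType} {n: nat} {G: groupType} (LG: lie_group R n G) (HG: semisimple LG) (Htype: orbits_meet_chambers_once LG) (D: model LG) {m: nat} (F: manifold R m (Flag D))
 (HF: homogeneous_structure F) (q: riemannian_metric F).
Context {P: {pred G}} {Gam: subGroupType P} (S0 S: seq Gam) (HS0: generates S0) (HS: generates S) (delta Kc: nat).
Hypothesis four_point: forall x y z w, (word_dist S0 x y + word_dist S0 z w <= maxn (word_dist S0 x z + word_dist S0 y w) (word_dist S0 x w + word_dist S0 y z) + delta.*2)%N.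
Hypotheses (dKS: forall x y, (word_dist S0 x y <= Kc * word_dist S x y)%N) (SKd: forall x y, (word_dist S x y <= Kc * word_dist S0 x y)%N) (nonelem: ~ virtually_cyclic Gam).
Hypothesis hypGam: word_hyperbolic Gam.
Local Notation bd:= (gromov_boundary S).
Local Notation d:= (flag_dist q).
Local Notation rho:= (@gam_act R n m G LG D F P Gam).
Local Notation HM:= (@manifold_hausdorff R m (Flag D) F).
Local Notation joinedM:= (flag_joined HG Htype HF).
Local Notation a1:= (@act_Flag1 R n G LG HG D).
Local Notation aM:= (@act_FlagM R n G LG HG D).
Local Notation N:= (tangent_norm q).
Local Notation orb:= (orb_ch LG F (@act_Flag R n G LG D)).
Local Notation e0:= (cfun (chart_at LG 1%g) 1%g).

Lemma flag_metr: metr_for d. Proof. exact: (riem_metr_for q HM joinedM). Qed.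
Lemma gam_act1 (x: mspace F): rho 1%g x = x.
Proof. by rewrite /gam_act gmulf1;exact: a1. Qed.
Lemma gam_actM (g h: Gam) (x: mspace F): rho (g * h)%g x = rho g (rho h x).
Proof. by rewrite /gam_act gmulfM;exact: aM. Qed.
Lemma gam_act_cont (g: Gam): continuous (rho g).
Proof. exact: (@act_continuous _ _ _ _ _ _ _ _ a1 aM HF (val g)). Qed.
Lemma gam_act_lip (g: Gam) (x: mspace F): exists L: R, 0 < L /\ exists2 r: R, 0 < r & forall y z, d x y < r -> d x z < r -> d (rho g y) (rho g z) <= L * d y z.
Proof. exact: (act_local_lip a1 aM HF q HM joinedM (val g) x). Qed.
(** A curve from [x] of length below [r] stays in the ball, so the ball is a union of curves through
    its centre. [expd_ball] rests on this. *)
Lemma flag_ball_conn x r: connected (mball d r x).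
Proof.
have /choice[f fP] : forall y, exists f: R -> mspace F, d x y < r -> [/\ sm_crv F f, f 0 = x, f 1 = y & forall t, 0 <= t <= 1 -> d x (f t) < r].
 move=> y;have [xy|nxy]:= pselect (d x y < r);last by exists (fun=> x). by have [f fP]:= dist_path joinedM xy;exists f.
have -> : mball d r x = \bigcup_(y in mball d r x) (f y @` `[0, 1]). apply/seteqP;split=>[y xy|_ [y xy [t/= t01 <-]]].
  by exists y=>//;exists 1; [rewrite/= in_itv/= ler01 lexx|have []:= fP y xy]. by have [_ _ _]:= fP y xy;apply;rewrite in_itv in t01.
apply: bigcup_connected. by exists x=> y xy;exists 0; [rewrite/= in_itv/= ler01 lexx|have []:= fP y xy].
move=> y xy;apply: connected_continuous_connected;first exact: segment_connected.
by apply: continuous_subspaceT=> t;have [fs _ _ _]:= fP y xy;exact: (sm_into_cont (fs t)).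
Qed.
Lemma flag_no_isol (v0: 'rV[R]_m) (x: mspace F) (r: R): v0 != 0 -> 0 < r -> exists2 y, y <> x & mball d r x y.
Proof.
move=> v0n r0;pose c:= chart_at F x;have Ac:= chart_atP F x.
have [dd _ _ _ _]:= flag_metr.
have oW': atlas_open (A:= F) (mball d r x):= mball_open flag_metr x r.
have oW: open (cfun c @` (mball d r x `&` cdom c)):= oW' c Ac.
have: nbhs (cfun c x) (cfun c @` (mball d r x `&` cdom c)). by apply: open_nbhs_nbhs;split=>//;exists x=>//;split; [rewrite /mball/= dd|exact: mem_chart_at].
move/nbhs_ltP=>[s s0 sP];have nv: 0 < `|v0| by rewrite normr_gt0.
have [|y [xy cy] yE]:= sP (cfun c x + (s / 2 / `|v0|) *: v0). by rewrite addrC addKr normrZ gtr0_norm ?divr_gt0// divfK ?gt_eqF// gtr_pMr// invf_lt1 ?ltr1n.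
exists y=>// E;move: yE;rewrite E -[LHS]addr0=> /addrI/esym/eqP.
by rewrite scaler_eq0 (negPf v0n) orbF gt_eqF ?divr_gt0.
Qed.
Lemma orb_bound (K: set (mspace F)): compact K -> exists2 C: R, 0 <= C & forall z, K z -> forall v, N z ('d (orb z) e0 v) <= C * `|v|.
Proof.
move=> cK;have [dd _ _ _ _]:= flag_metr.
have /choice[f fP] : forall z0: mspace F, exists f: R * R, 0 < f.2 /\ forall z, d z0 z < f.2 -> forall v, N z ('d (orb z) e0 v) <= f.1 * `|v|.
 by move=> z0;have [C [_ [r r0 rP]]]:= orb_der_bound a1 aM HF q HM joinedM z0;exists (C, r).
have [s _ sP]:= cpt_finite_cover (fun z=> mball_open flag_metr z (f z).2) (fun z=> ltac:(by rewrite /mball/= dd (fP z).1)) cK.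
have [C C0 CP]:= fin_max (fun z: seq_sub s=> (f (ssval z)).1) 0;exists C=>// z /sP[y [ys yz]] v.
apply: le_trans ((fP y).2 z yz v) _;rewrite ler_wpM2r//;exact: (CP (SeqSub ys)).
Qed.
Lemma anosov_large (psi: bd -> mspace F) xi r (T: R): nonuniformly_anosov_with q psi -> ray1 xi r -> exists k, T <= expansion_factor q (rho (r k)^-1%g) (psi xi).
Proof.
move=>[_ H] [xr r0];apply: contrapT=> HT;suff: (+oo <= T%:E)%E by [].
rewrite -(H xi r xr r0);apply: ge_ereal_sup=> _ [k _ <-];rewrite lee_fin leNgt;apply/negP=> h.
by apply: HT;exists k;exact: ltW.
Qed.
Lemma anosov_expd (psi: bd -> mspace F): nonuniformly_anosov_with q psi -> boundary_expanding_with q psi.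
Proof.
move=> an;have [emb _]:= an;split=>//;have [_ [pc pE pI _]]:= emb.
have [xi0 _]:= bd_nonempty HS nonelem.
have rays:= ray1_ex HS0 HS four_point dKS SKd.
have cR: compact (range psi). by apply: continuous_compact; [exact: continuous_subspaceT|exact: (bd_cpt HS0 HS four_point dKS SKd)].
(* Without nonzero tangent vectors the expansion factor would be the infimum of the empty set, which
   is 0, and the Anosov supremum could not be infinite. *)
have [v0 v0n] : exists v0: 'rV[R]_m, v0 != 0. apply: contrapT=> H;have [r0 xr0]:= rays xi0;have [k]:= anosov_large 1 an xr0.
 rewrite /expansion_factor (_: [set _ | v in _] = set0) ?inf0 ?ler10//. by apply/seteqP;split=>// _ [v/= vn _];apply: H;exists v.
have [|E EP]:= expn_datum_ex flag_metr flag_ball_conn gam_act1 gam_actM gam_act_cont gam_act_lip HS cR. move=> _ [xi _ <-];have [r xr]:= rays xi;have [k kP]:= anosov_large (4 * 2 + 1) an xr.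
 exists (r k)^-1%g;exact: (expn_factor_expd a1 aM HF HM joinedM (ltr0n R 2) kP).
split;last by exists E.
split=>//;last 3 first.
- by exists (psi xi0), xi0.
- by move=> g _ [xi _ <-];exists (act_boundary g xi).
- by move=> x _ r;exact: flag_no_isol v0n.
split; [exact: gam_act1|exact: gam_actM|].
exact: (LHomeo_act flag_metr gam_act1 gam_actM gam_act_cont gam_act_lip).
Qed.
Lemma expd_S_hyp (phi: bd -> mspace F): boundary_expanding_with q phi -> exists Lam E N0 pi, S_hyperbolic_postal q Lam E N0 pi /\ forall xi, Lam (phi xi) /\ pi (phi xi) = xi.
Proof.
move=>[[_ [pc pE pI pA]] [adm [E EP]]];have [_ [x0 [xi0 _ _]] cL inv _]:= adm.
have /choice[pi piP] : forall x, exists xi: bd, range phi x -> phi xi = x. by move=> x;have [[xi _ <-]|nx]:= pselect (range phi x); [exists xi|exists xi0].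
have rP xi: range phi (phi xi) by exists xi.
have [post [N0 SH]]:= emb_S_hyp HS0 HS four_point dKS SKd nonelem flag_metr adm EP pc pE pI rP piP.
exists (range phi), E, N0, pi;split;last by move=> xi;split=>//;exact/pI/piP.
split=>//;first by split=>//;apply: compact_closed=>//;exact: HM.
by move=> x y;rewrite !inE=> /piP{2}<- /piP{2}<- ->.
Qed.

(* The limit set map of an Anosov subgroup that moreover satisfies the uniform lower bound needed for uniqueness. *)
Lemma S_hyp_anosov Lam E N0 (pi: mspace F -> bd): S_hyperbolic_postal q Lam E N0 pi -> exists psi: bd -> mspace F, [/\ nonuniformly_anosov_with q psi,
  forall xi r, ray1 xi r -> exists2 c: R, 0 < c & forall k, c <= expansion_factor q (rho (r k)^-1%g) (psi xi), forall xi, Lam (psi xi) /\ pi (psi xi) = xi & forall x, Lam x -> psi (pi x) = x].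
Proof.
move=>[[cL inv anti] [adm EP _ _] post piI].
have piI' x y: Lam x -> Lam y -> pi x = pi y -> x = y by move=> Lx Ly;apply: piI;rewrite inE.
have [psi [pc pE pP pK]]:= post_inverse HS0 HS four_point dKS SKd nonelem flag_metr adm EP post piI'.
have [_ [x0 Lx0] _ _ iso]:= adm.
have [v0 v0n] : exists v0: 'rV[R]_m, v0 != 0. have [s s0 sP]:= mball_ch q HM joinedM x0 ltr01;have [y yx0 /sP[cy _]]:= iso x0 Lx0 s s0.
 exists (cfun (chart_at F x0) y - cfun (chart_at F x0) x0);apply/eqP=> /subr0_eq E0;apply: yx0. by rewrite -(cfunK cy) E0 cfunK//;exact: mem_chart_at.
have low x (c: R) g: 0 < c -> (exists2 e: R, 0 < e & forall y z, d x y < e -> d x z < e -> c * d y z <= d (rho g y) (rho g z)) -> c / 4 <= expansion_factor q (rho g) x.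
 move=> c0 [e e00 eP];exact: (expn_factor_ge a1 aM HF HM joinedM v0n c0 e00 eP).
have ex xi r: ray1 xi r -> (exists2 c: R, 0 < c & forall k, c <= expansion_factor q (rho (r k)^-1%g) (psi xi)) /\ forall T: R, exists k, T <= expansion_factor q (rho (r k)^-1%g) (psi xi).
 move=> xr;have [Lx px]:= pP xi;have xr': ray1 (pi (psi xi)) r by rewrite px. have [[c c0 cP] ub]:= post_expd HS0 HS four_point dKS SKd flag_metr adm EP post Lx xr'.
 split=>[|T];first by exists (c / 4)=>[|k]; [rewrite divr_gt0|exact: low (cP k)]. have [k kP]:= ub (4 * (`|T| + 1));exists k. have T0: 0 < 4 * (`|T| + 1) by rewrite mulr_gt0// ltr_wpDl.
 apply: le_trans (low _ _ _ T0 kP);have:= ler_norm T;lra.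
exists psi;split=>// [|xi r /ex[]//];split. split=>//;split=>//;first by move=> x y E0;rewrite -(pP x).2 E0 (pP y).2.
 by move=> _ _ [x _ <-] [y _ <-];apply: anti; [exact: (pP x).1|exact: (pP y).1].
move=> xi r xr r0;have [_ ub]:= ex xi r (conj xr r0);apply/eqyP=> T _.
have [k kP]:= ub T;apply: le_trans (_: (_ <= (expansion_factor q (rho (r k)^-1%g) (psi xi))%:E)%E) _;first by rewrite lee_fin;exact: kP.
by apply: ereal_sup_ubound;exists k.
Qed.
Lemma anosov_unique (psi psi': bd -> mspace F): nonuniformly_anosov_with q psi -> nonuniformly_anosov_with q psi' ->
 (forall xi r, ray1 xi r -> exists2 c: R, 0 < c & forall k, c <= expansion_factor q (rho (r k)^-1%g) (psi' xi)) -> psi =1 psi'.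
Proof.
move=> an [[_ [pc' pE' _ _]] _] low xi;have [[_ [pc pE _ _]] _]:= an.
have cb:= bd_cpt HS0 HS four_point dKS SKd.
have [r xr]:= ray1_ex HS0 HS four_point dKS SKd xi;have [c c0 cP]:= low xi r xr.
(* By equivariance the moved points stay in the compact image of [f], where the derivatives of the
   orbit maps are uniformly bounded. *)
have bound (f: bd -> mspace F): continuous f -> (forall a xi, f (act_boundary a xi) = rho a (f xi)) ->
  exists2 C: R, 0 <= C & forall k v, N (rho (r k)^-1%g (f xi)) ('d (orb (rho (r k)^-1%g (f xi))) e0 v) <= C * `|v|. move=> fc fE;have [|C C0 CP]:= @orb_bound (range f).
  by apply: continuous_compact; [exact: continuous_subspaceT|exact: cb]. by exists C=>// k;apply: CP;rewrite -fE;exists (act_boundary (r k)^-1%g xi).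
have [C C0 CP]:= bound psi pc pE;have [C' C0' CP']:= bound psi' pc' pE'.
have wk (a b t: R) w: a <= b -> t <= a * `|w: 'rV[R]_n| -> t <= b * `|w| by move=> ab h;apply: le_trans h _;rewrite ler_wpM2r.
apply: (@flag_unique R n G LG HG Htype D m F HF q (psi xi) (psi' xi) (Order.max C C') c (fun k=> val (r k)^-1%g))=>//.
- by rewrite le_max C0.
- by move=> k v;apply: wk (CP k v);rewrite le_max lexx.
- by move=> k v;apply: wk (CP' k v);rewrite le_max lexx orbT.
by move=> T;have [k kP]:= anosov_large T an xr;exists k;split=>//;exact: cP.
Qed.
End FlagActions.

Theorem theorem6p11 (R : realType) (n : nat) (G : groupType)
    (LG : lie_group R n G) (HG : semisimple LG)
    (Htype : orbits_meet_chambers_once LG)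
    (D : model LG) (Hiota : iota_invariant D)
    (m : nat) (F : manifold R m (Flag D)) (HF : homogeneous_structure F)
    (q : riemannian_metric F)
    (P : {pred G}) (Gam : subGroupType P)
    (Hhyp : word_hyperbolic Gam) (Hne : non_elementary Gam)
    (S : seq Gam) (HS : generates S) :
  let anosov (psi : gromov_boundary S -> mspace F) :=
    nonuniformly_anosov_with q psi in
  let expanding (phi : gromov_boundary S -> mspace F) :=
    boundary_expanding_with q phi in
  let s_hyperbolic Lam E N (pi : mspace F -> gromov_boundary S) :=
    S_hyperbolic_postal q Lam E N pi in
  [/\ (exists psi, anosov psi) <-> (exists phi, expanding phi),
      (exists phi, expanding phi) <->
        (exists Lam E N pi, s_hyperbolic Lam E N pi),
      forall psi phi, anosov psi -> expanding phi -> psi =1 phi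
    & forall psi Lam E N pi, anosov psi -> s_hyperbolic Lam E N pi ->
        (forall x, Lam x -> psi (pi x) = x) /\
        (forall xi, Lam (psi xi) /\ pi (psi xi) = xi)].
Proof.
move=> anosov expanding s_hyperbolic;have [S0 [HS0 [delta H4]]]:= Hhyp.
(* Hyperbolicity is given for some [S0], while the boundary is defined by [S]; the word metrics are
   compared up to one common factor. *)
have [K1 K1P]:= wd_compare HS0 HS;have [K2 K2P]:= wd_compare HS HS0.
have dKS x y: (word_dist S0 x y <= maxn K1 K2 * word_dist S x y)%N. by apply: leq_trans (K1P x y) _;rewrite leq_mul2r leq_maxl orbT.
have SKd x y: (word_dist S x y <= maxn K1 K2 * word_dist S0 x y)%N. by apply: leq_trans (K2P x y) _;rewrite leq_mul2r leq_maxr orbT.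
have AE psi: anosov psi -> expanding psi:= @anosov_expd _ _ _ _ HG Htype _ _ _ HF q _ _ _ _ HS0 HS _ _ H4 dKS SKd Hne psi.
have ES phi: expanding phi -> exists Lam E N pi, s_hyperbolic Lam E N pi /\ forall xi, Lam (phi xi) /\ pi (phi xi) = xi
 := @expd_S_hyp _ _ _ _ HG Htype _ _ _ HF q _ _ _ _ HS0 HS _ _ H4 dKS SKd Hne phi.
have SA Lam E N pi:= @S_hyp_anosov _ _ _ _ HG Htype _ _ _ HF q _ _ _ _ HS0 HS _ _ H4 dKS SKd Hne Hhyp Lam E N pi.
have AU psi psi':= @anosov_unique _ _ _ _ HG Htype _ _ _ HF q _ _ _ _ HS0 HS _ _ H4 dKS SKd psi psi'.
split.
- split=>[[psi /AE]|[phi /ES[Lam [E [N [pi [/SA[psi [h _ _ _]] _]]]]]]];first by exists psi. by exists psi.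
- split=>[[phi /ES[Lam [E [N [pi [h _]]]]]]|[Lam [E [N [pi /SA[psi [h _ _ _]]]]]]];first by exists Lam, E, N, pi. by exists psi;exact: AE.
(* [psi] is compared with the map [psi'] obtained from S-hyperbolicity at the image of [phi]: it has
   the uniform lower bound that [anosov_unique] needs, and it inverts the postal map, as [phi]
   does. *)
- move=> psi phi an /ES[Lam [E [N [pi [/SA[psi' [an' low _ pK]] pP]]]]] xi. by have [Lx px]:= pP xi;rewrite (AU psi psi' an an' low) -{1}px pK.
move=> psi Lam E N pi an /SA[psi' [an' low pP pK]];have eq:= AU psi psi' an an' low.
by split=>[x Lx|xi];rewrite eq; [exact: pK|exact: pP].
Qed.
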